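(* Let $h:\mathbb R\to[0,\infty)$ be Lipschitz continuous and let $\varphi:[0,\infty)\to\mathbb R$ be locally square integrable. For $N\ge1$, let $\mathbb G_N$ be the graph with vertex set $\mathcal S_N=\{1,\dots,N\}$ and edge set $\mathcal E_N=\{(i,j):i,j\in\mathcal S_N\}$, and put $h^N_i=h$ for all $i\in\mathcal S_N$ and $\varphi^N_{ji}=N^{-1}\varphi$ for all $(j,i)\in\mathcal E_N$. Consider the limit equation $$\overline Z_t=\int_0^t\int_0^\infty\mathbf 1_{\{z\le h(\int_0^s\varphi(s-u)\,d\mathbb E[\overline Z_u])\}}\,\pi(ds\,dz)\quad\text{for every }t\ge0,\qquad(\ast)$$ where $\pi(ds\,dz)$ is a Poisson measure on $[0,\infty)\times[0,\infty)$ with intensity measure $ds\,dz$. (i) There is a pathwise unique solution $(\overline Z_t)_{t\ge0}$ to $(\ast)$ such that $(\mathbb E[\overline Z_t])_{t\ge0}$ is locally bounded. (ii) It is possible to build simultaneously the Hawkes process $(Z^{N,1}_t,\dots,Z^{N,N}_t)_{t\ge0}$ with parameters $(\mathbb G_N,\boldsymbol\varphi^N,\boldsymbol h^N)$ and an i.i.d. family $(\overline Z^i_t)_{t\ge0,\,i=1,\dots,N}$ of solutions to $(\ast)$ in such a way that for all $T>0$ and all $i=1,\dots,N$, $$\mathbb E\Big[\sup_{[0,T]}|Z^{N,i}_t-\overline Z^i_t|\Big]\le C_TN^{-1/2},$$ where the constant $C_T$ depends only on $h$, $\varphi$ and $T$. (iii) Consequently, $$\frac1N\sum_{i=1}^N\delta_{(Z^{N,i}_t)_{t\ge0}}\longrightarrow\mathcal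 L\big((\overline Z_t)_{t\ge0}\big)\quad\text{in probability, as }N\to\infty,$$ where the set $\mathcal P(\mathbb D([0,\infty),\mathbb R))$ of probability measures on $\mathbb D([0,\infty),\mathbb R)$ is endowed with the weak convergence topology associated with the topology (on $\mathbb D([0,\infty),\mathbb R)$) of uniform convergence on compact time intervals.
   Context: The Hawkes process with parameters $(\mathbb G_N,\boldsymbol\varphi^N,\boldsymbol h^N)$ is the pathwise unique family of càdlàg adapted processes, with $\mathbb E[Z^{N,i}_t]<\infty$ for all $i$ and $t$, such that a.s. for all $i=1,\dots,N$ and $t\ge0$, $$Z^{N,i}_t=\int_0^t\int_0^\infty\mathbf 1_{\{z\le h(N^{-1}\sum_{j=1}^N\int_0^{s-}\varphi(s-u)\,dZ^{N,j}_u)\}}\,\pi^i(ds\,dz),$$ where $(\pi^i(ds\,dz))_{i\ge1}$ are i.i.d. Poisson measures on $[0,\infty)\times[0,\infty)$ with intensity measure $ds\,dz$ (with respect to the underlying filtration). In $(\ast)$, $d\mathbb E[\overline Z_u]$ is the measure on $[0,\infty)$ associated with the (necessarily) non-decreasing function $u\mapsto\mathbb E[\overline Z_u]$. $\mathbb D([0,\infty),\mathbb R)$ is the space of càdlàg functions from $[0,\infty)$ to $\mathbb R$, and $\mathcal L(X)$ denotes the law of $X$. *)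

(* Defs.v *)
From HB Require Import structures.
From mathcomp Require Import all_boot all_order all_algebra.
From mathcomp Require Import all_classical all_reals all_analysis.
From mathcomp Require Import measurable_realfun.

Set Implicit Arguments.
Unset Strict Implicit.
Unset Printing Implicit Defensive.

Import Order.TTheory GRing.Theory Num.Theory.
Import numFieldNormedType.Exports.

Local Open Scope classical_set_scope.
Local Open Scope ring_scope.

(** A function on [0,oo) is encoded by its extension by 0 to the negative
half-line, so that [skorokhod R] is in bijection with D([0,oo), R). *)

Definition is_cadlag (R : realType) (f : R -> R) : Prop :=
  [/\ forall t, t < 0 -> f t = 0,
      forall t, 0 <= t -> f x @[x --> t^'+] --> f t &
      forall t, 0 < t -> cvg (f x @[x --> t^'-])].

Lemma is_cadlag0 (R : realType) : is_cadlag (fun _ : R => 0 : R).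
Proof. by split=> // t _; [exact: cvg_cst | exact: is_cvg_cst]. Qed.

Record skorokhod (R : realType) := Skorokhod {
  skorokhod_path :> R -> R ;
  skorokhod_cadlag : is_cadlag skorokhod_path }.

HB.instance Definition _ (R : realType) := gen_eqMixin (skorokhod R).
HB.instance Definition _ (R : realType) := gen_choiceMixin (skorokhod R).
HB.instance Definition _ (R : realType) :=
  isPointed.Build (skorokhod R) (Skorokhod (@is_cadlag0 R)).

(** The sigma-algebra is the one generated by the coordinate maps.  The Borel
sigma-algebra of the (non-separable) topology of locally uniform convergence is
too large: counting processes are not random variables for it. *)

Definition coordinate_events (R : realType) : set_system (skorokhod R) :=
  [set A | exists t (B : set R), [/\ 0 <= t, measurable B &
    A = [set z : skorokhod R | B (z t)]]].

HB.instance Definition _ (R : realType) :=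
  Measurable.copy (skorokhod R)
    (g_sigma_algebraType (@coordinate_events R)).

Definition skorokhod_incl (R : realType) (z : skorokhod R) :
  {family compact, R -> R} := skorokhod_path z.

HB.instance Definition _ (R : realType) :=
  Topological.copy (skorokhod R) (initial_topology (@skorokhod_incl R)).

(** The test functions for weak convergence are bounded and continuous for locally uniform
convergence; they also have to be measurable for the coordinate sigma-algebra, since continuity
does not imply it. *)

Record test_function (R : realType) := TestFunction {
  test_fun :> skorokhod R -> R ;
  test_fun_measurable : measurable_fun [set: skorokhod R] test_fun ;
  test_fun_continuous : continuous test_fun ;
  test_fun_bounded : bounded_fun test_fun }.

Definition test_eval (R : realType) (mu : probability (skorokhod R) R) :
  {ptws test_function R -> R} := fun f => \int[mu]_z f z.

Definition weak_topology_on_laws (R : realType) : topologicalType :=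
  initial_topology (@test_eval R).

Section empirical_measure.
Local Open Scope ereal_scope.
Context d (T : measurableType d) (R : realType) (n : nat) (x : 'I_n.+1 -> T).

(** (n+1)^-1 \sum_(i < n+1) \d_(x i); [msum] is indexed by [nat]. *)
Definition empirical : set T -> \bar R :=
  mscale (n.+1%:R^-1%:nng)%R (msum (fun k => \d_(x (inord k))) n.+1).

HB.instance Definition _ := Measure.on empirical.

Let empirical_setT : empirical [set: T] = 1.
Proof.
rewrite /empirical /mscale/= /msum.
under eq_bigr do rewrite /= /dirac indicE in_setT.
by rewrite sumEFin sumr_const card_ord -EFinM mulVf// pnatr_eq0.
Qed.

HB.instance Definition _ :=
  Measure_isProbability.Build _ _ _ empirical empirical_setT.
End empirical_measure.

(** Convergence in probability to a deterministic point, the N-th variable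
living on its own space.  Outer probabilities are used because the events
need not be measurable for an arbitrary neighbourhood. *)

Definition cvg_in_probability (R : realType) (dO : nat -> measure_display)
    (Om : forall N, measurableType (dO N)) (P : forall N, probability (Om N) R)
    (T : topologicalType) (X : forall N, Om N -> T) (l : T) : Prop :=
  forall V : set T, nbhs l V ->
    mu_ext (P N) [set w | ~ V (X N w)] @[N --> \oo] --> 0%E.

Section stieltjes.
Context (R : realType) (f : R -> R).
Hypotheses (ndf : nondecreasing f) (rcf : right_continuous f).

(* The proofs are arguments so that the structure can be inferred. *)
Definition cumulative_of & nondecreasing f & right_continuous f : R -> R := f.

HB.instance Definition _ :=
  isCumulative.Build R _ R (cumulative_of ndf rcf) ndf rcf.
End stieltjes.

(** The measure df of a nondecreasing right-continuous function f : R -> R; by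
convention 0 for other functions.  For f vanishing on the negative half-line,
this is a measure on [0,oo), with mass f 0 at 0. *)

Definition stieltjes (R : realType) (f : R -> R) :
    {measure set (measurableTypeR R) -> \bar R} :=
  match pselect (nondecreasing f /\ right_continuous f) with
  | left H => lebesgue_stieltjes_measure (cumulative_of H.1 H.2)
  | right _ => mzero
  end.

Section independence.
Context d (Om : measurableType d) (R : realType) (P : probability Om R).

Definition independent_systems (I : finType) (G : I -> set_system Om) : Prop :=
  forall (J : {set I}) (A : I -> set Om), (forall i, i \in J -> G i (A i)) ->
    fine (P (\bigcap_(i in [set` J]) A i)) = \prod_(i in J) fine (P (A i)).

Definition iid d' (T : measurableType d') (I : finType)
    (X : I -> {RV P >-> T}) : Prop :=
  independent_systems
    (fun i => preimage_set_system [set: Om] (X i) measurable) /\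
  forall i j A, measurable A -> distribution P (X i) A = distribution P (X j) A.

End independence.

Section poisson_measure.
Context d d' (Om : measurableType d) (T : measurableType d') (R : realType).
Variables (P : probability Om R) (ppm : R.-ker Om ~> T).

Definition is_poisson_measure (nu : {measure set T -> \bar R}) : Prop :=
  (forall B, measurable B -> (nu B < +oo)%E -> forall k : nat,
     (* the second argument of [poisson_prob] is a dummy *)
     P [set w | ppm w B = k%:R%:E] = poisson_prob (fine (nu B)) k [set k]) /\
  (forall n (B : 'I_n -> set T), (forall i, measurable (B i)) ->
     trivIset [set: 'I_n] B ->
     independent_systems P (fun i =>
       preimage_set_system [set: Om] (fun w => ppm w (B i))
         (measurable : set (set (\bar R))))).

Definition noise_events (D : set T) : set_system Om :=
  [set A | exists B (C : set (\bar R)), [/\ measurable B, B `<=` D,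
    measurable C & A = [set w | C (ppm w B)]]].

End poisson_measure.

(* [lebesgue_measure] lives on [measurableTypeR R], which has the same measurable
sets as the canonical structure of [R] but another display. *)
Definition plane (R : realType) := (measurableTypeR R * measurableTypeR R)%type.

Definition quadrant (R : realType) : set (plane R) :=
  `[0 : R, +oo[ `*` `[0 : R, +oo[.

Lemma measurable_quadrant (R : realType) : measurable (@quadrant R).
Proof. by apply: measurableX; exact: (@measurable_itv R). Qed.

Definition quadrant_lebesgue (R : realType) :
    {measure set (plane R) -> \bar R} :=
  mrestr (lebesgue_measure \x lebesgue_measure)%E (@measurable_quadrant R).

Definition is_filtration d (Om : measurableType d) (R : realType)
    (F : R -> set_system Om) : Prop :=
  (forall t, 0 <= t ->
     sigma_algebra [set: Om] (F t) /\ F t `<=` measurable) /\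
  (forall s t, 0 <= s -> s <= t -> F s `<=` F t).

(** i.i.d. Poisson measures with intensity ds dz, with respect to F: the noise
on [0,t] is F_t-measurable, and the noise after t is independent of F_t. *)
Definition is_poisson_noise d (Om : measurableType d) (R : realType)
    (P : probability Om R) (F : R -> set_system Om) (I : finType)
    (ppm : I -> R.-ker Om ~> plane R) : Prop :=
  [/\ forall i, is_poisson_measure P (ppm i) (quadrant_lebesgue R),
      independent_systems P (fun i => <<s noise_events (ppm i) setT >>),
      forall i t, 0 <= t ->
        noise_events (ppm i) (`[0, t] `*` `[0, +oo[) `<=` F t &
      forall t, 0 <= t -> forall A B, F t A ->
        <<s \bigcup_i noise_events (ppm i) (`]t, +oo[ `*` `[0, +oo[) >> B ->
        (P (A `&` B) = P A * P B)%E].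

(** \int_0^t \int_0^oo 1_{z <= lam s} nu(ds dz) *)
Definition thinning (R : realType) (nu : {measure set (plane R) -> \bar R})
    (lam : R -> R) (t : R) : \bar R :=
  (\int[nu]_(x in `[0%R, t] `*` `[0%R, +oo[)
     (\1_[set y : R * R | (y.2 <= lam y.1)%R] x)%:E)%E.

(** The Hawkes process with parameters (G, phi, h), for the graph G with finite
vertex set V and edge relation E; [phi j i] is the weight of the edge (j, i).
The equation forces almost all paths to be nondecreasing, so that the default
value of [stieltjes] plays no role. *)
Definition is_hawkes (V : finType) (E : rel V) d (Om : measurableType d)
    (R : realType) (phi : V -> V -> R -> R) (h : V -> R -> R)
    (P : probability Om R) (F : R -> set_system Om)
    (ppm : V -> R.-ker Om ~> plane R) (Z : V -> {RV P >-> skorokhod R}) :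
    Prop :=
  [/\ forall i t, 0 <= t ->
        preimage_set_system [set: Om] (fun w => Z i w t)
          (measurable : set (set R)) `<=` F t,
      forall i t, 0 <= t -> ('E_P[fun w => Z i w t] < +oo)%E &
      {ae P, forall w, forall i t, 0 <= t ->
        (Z i w t)%:E = thinning (ppm i w)
          (fun s => h i (\sum_(j | E j i)
             \int[stieltjes (Z j w)]_(u in `[0, s[) phi j i (s - u))) t}].

(** N = n+1 vertices, all pairs (j, i) (loops included) being edges. *)
Definition is_mean_field_hawkes (n : nat) d (Om : measurableType d)
    (R : realType) (h phi : R -> R) (P : probability Om R)
    (F : R -> set_system Om) (ppm : 'I_n.+1 -> R.-ker Om ~> plane R)
    (Z : 'I_n.+1 -> {RV P >-> skorokhod R}) : Prop :=
  is_hawkes (fun _ _ => true) (fun _ _ t => n.+1%:R^-1 * phi t) (fun _ => h)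
    F ppm Z.

Definition mean_path d (Om : measurableType d) (R : realType)
    (P : probability Om R) (Z : {RV P >-> skorokhod R}) (t : R) : R :=
  fine 'E_P[fun w => Z w t].

(** Solutions of the limit equation with locally bounded expectation. *)
Definition is_limit_solution d (Om : measurableType d) (R : realType)
    (h phi : R -> R) (P : probability Om R) (ppm : R.-ker Om ~> plane R)
    (Z : {RV P >-> skorokhod R}) : Prop :=
  (forall T, 0 <= T -> exists M : R, forall t, 0 <= t <= T ->
     (`| 'E_P[fun w => Z w t] | <= M%:E)%E) /\
  {ae P, forall w, forall t, 0 <= t ->
    (Z w t)%:E = thinning (ppm w)
      (fun s => h (\int[stieltjes (mean_path Z)]_(u in `[0, s]) phi (s - u)))
      t}.

Definition locally_square_integrable (R : realType) (phi : R -> R) : Prop :=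
  measurable_fun (`[0, +oo[ : set R) phi /\
  forall T, 0 < T ->
    (\int[lebesgue_measure]_(t in `[0%R, T]) ((phi t) ^+ 2)%:E < +oo)%E.

(* Main.v *)
(* The limiting intensity solves lam(s) = h(int_0^s phi(s - u) lam(u) du), a fixed point equation
with a unique locally bounded solution: for an exponential weight the kernel |phi| is a contraction.
The Hawkes process and the copies of the limit are thinnings of the same Poisson measures, so that
the points lying between the two intensities bound sup |Z - Zbar|; their mean number is the L1
distance g of the intensities, which satisfies g <= L |phi| * g + O(N^(-1/2)), the last term being the
fluctuation of N i.i.d. integrals of phi, of finite variance since phi is square integrable. For the
empirical measures, a first-disagreement argument gives pathwise uniqueness, hence Z = Zbar on
[0, T] up to probability O(N^(-1/2)). As the topology of the path space is not separable, passing
from Zbar to Z in a continuous test function needs compactness, found by coding step paths as points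
of a Cantor space and using inner regularity there; the copies obey the law of large numbers. *)
Require Import Defs.
From HB Require Import structures.
From mathcomp Require Import all_boot all_order all_algebra.
From mathcomp Require Import all_classical all_reals all_analysis.
From mathcomp Require Import measurable_realfun.
From mathcomp Require Import ring lra.

Set Implicit Arguments.
Unset Strict Implicit.
Unset Printing Implicit Defensive.

Import Order.TTheory GRing.Theory Num.Theory.
Import numFieldNormedType.Exports.

Local Open Scope classical_set_scope.
Local Open Scope ring_scope.

(** Three obstacles shape the proof. Part (ii) asserts that a probability space exists, so the
    noises have to be constructed: the even and odd binary digits of a uniform variable give two
    independent uniform variables, and iterating this splitting extracts from [0, 1[ all the
    randomness needed. The definition of a Poisson measure concerns laws, so that a count is an
    integer only off a null set depending on the region; each noise is therefore replaced by a
    version that is integer-valued for every outcome and every region, and the filtration is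
    completed to keep this version adapted. Integrality is then decisive: counts with a finite sum
    vanish from some rank on, so that the Picard iterates of the random intensity become constant
    instead of merely converging, and a count of small mean is 0 with large probability. Finally,
    the mean number of points between two random intensities is given by the compensation formula,
    which requires predictable intensities; they are thus built as functions measurable for the
    predictable sigma-algebra, whose values at time s involve only points strictly before s. *)

Local Notation measfun := (measurable_fun setT).
Local Notation mcomp := measurableT_comp.
Local Notation lip L h := (forall x y, `|h x - h y| <= L * `|x - y|).
Local Notation loc_bounded lam := (forall T, exists2 M, 0 <= M & forall u, 0 <= u <= T -> 0 <= lam u <= M).
Local Notation leb := (@lebesgue_measure _).
Local Notation nu := (quadrant_lebesgue _).

Ltac side_more m := fail.

(* Measurability, positivity and propositional identities between sets. *)
Ltac side_rec n :=
 match n with S ?m =>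
 match goal with
 | |- _ => solve [assumption | side_more m | by []]
 | |- measurable_fun _ _ => first
  [ exact: measurable_cst | exact: measurable_id | exact: measurable_fst | exact: measurable_snd
  | exact: measurable_funPT
  | apply: measurable_indic; side_rec m
  | apply/measurable_EFinP; side_rec m
  | apply: measurable_funD; side_rec m | apply: measurable_funB; side_rec m
  | apply: measurable_funM; side_rec m | apply: measurable_funX; side_rec m
  | apply: emeasurable_funD; side_rec m | apply: measurable_funeM; side_rec m
  | apply: measurable_sum; intros; side_rec m | apply: emeasurable_sum; intros; side_rec m
  | apply: measurable_fun_pair; side_rec m
  | apply: measurable_funTS; side_rec m
  | apply: mcomp; [solve [assumption | by []]|side_rec m] ]
 | |- @measurable _ _ _ => first
  [ exact: measurable_itv | exact: measurable_set1
  | apply: measurableI; side_rec m | apply: measurableU; side_rec m | apply: measurableD; side_rec m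
  | apply: measurableC; side_rec m | apply: measurableX; side_rec m
  | apply: bigcupT_measurable; intros; side_rec m | apply: bigcapT_measurable; intros; side_rec m ]
 | |- is_true (Order.le _ _) => first
  [ rewrite lee_fin; side_rec m | exact: sqr_ge0 | exact: expR_ge0 | exact: measure_ge0
  | apply: mulr_ge0; side_rec m | apply: addr_ge0; side_rec m | apply: divr_ge0; side_rec m
  | rewrite invr_ge0; side_rec m | apply: exprn_ge0; side_rec m | apply: mule_ge0; side_rec m
  | apply: adde_ge0; side_rec m | apply: sumr_ge0; intros; side_rec m | apply: sume_ge0; intros; side_rec m
  | apply: integral_ge0; intros; side_rec m | apply: ltW; side_rec m ]
 | |- is_true (Order.lt _ _) => first
  [ rewrite lte_fin; side_rec m | apply: divr_gt0; side_rec m | apply: mulr_gt0; side_rec m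
  | apply: addr_gt0; side_rec m | rewrite invr_gt0; side_rec m | apply: exprn_gt0; side_rec m ]
 end end.

Ltac side := first [ solve [intros; side_rec constr:(7%N)]
 | match goal with |- @eq (set _) _ _ => apply/seteqP; split => ? /=; tauto end
 | match goal with |- subset _ _ => move=> ? /=; tauto end ].

(** * Independence of sigma-algebras *)

Section sigma.
Context d (Om : measurableType d) (R : realType) (P : probability Om R).
Local Open Scope ereal_scope.

Lemma sigma_measurable (G : set_system Om) : G `<=` measurable ->
 <<s G >> `<=` measurable.
Proof. by move=> Gm; apply: smallest_sub => //; exact: sigma_algebra_measurable. Qed.

(** The events independent of a fixed [B] form a Dynkin system, and the Dynkin system generated by
    the pi-system [G] is [<<s G >>]. *)
Lemma indep_sigma (G : set_system Om) (B : set Om) :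
 G `<=` measurable -> setI_closed G -> measurable B ->
 (forall A, G A -> P (A `&` B) = P A * P B) ->
 forall A, <<s G >> A -> P (A `&` B) = P A * P B.
Proof.
move=> Gm GI mB GB.
suff : <<s G >> `<=` [set A | measurable A /\ P (A `&` B) = P A * P B].
 by move=> h A /h[].
rewrite -setI_closed_g_dynkin_g_sigma_algebra//.
apply: smallest_sub; last by move=> A GA; split; [exact: Gm|exact: GB].
split.
- by split => //; rewrite setTI probability_setT mul1e.
- move=> A [mA AB]; split; first side.
 rewrite setIC -setDE measureD//; last by rewrite (le_lt_trans (probability_le1 P mB))// ltry.
 rewrite probability_setC// (setIC B A) /= AB.
 by rewrite muleBl ?mul1e ?fin_num_adde_defl ?fin_numN ?fin_num_measure//.
- move=> F tF F_; split; first by apply: bigcupT_measurable => i; case: (F_ i).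
 rewrite setI_bigcupl measure_semi_bigcup//; last 3 first.
 + by move=> i; apply: measurableI => //; case: (F_ i).
 + exact: trivIset_setIr.
 + by apply: bigcupT_measurable => i; apply: measurableI => //; case: (F_ i).
 rewrite (@measure_semi_bigcup _ _ _ P F)//; last 2 first.
 + by move=> i; case: (F_ i).
 + by apply: bigcupT_measurable => i; case: (F_ i).
 have F2 i : P (F i `&` B) = P B * P (F i) by rewrite (F_ i).2 muleC.
 rewrite (eq_eseriesr (fun i _ => F2 i)).
 by rewrite -(@fineK _ (P B)) ?fin_num_measure// nneseriesZl// muleC.
Qed.

Lemma indep_sigma2 (G H : set_system Om) :
 G `<=` measurable -> setI_closed G -> H `<=` measurable -> setI_closed H ->
 (forall A B, G A -> H B -> P (A `&` B) = P A * P B) ->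
 forall A B, <<s G >> A -> <<s H >> B -> P (A `&` B) = P A * P B.
Proof.
move=> Gm GI Hm HI GH A B sA sB; apply: (@indep_sigma G) => //.
 exact: (sigma_measurable Hm).
move=> {sA}A GA; rewrite setIC muleC; apply: (@indep_sigma H) => //.
 exact: Gm.
by move=> {sB}B HB; rewrite setIC muleC; exact: GH.
Qed.

End sigma.

Section independent.
Context d (Om : measurableType d) (R : realType) (P : probability Om R).

Lemma bigcap_finset (I : finType) (J : {set I}) (A : I -> set Om) :
 \bigcap_(i in [set` J]) A i = \big[setI/setT]_(i in J) A i.
Proof.
rewrite -bigcap_seq_cond; apply/seteqP; split=> w /= h i /=; last first.
 by move=> iJ; apply: h; rewrite /= mem_index_enum.
by move=> /andP[_ iJ]; exact: h.
Qed.

Lemma bigcap_finset_measurable (I : finType) (J : {set I}) (A : I -> set Om) :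
 (forall i, i \in J -> measurable (A i)) ->
 measurable (\bigcap_(i in [set` J]) A i).
Proof.
by move=> mA; rewrite bigcap_finset; apply: bigsetI_measurable => i /mA.
Qed.

Lemma bigcap_finsetD1 (I : finType) (J : {set I}) (A : I -> set Om) i0 :
 i0 \in J -> \bigcap_(i in [set` J]) A i =
 A i0 `&` \bigcap_(i in [set` J :\ i0]) A i.
Proof.
move=> i0J; apply/seteqP; split=> w /=.
 by move=> h; split; [exact: h|move=> i /=; rewrite !inE => /andP[_ /h]].
move=> [h1 h2] i /= iJ; have [->//|ii0] := eqVneq i i0.
by apply: h2; rewrite /= !inE ii0.
Qed.

Lemma indep_systems_sub (I : finType) (G H : I -> set_system Om) :
 (forall i, G i `<=` H i) -> independent_systems P H -> independent_systems P G.
Proof. by move=> GH iH J A AG; apply: iH => i /AG; exact: GH. Qed.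

Lemma indep_systems_sigma (I : finType) (G : I -> set_system Om) :
 (forall i, G i `<=` measurable) -> (forall i, setI_closed (G i)) ->
 independent_systems P G -> independent_systems P (fun i => <<s G i >>).
Proof.
move=> Gm GI iG.
(* In [S s] the systems with index in [s] have been replaced by the sigma-algebras that they
   generate; the induction on [s] replaces one more at a time. *)
pose S (s : seq I) i := if i \in s then <<s G i >> else G i.
have GS s i : G i `<=` S s i.
 rewrite /S; case: ifP => _; side.
have Sm s i : S s i `<=` measurable.
 by rewrite /S; case: ifP => _; [exact: sigma_measurable|side].
suff iS s : independent_systems P (S s).
 by apply: indep_systems_sub (iS (enum I)) => i; rewrite /S mem_enum.
elim: s => [|i0 s IHs]; first side.
move=> J A AS.
have AS' i : i != i0 -> i \in J -> S s i (A i).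
 by move=> ii0 /AS; rewrite /S inE (negbTE ii0).
have [i0J|i0J] := boolP (i0 \in J); last first.
 apply: IHs => i iJ; apply: AS' => //.
 by apply: contraNneq i0J => <-.
set B := \bigcap_(i in [set` J :\ i0]) A i.
have AS'' i : i \in J :\ i0 -> S s i (A i).
 by rewrite !inE => /andP[ii0 iJ]; exact: AS'.
have mB : measurable B.
 by apply: bigcap_finset_measurable => i /AS'' /Sm.
have PB : fine (P B) = \prod_(i in J :\ i0) fine (P (A i)) by exact: IHs.
rewrite (bigcap_finsetD1 _ i0J) -/B (big_setD1 i0)//= -PB.
suff -> : P (A i0 `&` B) = (P (A i0) * P B)%E.
 rewrite fineM// fin_num_measure//; apply: (Sm (i0 :: s)); exact: AS.
apply: (@indep_sigma _ _ _ P (G i0)) => //; last first.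
 by have := AS _ i0J; rewrite /S inE eqxx.
move=> E GE.
(* The induction hypothesis is used with a generator [E] at the index [i0]; [indep_sigma] then
   passes from generators to the sigma-algebra. *)
pose A' i := if i == i0 then E else A i.
have PEB : fine (P (E `&` B)) = fine (P E) * fine (P B).
 have A'0 : A' i0 = E by rewrite /A' eqxx.
 have := IHs J A'.
 rewrite (bigcap_finsetD1 _ i0J) (big_setD1 i0)//= A'0.
 rewrite (_ : \bigcap_(i in [set` J :\ i0]) A' i = B); last first.
  apply: eq_bigcapr => i /=; rewrite !inE /A' => /andP[/negbTE ->//].
 rewrite (eq_bigr (fun i => fine (P (A i)))); last first.
  by move=> i; rewrite !inE /A' => /andP[/negbTE ->//].
 rewrite -PB; apply => i iJ; rewrite /A'; case: eqVneq => [->|ii0].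
  exact: GS.
 exact: AS'.
rewrite -[LHS]fineK ?fin_num_measure//; last by apply: measurableI => //; exact: (Gm i0).
by rewrite PEB EFinM !fineK// fin_num_measure//; exact: (Gm i0).
Qed.

(** The intersections of one event for each index of a block form a pi-system, and these pi-systems
    are independent because products can be regrouped. As every [G i] contains [setT], a single
    event of the block is such an intersection, so the pi-system generates the sigma-algebra of the
    block. *)
Lemma indep_systems_group (I K : finType) (p : I -> K)
  (G : I -> set_system Om) :
 (forall i, G i `<=` measurable) -> (forall i, setI_closed (G i)) ->
 (forall i, G i setT) ->
 independent_systems P G ->
 independent_systems P (fun k => <<s \bigcup_(i in [set i | p i = k]) G i >>).
Proof.
move=> Gm GI GT iG.
pose H (k : K) := [set A | exists2 E : I -> set Om, forall i, G i (E i) &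
 A = \bigcap_(i in [set` [set i | p i == k]%SET]) E i].
have HI k : setI_closed (H k).
 move=> A B [E GE ->] [F GF ->]; exists (fun i => E i `&` F i).
  by move=> i; apply: GI.
 by rewrite -bigcapI.
have Hm k : H k `<=` measurable.
 by move=> A [E GE ->]; apply: bigcap_finset_measurable => i _; apply/Gm/GE.
have iH : independent_systems P H.
 move=> J A AH.
 have AE k : exists E : I -> set Om, k \in J -> (forall i, G i (E i)) /\
   A k = \bigcap_(i in [set` [set i | p i == k]%SET]) E i.
  have [/AH[E GE AE]|_] := boolP (k \in J); first by exists E.
  by exists (fun=> setT).
 move: AE => /choice[E AE].
 rewrite (_ : \bigcap_(i in _) _ =
   \bigcap_(i in [set` [set i | p i \in J]%SET]) E (p i) i); last first.
  apply/seteqP; split=> w /= h i /=.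
   rewrite inE => piJ; have := h _ piJ; rewrite (AE _ piJ).2; apply.
   by rewrite /= inE.
  by move=> iJ; rewrite (AE _ iJ).2 => j /=; rewrite inE => /eqP pj; rewrite -pj; apply: h; rewrite /= inE pj.
 rewrite iG; last by move=> i; rewrite inE => /AE[].
 rewrite (partition_big p (mem J)) => [|i]; last by rewrite inE.
 apply: eq_bigr => k kJ; rewrite (AE _ kJ).2 iG; last by move=> i _; have [] := AE _ kJ.
 apply: eq_big => [i|i].
  by rewrite !inE; apply: andb_idl => /eqP ->.
 by rewrite !inE => /andP[_ /eqP ->].
apply: indep_systems_sub (indep_systems_sigma Hm HI iH) => k.
apply: smallest_sub; first side.
move=> A [i /= pik GA]; apply: sub_sigma_algebra.
exists (fun j => if j == i then A else setT).
 by move=> j; case: eqP => [->|].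
apply/seteqP; split=> w /=.
 by move=> Aw j _; case: eqP.
by move=> /(_ i); rewrite /= inE pik !eqxx; apply.
Qed.

End independent.

Section expectation.
Context d (Om : measurableType d) (R : realType) (P : probability Om R).
Local Open Scope ereal_scope.

(** The joint law agrees with the product of the two laws on rectangles, hence everywhere; Tonelli's
    theorem then integrates one variable at a time. *)
Lemma indep_ge0_int d1 d2 (T1 : measurableType d1) (T2 : measurableType d2)
  (X : Om -> T1) (Y : Om -> T2) (f : T1 * T2 -> \bar R) :
 measfun X -> measfun Y ->
 measfun f -> (forall z, 0 <= f z) ->
 (forall A B, measurable A -> measurable B ->
   P (X @^-1` A `&` Y @^-1` B) = P (X @^-1` A) * P (Y @^-1` B)) ->
 \int[P]_w f (X w, Y w) = \int[P]_w \int[P]_w' f (X w, Y w').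
Proof.
move=> mX mY mf f0 iXY.
pose PX : {RV P >-> T1} := mfun_Sub (mem_set mX).
pose PY : {RV P >-> T2} := mfun_Sub (mem_set mY).
have mXY : measfun (fun w => (X w, Y w)) by side.
pose PXY : {RV P >-> (T1 * T2)%type} := mfun_Sub (mem_set mXY).
transitivity (\int[distribution P PXY]_z f z).
 by rewrite ge0_integral_distribution.
transitivity (\int[(distribution P PX \x distribution P PY)%E]_z f z).
 apply: eq_measure_integral => A mA _.
 exact/esym/product_measure_unique.
rewrite fubini_tonelli1// ge0_integral_distribution//; last 2 first.
 exact: measurable_fun_fubini_tonelli_F.
 side.
apply: eq_integral => w _; rewrite /fubini_F /= ge0_integral_distribution//.
side.
Qed.

Lemma indep_ge0_intM (X Y : Om -> \bar R) :
 measfun X -> measfun Y ->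
 (forall w, 0 <= X w) -> (forall w, 0 <= Y w) ->
 (forall A B, measurable A -> measurable B ->
   P (X @^-1` A `&` Y @^-1` B) = P (X @^-1` A) * P (Y @^-1` B)) ->
 \int[P]_w (X w * Y w) = (\int[P]_w X w) * (\int[P]_w Y w).
Proof.
move=> mX mY X0 Y0 iXY.
(* [indep_ge0_int] wants a function that is nonnegative on the whole product, so absolute values are
   inserted, and removed afterwards. *)
have mabs : measfun (fun z : \bar R * \bar R => `|z.1| * `|z.2|).
 apply: emeasurable_funM; apply: mcomp => //; side.
have /= := @indep_ge0_int _ _ _ _ X Y _ mX mY mabs.
under eq_integral do rewrite !gee0_abs//.
move=> ->//.
under eq_integral => w _.
 under eq_integral do rewrite !gee0_abs//.
 rewrite ge0_integralZl//; over.
by rewrite /= ge0_integralZr// integral_ge0.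
Qed.

End expectation.

Lemma int_prob_cst d (Om : measurableType d) (R : realType)
 (P : probability Om R) (r : \bar R) : (\int[P]__ r = r)%E.
Proof. by rewrite integral_cst//= probability_setT mule1. Qed.

(** * Image measures and affine changes of variable *)

Section integral.
Context d (T : measurableType d) (R : realType).
Variables (mu : {measure set T -> \bar R}) (D : set T) (mD : measurable D).

Lemma ge0_int_mrestr (f : T -> \bar R) :
 measfun f -> (forall x, (0 <= f x)%E) ->
 (\int[mrestr mu mD]_x f x = \int[mu]_(x in D) f x)%E.
Proof.
move=> mf f0; rewrite -(setUv D) ge0_integral_setU//; last 3 first.
 - side.
 - side.
 - by apply/disj_setPS => x [].
rewrite [X in (_ + X)%E](_ : _ = 0%E) ?adde0; last first.
 rewrite null_set_integral//; [side|exact: measurable_funTS|].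
 by rewrite /= /mrestr setICl measure0.
by apply: eq_measure_integral => A mA AD; rewrite /= /mrestr setIidl.
Qed.

End integral.

Section image.
Context d1 d2 (T1 : measurableType d1) (T2 : measurableType d2) (R : realType).
Variables (mu : {measure set T1 -> \bar R}) (f : T1 -> T2).

(* The measurability proof is an argument so that the structure can be inferred. *)
Definition image_mu of measfun f : set T2 -> \bar R :=
 pushforward mu f.

Hypothesis mf : measfun f.

Let image_measure0 : image_mu mf set0 = 0%E.
Proof. by rewrite /image_mu /pushforward preimage_set0 measure0. Qed.

Let image_measure_ge0 A : (0 <= image_mu mf A)%E.
Proof. side. Qed.

Let image_measure_sigma_additive : semi_sigma_additive (image_mu mf).
Proof.
move=> F mF tF mUF; rewrite /image_mu /pushforward preimage_bigcup.
apply: measure_semi_sigma_additive.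
- by move=> n; rewrite -[X in measurable X]setTI; exact: mf.
- apply/trivIsetP => i j _ _ ij; rewrite -preimage_setI.
 move/trivIsetP : tF => /(_ _ _ I I ij) ->; side.
- by rewrite -preimage_bigcup -[X in measurable X]setTI; exact: mf.
Qed.

HB.instance Definition _ := isMeasure.Build _ _ _ (image_mu mf)
 image_measure0 image_measure_ge0 image_measure_sigma_additive.

Lemma ge0_int_image_measure (g : T2 -> \bar R) :
 measfun g -> (forall y, (0 <= g y)%E) ->
 (\int[image_mu mf]_y g y = \int[mu]_x g (f x))%E.
Proof. by move=> mg g0; rewrite ge0_integral_pushforward. Qed.

End image.

Section lebesgue.
Context (R : realType).

Lemma lebesgue_measure_affine (c e : R) (A : set (measurableTypeR R)) :
 0 < c -> measurable A ->
 leb ((fun x : measurableTypeR R => c * x + e) @^-1` A) = (c^-1%:E * leb A)%E.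
Proof.
move=> c0 mA.
have mf : @measurable_fun _ _ (measurableTypeR R) (measurableTypeR R) setT (fun x => c * x + e).
 apply: measurable_funD => //; side.
pose cp : {nonneg R} := NngNum (ltW c0).
(* The image measure scaled by [c] agrees with Lebesgue measure on the intervals []a, b]], which
   characterises the latter. *)
pose m := mscale cp (image_mu leb mf).
have mE B : m B = (c%:E * leb ((fun x : measurableTypeR R => (c * x + e)%R) @^-1` B))%E by [].
transitivity (c^-1%:E * m A)%E; last first.
 congr (_ * _)%E; apply/esym.
 apply: lebesgue_measure_unique => // X [[a b] _ <-].
 rewrite [RHS]mE /=.
 have -> : (fun x : R => c * x + e) @^-1` `]a, b] = `](a - e) / c, (b - e) / c]%classic.
  by apply/seteqP; split => x /=; rewrite !in_itv /= ltr_pdivrMr// ler_pdivlMr// ltrBlDr lerBrDr mulrC.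
 rewrite !lebesgue_measure_itv /= !lte_fin ltr_pM2r ?invr_gt0// ltrD2r.
 case: ifP => _; last by rewrite mule0.
 by rewrite -!EFinD -EFinM; congr EFin; field; rewrite gt_eqF.
by rewrite mE muleA -EFinM mulVf ?gt_eqF// mul1e.
Qed.

End lebesgue.

(** * Two independent uniform variables from the binary digits of one *)

Section unit.
Context (R : realType).

Lemma meas_unit_itv : @measurable _ (measurableTypeR R) `[0%R, 1%R[.
Proof. side. Qed.

Definition unif : set (measurableTypeR R) -> \bar R := mrestr leb meas_unit_itv.

HB.instance Definition _ := Measure.on unif.

Let unif_setT : unif setT = 1%E.
Proof. by rewrite /unif /mrestr setTI lebesgue_measure_itv/= lte_fin ltr01 sube0. Qed.

HB.instance Definition _ := Measure_isProbability.Build _ _ _ unif unif_setT.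

Definition digit (x : R) : R := if x < 2^-1 then 0 else 1.
Definition dshift (x : R) : R := 2 * x - digit x.

Lemma meas_digit : measfun (digit : measurableTypeR R -> R).
Proof. by apply: measurable_fun_if => //; exact: measurable_fun_ltr. Qed.

Lemma meas_dshift :
 measfun (dshift : measurableTypeR R -> measurableTypeR R).
Proof.
by apply: measurable_funB; [side|exact: meas_digit].
Qed.

(** On the half of [0, 1[ where the first digit is [e], [dshift] is the affine map of slope 2 onto
    [0, 1[: the first digit is a fair coin, independent of the remaining ones. *)
Lemma unif_digit (e : bool) (A : set (measurableTypeR R)) : measurable A ->
 unif [set x | digit x = e%:R /\ A (dshift x)] = (2^-1%:E * unif A)%E.
Proof.
move=> mA; rewrite /unif /mrestr -(@lebesgue_measure_affine _ 2 (- e%:R))//; last first.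
 side.
congr (leb _); apply/seteqP; split => x /=; rewrite !in_itv /= /dshift /digit.
 move=> [[+ +] /andP[]]; case: ltP; case: e => //=.
 - by move=> ? /eqP; rewrite eq_sym oner_eq0.
 - by move=> ? _ ? ? ?; split => //; apply/andP; split; lra.
 - by move=> ? _ ? ? ?; split => //; apply/andP; split; lra.
 - by move=> ? /eqP; rewrite oner_eq0.
move=> [Ax /andP[]]; case: e Ax => /= Ax h1 h2.
 have -> : (x < 2^-1) = false by apply/negbTE; rewrite -leNgt; lra.
 by split => //; apply/andP; split; lra.
have -> : x < 2^-1 by lra.
by split => //; apply/andP; split; lra.
Qed.

Lemma unif_digit2 (e e' : bool) (A : set (measurableTypeR R)) : measurable A ->
 unif [set x | [/\ digit x = e%:R, digit (dshift x) = e'%:R & A (dshift (dshift x))]]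
 = (4^-1%:E * unif A)%E.
Proof.
move=> mA.
have -> : (4^-1%:E * unif A = 2^-1%:E * (2^-1%:E * unif A))%E.
 by rewrite muleA -EFinM; congr (_%:E * _)%E; field.
rewrite -(unif_digit e' mA) -(unif_digit e); last first.
 apply: measurableI; last first.
  by rewrite -[X in measurable X]setTI; exact: meas_dshift.
 have := meas_digit measurableT (@measurable_set1 R e'%:R).
 by rewrite setTI.
by congr unif; apply/seteqP; split => x /= [] // ? [].
Qed.

Fixpoint even_digits (n : nat) (x : R) : R :=
 if n is m.+1 then (digit x + even_digits m (dshift (dshift x))) / 2 else 0.
Fixpoint odd_digits (n : nat) (x : R) : R :=
 if n is m.+1 then (digit (dshift x) + odd_digits m (dshift (dshift x))) / 2 else 0.

(* The distribution function of a uniform point of the 2^n-th grid. *)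
Fixpoint grid_cdf (n : nat) (a : R) : R :=
 if n is m.+1 then (grid_cdf m (2 * a) + grid_cdf m (2 * a - 1)) / 2
 else (0 <= a)%R%:R.

(** The distribution function of the uniform law on [0, 1]. *)
Definition clamp (a : R) : R := if a < 0 then 0 else if a < 1 then a else 1.

(** [clamp] satisfies the same halving recursion ([cE]) as [grid_cdf], and the error is one step of
    the grid. *)
Lemma grid_cdf_bounds n (a : R) : clamp a <= grid_cdf n a <= clamp (a + 2^-1 ^+ n).
Proof.
elim: n a => [a|n IHn a] /=.
 by rewrite expr0 /clamp; case: (ltP a 0) => a0 /=; case: (ltP a 1) => a1; case: (ltP (a + 1) 0); case: (ltP (a + 1) 1); lra.
have /andP[h1 h2] := IHn (2 * a); have /andP[h3 h4] := IHn (2 * a - 1).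
have cE b : clamp b = (clamp (2 * b) + clamp (2 * b - 1)) / 2.
 have F (x y : R) : y <= x -> (x < y) = false by rewrite leNgt => /negbTE.
 rewrite /clamp; have [b0|b0] := ltP b 0.
  by rewrite (_ : 2 * b < 0) 1?(_ : 2 * b - 1 < 0); lra.
 rewrite (F (2 * b) 0); last by lra.
 have [b1|b1] := ltP b 1; last by rewrite !F; lra.
 have [b2|b2] := ltP b 2^-1.
  by rewrite (_ : 2 * b < 1) 1?(_ : 2 * b - 1 < 0); lra.
 by rewrite (F (2 * b) 1) 1?(F (2 * b - 1) 0) 1?(_ : 2 * b - 1 < 1); lra.
rewrite (cE a) (cE (a + _)) exprS.
have -> : 2 * (a + 2^-1 * 2^-1 ^+ n) = 2 * a + 2^-1 ^+ n by field.
have -> : 2 * a + 2^-1 ^+ n - 1 = 2 * a - 1 + 2^-1 ^+ n by ring.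
by apply/andP; split; lra.
Qed.

Lemma meas_even_digits n :
 measfun (even_digits n : measurableTypeR R -> R).
Proof.
elim: n => //= n IHn; apply: measurable_funM => //; apply: measurable_funD.
 exact: meas_digit.
apply: (mcomp IHn).
by apply: mcomp; exact: meas_dshift.
Qed.

Lemma meas_odd_digits n :
 measfun (odd_digits n : measurableTypeR R -> R).
Proof.
elim: n => //= n IHn; apply: measurable_funM => //; apply: measurable_funD.
 by apply: mcomp; [exact: meas_digit|exact: meas_dshift].
apply: (mcomp IHn).
by apply: mcomp; exact: meas_dshift.
Qed.

Lemma meas_le_cst d (T : measurableType d) (f : T -> R) a :
 measfun f -> measurable [set x | f x <= a].
Proof.
move=> mf; rewrite -[X in measurable X]setTI.
have -> : [set x | f x <= a] = f @^-1` `]-oo, a] by side.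
exact: mf.
Qed.

(** The first two digits give four equally likely cases, one digit for each coordinate; summing over
    them reproduces the recursion of [grid_cdf] in both variables at once. *)
Lemma unif_digits n (a b : R) :
 unif [set x | even_digits n x <= a /\ odd_digits n x <= b] =
 (grid_cdf n a * grid_cdf n b)%:E.
Proof.
elim: n a b => [a b|n IHn a b] /=.
 case: (leP 0 a) => a0; case: (leP 0 b) => b0; rewrite /= ?mulr1 ?mulr0 ?mul0r.
 - rewrite (_ : [set _ | _] = setT) ?probability_setT//.
  by apply/seteqP; split.
 - by rewrite (_ : [set _ | _] = set0) ?measure0//; apply/seteqP; split => x //= [].
 - by rewrite (_ : [set _ | _] = set0) ?measure0//; apply/seteqP; split => x //= [].
 - by rewrite (_ : [set _ | _] = set0) ?measure0//; apply/seteqP; split => x //= [].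
pose S (e e' : bool) := [set x : measurableTypeR R | [/\ digit x = e%:R, digit (dshift x) = e'%:R &
 [set y : R | even_digits n y <= 2 * a - e%:R /\ odd_digits n y <= 2 * b - e'%:R]
  (dshift (dshift x))]].
have mE (a' b' : R) : measurable [set y : measurableTypeR R | even_digits n y <= a' /\ odd_digits n y <= b'].
 by apply: measurableI; apply: meas_le_cst; [exact: meas_even_digits|exact: meas_odd_digits].
have mS e e' : measurable (S e e').
 have m2 : measfun (fun x : measurableTypeR R => dshift (dshift x) : measurableTypeR R).
  by apply: mcomp; exact: meas_dshift.
 have -> : S e e' = (digit @^-1` [set e%:R]) `&` ((digit \o dshift) @^-1` [set e'%:R]) `&`
   (fun x : measurableTypeR R => dshift (dshift x)) @^-1` [set y : measurableTypeR R | even_digits n y <= 2 * a - e%:R /\ odd_digits n y <= 2 * b - e'%:R].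
  by apply/seteqP; split => x /=; [move=> [? ? []]|move=> [[? ?] []]].
 apply: measurableI; last by rewrite -[X in measurable X]setTI; exact: m2.
 apply: measurableI; rewrite -[X in measurable X]setTI.
  apply: meas_digit => //; side.
 exact: (mcomp meas_digit meas_dshift) measurableT _ (@measurable_set1 R e'%:R).
have -> : [set x | (digit x + even_digits n (dshift (dshift x))) / 2 <= a /\
   (digit (dshift x) + odd_digits n (dshift (dshift x))) / 2 <= b] =
  (S true true `|` S true false) `|` (S false true `|` S false false).
 have hE (u v w : R) : ((u + v) / 2 <= w) = (v <= 2 * w - u).
  by rewrite ler_pdivrMr// lerBrDl mulrC.
 have dE x : digit x = 0 \/ digit x = 1 by rewrite /digit; case: ifP; [left|right].
 apply/seteqP; split => x /=; rewrite !hE.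
  move=> [h1 h2]; have [d0|d1] := dE x; have [e0|e1] := dE (dshift x).
  - right; right; rewrite d0 e0 in h1 h2; side.
  - right; left; rewrite d0 e1 in h1 h2; side.
  - left; right; rewrite d1 e0 in h1 h2; side.
  - left; left; rewrite d1 e1 in h1 h2; side.
 by move=> [[]|[]] [-> -> []].
have neq : (1 : R) <> 0 by move/eqP; rewrite oner_eq0.
have dj2 e : S e true `&` S e false = set0.
 by apply/seteqP; split => x // [[_ e1 _] [_ e2 _]]; apply: neq; rewrite -[LHS]e1 e2.
have dj1 : (S true true `|` S true false) `&` (S false true `|` S false false) = set0.
 apply/seteqP; split => x // [h1 h2]; apply: neq.
 have -> : (1 : R) = digit x by case: h1 => -[].
 by case: h2 => -[].
rewrite !measureU//; try exact: measurableU.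
have US e e' : unif (S e e') =
  (4^-1 * (grid_cdf n (2 * a - e%:R) * grid_cdf n (2 * b - e'%:R)))%:E.
 by rewrite unif_digit2// IHn EFinM.
by rewrite /= !US /= !subr0 -!EFinD; congr EFin; field.
Qed.

Lemma even_digits_nd (x : R) : nondecreasing_seq (even_digits^~ x).
Proof.
apply/nondecreasing_seqP => n; elim: n x => [x|n IHn x] /=.
 by rewrite addr0 divr_ge0// /digit; case: ifP.
rewrite ler_pM2r ?invr_gt0// lerD2l; side.
Qed.

Lemma odd_digits_nd (x : R) : nondecreasing_seq (odd_digits^~ x).
Proof.
apply/nondecreasing_seqP => n; elim: n x => [x|n IHn x] /=.
 by rewrite addr0 divr_ge0// /digit; case: ifP.
rewrite ler_pM2r ?invr_gt0// lerD2l; side.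
Qed.

Lemma even_digits_le1 n (x : R) : even_digits n x <= 1.
Proof.
elim: n x => //= n IHn x; rewrite ler_pdivrMr// mul1r.
by rewrite [leRHS](_ : 2 = 1 + 1)// lerD// /digit; case: ifP.
Qed.

Lemma odd_digits_le1 n (x : R) : odd_digits n x <= 1.
Proof.
elim: n x => //= n IHn x; rewrite ler_pdivrMr// mul1r.
by rewrite [leRHS](_ : 2 = 1 + 1)// lerD// /digit; case: ifP.
Qed.

Definition even_part (x : measurableTypeR R) : measurableTypeR R := limn (even_digits^~ x).
Definition odd_part (x : measurableTypeR R) : measurableTypeR R := limn (odd_digits^~ x).

Lemma cvg_even_digits (x : R) : even_digits^~ x @ \oo --> even_part x.
Proof.
apply/cvg_ex; eexists; apply: nondecreasing_cvgn; first exact: even_digits_nd.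
by exists 1 => _ [n _ <-]; exact: even_digits_le1.
Qed.

Lemma cvg_odd_digits (x : R) : odd_digits^~ x @ \oo --> odd_part x.
Proof.
apply/cvg_ex; eexists; apply: nondecreasing_cvgn; first exact: odd_digits_nd.
by exists 1 => _ [n _ <-]; exact: odd_digits_le1.
Qed.

Lemma meas_even_part : measfun even_part.
Proof.
apply: (@measurable_fun_cvg _ _ _ _ even_digits).
 exact: meas_even_digits.
by move=> x _; exact: cvg_even_digits.
Qed.

Lemma meas_odd_part : measfun odd_part.
Proof.
apply: (@measurable_fun_cvg _ _ _ _ odd_digits).
 exact: meas_odd_digits.
by move=> x _; exact: cvg_odd_digits.
Qed.

Lemma limn_leP (u : nat -> R) (l a : R) : nondecreasing_seq u -> u @ \oo --> l ->
 (l <= a) <-> (forall n, u n <= a).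
Proof.
move=> ndu ul; split=> [la n|ua].
 by rewrite (le_trans _ la)// -(cvg_lim _ ul)//; apply: nondecreasing_cvgn_le => //; apply/cvg_ex; exists l.
by rewrite -(cvg_lim _ ul)//; apply: limr_le; [apply/cvg_ex; exists l|exact: nearW].
Qed.

Lemma cvg_grid_cdf (a : R) : grid_cdf ^~ a @ \oo --> clamp a.
Proof.
apply: (@squeeze_cvgr _ _ _ _ (fun=> clamp a) (fun n => clamp a + 2^-1 ^+ n)).
- near=> n; have /andP[-> h] /= := grid_cdf_bounds n a.
 rewrite (le_trans h)//.
 have : 0 < 2^-1 ^+ n :> R by side.
 rewrite /clamp; move: (2^-1 ^+ n) => r r0.
 by case: (ltP a 0) => ?; case: (ltP a 1) => ?; case: (ltP (a + r) 0) => ?; case: (ltP (a + r) 1) => ?; lra.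
- exact: cvg_cst.
- rewrite -[X in _ --> X]addr0; apply: cvgD; first exact: cvg_cst.
 by apply: cvg_expr; rewrite ger0_norm// invf_lt1// ltr1n.
Unshelve. all: by end_near. Qed.

(** The truncated expansions increase, so the event is a decreasing intersection of the events of
    [unif_digits], whose probabilities converge. *)
Lemma unif_parts (a b : R) :
 unif [set x | even_part x <= a /\ odd_part x <= b] = (clamp a * clamp b)%:E.
Proof.
pose E n := [set x : measurableTypeR R | even_digits n x <= a /\ odd_digits n x <= b].
have -> : [set x | even_part x <= a /\ odd_part x <= b] = \bigcap_n E n.
 apply/seteqP; split => x /=.
  move=> [/(limn_leP _ (@even_digits_nd x) (@cvg_even_digits x)) h1].
  move=> /(limn_leP _ (@odd_digits_nd x) (@cvg_odd_digits x)) h2 n _.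
  side.
 move=> h; split.
  by apply/(limn_leP _ (@even_digits_nd x) (@cvg_even_digits x)) => n; have [] := h n I.
 by apply/(limn_leP _ (@odd_digits_nd x) (@cvg_odd_digits x)) => n; have [] := h n I.
have mE n : measurable (E n).
 by apply: measurableI; apply: meas_le_cst; [exact: meas_even_digits|exact: meas_odd_digits].
have cvE : unif (E n) @[n --> \oo] --> unif (\bigcap_n E n).
 apply: nonincreasing_cvg_mu => //.
 - by rewrite (le_lt_trans (probability_le1 _ _))// ltry.
 - side.
 - move=> m n mn; apply/subsetPset => x [h1 h2]; split.
   by rewrite (le_trans _ h1)//; exact: even_digits_nd.
  by rewrite (le_trans _ h2)//; exact: odd_digits_nd.
rewrite -(cvg_lim _ cvE)//; apply/cvg_lim => //.
under eq_fun do rewrite unif_digits.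
apply: cvg_EFin; first exact: nearW.
exact: cvgM (@cvg_grid_cdf a) (@cvg_grid_cdf b).
Qed.

Lemma unif_itvNyc (a : R) : unif `]-oo, a] = (clamp a)%:E.
Proof.
rewrite /unif /mrestr /clamp; have [a0|a0] := ltP a 0.
 rewrite (_ : _ `&` _ = set0) ?measure0//.
 by apply/seteqP; split => x //=; rewrite !in_itv/= => -[xa /andP[x0 _]]; lra.
have [a1|a1] := ltP a 1.
 rewrite (_ : _ `&` _ = `[0, a]%classic).
  by rewrite lebesgue_measure_itv/= lte_fin -EFinB subr0; case: ltP => // ?; congr EFin; lra.
 apply/seteqP; split => x /=; rewrite !in_itv/=.
  by move=> [? /andP[? ?]]; exact/andP.
 by move=> /andP[? ?]; split => //; apply/andP; split => //; lra.
rewrite (_ : _ `&` _ = `[0, 1[%classic).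
 by rewrite lebesgue_measure_itv/= lte_fin ltr01 sube0.
apply/seteqP; split => x /=; rewrite !in_itv/=; first by case.
move=> /andP[? ?].
by split; [lra|exact/andP].
Qed.

(** [setT] is added to the half-lines so that the pi-system covers the space, as the uniqueness
    theorem for measures requires. *)
Let rays : set_system (measurableTypeR R) := [set A | A = setT \/ exists a, A = `]-oo, a]%classic].

Let meas_rays : @measurable _ (measurableTypeR R) = <<s rays >>.
Proof.
apply/seteqP; split; last first.
 apply: smallest_sub; first exact: sigma_algebra_measurable.
 move=> A [->|[a ->]]; side.
apply: smallest_sub; first side.
move=> _ [[a b] _ <-] /=.
have -> : `]a, b]%classic = `]-oo, b]%classic `\` `]-oo, a]%classic.
 apply/seteqP; split => x /=; rewrite !in_itv/= ltNge.
  by move=> /andP[/negP].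
 by move=> [? /negP ?]; exact/andP.
by apply: (@measurableD _ (g_sigma_algebraType rays)); apply: sub_sigma_algebra;
  right; eexists.
Qed.

Let raysI : setI_closed rays.
Proof.
move=> A B [->|[a ->]]; first by rewrite setTI.
move=> [->|[b ->]]; first by rewrite setIT; right; exists a.
right; exists (Num.min a b); apply/seteqP; split => x /=; rewrite !in_itv/=.
 by move=> [? ?]; rewrite le_min; exact/andP.
by rewrite le_min => /andP.
Qed.

Lemma unif_unique (m : probability (measurableTypeR R) R) :
 (forall a, m `]-oo, a]%classic = (clamp a)%:E) ->
 forall A, measurable A -> m A = unif A.
Proof.
move=> ma A mA; apply: (measure_unique rays (fun=> setT)) => //.
- by move=> _; left.
- rewrite bigcup_const//; side.
- move=> B [->|[a ->]].
  exact: etrans (probability_setT m) (esym (probability_setT unif)).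
 exact: etrans (ma a) (esym (unif_itvNyc a)).
- by move=> _; apply: (le_lt_trans (probability_le1 m measurableT)); exact: ltry.
Qed.

Lemma clamp1 (a : R) : 1 <= a -> clamp a = 1.
Proof. by move=> a1; rewrite /clamp; case: ltP => ?; [lra|case: ltP => ?; lra]. Qed.

Lemma even_part_le1 x : even_part x <= 1.
Proof.
by apply/(limn_leP _ (@even_digits_nd x) (@cvg_even_digits x)) => n; exact: even_digits_le1.
Qed.

Lemma odd_part_le1 x : odd_part x <= 1.
Proof.
by apply/(limn_leP _ (@odd_digits_nd x) (@cvg_odd_digits x)) => n; exact: odd_digits_le1.
Qed.

Let even_RV : {RV unif >-> measurableTypeR R} := mfun_Sub (mem_set meas_even_part).
Let odd_RV : {RV unif >-> measurableTypeR R} := mfun_Sub (mem_set meas_odd_part).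

Lemma unif_even_part A : measurable A -> unif (even_part @^-1` A) = unif A.
Proof.
move=> mA; apply: (@unif_unique (distribution unif even_RV)) => // a.
transitivity (unif [set x | even_part x <= a /\ odd_part x <= 1]).
 congr unif; apply/seteqP; split => x /=; rewrite in_itv/=; last by case.
 by split => //; exact: odd_part_le1.
by rewrite unif_parts (clamp1 (lexx 1)) mulr1.
Qed.

Lemma unif_odd_part A : measurable A -> unif (odd_part @^-1` A) = unif A.
Proof.
move=> mA; apply: (@unif_unique (distribution unif odd_RV)) => // a.
transitivity (unif [set x | even_part x <= 1 /\ odd_part x <= a]).
 congr unif; apply/seteqP; split => x /=; rewrite in_itv/=; last by case.
 by split => //; exact: even_part_le1.
by rewrite unif_parts (clamp1 (lexx 1)) mul1r.
Qed.

Lemma indep_parts A B : measurable A -> measurable B ->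
 unif (even_part @^-1` A `&` odd_part @^-1` B) =
 (unif (even_part @^-1` A) * unif (odd_part @^-1` B))%E.
Proof.
have pre (f : measurableTypeR R -> measurableTypeR R) C : measurable C ->
  <<s preimage_set_system setT f rays >> (f @^-1` C).
 rewrite meas_rays => mC; rewrite g_sigma_preimageE.
 exists C => //; side.
have preI (f : measurableTypeR R -> measurableTypeR R) : setI_closed (preimage_set_system setT f rays).
 move=> _ _ [C rC <-] [D rD <-]; exists (C `&` D); first exact: raysI.
 side.
have prem (f : measurableTypeR R -> measurableTypeR R) : measfun f ->
  preimage_set_system setT f rays `<=` measurable.
 move=> mf _ [C rC <-]; apply: mf => //.
 by rewrite meas_rays; exact: sub_sigma_algebra.
move=> mA mB; apply: (indep_sigma2 (prem _ meas_even_part) (preI _)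
 (prem _ meas_odd_part) (preI _)); [|exact: pre|exact: pre].
move=> _ _ [C rC <-] [D rD <-]; rewrite !setTI.
case: rC => [->|[a ->]]; first by rewrite preimage_setT setTI probability_setT mul1e.
case: rD => [->|[b ->]]; first by rewrite preimage_setT setIT probability_setT mule1.
transitivity (unif [set x | even_part x <= a /\ odd_part x <= b]).
 side.
rewrite unif_parts EFinM; congr (_ * _)%E; rewrite -unif_itvNyc; apply/esym.
 apply: unif_even_part; side.
apply: unif_odd_part; side.
Qed.

(** One uniform variable carries the randomness of an independent pair; this is what allows [0, 1[
    to be the probability space of all the noises. *)
Lemma unif_split (F : measurableTypeR R * measurableTypeR R -> \bar R) :
 measfun F -> (forall z, (0 <= F z)%E) ->
 (\int[unif]_x F (even_part x, odd_part x) = \int[unif]_x \int[unif]_y F (x, y))%E.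
Proof.
move=> mF F0.
rewrite (indep_ge0_int meas_even_part meas_odd_part mF F0 indep_parts).
transitivity (\int[unif]_w \int[unif]_y F (even_part w, y))%E.
 apply: eq_integral => x _.
 have mFx : measfun (fun y : measurableTypeR R => F (even_part x, y)) by side.
 rewrite -(@ge0_integral_distribution _ _ _ _ _ unif odd_RV (fun y => F (even_part x, y)))//.
 by apply: eq_measure_integral => A mA _; exact: unif_odd_part.
have mG : measfun (fun x : measurableTypeR R => \int[unif]_y F (x, y))%E.
 exact: measurable_fun_fubini_tonelli_F.
rewrite -(@ge0_integral_distribution _ _ _ _ _ unif even_RV (fun x => \int[unif]_y F (x, y))%E)//; last first.
 side.
by apply: eq_measure_integral => A mA _; exact: unif_even_part.
Qed.

End unit.

Section measurable.
Context d (T : measurableType d).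

Lemma meas_fun_nat_param d' (T' : measurableType d') (X : T -> nat)
  (f : nat -> T -> T') :
 measfun X -> (forall n, measfun (f n)) ->
 measfun (fun x => f (X x) x).
Proof.
move=> mX mf _ B mB; rewrite setTI.
have -> : (fun x => f (X x) x) @^-1` B = \bigcup_n (X @^-1` [set n] `&` f n @^-1` B).
 by apply/seteqP; split => x /=; [move=> Bx; exists (X x)|move=> [n _ [/= <-]]].
apply: bigcupT_measurable => n; apply: measurableI; rewrite -[X in measurable X]setTI.
 exact: mX.
exact: mf.
Qed.

Lemma meas_fun_natP (X : T -> nat) :
 (forall n, measurable (X @^-1` [set n])) -> measfun X.
Proof.
move=> mX _ B mB; rewrite setTI.
have -> : X @^-1` B = \bigcup_(n in B) (X @^-1` [set n]).
 by apply/seteqP; split => x /=; [exists (X x)|move=> [n Bn /= ->]].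
exact: bigcup_measurable.
Qed.

Variables (R : realType) (mu : {measure set T -> \bar R}).

Lemma ge0_int_nat (X : T -> nat) (h : nat -> \bar R) :
 measfun X -> (forall n, (0 <= h n)%E) ->
 (\int[mu]_x h (X x) = \sum_(n <oo) h n * mu (X @^-1` [set n]))%E.
Proof.
move=> mX h0.
have mXn n : measurable (X @^-1` [set n]) by rewrite -[X in measurable X]setTI; exact: mX.
have XT : \bigcup_n (X @^-1` [set n]) = setT.
 by apply/seteqP; split => // x _; exists (X x).
rewrite -XT ge0_integral_bigcup//; last 2 first.
 side.
 by apply/trivIsetP => i j _ _ ij; apply/seteqP; split => x //= [-> /eqP]; rewrite (negbTE ij).
apply: eq_eseriesr => n _.
rewrite -integral_cst//; apply: eq_integral => x.
by rewrite inE => /= ->.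
Qed.

End measurable.

(** * Poisson weights and generating functions *)

Section poisson.
Context (R : realType).

(** The Poisson law as real numbers, including rate 0, where it is the unit mass at 0. *)
Definition poisson_wt (r : R) (k : nat) : R := r ^+ k * k`!%:R^-1 * expR (- r).

Lemma poisson_wt_ge0 r k : 0 <= r -> 0 <= poisson_wt r k.
Proof. side. Qed.

Lemma poisson_probE (r : R) k n : 0 <= r ->
 poisson_prob r n [set k] = (poisson_wt r k)%:E.
Proof.
rewrite /poisson_prob /poisson_wt le_eqVlt => /predU1P[<-|r0].
 rewrite ltxx oppr0 expR0 mulr1 diracE.
 case: k => [|k]; first by rewrite expr0 fact0 mul1r invr1 mem_set.
 by rewrite exprS !mul0r memNset.
by rewrite r0 esum_set1 /poisson_pmf ?r0// lee_fin !mulr_ge0 ?expR_ge0 ?exprn_ge0 ?ltW.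
Qed.

Lemma poisson_pgf (r s : R) : 0 <= r -> 0 <= s ->
 (\sum_(k <oo) (poisson_wt r k * s ^+ k)%:E = (expR ((s - 1) * r))%:E)%E.
Proof.
move=> r0 s0.
have -> : expR ((s - 1) * r) = expR (- r) * expR (r * s).
 by rewrite -expRD; congr expR; ring.
have -> : expR (r * s) = limn (pseries (fun n => n`!%:R^-1) (r * s)) by rewrite expRE.
have cvs : cvgn (pseries (fun n => n`!%:R^-1) (r * s)).
 by rewrite /pseries /=; under eq_fun do rewrite mulrC; exact: is_cvg_series_exp_coeff.
rewrite EFinM -(EFin_lim cvs).
have -> : EFin \o pseries (fun n => n`!%:R^-1) (r * s) =
  (fun n => \sum_(0 <= k < n) ((r * s) ^+ k * k`!%:R^-1)%:E)%E.
 apply/funext => n /=; rewrite /pseries /series /= sumEFin; congr EFin.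
 by apply: eq_bigr => k _; rewrite mulrC.
rewrite -nneseriesZl; last side.
by apply: eq_eseriesr => k _; rewrite -EFinM /poisson_wt exprMn; congr EFin; ring.
Qed.

Lemma poisson_wt_sum1 (r : R) : 0 <= r ->
 (\sum_(k <oo) (poisson_wt r k)%:E = 1)%E.
Proof.
move=> r0; have := @poisson_pgf r 1 r0 ler01.
by rewrite subrr mul0r expR0 => <-; apply: eq_eseriesr => k _; rewrite expr1n mulr1.
Qed.

(** Strong induction on the degree: once the terms of degree below [n] cancel, dividing by t^n and
    letting t tend to 0 compares the coefficients of degree [n], the rest being at most t times the
    total mass. *)
Lemma eq_power_series (a b : nat -> R) :
 (forall k, 0 <= a k) -> (forall k, 0 <= b k) ->
 (\sum_(k <oo) (b k)%:E < +oo)%E ->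
 (forall t : R, (0 <= t <= 1)%R ->
  \sum_(k <oo) (a k * t ^+ k)%:E = \sum_(k <oo) (b k * t ^+ k)%:E)%E ->
 a = b.
Proof.
move=> a0 b0 sb ab.
have sa : (\sum_(k <oo) (a k)%:E < +oo)%E.
 have := ab 1; rewrite lexx ler01 => /(_ isT).
 under eq_eseriesr do rewrite expr1n mulr1.
 by under [X in _ = X -> _]eq_eseriesr do rewrite expr1n mulr1; move=> ->.
(* Only one inequality is proved; the other follows by exchanging the two series. *)
have half (u v : nat -> R) n : (forall k, 0 <= u k) -> (forall k, 0 <= v k) ->
  (\sum_(k <oo) (v k)%:E < +oo)%E ->
  (forall t : R, (0 <= t <= 1)%R ->
   \sum_(k <oo) (u k * t ^+ k)%:E = \sum_(k <oo) (v k * t ^+ k)%:E)%E ->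
  (forall k, (k < n)%N -> u k = v k) -> u n <= v n.
 move=> u0 v0 sv uv IH.
 have [c cE] : exists c, (\sum_(k <oo) (v k)%:E = c%:E)%E.
  exists (fine (\sum_(k <oo) (v k)%:E)%E); rewrite fineK// ge0_fin_numE// nneseries_ge0// => k _ _; side.
 have c0 : 0 <= c by rewrite -lee_fin -cE; apply: nneseries_ge0 => k _ _; rewrite lee_fin.
 have sum_c m : \sum_(0 <= k < m) v k <= c.
  rewrite -lee_fin -cE -sumEFin; apply: nneseries_lim_ge => k _ _; by rewrite lee_fin.
 have key t : 0 < t -> t <= 1 -> u n <= v n + t * c.
  move=> t0 t1.
  have tn m : 0 < t ^+ m by side.
  have h1 : ((\sum_(0 <= k < n.+1) u k * t ^+ k)%:E <= \sum_(k <oo) (v k * t ^+ k)%:E)%E.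
   rewrite -uv ?(ltW t0)// -sumEFin; apply: nneseries_lim_ge => k _ _.
   side.
  have h2 : (\sum_(k <oo) (v k * t ^+ k)%:E <= (\sum_(0 <= k < n.+1) v k * t ^+ k + t ^+ n.+1 * c)%:E)%E.
   apply: lime_le; first by apply: is_cvg_nneseries => k _ _; rewrite lee_fin mulr_ge0// ltW.
   near=> m; rewrite sumEFin lee_fin.
   have nm : (n.+1 <= m)%N by near: m; exists n.+1.
   rewrite (@big_cat_nat _ _ _ n.+1)//= lerD2l.
   rewrite (@le_trans _ _ (t ^+ n.+1 * \sum_(n.+1 <= k < m) v k))//; last first.
    rewrite ler_pM2l// (le_trans _ (sum_c m))// (@big_cat_nat _ _ _ n.+1 0 m)//= lerDr.
    side.
   rewrite mulr_sumr; apply: ler_sum_nat => k /andP[nk _].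
   rewrite mulrC ler_wpM2r//.
   by rewrite ler_wiXn2l// ?ltW.
  have := le_trans h1 h2; rewrite lee_fin !big_nat_recr//=.
  rewrite (@eq_big_nat _ _ _ 0 n (fun k => u k * t ^+ k) (fun k => v k * t ^+ k)); last first.
   by move=> k /andP[_ kn]; rewrite IH.
  rewrite -addrA lerD2l exprS.
  have -> : v n * t ^+ n + t * t ^+ n * c = (v n + t * c) * t ^+ n by ring.
  by rewrite ler_pM2r.
 apply/ler_addgt0Pl => eps eps0.
 (* Chosen so that [t * c <= eps]; the added 1 keeps the quotient meaningful when [c = 0]. *)
 pose t := Num.min 1 (eps / (c + 1)).
 have c1 : 0 < c + 1 by lra.
 have t0 : 0 < t by rewrite lt_min ltr01 divr_gt0.
 have t1 : t <= 1 by rewrite ge_min lexx.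
 rewrite (le_trans (key t t0 t1))// addrC lerD2r.
 rewrite (@le_trans _ _ (eps / (c + 1) * c))//.
  by rewrite ler_wpM2r// ge_min lexx orbT.
 by rewrite mulrAC ler_pdivrMr// ler_wpM2l ?ltW//; lra.
apply/funext => n; elim/ltn_ind: n => n IH.
apply/eqP; rewrite eq_le; apply/andP; split; apply: half => //.
 by move=> t t01; rewrite ab.
by move=> k kn; rewrite IH.
Unshelve. all: by end_near. Qed.

End poisson.

Section generating.
Context d (Om : measurableType d) (R : realType) (P : probability Om R).

Lemma meas_eq_nat (X : Om -> nat) (k : nat) :
 measfun X -> measfun (fun w => (X w == k)%:R : R).
Proof.
by move=> mX; apply: (@meas_fun_nat_param _ _ _ R X (fun n _ => (n == k)%:R)).
Qed.

Lemma int_power_series (X : Om -> nat) (W : Om -> R) (t : R) :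
 measfun X -> measfun W -> (forall w, 0 <= W w) ->
 0 <= t ->
 (\int[P]_w (W w * t ^+ X w)%:E =
  \sum_(k <oo) (\int[P]_w (W w * (X w == k)%:R)%:E) * (t ^+ k)%:E)%E.
Proof.
move=> mX mW W0 t0.
transitivity (\sum_(k <oo) \int[P]_w (W w * (X w == k)%:R * t ^+ k)%:E)%E; last first.
 apply: eq_eseriesr => k _; under eq_integral do rewrite EFinM.
 rewrite ge0_integralZr//; last 3 first.
 - by apply/measurable_EFinP; apply: measurable_funM => //; exact: meas_eq_nat.
 - side.
 - side.
rewrite -integral_nneseries//; last 2 first.
 - move=> k; apply/measurable_EFinP; apply: measurable_funM => //.
  by apply: measurable_funM => //; exact: meas_eq_nat.
 - side.
apply: eq_integral => w _.
rewrite (@nneseriesD1 _ _ (X w))//; last side.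
rewrite eqxx mulr1 eseries0 ?adde0// => k _ /negbTE.
by rewrite eq_sym => ->; rewrite mulr0 mul0r.
Qed.

Variables (I : eqType) (X : I -> Om -> nat) (a : I -> R).
Hypothesis mX : forall i, measfun (X i).
Hypothesis a0 : forall i, 0 <= a i.

Lemma meas_prod_pow (r : seq I) (s : I -> R) :
 measfun (fun w => \prod_(i <- r) s i ^+ X i w).
Proof. apply: measurable_prod => i _; side. Qed.

(** The generating function on the unit cube determines the joint law. One variable is treated at a
    time, by comparing power series in [s i]; the weight [W] collects the indicators of the
    variables already treated, and [c] their weights. *)
Lemma pgf_poisson_law (r : seq I) (W : Om -> R) (c : R) :
 uniq r -> measfun W -> (forall w, 0 <= W w <= 1) -> 0 <= c ->
 (forall s : I -> R, (forall i, (0 <= s i <= 1)%R) ->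
  \int[P]_w (W w * \prod_(i <- r) s i ^+ X i w)%:E =
  (c * \prod_(i <- r) expR ((s i - 1) * a i))%:E)%E ->
 forall k : I -> nat,
  (\int[P]_w (W w * \prod_(i <- r) (X i w == k i)%:R)%:E =
  (c * \prod_(i <- r) poisson_wt (a i) (k i))%:E)%E.
Proof.
elim: r W c => [|i r IHr] W c /=.
 move=> _ _ _ _ h k; have := h (fun=> 1); rewrite !big_nil.
 under eq_integral do rewrite big_nil.
 under [X in _ -> X = _]eq_integral do rewrite big_nil.
 by apply => _; rewrite ler01 lexx.
move=> /andP[ir ur] mW W01 c0 h k.
have key (s : I -> R) (n : nat) : (forall i, 0 <= s i <= 1) ->
  (\int[P]_w ((W w * (X i w == n)%:R) * \prod_(j <- r) s j ^+ X j w)%:E =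
  ((c * poisson_wt (a i) n) * \prod_(j <- r) expR ((s j - 1) * a j))%:E)%E.
 move=> s01.
 pose W' w := W w * \prod_(j <- r) s j ^+ X j w.
 have mW' : measfun W' by apply: measurable_funM => //; exact: meas_prod_pow.
 have W'0 w : 0 <= W' w.
  rewrite mulr_ge0//; first by case/andP: (W01 w).
  by rewrite prodr_ge0// => j _; rewrite exprn_ge0//; case/andP: (s01 j).
 have W'1 w : W' w <= 1.
  rewrite mulr_ile1//; [by case/andP: (W01 w)| |by case/andP: (W01 w)|].
   by rewrite prodr_ge0// => j _; rewrite exprn_ge0//; case/andP: (s01 j).
  rewrite prodr_ile1// => j _; have /andP[? ?] := s01 j.
  by rewrite exprn_ge0//= exprn_ile1.
 pose b := c * \prod_(j <- r) expR ((s j - 1) * a j).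
 have b0 : 0 <= b by rewrite mulr_ge0// prodr_ge0// => j _; rewrite expR_ge0.
 pose A n := fine (\int[P]_w (W' w * (X i w == n)%:R)%:E)%E.
 have mA m : measfun (fun w => W' w * (X i w == m)%:R).
  by apply: measurable_funM => //; exact: meas_eq_nat.
 have AE m : (\int[P]_w (W' w * (X i w == m)%:R)%:E = (A m)%:E)%E.
  rewrite fineK// ge0_fin_numE; last first.
   side.
  rewrite (@le_lt_trans _ _ (\int[P]_w 1)%E)//; last first.
   by rewrite int_prob_cst ltry.
  apply: ge0_le_integral => //.
  - side.
  - side.
  - by move=> w _; rewrite lee_fin; case: eqP => _; rewrite ?mulr1 ?mulr0.
 have /(congr1 (fun f => f n)) : A = fun n => b * poisson_wt (a i) n.
  apply: eq_power_series.
  - move=> m; rewrite fine_ge0// integral_ge0// => w _; side.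
  - side.
  - under eq_eseriesr do rewrite EFinM.
   rewrite nneseriesZl; last side.
   by rewrite poisson_wt_sum1// mule1 ltry.
  - move=> t t01.
   transitivity (\int[P]_w (W' w * t ^+ X i w)%:E)%E.
    rewrite int_power_series//; last by case/andP: t01.
    by apply: eq_eseriesr => m _; rewrite AE EFinM.
   (* Only the coordinate [i] varies, so the generating function becomes a power series in [t]. *)
   pose s' j := if j == i then t else s j.
   have := h s' _.
   have sr : \prod_(j <- r) expR ((s' j - 1) * a j) = \prod_(j <- r) expR ((s j - 1) * a j).
    by apply: eq_big_seq => j jr; rewrite /s'; case: eqP => // ji; move: ir; rewrite -ji jr.
   have sr' w : \prod_(j <- r) s' j ^+ X j w = \prod_(j <- r) s j ^+ X j w.
    by apply: eq_big_seq => j jr; rewrite /s'; case: eqP => // ji; move: ir; rewrite -ji jr.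
   have s'i : s' i = t by rewrite /s' eqxx.
   rewrite big_cons sr s'i.
   under eq_integral do rewrite big_cons sr' s'i.
   move=> hs'.
   transitivity ((c * (expR ((t - 1) * a i) * \prod_(j <- r) expR ((s j - 1) * a j)))%:E).
    rewrite -hs'; last by move=> j; rewrite /s'; case: eqP.
    by apply: eq_integral => w _; rewrite /W'; congr EFin; ring.
   have -> : c * (expR ((t - 1) * a i) * \prod_(j <- r) expR ((s j - 1) * a j)) =
     b * expR ((t - 1) * a i) by rewrite /b; ring.
   rewrite EFinM -poisson_pgf//; last by case/andP: t01.
   rewrite -nneseriesZl; last first.
    by move=> m _; rewrite lee_fin mulr_ge0 ?poisson_wt_ge0 ?exprn_ge0//; case/andP: t01.
   by apply: eq_eseriesr => m _; rewrite -EFinM mulrA.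
 rewrite -[X in _ = (X * _)%:E]/(c * _) => An.
 transitivity (\int[P]_w (W' w * (X i w == n)%:R)%:E)%E.
  by apply: eq_integral => w _; rewrite /W'; congr EFin; ring.
 by rewrite AE An /b; congr EFin; ring.
have := IHr (fun w => W w * (X i w == k i)%:R) (c * poisson_wt (a i) (k i)) ur.
rewrite big_cons mulrA => <-.
- by apply: eq_integral => w _; rewrite big_cons mulrA.
- by apply: measurable_funM => //; exact: meas_eq_nat.
- by move=> w; case: eqP => _; rewrite ?mulr1 ?mulr0 ?lexx ?ler01.
- side.
- by move=> s s01; exact: key.
Qed.

End generating.

(** * Sequences of independent uniform variables *)

Section seeds.
Context (R : realType).
Local Notation E := (measurableTypeR R).
Local Notation U := (@unif R).
Local Notation ev := (@even_part R).
Local Notation od := (@odd_part R).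

(** What is left of [x] after removing [k] even parts; the even parts of the successive tails, the
    values [seed k x], are independent and uniform. *)
Definition tail (k : nat) (x : E) : E := iter k od x.
Definition seed (k : nat) (x : E) : E := ev (tail k x).

Lemma meas_tail k : measfun (tail k).
Proof.
rewrite /tail; elim: k => [|k IHk]; first side.
exact: mcomp (@meas_odd_part R) IHk.
Qed.

Lemma meas_seed k : measfun (seed k).
Proof. by apply: mcomp; [exact: meas_even_part|exact: meas_tail]. Qed.

Lemma tailSr k x : tail k.+1 x = tail k (od x).
Proof. exact: iterSr. Qed.

Lemma unif_splitM (F G : E -> R) (a b : R) :
 measfun F -> measfun G ->
 (forall x, 0 <= F x) -> (forall x, 0 <= G x) ->
 (\int[U]_x (F x)%:E = a%:E)%E -> (\int[U]_x (G x)%:E = b%:E)%E ->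
 (\int[U]_x (F (ev x) * G (od x))%:E = (a * b)%:E)%E.
Proof.
move=> mF mG F0 G0 Fa Gb.
rewrite (@unif_split _ (fun z => (F z.1 * G z.2)%:E)); last 2 first.
- by apply/measurable_EFinP; apply: measurable_funM; apply: mcomp.
- side.
under eq_integral => x _.
 under eq_integral do rewrite EFinM /=.
 rewrite ge0_integralZl//; last 3 first.
 - side.
 - side.
 - side.
 rewrite Gb; over.
rewrite ge0_integralZr//; last 3 first.
- side.
- side.
- rewrite -Gb; apply: integral_ge0 => x _; by rewrite lee_fin.
by rewrite Fa EFinM.
Qed.

Lemma unif_seeds (K : nat) (F : nat -> E -> R) (r : nat -> R) :
 (forall k, measfun (F k)) -> (forall k x, 0 <= F k x) ->
 (forall k, \int[U]_x (F k x)%:E = (r k)%:E)%E ->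
 (\int[U]_x (\prod_(k < K) F k (seed k x))%:E = (\prod_(k < K) r k)%:E)%E.
Proof.
elim: K F r => [|K IHK] F r mF F0 Fr.
 under eq_integral do rewrite big_ord0.
 by rewrite big_ord0 int_prob_cst.
under eq_integral.
 move=> x _; rewrite big_ord_recl.
 rewrite (eq_bigr (fun k : 'I_K => F k.+1 (seed k (od x)))); last first.
  by move=> k _; rewrite /seed lift0 tailSr.
 over.
rewrite big_ord_recl.
apply: (@unif_splitM (F 0%N) (fun y => \prod_(k < K) F k.+1 (seed k y))) => //.
- apply: measurable_prod => k _; apply: mcomp => //; exact: meas_seed.
- by move=> x; exact: prodr_ge0.
- exact: (IHK (fun k => F k.+1) (fun k => r k.+1)).
Qed.

End seeds.

Section poisson.
Context (R : realType).
Local Notation E := (measurableTypeR R).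
Local Notation U := (@unif R).
Local Notation p := (poisson_wt (1 : R)).

Let cum (k : nat) : R := \sum_(0 <= j < k) p j.

Let p0 k : 0 <= p k. Proof. side. Qed.

Let cum_nd : nondecreasing_seq cum.
Proof. by apply/nondecreasing_seqP => k; rewrite /cum big_nat_recr//= lerDl. Qed.

Let cum_ge0 k : 0 <= cum k. Proof. side. Qed.

Let cvg_cum : (cum k)%:E @[k --> \oo] --> 1%E.
Proof.
rewrite -(poisson_wt_sum1 (@ler01 R)).
under eq_fun do rewrite /cum -sumEFin.
apply: is_cvg_nneseries => k _ _; side.
Qed.

Let cum_le1 k : cum k <= 1.
Proof.
rewrite -lee_fin -(poisson_wt_sum1 (@ler01 R)) /cum -sumEFin.
apply: nneseries_lim_ge => j _ _; side.
Qed.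

Let cell k : set E := `[cum k, cum k.+1[%classic.

Let mcell k : measurable (cell k). Proof. side. Qed.

Let cell_inj x j k : cell j x -> cell k x -> j = k.
Proof.
have aux m n : (m < n)%N -> cell m x -> cell n x -> False.
 rewrite /cell /= !in_itv/= => mn /andP[_ xm] /andP[nx _].
 have := cum_nd mn; lra.
move=> xj xk; have [jk|kj|//] := ltngtP j k.
- by case: (aux _ _ jk xj xk).
- by case: (aux _ _ kj xk xj).
Qed.

Let unif_cell k : U (cell k) = (p k)%:E.
Proof.
have pE : p k = cum k.+1 - cum k by rewrite /cum big_nat_recr//=; ring.
have ck : cum k <= cum k.+1 by exact: cum_nd.
rewrite /unif /mrestr /cell (_ : _ `&` _ = `[cum k, cum k.+1[%classic).
 by rewrite lebesgue_measure_itv/= lte_fin pE; case: ltP => // ?; congr EFin; lra.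
apply/seteqP; split => x /=; rewrite !in_itv/=; first by case.
move=> /andP[h1 h2]; split; first exact/andP.
by rewrite (le_trans (cum_ge0 k) h1) (lt_le_trans h2 (cum_le1 _)).
Qed.

(** Inversion of the distribution function: [0, 1[ is cut into consecutive intervals whose lengths
    are the Poisson weights of rate 1. The default value 0 is taken outside the cells, on a null
    set. *)
Definition poisson_var (x : E) : nat := xget 0%N [set k | cell k x].

Let cell_var k x : cell k x -> poisson_var x = k.
Proof.
by move=> xk; rewrite /poisson_var; apply: xget_unique => // j xj; exact: cell_inj xj xk.
Qed.

Lemma meas_poisson_var : measfun poisson_var.
Proof.
apply: meas_fun_natP => -[|n]; last first.
 rewrite (_ : _ @^-1` _ = cell n.+1)//; apply/seteqP; split => x /=; last exact: cell_var.
 by rewrite /poisson_var; case: xgetP => [k -> /= xk <-//|].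
rewrite (_ : _ @^-1` _ = ~` \bigcup_k cell k.+1).
 side.
apply/seteqP; split => x /=.
 by move=> h [k _ /cell_var]; rewrite h.
move=> h; rewrite /poisson_var; case: xgetP => [k kE /= xk|//].
by case: k {kE} xk => // k xk; exfalso; apply: h; exists k.
Qed.

Lemma int_poisson_var (t : R) : 0 <= t ->
 (\int[U]_x (t ^+ poisson_var x)%:E = (expR (t - 1))%:E)%E.
Proof.
move=> t0; rewrite (@ge0_int_nat _ _ _ U poisson_var (fun k => (t ^+ k)%:E)); last 2 first.
- exact: meas_poisson_var.
- side.
transitivity (\sum_(k <oo) (p k * t ^+ k)%:E)%E; last first.
 by rewrite poisson_pgf// mulr1.
have cell_le k : cell k `<=` poisson_var @^-1` [set k].
 by move=> x /= /cell_var.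
have Uk k : U (poisson_var @^-1` [set k]) = (p k)%:E.
 have mk : measurable (poisson_var @^-1` [set k]).
  by rewrite -[X in measurable X]setTI; exact: meas_poisson_var.
 rewrite -unif_cell; apply/eqP; rewrite eq_le; apply/andP; split; last first.
  by apply: le_measure; rewrite ?inE.
 (* The cells have total mass 1, so the points with the default value are negligible. *)
 have nul : U (~` \bigcup_k cell k) = 0%E.
  rewrite probability_setC; last side.
  rewrite measure_semi_bigcup//; last 2 first.
  - by apply/trivIsetP => i j _ _ ij; apply/seteqP; split => x //= [xi xj]; rewrite (cell_inj xi xj) eqxx in ij.
  - side.
  by rewrite (eq_eseriesr (fun k _ => unif_cell k)) poisson_wt_sum1// subee.
 apply: (@le_trans _ _ (U (cell k `|` ~` \bigcup_k cell k))).
  apply: le_measure; rewrite ?inE//.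
   side.
  move=> x /= xk; have [[j _ xj]|] := pselect ((\bigcup_k cell k) x); last by right.
  by left; rewrite -xk (cell_var xj).
 apply: (le_trans (measureU2 _ _ _)) => //.
  side.
 by rewrite [X in (_ + X)%E]nul adde0.
by apply: eq_eseriesr => k _; rewrite EFinM muleC; congr (_ * _)%E; exact: Uk.
Qed.

End poisson.

(** * Construction of Poisson point processes *)

Section poisson.
Context (R : realType) d (T : measurableType d).
Local Notation E := (measurableTypeR R).
Local Notation U := (@unif R).
Local Notation ev := (@even_part R).
Local Notation od := (@odd_part R).
Variable v : nat -> E -> T.
Hypothesis mv : forall k, measfun (v k).

(* The k-th cell contains [pts_nb k] points, the l-th of which is [pt k l]. *)
Definition pts_nb (k : nat) (x : E) : nat := poisson_var (ev (seed k x)).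
Definition pt (k l : nat) (x : E) : T := v k (seed l (od (seed k x))).

Lemma meas_pts_nb k : measfun (pts_nb k).
Proof.
apply: mcomp; first exact: meas_poisson_var.
by apply: mcomp; [exact: meas_even_part|exact: meas_seed].
Qed.

Lemma meas_pt k l : measfun (pt k l).
Proof.
apply: mcomp => //; apply: mcomp; first exact: meas_seed.
by apply: mcomp; [exact: meas_odd_part|exact: meas_seed].
Qed.

(** The cell [k] receives a Poisson number, of mean 1, of independent points distributed as the
    image of the uniform law under [v k]. Superposing the cells gives a Poisson process whose
    intensity [process_rate] is the sum of these laws. *)
Definition point_process (x : E) : {measure set T -> \bar R} :=
 mseries (fun k => msum (fun l => \d_(pt k l x)) (pts_nb k x)) 0.

Definition cell_count (k : nat) (B : set T) (x : E) : nat :=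
 \sum_(l < pts_nb k x) (pt k l x \in B).

Definition pcount (K : nat) (B : set T) (x : E) : nat :=
 \sum_(k < K) cell_count k B x.

Lemma meas_cell_count k B : measurable B -> measfun (cell_count k B).
Proof.
move=> mB; apply: (@meas_fun_nat_param _ _ _ _ (pts_nb k)
 (fun n x => \sum_(l < n) (pt k l x \in B))%N); first exact: meas_pts_nb.
elim=> [|n IHn].
 by apply: eq_measurable_fun (measurable_cst 0%N) => x _; rewrite big_ord0.
under eq_fun do rewrite big_ord_recr /=; apply: measurable_fun_addn => //.
have -> : (fun x => nat_of_bool (pt k n x \in B)) = (nat_of_bool \o mem B) \o pt k n by [].
apply: mcomp; last exact: meas_pt.
apply: meas_fun_natP => -[|[|m]].
- rewrite (_ : _ @^-1` _ = ~` B); first side.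
 apply/seteqP; split => x /=; first by case: (boolP (x \in B)) => // /negP xB _ /mem_set.
 by move=> xB; rewrite memNset.
- rewrite (_ : _ @^-1` _ = B)//; apply/seteqP; split => x /=.
  by case: (boolP (x \in B)) => // /set_mem.
 by move=> xB; rewrite mem_set.
- rewrite (_ : _ @^-1` _ = set0)//; apply/seteqP; split => x //=.
 by case: (x \in B).
Qed.

Lemma meas_partial_count K B : measurable B -> measfun (pcount K B).
Proof.
move=> mB; rewrite /pcount; elim: K => [|K IHK].
 by apply: eq_measurable_fun (measurable_cst 0%N) => x _; rewrite big_ord0.
under eq_fun do rewrite big_ord_recr /=; apply: measurable_fun_addn => //.
exact: meas_cell_count.
Qed.

Lemma point_processE x B : measurable B ->
 point_process x B = (\sum_(k <oo) ((cell_count k B x)%:R : R)%:E)%E.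
Proof.
move=> mB; rewrite /point_process /= /mseries; apply: eq_eseriesr => k _.
rewrite /msum /= /cell_count natr_sum -sumEFin; apply: eq_bigr => l _.
side.
Qed.

Lemma meas_point_process B : measurable B ->
 measfun (point_process ^~ B).
Proof.
move=> mB; under eq_fun do rewrite point_processE//.
apply: ge0_emeasurable_sum => // k _; apply/measurable_EFinP.
by apply: mcomp => //; exact: meas_cell_count.
Qed.

HB.instance Definition _ := isKernel.Build _ _ E T R point_process meas_point_process.

Lemma partial_countE K B x :
 (\sum_(0 <= k < K) ((cell_count k B x)%:R : R)%:E = ((pcount K B x)%:R : R)%:E)%E.
Proof. by rewrite sumEFin /pcount natr_sum big_mkord. Qed.

Lemma partial_count_nd B x : {homo pcount ^~ B ^~ x : m n / (m <= n)%N}.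
Proof.
apply: homo_leq => // [? ? ?|K]; first exact: leq_trans.
by rewrite /pcount big_ord_recr leq_addr.
Qed.

Lemma cvg_partial_count B x : measurable B ->
 (((pcount K B x)%:R : R)%:E @[K --> \oo] --> point_process x B)%E.
Proof.
move=> mB; rewrite point_processE//; under eq_fun do rewrite -partial_countE.
apply: is_cvg_nneseries => k _ _; side.
Qed.

Lemma partial_count_eventually B x (n : nat) : measurable B ->
 point_process x B = (n%:R : R)%:E <-> (\forall K \near \oo, pcount K B x = n).
Proof.
move=> mB; have cv := @cvg_partial_count B x mB; split=> [pn|h]; last first.
 apply: (@cvg_unique _ _ (fmap (fun K => ((pcount K B x)%:R : R)%:E) (nbhs \oo))) => //.
 apply: cvg_near_cst; by apply: filterS h => K ->.
have le K : (pcount K B x <= n)%N.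
 rewrite -(@ler_nat R) -lee_fin -pn -(cvg_lim _ cv)//.
 under eq_fun do rewrite -partial_countE;
  rewrite -partial_countE; apply: nneseries_lim_ge => k _ _; side.
have [h|h] := pselect (forall K, (pcount K B x < n)%N); last first.
 move/existsNP : h => [K0 /negP]; rewrite -leqNgt => h.
 exists K0 => // K /= KK; apply/eqP; rewrite eqn_leq le/=.
 by rewrite (leq_trans h)//; exact: partial_count_nd.
case: n pn le h => [pn le /(_ 0%N)//|n pn le h].
have : (point_process x B <= (n%:R : R)%:E)%E.
 rewrite -(cvg_lim _ cv)//; apply: lime_le; first by apply/cvg_ex; eexists; exact: cv.
 by apply: nearW => K; rewrite lee_fin ler_nat -ltnS.
by rewrite pn lee_fin ler_nat ltnn.
Qed.

Definition cell_mass (k : nat) (B : set T) : R := fine (U (v k @^-1` B)).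

Lemma cell_mass_ge0 k B : 0 <= cell_mass k B. Proof. exact: fine_ge0. Qed.

Lemma cell_massE k B : measurable B -> U (v k @^-1` B) = (cell_mass k B)%:E.
Proof.
move=> mB; rewrite fineK// fin_num_measure//.
by rewrite -[X in measurable X]setTI; exact: mv.
Qed.

(** Given the number l of points, the expected product is c^l; averaging over a Poisson number of
    mean 1 gives exp (c - 1). *)
Lemma cell_pgf k (g : T -> R) (c : R) : measfun g ->
 (forall y, 0 <= g y) -> (\int[U]_x (g (v k x))%:E = c%:E)%E ->
 (\int[U]_x (\prod_(l < poisson_var (ev x)) g (v k (seed l (od x))))%:E =
  (expR (c - 1))%:E)%E.
Proof.
move=> mg g0 gc.
have c0 : 0 <= c by rewrite -lee_fin -gc; apply: integral_ge0 => x _; rewrite lee_fin.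
have mp (n : nat) : measfun (fun y => \prod_(l < n) g (v k (seed l y))).
 apply: measurable_prod => l _; apply: mcomp => //.
 by apply: mcomp => //; exact: meas_seed.
rewrite (@unif_split _ (fun z : E * E => (\prod_(l < poisson_var z.1) g (v k (seed l z.2)))%:E)); last 2 first.
- apply/measurable_EFinP; apply: (@meas_fun_nat_param _ _ _ R (@poisson_var R \o fst)
  (fun n (z : E * E) => \prod_(l < n) g (v k (seed l z.2)))).
  by apply: mcomp => //; exact: meas_poisson_var.
 by move=> n; exact: (mcomp (mp n)).
- by move=> z; rewrite lee_fin prodr_ge0.
rewrite -(int_poisson_var c0); apply: eq_integral => x _ /=.
rewrite (@unif_seeds R (poisson_var x) (fun _ y => g (v k y)) (fun=> c))//.
- by rewrite prodr_const card_ord.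
- by move=> _; exact: mcomp.
Qed.

Lemma partial_pgf K (g : T -> R) (c : nat -> R) : measfun g ->
 (forall y, 0 <= g y) -> (forall k, \int[U]_x (g (v k x))%:E = (c k)%:E)%E ->
 (\int[U]_x (\prod_(k < K) \prod_(l < pts_nb k x) g (pt k l x))%:E =
  (expR (\sum_(k < K) (c k - 1)))%:E)%E.
Proof.
move=> mg g0 gc.
rewrite expR_sum -(@unif_seeds R K
 (fun k y => \prod_(l < poisson_var (ev y)) g (v k (seed l (od y)))) (fun k => expR (c k - 1)))//.
- move=> k; apply: (@meas_fun_nat_param _ _ _ R (@poisson_var R \o ev)
  (fun n y => \prod_(l < n) g (v k (seed l (od y))))).
  by apply: mcomp; [exact: meas_poisson_var|exact: meas_even_part].
 move=> n; apply: measurable_prod => l _; apply: mcomp => //.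
 apply: mcomp => //; apply: mcomp; first exact: meas_seed.
 exact: meas_odd_part.
- by move=> k x; rewrite prodr_ge0.
- by move=> k; exact: cell_pgf.
Qed.

Definition partial_mass (K : nat) (B : set T) : R := \sum_(k < K) cell_mass k B.

Lemma partial_mass_ge0 K B : 0 <= partial_mass K B.
Proof. by apply: sumr_ge0 => k _; exact: cell_mass_ge0. Qed.

Definition process_rate : {measure set T -> \bar R} :=
 mseries (fun k => image_mu U (mv k)) 0.

Lemma cvg_partial_mass B : measurable B ->
 ((partial_mass K B)%:E @[K --> \oo] --> process_rate B)%E.
Proof.
move=> mB; rewrite /process_rate /= /mseries.
rewrite (eq_eseriesr (fun k _ => @cell_massE k B mB)).
under eq_fun do rewrite /partial_mass -sumEFin -(big_mkord xpredT (fun k => (cell_mass k B)%:E)).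
by apply: is_cvg_nneseries => k _ _; rewrite lee_fin cell_mass_ge0.
Qed.

Section counts.
Variables (n : nat) (B : 'I_n -> set T).
Hypothesis mB : forall i, measurable (B i).
Hypothesis tB : trivIset [set: 'I_n] B.

Lemma partial_count_law K (r : seq 'I_n) (k : 'I_n -> nat) : uniq r ->
 (\int[U]_x (\prod_(i <- r) (pcount K (B i) x == k i)%:R)%:E =
  (\prod_(i <- r) poisson_wt (partial_mass K (B i)) (k i))%:E)%E.
Proof.
move=> ur.
transitivity (\int[U]_x (1 * \prod_(i <- r) (pcount K (B i) x == k i)%:R)%:E)%E.
 by apply: eq_integral => x _; rewrite mul1r.
rewrite (@pgf_poisson_law _ _ _ U _ (fun i => pcount K (B i))
 (fun i => partial_mass K (B i)) (fun i => meas_partial_count _ (mB i))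
 (fun i => partial_mass_ge0 _ _) r (fun=> 1) 1 ur) ?mul1r//.
- by move=> x; rewrite ler01 lexx.
- move=> s s01.
 have s0 i : 0 <= s i by case/andP: (s01 i).
 (* The product of [g] over all points is the integrand of the generating function. As the [B i] are
    disjoint, at most one factor differs from 1 and [g] has the affine form [gE], whose integral is
    computed termwise. *)
 pose g (y : T) : R := \prod_(i <- r) s i ^+ (y \in B i).
 have g0 y : 0 <= g y by rewrite prodr_ge0// => i _; rewrite exprn_ge0.
 have mg : measfun g.
  apply: measurable_prod => i _.
  rewrite (_ : (fun y => _) = (fun y => 1 + (s i - 1) * \1_(B i) y)); last first.
   by apply/funext => y; rewrite indicE; case: (_ \in _); rewrite /= ?mulr1 ?mulr0 ?addr0 ?expr0// expr1 addrC subrK.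
  by apply: measurable_funD => //; apply: measurable_funM.
 have gE y : g y = 1 + \sum_(i <- r) (s i - 1) * \1_(B i) y.
  have [[i0 [i0r yi0]]|nB] := pselect (exists i, i \in r /\ B i y).
   have yN i : i != i0 -> (y \in B i) = false.
    move=> ii0; apply/negbTE/negP => /set_mem yi.
    move/trivIsetP : tB => /(_ i i0 I I ii0) /seteqP[/(_ y)].
    by move=> /(_ (conj yi yi0)).
   rewrite /g (bigD1_seq i0)//= [X in _ = _ + X](bigD1_seq i0)//= indicE mem_set//=.
   rewrite big1 ?big1//; first by rewrite expr1 mulr1 mulr1 addr0 addrC subrK.
    by move=> i ii0; rewrite indicE yN// mulr0.
   by move=> i ii0; rewrite yN.
  rewrite /g big1_seq ?big1_seq ?addr0// => i /andP[_ ir].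
   by rewrite indicE memNset ?mulr0// => yi; apply: nB; exists i.
  by rewrite memNset// => yi; apply: nB; exists i.
 pose c k := 1 + \sum_(i <- r) (s i - 1) * cell_mass k (B i).
 have gc k' : (\int[U]_x (g (v k' x))%:E = (c k')%:E)%E.
  have mvB i : measurable (v k' @^-1` B i) by rewrite -[X in measurable X]setTI; exact: mv.
  under eq_integral do rewrite gE EFinD -sumEFin.
  have ind i : (U.-integrable setT (fun x => ((s i - 1) * \1_(B i) (v k' x))%:E))%E.
   under eq_fun do rewrite EFinM; apply: integrableZl => //.
   by rewrite (_ : (fun x => _) = (fun x => (\1_(v k' @^-1` B i) x)%:E))//; exact: integrable_indic.
  rewrite integralD//; last 2 first.
  - by have := finite_measure_integrable_cst U 1%R measurableT.
  - by apply: integrable_sum.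
  rewrite int_prob_cst integral_sum// EFinD -sumEFin; congr (_ + _)%E.
  apply: eq_bigr => i _; under eq_integral do rewrite EFinM.
  rewrite integralZl//; last first.
   by rewrite (_ : (fun x => _) = (fun x => (\1_(v k' @^-1` B i) x)%:E))//; exact: integrable_indic.
  rewrite EFinM; congr (_ * _)%E; rewrite -cell_massE//.
  by rewrite (_ : (fun x => _) = (fun x => (\1_(v k' @^-1` B i) x)%:E))// integral_indic// setIT.
 transitivity (\int[U]_x (\prod_(k < K) \prod_(l < pts_nb k x) g (pt k l x))%:E)%E.
  apply: eq_integral => x _; congr EFin; rewrite mul1r.
  rewrite /g /pcount /cell_count.
  under [RHS]eq_bigr do rewrite exchange_big.
  rewrite [RHS]exchange_big; apply: eq_bigr => i _.
  rewrite expr_sum; apply: eq_bigr => j _.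
  by rewrite expr_sum.
 rewrite (partial_pgf _ mg g0 gc) mul1r -expR_sum; congr (expR _)%:E.
 rewrite /partial_mass; under [RHS]eq_bigr do rewrite mulr_sumr.
 rewrite exchange_big; apply: eq_bigr => j _.
 by rewrite /c addrAC subrr add0r.
Qed.

Local Notation nu := process_rate.

(** All weights are 0 for an infinite rate: almost surely such a set contains infinitely many
    points. *)
Definition rate_wt (b : \bar R) (k : nat) : R :=
 if b is r%:E then poisson_wt r k else 0.

Lemma cvg_poisson_wt (a : nat -> R) (b : \bar R) k :
 (forall K, 0 <= a K) -> (a K)%:E @[K --> \oo] --> b ->
 poisson_wt (a K) k @[K --> \oo] --> rate_wt b k.
Proof.
move=> a0; case: b => [b|ab|/cvgeNyPle ab] /=.
- move=> /fine_cvgP[_ ab]; rewrite /poisson_wt.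
 apply: cvgM; first apply: cvgM; last 2 first.
 + exact: cvg_cst.
 + apply: (continuous_cvg _ (@continuous_expR R _)).
  exact: cvgN.
 + exact: (continuous_cvg _ (@exprn_continuous _ k _)).
(* The exponential dominates its term of degree k + 1, so the weights tend to 0 as the rate
   grows. *)
- have xe (x : R) : 0 < x -> poisson_wt x k <= k.+1%:R / x.
  move=> x0; rewrite ler_pdivlMr// /poisson_wt expRN.
  have := @expR_ge1Dxn R x k (ltW x0).
  have e0 := @expR_gt0 R x; have f0 : 0 < k`!%:R :> R by rewrite ltr0n fact_gt0.
  rewrite factS natrM exprS => h.
  have k0 : 0 < k.+1%:R :> R by [].
  have -> : x ^+ k / k`!%:R / expR x * x = (x * x ^+ k / k`!%:R) / expR x by ring.
  rewrite ler_pdivrMr//.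
  have -> : x * x ^+ k / k`!%:R = k.+1%:R * (x * x ^+ k / (k.+1%:R * k`!%:R)).
   by field; rewrite !gt_eqF.
  by rewrite ler_pM2l// (le_trans _ h)// lerDr.
 move/cvgeyPge : ab => ab.
 apply/cvgrPdist_le => e e0; near=> K.
 rewrite sub0r normrN ger0_norm ?poisson_wt_ge0//.
 have aK : k.+1%:R / e <= a K by rewrite -lee_fin; near: K; exact: ab.
 have aK0 : 0 < a K by rewrite (lt_le_trans _ aK)// divr_gt0.
 by rewrite (le_trans (xe _ aK0))// ler_pdivrMr// mulrC -ler_pdivrMr.
- exfalso; have /= [K _ /(_ K (leqnn K)) /=] := ab (-1).
 by rewrite lee_fin; have := a0 K; lra.
Unshelve. all: by end_near. Qed.

Definition count_event (i : 'I_n) (k : nat) : set E :=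
 [set x | point_process x (B i) = (k%:R : R)%:E].

Lemma meas_count_event i k : measurable (count_event i k).
Proof.
rewrite -[X in measurable X]setTI.
exact: (meas_point_process (mB i) measurableT (emeasurable_set1 _)).
Qed.

(** For each [x] the count over the first [K] cells increases with [K], so whether it equals [k i]
    is eventually settled; dominated convergence passes to the limit in [partial_count_law]. *)
Lemma count_event_law (r : seq 'I_n) (k : 'I_n -> nat) : uniq r ->
 U (\big[setI/setT]_(i <- r) count_event i (k i)) =
 (\prod_(i <- r) rate_wt (nu (B i)) (k i))%:E.
Proof.
move=> ur.
have mA : measurable (\big[setI/setT]_(i <- r) count_event i (k i)).
 by apply: bigsetI_measurable => i _; exact: meas_count_event.
set A := \big[setI/setT]_(i <- r) count_event i (k i) in mA *.
transitivity (\int[U]_x (\1_A x)%:E)%E; first by rewrite integral_indic// setIT.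
have cvl : (\int[U]_x (\prod_(i <- r) (pcount K (B i) x == k i)%:R)%:E @[K --> \oo] -->
  \int[U]_x (\1_A x)%:E)%E.
 pose f (K : nat) (x : E) := (\prod_(i <- r) (pcount K (B i) x == k i)%:R : R)%:E.
 apply: (@dominated_cvg _ _ _ U setT measurableT f (fun x => (\1_A x)%:E) (fun=> 1%E)).
 - move=> K; apply/measurable_EFinP; apply: measurable_prod => i _.
  by apply: meas_eq_nat; exact: meas_partial_count.
 - move=> x _; apply: cvg_near_cst.
  have : \forall K \near \oo, forall i, i \in r ->
    (pcount K (B i) x == k i) = `[< count_event i (k i) x >].
   have /filter_forall h : forall i : 'I_n, \forall K \near \oo, i \in r ->
    (pcount K (B i) x == k i) = `[< count_event i (k i) x >].
    move=> i; have [xk|xk] := asboolP (count_event i (k i) x).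
     move/(partial_count_eventually _ _ (mB i)) : xk.
     by apply: filterS => K -> _; rewrite eqxx.
    have [[K0 xK0]|nK] := pselect (exists K0, (k i < pcount K0 (B i) x)%N).
     exists K0 => // K /= KK _; apply/negbTE.
     by rewrite neq_ltn (leq_trans xK0) ?orbT//; exact: partial_count_nd.
    have le K : (pcount K (B i) x <= k i)%N.
     by rewrite leqNgt; apply/negP => h; apply: nK; exists K.
    apply: nearW => K _; apply/negbTE/eqP => pk; apply: xk.
    apply/(partial_count_eventually _ _ (mB i)); exists K => // K' /= KK'.
    by apply/eqP; rewrite eqn_leq le/= -pk; exact: partial_count_nd.
   side.
  apply: filterS => K hK; congr EFin.
  rewrite indicE /A; rewrite (eq_big_seq (fun i => (`[< count_event i (k i) x >])%:R)); last first.
   by move=> i ir; rewrite hK.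
  elim: r {f ur mA A hK} => [|i r IHr]; first by rewrite !big_nil in_setT.
  rewrite !big_cons IHr in_setI.
  case: asboolP => ix; first by rewrite (mem_set ix) mul1r.
  by rewrite (memNset ix) mul0r.
 - by [].
 - by have := finite_measure_integrable_cst U 1%R measurableT.
 - move=> K x _; rewrite /f gee0_abs ?lee_fin; last by rewrite prodr_ge0.
  by rewrite prodr_ile1// => i _; case: (_ == _); rewrite ?lexx ?ler01.
rewrite -(cvg_lim _ cvl)//; apply/cvg_lim => //.
under eq_fun do rewrite partial_count_law//.
apply: cvg_EFin; first exact: nearW.
elim: r {ur mA A cvl} => [|i r IHr].
 by rewrite big_nil; under eq_fun do rewrite big_nil; exact: cvg_cst.
rewrite big_cons; under eq_fun do rewrite big_cons; apply: cvgM => //.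
apply: cvg_poisson_wt; last exact: cvg_partial_mass.
by move=> K; exact: partial_mass_ge0.
Qed.

(** The events that a count equals some integer form, with the empty set, a pi-system on which
    independence is [count_event_law]. They generate the events of the count: sets of values that
    contain [+oo] are reached through their complements. *)
Lemma indep_counts :
 independent_systems U (fun i =>
  preimage_set_system [set: E] (fun x => point_process x (B i))
   (measurable : set (set (\bar R)))).
Proof.
pose H (i : 'I_n) : set_system E := [set A | A = set0 \/ exists k, A = count_event i k].
have Hm i : H i `<=` measurable.
 by move=> A [->|[k ->]]; [side|exact: meas_count_event].
have HI i : setI_closed (H i).
 move=> A C [->|[k ->]]; first by rewrite set0I; left.
 move=> [->|[l ->]]; first by rewrite setI0; left.
 have [->|kl] := eqVneq k l; first by rewrite setIid; right; exists l.
 left; apply/seteqP; split => x //= [h1 h2]; move: kl.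
 have := etrans (esym h1) h2 => -[] /eqP; rewrite eqr_nat => /eqP ->.
 by rewrite eqxx.
have sH i : preimage_set_system [set: E] (fun x => point_process x (B i))
   (measurable : set (set (\bar R))) `<=` <<s H i>>.
 move=> _ [C mC <-]; rewrite setTI.
 have sub (D : set (\bar R)) : ~ D +oo%E ->
   <<s H i>> ((fun x => point_process x (B i)) @^-1` D).
  move=> Dy; rewrite (_ : _ @^-1` _ = \bigcup_(k in [set k | D (k%:R%:E)]) count_event i k).
   apply: (@bigcup_measurable _ (g_sigma_algebraType (H i))) => k _.
   by apply: sub_sigma_algebra; right; exists k.
  apply/seteqP; split => x /=; last first.
   by move=> [k /= Dk]; rewrite /count_event/= => ->.
  move=> Dx; have [[K hK]|h] := pselect (exists K, forall K', (K <= K')%N ->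
    pcount K' (B i) x = pcount K (B i) x).
   exists (pcount K (B i) x) => //=.
    by have <- : point_process x (B i) = _ := (partial_count_eventually _ _ (mB i)).2 (ex_intro2 _ _ K I hK).
   by apply/(partial_count_eventually _ _ (mB i)); exists K.
  exfalso; apply: Dy; suff <- : point_process x (B i) = +oo%E by [].
  rewrite -(cvg_lim _ (@cvg_partial_count (B i) x (mB i)))//; apply/cvg_lim => //.
  have unb M : exists K, (M <= pcount K (B i) x)%N.
   elim: M => [|M [K hK]]; first by exists 0%N.
   have /existsNP[K' /not_implyP[KK' neK']] : ~ (forall K', (K <= K')%N ->
     pcount K' (B i) x = pcount K (B i) x).
    by move=> hK'; apply: h; exists K.
   exists K'; rewrite (leq_ltn_trans hK)// ltn_neqAle partial_count_nd// andbT.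
   by apply/eqP => /esym.
  apply/cvgeyPge => M.
  have [K hK] := unb (Num.truncn M).+1.
  exists K => // K' /= KK'; rewrite lee_fin (le_trans (ltW (truncnS_gt M)))// ler_nat.
  by rewrite (leq_trans hK)//; exact: partial_count_nd.
 have [Cy|Cy] := pselect (C +oo%E); last exact: sub.
 rewrite -[C]setCK preimage_setC; apply: (@measurableC _ (g_sigma_algebraType (H i))).
 by apply: (sub (~` C)) => /(_ Cy).
apply: indep_systems_sub sH _; apply: indep_systems_sigma => //.
move=> J A AH.
have [[i iJ Ai0]|A0] := pselect (exists2 i, i \in J & A i = set0).
 rewrite (bigcap_finsetD1 _ iJ) Ai0 set0I measure0 (big_setD1 i)//= Ai0.
 by rewrite [in RHS]measure0 mul0r.
have /choice[k kA] : forall i, exists k, i \in J -> A i = count_event i k.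
 move=> i; have [iJ|_] := boolP (i \in J); last by exists 0%N.
 case: (AH _ iJ) => [Ai0|[k Ak]]; last by exists k.
 by exfalso; apply: A0; exists i.
rewrite bigcap_finset (eq_bigr (fun i => count_event i (k i))) => [|i iJ]; last exact: kA.
have cl := count_event_law k (enum_uniq (mem J)); rewrite !big_enum /= in cl.
transitivity (fine (\prod_(i in J) rate_wt (nu (B i)) (k i))%:E).
 congr fine; side.
apply: eq_bigr => i iJ; rewrite kA//.
have := @count_event_law [:: i] k isT; rewrite !big_seq1 => h.
exact: esym (congr1 fine h).
Qed.

End counts.

Theorem point_process_is_poisson :
 is_poisson_measure U point_process process_rate.
Proof.
split; last by move=> n B mB tB; exact: indep_counts.
move=> B mB Bfin k.
have mB' (i : 'I_1) : measurable B by [].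
have tB' : trivIset [set: 'I_1] (fun=> B) by move=> i j _ _ _; rewrite !ord1.
have := @count_event_law 1 (fun=> B) mB' tB' [:: ord0] (fun=> k) isT.
rewrite !big_seq1 => h; apply: (etrans h); rewrite poisson_probE ?fine_ge0//.
have : (0 <= process_rate B)%E by side.
by move: Bfin; case: (process_rate B).
Qed.

End poisson.

(** * Independence of Poisson noises over disjoint regions *)

Section finite.
Context (T : Type).

Definition finI (G : set_system T) : set_system T :=
 [set A | exists s : seq (set T), (forall B, B \in s -> G B) /\
  A = \big[setI/setT]_(B <- s) B].

Lemma finI_setI (G : set_system T) : setI_closed (finI G).
Proof.
move=> _ _ [s [sG ->]] [r [rG ->]]; exists (s ++ r); split; last by rewrite big_cat.
by move=> B; rewrite mem_cat => /orP[/sG|/rG].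
Qed.

Lemma sub_finI (G : set_system T) : G `<=` finI G.
Proof.
by move=> A GA; exists [:: A]; split; [move=> B; rewrite inE => /eqP ->|rewrite big_seq1].
Qed.

End finite.

Lemma finI_sigma (T : pointedType) (G H : set_system T) :
 sigma_algebra setT H -> G `<=` H -> finI G `<=` H.
Proof.
move=> sH GH _ [s [sG ->]].
have HE : H = <<s H>> by rewrite sigma_algebra_id.
rewrite HE big_seq; apply: (@bigsetI_measurable _ (g_sigma_algebraType H)) => B /sG /GH HB.
exact: sub_sigma_algebra.
Qed.

Section poisson.
Context d d' (Om : measurableType d) (T : measurableType d') (R : realType).
Variables (P : probability Om R) (ppm : R.-ker Om ~> T) (nu : {measure set T -> \bar R}).
Hypothesis poi : is_poisson_measure P ppm nu.

Definition count_sigma (B : set T) : set_system Om :=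
 preimage_set_system [set: Om] (fun w => ppm w B) (measurable : set (set (\bar R))).

Lemma count_sigma_measurable B : measurable B -> count_sigma B `<=` measurable.
Proof. by move=> mB _ [C mC <-]; exact: (measurable_kernel ppm B mB). Qed.

Lemma count_sigmaI B : setI_closed (count_sigma B).
Proof.
move=> _ _ [C mC <-] [D mD <-]; exists (C `&` D); first side.
side.
Qed.

Lemma count_sigmaT B : count_sigma B setT.
Proof. exists setT => //; side. Qed.

Lemma indep_count_sigma (I : finType) (B : I -> set T) :
 (forall i, measurable (B i)) -> trivIset setT B ->
 independent_systems P (fun i => count_sigma (B i)).
Proof.
move=> mB tB J A AJ.
have [_ /(_ #|I| (fun k => B (enum_val k)))] := poi.
move=> /(_ (fun k => mB _)) iP.
have {}iP := iP _ [set k | enum_val k \in J]%SET (fun k => A (enum_val k)).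
rewrite (_ : \bigcap_(i in [set` J]) A i =
 \bigcap_(k in [set` [set k : 'I_#|I| | enum_val k \in J]%SET]) A (enum_val k)); last first.
 apply/seteqP; split=> w /= h.
  by move=> k /=; rewrite inE => kJ; exact: h.
 by move=> i /= iJ; have := h (enum_rank i); rewrite /= inE enum_rankK; exact.
rewrite iP.
- rewrite (reindex_onto enum_rank enum_val)/=; last by move=> k _; rewrite enum_valK.
 by apply: eq_big => [i|i]; rewrite !inE enum_rankK ?eqxx ?andbT.
- apply/trivIsetP => k l _ _ kl; move/trivIsetP : tB; apply => //.
 by apply: contra_neq kl => /enum_val_inj.
- by move=> k; rewrite inE; exact: AJ.
Qed.

Lemma noise_eventsS D D' : D `<=` D' -> noise_events ppm D `<=` noise_events ppm D'.
Proof.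
by move=> DD' _ [B [C [mB BD mC ->]]]; exists B, C; split => //; exact: subset_trans DD'.
Qed.

Lemma noise_events_measurable D : noise_events ppm D `<=` measurable.
Proof.
move=> _ [B [C [mB _ mC ->]]]; rewrite -[X in measurable X]setTI.
exact: (measurable_kernel ppm B mB).
Qed.

(* Overlapping test sets are handled by counting the points in the atoms that
  they generate within each region. *)
Lemma indep_noise_events (K : finType) (D : K -> set T) :
 (forall k, measurable (D k)) -> trivIset setT D ->
 independent_systems P (fun k => <<s noise_events ppm (D k) >>).
Proof.
move=> mD tD.
suff iH : independent_systems P (fun k => finI (noise_events ppm (D k))).
 apply: indep_systems_sub (indep_systems_sigma _ _ iH).
 - move=> k; apply: smallest_sub; first side.
  by move=> A kA; apply: sub_sigma_algebra; exact: sub_finI.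
 - move=> k; apply: finI_sigma; first exact: sigma_algebra_measurable.
  exact: noise_events_measurable.
 - by move=> k; exact: finI_setI.
move=> J A AJ.
have /choice[s sA] : forall k, exists s : seq (set Om), k \in J ->
  (forall E, E \in s -> noise_events ppm (D k) E) /\ A k = \big[setI/setT]_(E <- s) E.
 move=> k; have [/AJ[s hs]|_] := boolP (k \in J); last by exists [::].
 by exists s.
have /choice[b bE] : forall kE : K * set Om, exists B : set T,
  kE.1 \in J -> kE.2 \in s kE.1 -> [/\ measurable B, B `<=` D kE.1 &
   exists2 C : set (\bar R), measurable C & kE.2 = [set w | C (ppm w B)]].
 move=> [k E] /=; have [kJ|_] := boolP (k \in J); last by exists set0.
 have [/(sA _ kJ).1[B [C [mB BD mC EC]]]|_] := boolP (E \in s k); last by exists set0.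
 by exists B => _ _; split => //; exists C.
pose W := [seq b (k, E) | k <- enum J, E <- s k].
pose m := size W.
pose F : finType := {ffun 'I_m -> bool}.
pose w_ (j : 'I_m) := nth set0 W j.
have mw j : measurable (w_ j).
 have : w_ j \in W by exact: mem_nth.
 move=> /allpairsPdep[k [E [kJ Es ->]]]; rewrite mem_enum in kJ.
 by have [] := bE (k, E) kJ Es.
pose at_ (q : K * F) : set T := D q.1 `&` \bigcap_(j in [set: 'I_m]) (if q.2 j then w_ j else ~` w_ j).
have mat q : measurable (at_ q).
 apply: measurableI => //; apply: fin_bigcap_measurable => // j _.
 case: ifP => _; side.
have tat : trivIset setT at_.
 move=> [k f] [l g] _ _ [x [[/= kx fx] [/= lx gx]]].
 have kl : k = l by apply: tD => //; exists x.
 subst l; congr pair; apply/ffunP => j.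
 by have := fx j I; have := gx j I; case: (f j); case: (g j).
have iat := indep_count_sigma mat tat.
have := indep_systems_group (p := fst) (fun q => count_sigma_measurable (mat q))
 (fun q => @count_sigmaI _) (fun q => count_sigmaT _) iat.
apply => k kJ; rewrite (sA k kJ).2 big_seq.
set S := \bigcup_(_ in _) _.
apply: (@bigsetI_measurable _ (g_sigma_algebraType S)) => E Es.
have [mB BD [C mC EC]] := bE (k, E) kJ Es; simpl in EC, mB, BD.
have BW : b (k, E) \in W by apply/allpairsPdep; exists k, E; rewrite mem_enum.
have jm : (index (b (k, E)) W < m)%N by rewrite index_mem.
pose j := Ordinal jm.
have wj : w_ j = b (k, E) by rewrite /w_ nth_index.
have ppmE w : ppm w (b (k, E)) = (\sum_(f \in [set f : F | f j]) ppm w (at_ (k, f)))%E.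
 rewrite -measure_fin_bigcup//; last 2 first.
 - exact: finite_finset.
 - by move=> f g _ _ fg; have [] := tat (k, f) (k, g) I I fg.
 congr (ppm w _); apply/seteqP; split => x /=; last first.
  by move=> [f /= fj [_ /(_ j I)]]; rewrite fj wj.
 move=> bx; exists [ffun l : 'I_m => x \in w_ l].
  by rewrite /= ffunE wj mem_set.
 split; first exact: BD.
 by move=> l _; rewrite ffunE; case: ifPn => [/set_mem|/negP xl /mem_set].
have -> : E = (fun w => \sum_(f \in [set f : F | f j]) ppm w (at_ (k, f)))%E @^-1` C.
 by rewrite EC; apply/seteqP; split => w /=; rewrite ppmE.
rewrite -[X in measurable X]setTI.
have mg : @measurable_fun _ _ (g_sigma_algebraType S) _ setT
  (fun w => \sum_(f \in [set f : F | f j]) ppm w (at_ (k, f)))%E.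
 apply: emeasurable_fsum; first exact: finite_finset.
 move=> f _ C' mC'; apply: sub_sigma_algebra.
 by exists (k, f) => //; exists C'.
exact: mg.
Qed.

End poisson.

(** * The noises of all vertices on one probability space *)

Section noise.
Context (R : realType) (n : nat).
Local Notation E := (measurableTypeR R).
Local Notation U := (@unif R).

(** The number [k] codes a plane and a unit square in it, and the two parts of [x] place a uniform
    point in that square. Numbers that code nothing send their points to the plane [n.+1], which
    belongs to no vertex. *)
Definition strip_point (k : nat) (x : E) : nat * plane R :=
 if @pickle_inv (nat * (nat * nat))%type k is Some (i, (a, b))
 then (i, (a%:R + even_part x, b%:R + odd_part x)) else (n.+1, (0, 0)).

Lemma meas_strip_point k : measfun (strip_point k).
Proof.
rewrite /strip_point; case: (pickle_inv k) => [[i [a b]]|]; last side.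
apply: measurable_fun_pair => //; apply: measurable_fun_pair.
 by apply: measurable_funD => //; exact: meas_even_part.
by apply: measurable_funD => //; exact: meas_odd_part.
Qed.

Definition strip_process (x : E) : {measure set (nat * plane R) -> \bar R} :=
 point_process (R := R) strip_point x.

HB.instance Definition _ := isKernel.Build _ _ E _ R strip_process
 (meas_point_process meas_strip_point).

Local Notation pp := strip_process.

Definition strip (i : nat) (B : set (plane R)) : set (nat * plane R) := [set i] `*` B.

Lemma meas_strip i B : measurable B -> measurable (strip i B).
Proof. side. Qed.

Definition unit_square (a b : nat) : set (plane R) :=
 `[a%:R, a%:R + 1[%classic `*` `[b%:R, b%:R + 1[%classic.

Lemma meas_unit_square a b : measurable (unit_square a b).
Proof. side. Qed.

Lemma unif_shift (a : R) (A : set E) : measurable A ->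
 U [set x | A (a + x)] = leb (A `&` `[a, a + 1[).
Proof.
move=> mA.
have mAa : measurable (A `&` `[a, a + 1[%classic) by side.
have := @lebesgue_measure_affine R 1 a _ ltr01 mAa.
rewrite invr1 mul1e => <-; rewrite /unif /mrestr; congr (leb _).
apply/seteqP; split => x /=; rewrite !in_itv/= mul1r addrC => -[Ax /andP[x0 x1]];
 by split => //; apply/andP; split; lra.
Qed.

Lemma meas_plane_shift a b :
 measfun (fun x => (a%:R + even_part x, b%:R + odd_part x) : plane R).
Proof.
apply: measurable_fun_pair.
 by apply: measurable_funD => //; exact: meas_even_part.
by apply: measurable_funD => //; exact: meas_odd_part.
Qed.

Lemma unif_square a b (B : set (plane R)) : measurable B ->
 U [set x | B (a%:R + even_part x, b%:R + odd_part x)] =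
 (leb \x leb)%E (B `&` unit_square a b).
Proof.
move=> mB.
have mi (c : R) : @measurable _ E `[c, c + 1[%classic by side.
pose m1 := mrestr leb (mi a%:R); pose m2 := mrestr leb (mi b%:R).
pose m' := image_mu U (meas_plane_shift a b).
pose m'' := mrestr (leb \x leb)%E (meas_unit_square a b).
have fin c : (mrestr leb (mi c) setT < +oo)%E.
 rewrite /mrestr setTI lebesgue_measure_itv /= lte_fin; case: ifP => _ //.
 by rewrite -EFinB ltry.
have g (A1 A2 : set E) : measurable A1 -> measurable A2 ->
  m' (A1 `*` A2) = m'' (A1 `*` A2).
 move=> mA1 mA2.
 pose B1 : set E := A1 `&` `[a%:R, a%:R + 1[%classic.
 pose B2 : set E := A2 `&` `[b%:R, b%:R + 1[%classic.
 transitivity (leb B1 * leb B2)%E.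
  rewrite /B1 /B2.
  rewrite -!unif_shift// /m' /image_mu /pushforward/=.
  have ms (c : R) A : measurable A -> measurable [set x : E | A (c + x)].
   move=> mA; rewrite -[X in measurable X]setTI.
   by apply: (@measurable_funD _ E R setT (cst c) id) => //.
  have h1 := unif_even_part (ms a%:R A1 mA1).
  have h2 := unif_odd_part (ms b%:R A2 mA2).
  rewrite -[in RHS]h1 -[in RHS]h2 -indep_parts//; last 2 first.
  - exact: ms.
  - exact: ms.
 rewrite /m'' /= /mrestr /unit_square -setXI product_measure1E//.
 - side.
 - side.
apply: (measure_unique [set A `*` B | A in measurable & B in measurable] (fun=> setT) _ _ _ _ m' m'') => //.
- by rewrite measurable_prod_measurableType.
- move=> _ _ [X1 mX1 [X2 mX2 <-]] [Y1 mY1 [Y2 mY2 <-]].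
 exists (X1 `&` Y1); first side.
 exists (X2 `&` Y2); side.
- move=> _; exists setT => //; exists setT => //; side.
- rewrite bigcup_const//; side.
- by move=> _ [A1 mA1 [A2 mA2 <-]]; exact: g.
- by move=> _; rewrite /m' /image_mu /pushforward /= preimage_setT; apply: (le_lt_trans (probability_le1 U measurableT)); exact: ltry.
Qed.

(** The unit squares partition the quadrant, and each of them is filled by exactly one cell of the
    plane [i], with Lebesgue measure on the square as its law. *)
Lemma strip_rate (i : 'I_n.+1) B : measurable B ->
 process_rate meas_strip_point (strip i B) = quadrant_lebesgue R B.
Proof.
move=> mB; rewrite /process_rate /quadrant_lebesgue /= /mseries /mrestr.
pose sq k : set (plane R) := if @pickle_inv (nat * (nat * nat))%type k is Some (j, (a, b))
 then (if j == i :> nat then unit_square a b else set0) else set0.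
have msq k : measurable (sq k).
 rewrite /sq; case: (pickle_inv k) => [[j [a b]]|] //; case: ifP => // _.
 side.
have -> : B `&` @quadrant R = \bigcup_k (B `&` sq k).
 rewrite -setI_bigcupr; congr (B `&` _); apply/seteqP; split => -[x y].
  rewrite /quadrant /= !in_itv/= !andbT => -[x0 y0].
  pose k := pickle (nat_of_ord i, (Num.truncn x, Num.truncn y)).
  exists k => //; rewrite /sq /k pickleK_inv eqxx /unit_square /= !in_itv/=.
  by rewrite !natr1 !truncn_itv.
 move=> [k _]; rewrite /sq; case: (pickle_inv k) => [[j [a b]]|] //.
 case: ifP => // _; rewrite /unit_square /quadrant /= !in_itv/= !andbT.
 by move=> [/andP[h1 _] /andP[h2 _]]; rewrite (le_trans _ h1)// (le_trans _ h2).
rewrite measure_semi_bigcup//; last 3 first.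
- side.
- apply/trivIsetP => k l _ _ kl; apply/seteqP; split => -[x y] //= [[_ +] [_]].
 move: kl; rewrite /sq.
 have := @pickle_invK (nat * (nat * nat))%type k; have := @pickle_invK (nat * (nat * nat))%type l.
 case: (pickle_inv k) => [[j [a b]]|] //; case: (pickle_inv l) => [[j' [a' b']]|] //=.
 move=> <- <- kl; case: eqP => // ji; case: eqP => // ji'.
 rewrite /unit_square /= !in_itv/= => -[/andP[h1 h2] /andP[h3 h4]] [/andP[h5 h6] /andP[h7 h8]].
 have e1 (c c' : nat) (z : R) : c%:R <= z -> z < c%:R + 1 -> c'%:R <= z -> z < c'%:R + 1 -> c = c'.
  move=> l1 l2 l3 l4; apply/eqP; rewrite eqn_leq.
  by apply/andP; split; rewrite -ltnS -(ltr_nat R) -natr1; lra.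
 move: kl; rewrite ji ji' (e1 a a' x)// (e1 b b' y)//.
 by rewrite eqxx.
- side.
apply: eq_eseriesr => k _; rewrite [LHS](_ : _ = U (strip_point k @^-1` strip i B))//.
rewrite /sq /strip_point; case: (pickle_inv k) => [[j [a b]]|]; last first.
 rewrite setI0 measure0 (_ : _ @^-1` _ = set0) ?measure0//.
 by apply/seteqP; split => x //= [/= ni _]; have := ltn_ord i; rewrite -ni ltnn.
case: eqP => [->|ji].
 apply: etrans (unif_square a b mB); congr (U _).
 by apply/seteqP; split => x //=; first by case.
rewrite setI0 measure0 (_ : _ @^-1` _ = set0) ?measure0//.
by apply/seteqP; split => x //= [/= ji' _].
Qed.

Definition slice (i : 'I_n.+1) (x : E) : {measure set (plane R) -> \bar R} :=
 image_mu (mrestr (pp x) (meas_strip i measurableT)) measurable_snd.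

Lemma sliceE i x B : measurable B -> slice i x B = pp x (strip i B).
Proof.
move=> mB; rewrite /slice /= /image_mu /pushforward /mrestr; congr (pp x _).
by apply/seteqP; split => -[j y] /= [] // ? [].
Qed.

Lemma meas_slice i B : measurable B -> measfun (slice i ^~ B).
Proof.
move=> mB; under eq_fun do rewrite sliceE//.
exact: (measurable_kernel pp _ (meas_strip i mB)).
Qed.

HB.instance Definition _ i := isKernel.Build _ _ E (plane R) R (slice i) (@meas_slice i).

Definition slice_ker (i : 'I_n.+1) : R.-ker E ~> plane R := slice i.

Local Notation nu := (process_rate meas_strip_point).

Lemma slice_is_poisson i : is_poisson_measure U (slice_ker i) (quadrant_lebesgue R).
Proof.
have [law ind] : is_poisson_measure U pp nu :=
 point_process_is_poisson meas_strip_point.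
split=> [B mB Bfin k|m B mB tB].
 have := law _ (meas_strip i mB); rewrite strip_rate// => /(_ Bfin k) <-.
 by congr (U _); apply/seteqP; split => x /=; rewrite -sliceE.
have := ind m (fun j => strip i (B j)) (fun j => meas_strip i (mB j)).
have tS : trivIset setT (fun j => strip i (B j)).
 by move=> j l _ _ [[a y] [[/= _ By] [/= _ Cy]]]; apply: tB => //; exists y.
move=> /(_ tS); apply: indep_systems_sub => j _ [C mC <-]; exists C => //.
suff -> : (fun w => slice_ker i w (B j)) = fun w => pp w (strip i (B j)) by [].
by apply/funext => w; exact: sliceE.
Qed.

Lemma slice_events i D : noise_events (slice_ker i) D `<=`
 noise_events pp (strip i D).
Proof.
move=> _ [B [C [mB BD mC ->]]]; exists (strip i B), C; split => //.
- side.
- by move=> [a y] [/= ai By]; split => //=; exact: BD.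
- by apply: (congr1 (preimage^~ C)); apply/funext => x; exact: sliceE.
Qed.

Definition slice_filtration (t : R) : set_system E :=
 <<s \bigcup_i noise_events (slice_ker i) (`[0%R, t] `*` `[0%R, +oo[) >>.

Lemma slice_filtrationP : is_filtration slice_filtration.
Proof.
split=> [t t0|s t s0 st].
 split; first exact: smallest_sigma_algebra.
 apply: smallest_sub; first exact: sigma_algebra_measurable.
 by move=> A [i _]; exact: noise_events_measurable.
apply: smallest_sub; first exact: smallest_sigma_algebra.
move=> A [i _ [B [C [mB BD mC ->]]]]; apply: sub_sigma_algebra; exists i => //.
exists B, C; split => // -[x y] /BD; rewrite /= !in_itv/= => -[/andP[x0 xs] ->].
by rewrite x0 (le_trans xs).
Qed.

(** All the planes are regions of one Poisson process, so both independence statements are instances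
    of [indep_noise_events]: distinct vertices own disjoint strips, and past and future are disjoint
    slabs across all planes. *)
Lemma slice_noise : is_poisson_noise U slice_filtration slice_ker.
Proof.
have poi : is_poisson_measure U pp nu := point_process_is_poisson meas_strip_point.
split.
- exact: slice_is_poisson.
- have mS (i : 'I_n.+1) : measurable (strip i setT) by side.
 have tS : trivIset setT (fun i : 'I_n.+1 => strip i setT).
  by move=> i j _ _ [[a y] [[/= -> _] [/= /val_inj ? _]]].
 have := indep_noise_events poi mS tS; apply: indep_systems_sub => i.
 by apply: sub_sigma_algebra2; exact: slice_events.
- by move=> i t t0 A iA; apply: sub_sigma_algebra; exists i.
move=> t t0 A B FA FB.
pose D (b : bool) : set (nat * plane R) :=
 setT `*` (if b then `[0, t] `*` `[0, +oo[ else `]t, +oo[ `*` `[0, +oo[).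
have mD b : measurable (D b).
 apply: measurableX => //; case: b; side.
have tD : trivIset setT D.
 move=> b b' _ _ [[a [x y]] []].
 rewrite /D; case: b; case: b' => //= -[_ [/= + _]] [_ [/= + _]]; rewrite !in_itv/= ?andbT.
  by move=> /andP[_]; rewrite leNgt => /negbTE ->.
 by move=> xt /andP[_]; rewrite leNgt xt.
pose Q (b : bool) : set (plane R) :=
 if b then `[0, t] `*` `[0, +oo[ else `]t, +oo[ `*` `[0, +oo[.
have sub i b : noise_events (slice_ker i) (Q b) `<=`
  noise_events pp (D b).
 move=> X /slice_events; apply: noise_eventsS.
 rewrite /D /Q => -[a x] [_]; side.
have := indep_noise_events poi mD tD (J := [set: bool]%SET)
 (A := fun b : bool => if b then A else B).
have AB (b : bool) : b \in [set: bool]%SET -> (<<s noise_events pp (D b) >>) (if b then A else B).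
 move=> _; case: b.
  by move: FA; apply: sub_sigma_algebra2 => X [i _]; exact: (sub i true).
 by move: FB; apply: sub_sigma_algebra2 => X [i _]; exact: (sub i false).
move=> /(_ AB) {AB}.
rewrite (_ : \bigcap_(_ in _) _ = A `&` B); last first.
 apply/seteqP; split => x /=; last by move=> [Ax Bx] [].
 move=> h; have h1 b := h b; split.
  by have := h1 true; apply; rewrite /= inE.
 by have := h1 false; apply; rewrite /= inE.
rewrite (eq_bigl xpredT); last by move=> b; rewrite inE.
rewrite big_bool/= => e.
have [/(_ t t0)[_ Fm] _] := slice_filtrationP.
have mA : measurable A by exact: Fm.
have mB : measurable B.
 move: FB; apply: smallest_sub; first exact: sigma_algebra_measurable.
 by move=> X [i _]; exact: noise_events_measurable.
have fU X : measurable X -> (U X = (fine (U X))%:E)%E.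
 by move=> mX; rewrite fineK//; exact: (fin_num_measure U).
rewrite [LHS]fU; last side.
by rewrite e [in RHS](fU _ mA) [in RHS](fU _ mB) EFinM.
Qed.

End noise.

(** * Integration against kernels that are finite on an exhaustion *)

Section locally.
Import HBNNSimple.
Context d d' (X : measurableType d) (Y : measurableType d') (R : realType).
Variables (k : R.-ker X ~> Y) (D : nat -> set Y).
Hypotheses (mD : forall n, measurable (D n)) (ndD : nondecreasing_seq D)
 (covD : \bigcup_n D n = setT) (finD : forall x n, (k x (D n) < +oo)%E).

Lemma meas_kernel_xsection (A : set (X * Y)) : measurable A ->
 measfun (fun x => k x (xsection A x)).
Proof.
move=> mA.
(* Each restriction to [D n] is finite for every [x], which is the case of the standard section
   theorem; the restrictions then increase to the kernel. *)
have mr n : measfun (fun x => mrestr (k x) (mD n) (xsection A x)).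
 have [] // := @measurable_prod_subset_xsection_kernel _ _ X Y R k _ (mD n) _ A mA.
 move=> x; exists (fine (k x (D n)) + 1) => B mB.
 rewrite EFinD fineK ?ge0_fin_numE// /mrestr (@le_lt_trans _ _ (k x (D n)))//.
  apply: le_measure; rewrite ?inE//; side.
 by rewrite lteDl ?lte01// ge0_fin_numE.
apply: (emeasurable_fun_cvg (fun n x => mrestr (k x) (mD n) (xsection A x)) _ mr).
move=> x _.
have -> : k x (xsection A x) = k x (\bigcup_n (xsection A x `&` D n)).
 by rewrite -setI_bigcupr covD setIT.
apply: nondecreasing_cvg_mu.
- by move=> n; apply: measurableI => //; exact: measurable_xsection.
- by apply: bigcupT_measurable => n; apply: measurableI => //; exact: measurable_xsection.
- by move=> m n mn; apply/subsetPset; apply: setIS; apply/subsetPset; exact: ndD.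
Qed.

Lemma meas_kernel_int (f : X * Y -> \bar R) :
 measfun f -> (forall z, (0 <= f z)%E) ->
 measfun (fun x => (\int[k x]_y f (x, y))%E).
Proof.
move=> mf f0; pose f_ := nnsfun_approx measurableT mf.
apply: (@measurable_fun_xsection_integral _ _ _ _ _ f k f_).
- by move=> a b ab; exact/nd_nnsfun_approx.
- move=> z; apply: cvg_nnsfun_approx => // ? _; side.
- move=> n r; apply: meas_kernel_xsection; side.
Qed.

End locally.

(** * Integer-valued measures on the plane *)

Section counting.
Context (R : realType).
Local Notation E := (measurableTypeR R).

Definition is_count (x : \bar R) := exists m : nat, x = m%:R%:E.

Lemma count_cvg (a : nat -> \bar R) (l : \bar R) : (forall n, is_count (a n)) ->
 nondecreasing_seq a -> a @ \oo --> l -> l = +oo%E \/ is_count l.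
Proof.
move=> /choice[b ab] nda al.
have lE : l = ereal_sup (range a).
 by rewrite -(cvg_lim _ al)//; apply/cvg_lim => //; exact: ereal_nondecreasing_cvgn.
have [[M bM]|nb] := pselect (exists M, forall n, (b n <= M)%N).
 right.
 have eb : exists m, `[< exists n, b n = m >] by exists (b 0%N); apply/asboolP; exists 0%N.
 have ub m : `[< exists n, b n = m >] -> (m <= M)%N by move=> /asboolP[n <-].
 have [m /asboolP[n bn] mmax] := ex_maxnP eb ub.
 exists m; rewrite lE; apply/eqP; rewrite eq_le; apply/andP; split.
  apply: ge_ereal_sup => _ [j _ <-]; rewrite ab lee_fin ler_nat; apply: mmax.
  by apply/asboolP; exists j.
 by apply: ereal_sup_ubound; exists n => //; rewrite ab bn.
left; apply/eqyP => A A0.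
have [n An] : exists n, (Num.truncn A < b n)%N.
 apply: contrapT => h; apply: nb; exists (Num.truncn A) => n.
 by rewrite leqNgt; apply/negP => ?; apply: h; exists n.
rewrite lE; apply: (@le_trans _ _ (a n)); last by apply: ereal_sup_ubound; exists n.
by rewrite ab lee_fin; apply: ltW; rewrite (lt_le_trans (truncnS_gt A))// ler_nat.
Qed.

Lemma is_countD (x y : \bar R) : is_count x -> is_count y -> is_count (x + y)%E.
Proof. by move=> [m ->] [n ->]; exists (m + n)%N; rewrite natrD EFinD. Qed.

Definition box (n : nat) : set (plane R) :=
 `[- n%:R, n%:R]%classic `*` `[- n%:R, n%:R]%classic.

Lemma meas_box n : measurable (box n).
Proof. side. Qed.

Lemma box_nd : nondecreasing_seq box.
Proof.
move=> m n mn; apply/subsetPset => -[x y]; rewrite /box /= !in_itv/=.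
have := mn; rewrite -(ler_nat R) => {}mn.
by move=> [/andP[x0 x1] /andP[y0 y1]]; split; apply/andP; split; lra.
Qed.

Lemma box_cover : \bigcup_n box n = setT.
Proof.
apply/seteqP; split => // -[x y] _.
exists (maxn (Num.truncn `|x|).+1 (Num.truncn `|y|).+1) => //.
rewrite /box /= !in_itv/= -!ler_norml natr_max !le_max.
by rewrite (ltW (truncnS_gt `|x|)) (ltW (truncnS_gt `|y|)) orbT.
Qed.

(** Open at time 0, like the rectangles generating the predictable sigma-algebra; the axis of time 0
    is null for the intensity. *)
Definition positive_quad : set (plane R) := `]0%R, +oo[%classic `*` `[0%R, +oo[%classic.

Lemma meas_positive_quad : measurable positive_quad.
Proof. side. Qed.

(** What is asked of the noise for every outcome: integer counts of all measurable sets at once,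
    whereas the definition of a Poisson measure leaves a null set for each of them. *)
Definition count_measure (m : {measure set (plane R) -> \bar R}) := [/\
 forall n, (m (box n) < +oo)%E,
 forall B, measurable B -> m B = +oo%E \/ is_count (m B) &
 m (~` positive_quad) = 0%E].

Definition rat_rays : set_system E := range (fun q : rat => `]-oo, (ratr q : R)[%classic).

Lemma rat_raysE : @measurable _ E = <<s rat_rays >>.
Proof.
rewrite [LHS]RGenInftyO.measurableE; apply/seteqP; split.
 apply: smallest_sub; first side.
 move=> _ [x ->].
 have -> : `]-oo, x[%classic =
   \bigcup_q (if ratr q < x then `]-oo, (ratr q : R)[%classic else set0).
  apply/seteqP; split => [y|y [q _]]; last first.
   by case: ifPn => // qx; rewrite /= !in_itv/= => /lt_trans; exact.
  rewrite /= in_itv/= => /rat_in_itvoo[q]; rewrite in_itv/= => /andP[yq qx].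
  by exists q => //; rewrite qx /= in_itv.
 apply: (@bigcupT_measurable_rat _ (g_sigma_algebraType rat_rays)) => q.
 by case: ifP => // _; apply: sub_sigma_algebra; exists q.
apply: smallest_sub; first exact: smallest_sigma_algebra.
by move=> _ [q _ <-]; apply: sub_sigma_algebra; exists (ratr q).
Qed.

Definition rat_rectangles : set_system (plane R) :=
 range (fun qr : rat * rat => `]-oo, (ratr qr.1 : R)[%classic `*` `]-oo, (ratr qr.2 : R)[%classic).

Lemma rat_rectanglesE : @measurable _ (plane R) = <<s rat_rectangles >>.
Proof.
pose S := g_sigma_algebraType rat_rectangles.
have big (q : R) : q%:E = q%:E by [].
have cov1 (A : rat -> set E) : \bigcup_r (`]-oo, (ratr r : R)[%classic) = [set: E].
 apply/seteqP; split => // x _.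
 have /rat_in_itvoo[r] : x < x + 1 by rewrite ltrDl.
 rewrite in_itv/= => /andP[xr _]; exists r => //; side.
have m1 A : measurable A -> @measurable _ S (A `*` [set: E]).
 rewrite rat_raysE; apply: (@smallest_sub _ _ _ [set A | @measurable _ S (A `*` [set: E])]).
  split => /=.
  - rewrite set0X; side.
  - move=> A0 mA0; rewrite (_ : _ `*` _ = ~` (A0 `*` setT)); first side.
   side.
  - move=> F mF; rewrite setX_bigcupl; side.
 move=> _ [q _ <-] /=; rewrite -(cov1 (fun=> set0)) setX_bigcupr.
 by apply: bigcupT_measurable_rat => r; apply: sub_sigma_algebra; exists (q, r).
have m2 A : measurable A -> @measurable _ S ([set: E] `*` A).
 rewrite rat_raysE; apply: (@smallest_sub _ _ _ [set A | @measurable _ S ([set: E] `*` A)]).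
  split => /=.
  - rewrite setX0; side.
  - move=> A0 mA0; rewrite (_ : _ `*` _ = ~` (setT `*` A0)); first side.
   side.
  - move=> F mF; rewrite setX_bigcupr; side.
 move=> _ [q _ <-] /=; rewrite -(cov1 (fun=> set0)) setX_bigcupl.
 by apply: bigcupT_measurable_rat => r; apply: sub_sigma_algebra; exists (r, q).
apply/seteqP; split; last first.
 apply: smallest_sub; first exact: sigma_algebra_measurable.
 move=> _ [q _ <-]; side.
rewrite measurable_prod_measurableType; apply: smallest_sub.
 side.
move=> _ [A mA [B mB <-]].
rewrite (_ : A `*` B = (A `*` setT) `&` (setT `*` B)); last first.
 side.
by apply: (@measurableI _ S); [exact: m1|exact: m2].
Qed.

Lemma rat_rectanglesI : setI_closed rat_rectangles.
Proof.
move=> _ _ [[q r] _ <-] [[q' r'] _ <-]; exists (Num.min q q', Num.min r r') => //.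
apply/seteqP; split => -[x y] /=; rewrite !in_itv/= !minElt.
 by case: ifPn; case: ifPn => h h' [h1 h2]; move: h h'; rewrite -?leNgt -?(ltr_rat R) -?(ler_rat R);
  repeat split; lra.
by case: ifPn; case: ifPn => ? ? [[? ?] [? ?]].
Qed.

(** The hypotheses are countably many, hence hold together almost surely for a Poisson measure.
    Inside a box the sets with an integer count form a Dynkin system, since a finite count can be
    subtracted; the rational rectangles are a generating pi-system. *)
Lemma count_measureP (m : {measure set (plane R) -> \bar R}) :
 (forall n, is_count (m (box n))) ->
 (forall n B, rat_rectangles B -> is_count (m (B `&` box n))) ->
 m (~` positive_quad) = 0%E -> count_measure m.
Proof.
move=> mbox mrect m0.
have boxoo n : (m (box n) < +oo)%E by have [k ->] := mbox n; rewrite ltry.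
have cbox n B : measurable B -> is_count (m (B `&` box n)).
 have mI S : measurable S -> measurable (S `&` box n) by side.
 move=> mB; have := mB; rewrite rat_rectanglesE.
 apply: (@dynkin_induction _ _ rat_rectangles (fun B => is_count (m (B `&` box n)))).
 - exact: rat_rectanglesE.
 - exact: rat_rectanglesI.
 - by rewrite setTI.
 - exact: mrect.
 - move=> S mS [k Sk]; have [b bE] := mbox n; exists (b - k)%N.
  have : m (box n) = (m (S `&` box n) + m (~` S `&` box n))%E.
   rewrite -measureU; first by rewrite -setIUl setUv setTI.
   - side.
   - side.
   - side.
  rewrite Sk bE => h.
  have kb : (k <= b)%N.
   by rewrite -(ler_nat R) -lee_fin h leeDl.
  by rewrite natrB// EFinB h addeAC subee// add0e.
 - move=> F mF tF cF.
  have [e|//] : m ((\bigcup_k F k) `&` box n) = +oo%E \/ is_count (m ((\bigcup_k F k) `&` box n)).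
   apply: (@count_cvg (fun j => (\sum_(0 <= i < j) m (F i `&` box n))%E)).
   + elim=> [|j IHj]; first by rewrite big_geq//; exists 0%N.
    by rewrite big_nat_recr//=; exact: is_countD.
   + by apply: ereal_nondecreasing_series.
   + rewrite setI_bigcupl; apply: measure_semi_sigma_additive => //.
    * side.
    * by apply: trivIset_setIr.
    * side.
  move: (boxoo n); rewrite ltNge => /negP[]; rewrite -e.
  apply: le_measure; rewrite ?inE//; side.
split => // B mB; apply: (@count_cvg (fun n => m (B `&` box n))) => //.
- by move=> n; exact: cbox.
- move=> i j ij; apply: le_measure; rewrite ?inE.
 + side.
 + side.
 + by apply: setIS; apply/subsetPset; exact: box_nd.
have -> : m B = m (\bigcup_n (B `&` box n)) by rewrite -setI_bigcupr box_cover setIT.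
apply: nondecreasing_cvg_mu.
- side.
- side.
- by move=> i j ij; apply/subsetPset; apply: setIS; apply/subsetPset; exact: box_nd.
Qed.

Lemma quad_lebX (A B : set E) : measurable A -> measurable B ->
 nu (A `*` B) = (leb (A `&` `[0%R, +oo[) * leb (B `&` `[0%R, +oo[))%E.
Proof.
move=> mA mB; rewrite /quadrant_lebesgue /= /mrestr /quadrant -setXI.
rewrite product_measure1E//; apply: measurableI => //; exact: measurable_itv.
Qed.

Lemma quad_leb_box n : (nu (box n) < +oo)%E.
Proof.
pose I : set E := `[- n%:R, n%:R]%classic.
have h : (leb (I `&` `[0%R, +oo[) < +oo)%E.
 apply: (@le_lt_trans _ _ (leb I)).
  apply: le_measure; rewrite ?inE//; last side.
  side.
 by rewrite lebesgue_measure_itv/=; case: ifP; rewrite ?ltry.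
rewrite /box quad_lebX; [|side|exact: measurable_itv].
by rewrite -/I; apply: lte_mul_pinfty => //; rewrite ge0_fin_numE.
Qed.

Lemma quad_leb_positive : nu (~` positive_quad) = 0%E.
Proof.
rewrite /quadrant_lebesgue /= /mrestr /quadrant.
rewrite (_ : _ `&` _ = [set 0%R] `*` `[0%R, +oo[%classic); last first.
 apply/seteqP; split => -[x y]; rewrite /positive_quad /= !in_itv/= ?andbT.
  by move=> [h [x0 y0]]; split => //; apply/eqP; rewrite eq_le x0 andbT leNgt; apply/negP => ?; exact: h.
 by move=> [-> y0]; split => //; rewrite ltxx => -[].
transitivity (@lebesgue_measure R [set 0%R] * @lebesgue_measure R `[0%R, +oo[)%E; last by rewrite lebesgue_measure_set1 mul0e.
apply: product_measure1E => //; side.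
Qed.

End counting.

Section poisson.
Context d d' (Om : measurableType d) (T : measurableType d') (R : realType).
Variables (P : probability Om R) (ppm : R.-ker Om ~> T) (nu : {measure set T -> \bar R}).
Hypothesis poi : is_poisson_measure P ppm nu.

Lemma prob1_ae (A : set Om) : measurable A -> P A = 1%E -> {ae P, forall w, A w}.
Proof.
by move=> mA PA; exists (~` A); split => //; [side|rewrite probability_setC// PA subee].
Qed.

Lemma meas_count_eq B (x : \bar R) : measurable B -> measurable [set w | ppm w B = x].
Proof.
move=> mB; rewrite -[X in measurable X]setTI.
exact: (measurable_kernel ppm B mB measurableT _ (emeasurable_set1 x)).
Qed.

Lemma poisson_prob_eq B (k : nat) : measurable B -> (nu B < +oo)%E ->
 P [set w | ppm w B = k%:R%:E] = (poisson_wt (fine (nu B)) k)%:E.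
Proof. by move=> mB Boo; rewrite poi.1// poisson_probE// fine_ge0. Qed.

Lemma poisson_ae_count B : measurable B -> (nu B < +oo)%E ->
 {ae P, forall w, is_count (ppm w B)}.
Proof.
move=> mB Boo.
have mk k : measurable [set w | ppm w B = k%:R%:E] by exact: meas_count_eq.
have mU : measurable (\bigcup_k [set w | ppm w B = k%:R%:E]) by side.
suff : P (\bigcup_k [set w | ppm w B = k%:R%:E]) = 1%E.
 by move=> /(prob1_ae mU); apply: filterS => w [k _ kE]; exists k.
rewrite measure_semi_bigcup//.
 rewrite -(poisson_wt_sum1 (fine_ge0 (measure_ge0 nu B))).
 by apply: eq_eseriesr => k _; exact: poisson_prob_eq.
move=> i j _ _ [w [/= -> /(congr1 fine)/= /eqP]]; rewrite eqr_nat => /eqP ->.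
by [].
Qed.

Lemma poisson_ae0 B : measurable B -> nu B = 0%E -> {ae P, forall w, ppm w B = 0%E}.
Proof.
move=> mB B0; apply: (@prob1_ae [set w | ppm w B = 0%E]).
 exact: meas_count_eq.
have := @poisson_prob_eq B 0 mB; rewrite B0 => /(_ (ltry _)) ->.
by rewrite /poisson_wt fact0 expr0 invr1 !mul1r oppr0 expR0.
Qed.

End poisson.

(** * Versions of the noise and completion of the filtration *)

Section good.
Context d (Om : measurableType d) (R : realType) (P : probability Om R).

Lemma poisson_ae_counting (ppm : R.-ker Om ~> plane R) : is_poisson_measure P ppm nu ->
 {ae P, forall w, count_measure (ppm w)}.
Proof.
move=> poi.
have h1 : {ae P, forall w, forall n, is_count (ppm w (@box R n))}.
 apply: ae_foralln => n; apply: (poisson_ae_count poi); first side.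
 exact: quad_leb_box.
pose r (n : nat) : set (plane R) := if @unpickle (rat * rat)%type n is Some q then
  `]-oo, (ratr q.1 : R)[%classic `*` `]-oo, (ratr q.2 : R)[%classic else set0.
have mr n : measurable (r n).
 rewrite /r; case: (unpickle n) => // q; side.
have h2 : {ae P, forall w, forall m n, is_count (ppm w (r m `&` @box R n))}.
 apply: ae_foralln => m; apply: ae_foralln => n; apply: (poisson_ae_count poi).
  side.
 apply: (le_lt_trans _ (@quad_leb_box R n)); apply: le_measure; rewrite ?inE//.
 - side.
 - side.
have h3 := poisson_ae0 poi (measurableC (@meas_positive_quad R))
 (@quad_leb_positive R).
apply: filterS3 h1 h2 h3 => w c1 c2 c3; apply: count_measureP => // n B [q _ <-].
have := c2 (pickle q) n; rewrite /r pickleK; exact.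
Qed.

Section cut.
Context d' (T : measurableType d') (N : set Om) (mN : measurable N) (k : R.-ker Om ~> T).

(** The zero measure is integer-valued, so cutting on a null set makes an almost sure regularity of
    the kernel hold everywhere. *)
Definition cut of measurable N : Om -> {measure set T -> \bar R} :=
 fun w => if w \in N then (mzero : {measure set T -> \bar R}) else k w.

Lemma meas_cut B : measurable B -> measfun (cut mN ^~ B).
Proof.
move=> mB; rewrite (_ : cut mN ^~ B = fun w => if w \in N then 0%E else k w B); last first.
 by apply/funext => w; rewrite /cut; case: ifP.
apply: measurable_fun_ifT => //; last exact: measurable_kernel.
apply: (measurable_fun_bool true); rewrite setTI (_ : _ @^-1` _ = N)//.
 by apply/seteqP; split => w /=; [exact: set_mem|exact: mem_set].
Qed.

HB.instance Definition _ := isKernel.Build _ _ Om T R (cut mN) meas_cut.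
End cut.

(** Agreeing outside [N] with a set of [<<s G >>] is stable under complements and countable unions,
    so it is enough to check it on generators. *)
Lemma sigma_modulo (N : set Om) (G G' : set_system Om) :
 (forall A', G' A' -> exists2 A, <<s G >> A & A `\` N = A' `\` N) ->
 forall A', <<s G' >> A' -> exists2 A, <<s G >> A & A `\` N = A' `\` N.
Proof.
move=> GG'; apply: smallest_sub => //; split => /=.
- by exists set0 => //; exact: (@measurable0 _ (g_sigma_algebraType G)).
- move=> A' [A GA AE]; exists (~` A); first exact: (@measurableC _ (g_sigma_algebraType G)).
 rewrite setTD; apply/seteqP; split => w /= [nA nN]; split => // h; apply: nA.
  by have [] : (A `\` N) w by rewrite AE.
 by have [] : (A' `\` N) w by rewrite -AE.
- move=> F FP.
 have /choice[f fP] : forall n, exists A, <<s G >> A /\ A `\` N = F n `\` N.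
  by move=> n; have [A] := FP n; exists A.
 exists (\bigcup_n f n).
  by apply: (@bigcupT_measurable _ (g_sigma_algebraType G)) => n; have [] := fP n.
 by rewrite !setD_bigcupl; apply: eq_bigcupr => n _; have [] := fP n.
Qed.

Lemma measure_modulo (N A B : set Om) : measurable N -> P N = 0%E ->
 measurable A -> measurable B -> A `\` N = B `\` N -> P A = P B.
Proof.
move=> mN N0 mA mB AB.
have h S : measurable S -> P S = P (S `\` N).
 move=> mS; rewrite (measureDI P mS mN) [X in (_ + X)%E](_ : _ = 0%E) ?adde0//.
 apply/eqP; rewrite eq_le measure_ge0 andbT -N0; apply: le_measure; rewrite ?inE//.
 side.
by rewrite h// AB -h.
Qed.

Lemma bigcap_modulo (I : finType) (J : {set I}) (N : set Om) (A B : I -> set Om) :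
 (forall i, i \in J -> A i `\` N = B i `\` N) ->
 (\bigcap_(i in [set` J]) A i) `\` N = (\bigcap_(i in [set` J]) B i) `\` N.
Proof.
move=> AB; apply/seteqP; split => w [h nN]; split => // i iJ.
 by have : (A i `\` N) w; [split => //; exact: h|rewrite AB// => -[]].
by have : (B i `\` N) w; [split => //; exact: h|rewrite -AB// => -[]].
Qed.

Lemma indep_modulo (I : finType) (N : set Om) (G G' : I -> set_system Om) :
 measurable N -> P N = 0%E -> (forall i, G i `<=` measurable) ->
 (forall i, G' i `<=` measurable) ->
 (forall i A', G' i A' -> exists2 A, G i A & A `\` N = A' `\` N) ->
 independent_systems P G -> independent_systems P G'.
Proof.
move=> mN N0 mG mG' GG' iG J A' AJ.
have /choice[A AP] : forall i, exists A, i \in J -> G i A /\ A `\` N = A' i `\` N.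
 move=> i; have [/AJ/GG'[A GA AE]|_] := boolP (i \in J); last by exists set0.
 by exists A.
have mJ (S : I -> set Om) : (forall i, i \in J -> measurable (S i)) -> measurable (\bigcap_(i in [set` J]) S i).
 exact: bigcap_finset_measurable.
rewrite -(@measure_modulo N (\bigcap_(i in [set` J]) A i))//.
- rewrite iG; last by move=> i /AP[].
 apply: eq_bigr => i iJ; congr fine; apply: (@measure_modulo N) => //.
 + by apply: (mG i); have [] := AP i iJ.
 + by apply: (mG' i); exact: AJ.
 + by have [] := AP i iJ.
- by apply: mJ => i /AP[? _]; exact: (mG i).
- by apply: mJ => i /AJ; exact: (mG' i).
- by apply: bigcap_modulo => i /AP[].
Qed.

Definition null_complete (F : R -> set_system Om) : Prop :=
 forall t A B, 0 <= t -> F t A -> measurable B ->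
  P ((A `\` B) `|` (B `\` A)) = 0%E -> F t B.

(** The cut noise, and later the Hawkes paths, are determined by events of [F t] only up to null
    sets; the completion is the filtration to which they are adapted. *)
Definition completion (F : R -> set_system Om) (t : R) : set_system Om :=
 [set B | measurable B /\ exists2 A, F t A & P ((A `\` B) `|` (B `\` A)) = 0%E].

Lemma ae_forall_fin (I : finType) (Q : I -> Om -> Prop) :
 (forall i, {ae P, forall w, Q i w}) -> {ae P, forall w, forall i, Q i w}.
Proof.
move=> h.
pose e (n : nat) w := if @insub nat (fun i => (i < #|I|)%N) 'I_#|I| n is Some j then Q (enum_val j) w else True.
have : {ae P, forall w, forall n, e n w}.
 by apply: ae_foralln => n; rewrite /e; case: insubP => [j _ _|_]; [side|exact: aeW].
apply: filterS => w he i; have := he (enum_rank i); rewrite /e.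
by rewrite valK enum_rankK.
Qed.

Lemma measure0_le (A B : set Om) : measurable A -> measurable B -> A `<=` B ->
 P B = 0%E -> P A = 0%E.
Proof.
move=> mA mB AB B0; apply/eqP; rewrite eq_le measure_ge0 andbT -B0.
by apply: le_measure; rewrite ?inE.
Qed.

Lemma symdiff_modulo (A B : set Om) : A `\` ((A `\` B) `|` (B `\` A)) =
 B `\` ((A `\` B) `|` (B `\` A)).
Proof.
apply/seteqP; split => w /= [h nh]; split => //; apply: contrapT => h'; apply: nh.
 by left.
by right.
Qed.

Lemma meas_symdiff (A B : set Om) : measurable A -> measurable B ->
 measurable ((A `\` B) `|` (B `\` A)).
Proof. side. Qed.

Section completion.
Variable F : R -> set_system Om.
Hypothesis fF : is_filtration F.

Lemma completion_filtration : is_filtration (completion F).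
Proof.
have [Fs Fnd] := fF.
split=> [t t0|s t s0 st B [mB [A FA AB]]]; last first.
 by split => //; exists A => //; exact: Fnd FA.
have [sF mF] := Fs t t0; have [F0 FC FU] := sF.
split; last by move=> B [].
split.
- by split => //; exists set0 => //; rewrite setDv setU0 measure0.
- move=> B [mB [A FA AB]]; split; first side.
 exists (setT `\` A); first exact: FC.
 by rewrite !setTD !setDE !setCK setUC (setIC (~` B)) (setIC (~` A)) -!setDE.
- move=> B BP; split; first by apply: bigcupT_measurable => n; have [] := BP n.
 have /choice[A AP] : forall n, exists A, F t A /\ P ((A `\` B n) `|` (B n `\` A)) = 0%E.
  by move=> n; have [_ [A FA AB]] := BP n; exists A.
 have mA n : measurable (A n) by apply: mF; have [] := AP n.
 have mB n : measurable (B n) by have [] := BP n.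
 exists (\bigcup_n A n); first by apply: FU => n; have [] := AP n.
 apply: (@measure0_le _ (\bigcup_n ((A n `\` B n) `|` (B n `\` A n)))).
 + side.
 + side.
 + move=> w [[[n _ An] nB]|[[n _ Bn] nA]]; exists n => //.
   by left; split => // h; apply: nB; exists n.
  by right; split => // h; apply: nA; exists n.
 + apply/eqP; rewrite eq_le measure_ge0 andbT.
  apply: (le_trans (generalized_Boole_inequality _ _ _)).
  * side.
  * side.
  * by rewrite eseries0// => n _ _; have [] := AP n.
Qed.

Lemma completion_null_complete : null_complete (completion F).
Proof.
move=> t A B t0 [mA [A0 FA0 A0A]] mB AB; split => //; exists A0 => //.
have mA0 : measurable A0 by have [/(_ t t0)[_ +] _] := fF; apply.
apply: (@measure0_le _ (((A0 `\` A) `|` (A `\` A0)) `|` ((A `\` B) `|` (B `\` A)))).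
- side.
- side.
- by move=> w /= ; have [?|?] := pselect (A w); tauto.
- apply/eqP; rewrite eq_le measure_ge0 andbT.
 apply: (@le_trans _ _ (P ((A0 `\` A) `|` (A `\` A0)) + P ((A `\` B) `|` (B `\` A)))%E).
  apply: measureU2; side.
 by rewrite A0A AB adde0.
Qed.

End completion.

Lemma poisson_measure_modulo (k k0 : R.-ker Om ~> plane R) (N : set Om) : measurable N -> P N = 0%E ->
 (forall w, ~ N w -> (k w : {measure set _ -> \bar R}) = k0 w) ->
 is_poisson_measure P k0 (quadrant_lebesgue R) -> is_poisson_measure P k (quadrant_lebesgue R).
Proof.
move=> mN N0 kE poi; split=> [B mB Boo m|n B mB tB].
 rewrite -poi.1//; apply: (@measure_modulo N) => //.
 - exact: meas_count_eq.
 - exact: meas_count_eq.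
 - by apply/seteqP; split => w /= [h Nw]; move: h; rewrite kE.
apply: (indep_modulo mN N0) (poi.2 n B mB tB).
- by move=> i; exact: count_sigma_measurable.
- by move=> i; exact: count_sigma_measurable.
move=> i _ [C mC <-]; exists ((fun w => k0 w (B i)) @^-1` C); first by exists C => //; rewrite setTI.
by rewrite setTI; apply/seteqP; split => w /= [h Nw]; move: h; rewrite kE.
Qed.

Lemma count_version (ppm : R.-ker Om ~> plane R) : is_poisson_measure P ppm (quadrant_lebesgue R) ->
 exists k : R.-ker Om ~> plane R, [/\ is_poisson_measure P k (quadrant_lebesgue R),
  forall w, count_measure (k w) & {ae P, forall w, (k w : {measure set _ -> \bar R}) = ppm w}].
Proof.
move=> poi; have [N [mN N0 NP]] := poisson_ae_counting poi.
pose k : R.-ker Om ~> plane R := cut ppm mN.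
have cutE w : ~ N w -> (k w : {measure set _ -> \bar R}) = ppm w.
 by move=> Nw; rewrite /k /= /cut ifF//; apply/negP => /set_mem.
exists k; split.
- exact: (poisson_measure_modulo mN N0 cutE).
- move=> w; have [Nw|Nw] := pselect (N w).
  rewrite /k /= /cut mem_set//; split => //.
  + by move=> n; rewrite /mzero ltry.
  + by move=> B mB; right; exists 0%N.
 by rewrite cutE//; apply: contrapT => nc; apply: Nw; exact: NP.
- by exists N; split => // w nw; apply: contrapT => Nw; apply: nw; exact: cutE.
Qed.

(** The Poisson laws, the independence of the noises and that of past and future only see events
    modulo null sets, so they survive cutting and completing. Constructions on an arbitrary noise
    are then made with this version. *)
Lemma good_noise (I : finType) (F : R -> set_system Om) (ppm : I -> R.-ker Om ~> plane R) :
 is_filtration F -> is_poisson_noise P F ppm ->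
 exists (F' : R -> set_system Om) (ppm' : I -> R.-ker Om ~> plane R),
  [/\ is_filtration F', is_poisson_noise P F' ppm', null_complete F',
   forall i w, count_measure (ppm' i w) &
   {ae P, forall w, forall i, (ppm' i w : {measure set _ -> \bar R}) = ppm i w}].
Proof.
move=> fF [poi ind ad fut].
have : {ae P, forall w, forall i, count_measure (ppm i w)}.
 by apply: ae_forall_fin => i; exact: poisson_ae_counting.
move=> [N [mN N0 NP]].
pose ppm' i : R.-ker Om ~> plane R := cut (ppm i) mN.
have cutE i w : ~ N w -> (ppm' i w : {measure set _ -> \bar R}) = ppm i w.
 by move=> Nw; rewrite /ppm' /= /cut ifF//; apply/negP => /set_mem.
have evE i D A' : noise_events (ppm' i) D A' ->
  exists2 A, noise_events (ppm i) D A & A `\` N = A' `\` N.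
 move=> [B [C [mB BD mC ->]]]; exists [set w | C (ppm i w B)]; first by exists B, C.
 by apply/seteqP; split => w /= [h Nw]; move: h; rewrite cutE.
have sym A A' : A `\` N = A' `\` N -> (A `\` A') `|` (A' `\` A) `<=` N.
 move=> AA w h; apply: contrapT => Nw; case: h => -[h h']; apply: h'.
  by have [] : (A' `\` N) w by rewrite -AA.
 by have [] : (A `\` N) w by rewrite AA.
exists (completion F), ppm'; split.
- exact: completion_filtration.
- split.
 + by move=> i; exact: (poisson_measure_modulo mN N0 (cutE i) (poi i)).
 + apply: (indep_modulo mN N0) ind => i.
  * by apply: smallest_sub; [exact: sigma_algebra_measurable|exact: noise_events_measurable].
  * by apply: smallest_sub; [exact: sigma_algebra_measurable|exact: noise_events_measurable].
  * apply: sigma_modulo => A' /evE[A hA AE]; exists A => //; exact: sub_sigma_algebra.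
 + move=> i t t0 A' hA'; have [A hA AE] := evE _ _ _ hA'.
  split; first exact: noise_events_measurable hA'.
  exists A; first exact: ad hA.
  apply: (@measure0_le _ N) => //; last exact: sym.
  by apply: meas_symdiff; [exact: noise_events_measurable hA|exact: noise_events_measurable hA'].
 + move=> t t0 A' B' [mA' [A FA AA']] sB'.
  set G' := \bigcup_i noise_events (ppm' i) _ in sB'.
  pose G := \bigcup_i noise_events (ppm i) (`]t, +oo[ `*` `[0%R, +oo[).
  have [B GB BE] : exists2 B, <<s G >> B & B `\` N = B' `\` N.
   apply: sigma_modulo sB' => X [i _ /evE[Y hY YE]]; exists Y => //.
   by apply: sub_sigma_algebra; exists i.
  have mA : measurable A by have [/(_ t t0)[_ +] _] := fF; apply.
  have mG : G `<=` measurable by move=> X [i _]; exact: noise_events_measurable.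
  have mB : measurable B.
   by move: GB; apply: smallest_sub => //; exact: sigma_algebra_measurable.
  have mG' : G' `<=` measurable by move=> X [i _]; exact: noise_events_measurable.
  have mB' : measurable B'.
   by move: sB'; apply: smallest_sub => //; exact: sigma_algebra_measurable.
  have mS := meas_symdiff mA mA'.
  have AA : P A = P A' by apply: (measure_modulo mS) => //; exact: symdiff_modulo.
  rewrite -AA -(measure_modulo mN N0 mB mB' BE) -(fut t t0)//.
  (* Two null sets are discarded: the one on which the noise is cut, and the difference between [A']
     and the event of [F t] that it completes. *)
  apply/esym/(@measure_modulo (N `|` ((A `\` A') `|` (A' `\` A)))).
  * side.
  * apply/eqP; rewrite eq_le measure_ge0 andbT.
   apply: (le_trans (measureU2 P mN mS)).
   have e : (P N + P ((A `\` A') `|` (A' `\` A)) = 0)%E by rewrite N0 AA' adde0.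
   by rewrite -[leRHS]e.
  * side.
  * side.
  * have bb w : ~ N w -> B w <-> B' w.
    by move=> Nw; split => Bw; [have [] : (B' `\` N) w by rewrite -BE|have [] : (B `\` N) w by rewrite BE].
   by apply/seteqP; split => w /= [[Aw /bb Bw] nw]; (split => //; split; [|apply: Bw]);
     move: nw; have [?|?] := pselect (A w); have [?|?] := pselect (A' w); tauto.
- exact: completion_null_complete.
- move=> i w; have [Nw|Nw] := pselect (N w).
  rewrite /ppm' /= /cut mem_set//; split => //.
  + by move=> n; rewrite /mzero ltry.
  + by move=> B mB; right; exists 0%N.
 rewrite cutE//; have : forall i, count_measure (ppm i w); last exact.
 by apply: contrapT => h; apply: Nw; apply: NP.
- by exists N; split => // w h; apply: contrapT => Nw; apply: h => i; exact: cutE.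
Qed.

End good.

Ltac side_more m ::= exact: meas_box.

(** * Moments and deviations of Poisson integrals *)

Lemma indep_systems2 d (Om : measurableType d) (R : realType) (P : probability Om R)
  (I : finType) (G : I -> set_system Om) (i j : I) (A B : set Om) :
 (forall i, G i `<=` measurable) -> independent_systems P G -> i != j -> G i A -> G j B ->
 P (A `&` B) = (P A * P B)%E.
Proof.
move=> mG iG ij GA GB.
have hA k : k \in [set i; j]%SET -> G k (if k == i then A else B).
 by rewrite !inE => /orP[/eqP ->|/eqP ->]; rewrite ?eqxx// eq_sym (negbTE ij).
have := iG [set i; j]%SET _ hA.
rewrite (_ : \bigcap_(_ in _) _ = A `&` B); last first.
 apply/seteqP; split => w /=.
  move=> h; split.
   by have := h i; rewrite /= eqxx; apply; rewrite !inE eqxx.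
  by have := h j; rewrite /= eq_sym (negbTE ij); apply; rewrite !inE eqxx orbT.
 by move=> [Aw Bw] k /=; case: ifP.
rewrite big_setU1 ?inE//= big_set1 eqxx eq_sym (negbTE ij) => e.
have mA := mG _ _ GA; have mB := mG _ _ GB.
have fU X : measurable X -> (P X = (fine (P X))%:E)%E.
 by move=> mX; rewrite fineK//; exact: (fin_num_measure P).
rewrite [LHS]fU; last side.
by rewrite e [in RHS](fU _ mA) [in RHS](fU _ mB) EFinM.
Qed.

Lemma nneseries_shift (R : realType) (f : nat -> \bar R) : (forall k, (0 <= f k)%E) ->
 (\sum_(1 <= k <oo) f k = \sum_(k <oo) f k.+1)%E.
Proof.
move=> f0.
have : (\sum_(1 <= k < n) f k)%E @[n --> \oo] --> (\sum_(1 <= k <oo) f k)%E.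
 apply: is_cvg_nneseries => k _ _; side.
rewrite -cvg_shiftS.
rewrite (_ : (fun n => _) = (fun n => \sum_(0 <= k < n) f k.+1)%E); last first.
 by apply/funext => n; rewrite big_add1.
by move=> h; apply/esym/cvg_lim.
Qed.

(** The identity E[N g(N)] = r E[g(N + 1)] for a Poisson variable N, from which the first two
    moments follow. *)
Lemma poisson_wt_shift (R : realType) (r : R) (g : nat -> R) : 0 <= r ->
 (forall k, 0 <= g k) ->
 (\sum_(k <oo) (k%:R * g k)%:E * (poisson_wt r k)%:E =
  r%:E * \sum_(k <oo) (g k.+1)%:E * (poisson_wt r k)%:E)%E.
Proof.
move=> r0 g0.
have w0 k := poisson_wt_ge0 k r0.
have nn k : (0 <= (k%:R * g k)%:E * (poisson_wt r k)%:E)%E by side.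
rewrite (nneseries_recl (fun k _ => nn k))// mul0r mul0e add0e -nneseriesZl; last first.
 side.
rewrite nneseries_shift//.
apply: eq_eseriesr => k _; rewrite -!EFinM; congr EFin.
rewrite /poisson_wt exprS factS natrM invfM.
have s0 : (k.+1%:R : R) != 0 by side.
have f0 : (k`!%:R : R) != 0 by side.
move: (k.+1%:R : R) (k`!%:R : R) s0 f0 => x y x0 y0.
by field; apply/andP.
Qed.

Section poisson.
Context d d' (Om : measurableType d) (T : measurableType d') (R : realType).
Variables (P : probability Om R) (ppm : R.-ker Om ~> T) (nu : {measure set T -> \bar R}).
Hypothesis poi : is_poisson_measure P ppm nu.

Definition count (B : set T) (w : Om) : R := fine (ppm w B).

Lemma count_ge0 B w : 0 <= count B w. Proof. exact: fine_ge0. Qed.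

Lemma meas_count B : measurable B -> measfun (count B).
Proof.
move=> mB; apply: mcomp => //.
exact: measurable_kernel.
Qed.

Lemma int_count (h : R -> R) B : measfun h -> (forall x, 0 <= h x) ->
 measurable B -> (nu B < +oo)%E ->
 (\int[P]_w (h (count B w))%:E =
  \sum_(k <oo) (h k%:R)%:E * (poisson_wt (fine (nu B)) k)%:E)%E.
Proof.
move=> mh h0 mB Boo; pose N w := Num.truncn (count B w).
have mN : measfun N.
 apply: meas_fun_natP => n.
 rewrite (_ : _ @^-1` _ = count B @^-1` `[n%:R, n.+1%:R[%classic).
  rewrite -[X in measurable X]setTI; apply: meas_count => //; side.
 apply/seteqP; split => w /=; rewrite in_itv/=; first by move=> <-; exact/truncn_itv/count_ge0.
 exact: truncn_def.
have ae := poisson_ae_count poi mB Boo.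
transitivity (\int[P]_w (h (N w)%:R)%:E)%E.
 apply: ae_eq_integral => //.
 - by apply/measurable_EFinP; apply: mcomp => //; exact: meas_count.
 - by apply: (@meas_fun_nat_param _ _ _ _ N (fun k _ => (h k%:R)%:E)) => //.
 - by apply: filterS ae => w [k kE] _; rewrite /N /count kE /= natrK.
rewrite (@ge0_int_nat _ _ _ _ N (fun k => (h k%:R)%:E))//; last side.
apply: eq_eseriesr => k _; congr (_ * _)%E; rewrite -(poisson_prob_eq poi _ mB Boo).
have mk : measurable (N @^-1` [set k]) by rewrite -[X in measurable X]setTI; exact: mN.
have [Z [mZ Z0 NZ]] := ae.
apply: (@measure_modulo _ _ _ P Z) => //; first exact: meas_count_eq.
have c w : ~ Z w -> is_count (ppm w B) by move=> Zw; apply: contrapT => /NZ.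
apply/seteqP; split => w /= [+ Zw]; have [m mE] := c w Zw; rewrite /N /count mE /= ?natrK.
 by move=> ->.
by move=> /(congr1 fine)/= /eqP; rewrite eqr_nat => /eqP ->.
Qed.

Lemma poisson_mean B : measurable B -> (nu B < +oo)%E ->
 (\int[P]_w (count B w)%:E = nu B)%E.
Proof.
move=> mB Boo; rewrite (eq_integral (fun w => `|count B w|%:E)%R); last first.
 by move=> w _; rewrite ger0_norm// count_ge0.
rewrite (@int_count Num.norm)//.
under eq_eseriesr do rewrite normr_nat -[X in (X%:E * _)%E]mulr1.
rewrite (@poisson_wt_shift _ _ (fun=> 1%R)) ?fine_ge0//.
under eq_eseriesr do rewrite mul1e.
by rewrite poisson_wt_sum1 ?fine_ge0// mule1 fineK// ge0_fin_numE.
Qed.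

Lemma poisson_second_moment B : measurable B -> (nu B < +oo)%E ->
 (\int[P]_w (count B w ^+ 2)%:E = (fine (nu B) ^+ 2 + fine (nu B))%:E)%E.
Proof.
move=> mB Boo; rewrite (@int_count (fun x => x ^+ 2))//; last side.
under eq_eseriesr do rewrite expr2.
rewrite (@poisson_wt_shift _ _ (fun k => k%:R)) ?fine_ge0//.
under eq_eseriesr do rewrite -natr1 EFinD muleDl// mul1e.
rewrite nneseriesD; [|side|
 by move=> k _; rewrite lee_fin poisson_wt_ge0// fine_ge0].
under [X in (_ * (X + _))%E]eq_eseriesr do rewrite -[X in (X%:E * _)%E]mulr1.
rewrite (@poisson_wt_shift _ _ (fun=> 1%R)) ?fine_ge0//.
under [X in (_ * (_ * X + _))%E]eq_eseriesr do rewrite mul1e.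
rewrite poisson_wt_sum1 ?fine_ge0// mule1 -EFinD -EFinM; congr EFin; ring.
Qed.

End poisson.

Section orthogonal.
Context d (Om : measurableType d) (R : realType) (P : probability Om R) (L : finType).
Variables (X : L -> Om -> R) (r v a : L -> R).
Hypotheses (mX : forall l, measfun (X l)) (X0 : forall l w, 0 <= X l w)
 (EX : forall l, (\int[P]_w (X l w)%:E = (r l)%:E)%E)
 (EXX : forall l m, (\int[P]_w (X l w * X m w)%:E = (r l * r m + (l == m)%:R * v l)%:E)%E).

Let iX l : P.-integrable setT (EFin \o X l).
Proof.
apply/integrableP; split; first side.
rewrite (eq_integral (fun w => (X l w)%:E)); last first.
 by move=> w _ /=; rewrite ger0_norm.
by rewrite EX ltry.
Qed.

Let iXX l m : P.-integrable setT (EFin \o (fun w => X l w * X m w)).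
Proof.
apply/integrableP; split; first side.
rewrite (eq_integral (fun w => (X l w * X m w)%:E)); last first.
 by move=> w _ /=; rewrite ger0_norm// mulr_ge0.
by rewrite EXX ltry.
Qed.

Let c (lm : L * L) w := a lm.1 * a lm.2 *
 (X lm.1 w * X lm.2 w - r lm.2 * X lm.1 w - r lm.1 * X lm.2 w + r lm.1 * r lm.2).

Let c_int lm : P.-integrable setT (EFin \o c lm) /\
 (\int[P]_w (c lm w)%:E = (a lm.1 * a lm.2 * ((lm.1 == lm.2)%:R * v lm.1))%:E)%E.
Proof.
case: lm => l m; rewrite /c /=.
have i1 : P.-integrable setT (fun w => (r m)%:E * (X l w)%:E)%E.
 by apply: integrableZl => //; exact: iX.
have i2 : P.-integrable setT (fun w => (r l)%:E * (X m w)%:E)%E.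
 by apply: integrableZl => //; exact: iX.
have i3 : P.-integrable setT (fun w => (X l w * X m w)%:E - (r m)%:E * (X l w)%:E)%E.
 by apply: integrableB => //; exact: iXX.
have i4 : P.-integrable setT (fun w => (X l w * X m w)%:E - (r m)%:E * (X l w)%:E - (r l)%:E * (X m w)%:E)%E.
 by apply: integrableB.
have i5 : P.-integrable setT (fun _ : Om => (r l * r m)%:E) by exact: finite_measure_integrable_cst.
have i6 : P.-integrable setT (fun w => (X l w * X m w)%:E - (r m)%:E * (X l w)%:E - (r l)%:E * (X m w)%:E + (r l * r m)%:E)%E.
 by apply: integrableD.
split; first by have := @integrableZl _ _ _ P setT measurableT (a l * a m) _ i6.
under eq_integral do rewrite EFinM EFinD !EFinB.
have i6' : P.-integrable setT (fun w => (X l w * X m w)%:E - (r m * X l w)%:E - (r l * X m w)%:E + (r l * r m)%:E)%E by [].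
rewrite integralZl// [X in (_ * X)%E](_ : _ = ((l == m)%:R * v l)%:E)%E//.
rewrite (@integralD _ _ _ P _ measurableT _ _ i4 i5).
rewrite (@integralB _ _ _ P _ measurableT _ _ i3 i2).
rewrite (@integralB _ _ _ P _ measurableT _ _ (iXX l m) i1) /=.
rewrite !integralZl//; last 2 first.
 exact: iX.
 exact: iX.
rewrite EXX !EX int_prob_cst -!EFinM -!EFinB -EFinD; congr EFin; ring.
Qed.

Lemma orthogonal_sum :
 (\int[P]_w ((\sum_l a l * (X l w - r l)) ^+ 2)%:E = (\sum_l a l ^+ 2 * v l)%:E)%E.
Proof.
transitivity (\int[P]_w \sum_(lm : L * L) (c lm w)%:E)%E.
 apply: eq_integral => w _; rewrite sumEFin; congr EFin.
 rewrite expr2 mulr_suml.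
 under eq_bigr do rewrite mulr_sumr.
 rewrite pair_big; apply: eq_bigr => -[l m] _ /=; rewrite /c /=; ring.
rewrite integral_sum//; last by move=> lm; have [] := c_int lm.
rewrite (eq_bigr _ (fun lm _ => (c_int lm).2)) sumEFin; congr EFin.
rewrite -(pair_big xpredT xpredT (fun l m => a l * a m * ((l == m)%:R * v l)))/=.
apply: eq_bigr => l _; rewrite (bigD1 l)//= big1 ?addr0; last first.
 by move=> m ml; rewrite eq_sym (negbTE ml) mul0r mulr0.
by rewrite !eqxx mul1r expr2.
Qed.

(** From |x| <= (e x^2 + 1/e) / 2, a linear substitute for the Cauchy-Schwarz inequality. The free
    parameter [e] is later the inverse of the expected size of the sum. *)
Lemma orthogonal_sum_abs (e : R) : 0 < e ->
 (\int[P]_w (`|\sum_l a l * (X l w - r l)|)%:E <=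
  ((e * (\sum_l a l ^+ 2 * v l) + e^-1) / 2)%:E)%E.
Proof.
move=> e0; set S := fun w => \sum_l a l * (X l w - r l).
have mS : measfun S.
 apply: measurable_sum => l; apply: measurable_funM => //.
 exact: measurable_funB.
apply: (@le_trans _ _ (\int[P]_w (e / 2 * S w ^+ 2 + e^-1 / 2)%:E)%E).
 apply: ge0_le_integral => //.
 - by apply/measurable_EFinP; exact: mcomp.
 - apply/measurable_EFinP; apply: measurable_funD => //; apply: measurable_funM => //.
  exact: measurable_funX.
 - move=> w _; rewrite lee_fin -real_normK ?num_real//; set x := `|S w|.
  have -> : e / 2 * x ^+ 2 + e^-1 / 2 = x + e / 2 * (x - e^-1) ^+ 2.
   by field; exact: lt0r_neq0.
  by rewrite lerDl mulr_ge0 ?sqr_ge0// divr_ge0// ltW.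
under eq_integral do rewrite EFinD EFinM.
rewrite ge0_integralD//; last 3 first.
- side.
- by apply: measurable_funeM; apply/measurable_EFinP; exact: measurable_funX.
- side.
rewrite ge0_integralZl//; last 3 first.
- by apply/measurable_EFinP; exact: measurable_funX.
- side.
- side.
by rewrite orthogonal_sum int_prob_cst -EFinM -EFinD lee_fin; lra.
Qed.

End orthogonal.

Section simple.
Context d (T : measurableType d) (R : realType).
Import HBNNSimple.

Definition level_seq (u : {nnsfun T >-> R}) : seq R :=
 finmap.enum_fset (fset_set (range u `\ 0)).

Definition levels (u : {nnsfun T >-> R}) : finType := seq_sub (level_seq u).

Lemma mem_level_seq u x : (x \in level_seq u) = (x \in range u `\ 0).
Proof. by apply: in_fset_set; exact: finite_setD. Qed.

Lemma levels_neq0 (u : {nnsfun T >-> R}) (i : levels u) : 0 < val i.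
Proof.
have := valP i; rewrite mem_level_seq inE /= => -[[x _ <-] /eqP ne0].
by rewrite lt_neqAle eq_sym ne0 fun_ge0.
Qed.

(** Used with the absolute value and the square for [g]. The condition [g 0 = 0] allows the level 0
    to be left out, whose preimage may have infinite measure. *)
Lemma int_simple (u : {nnsfun T >-> R}) (g : R -> R) (m : {measure set T -> \bar R}) :
 g 0 = 0 -> (forall x, 0 <= g x) ->
 (\int[m]_y (g (u y))%:E = \sum_(i : levels u) (g (val i))%:E * m (u @^-1` [set val i]))%E.
Proof.
move=> g0 gge0.
have mB (i : levels u) : measurable (u @^-1` [set val i]) by side.
transitivity (\int[m]_y \sum_(i : levels u) (g (val i))%:E * (\1_(u @^-1` [set val i]) y)%:E)%E.
 apply: eq_integral => y _.
 have [uy0|uy0] := eqVneq (u y) 0.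
  rewrite uy0 g0 big1// => i _; rewrite indicE memNset ?mule0//=.
  by rewrite uy0 => i0; have := levels_neq0 i; rewrite /= -i0 ltxx.
 have uyl : u y \in level_seq u.
  by rewrite mem_level_seq inE; split => //; exact/eqP.
 rewrite (bigD1 (SeqSub uyl : levels u))//= big1 ?adde0.
  by rewrite indicE mem_set// mule1.
 move=> i iy; rewrite indicE memNset ?mule0//= => uyi.
 by move/eqP : iy; apply; apply: val_inj.
rewrite ge0_integral_sum//.
- apply: eq_bigr => i _; rewrite ge0_integralZl//; last side.
  by rewrite integral_indic// setIT.
 side.
- move=> i; apply: emeasurable_funM => //; apply/measurable_EFinP.
 side.
- side.
Qed.

Lemma cvg_int_approx (f : T -> \bar R) (mf : measfun f)
  (m : {measure set T -> \bar R}) : (forall y, (0 <= f y)%E) ->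
 (\int[m]_y (nnsfun_approx measurableT mf n y)%:E)%E @[n --> \oo] --> (\int[m]_y f y)%E.
Proof.
move=> f0; pose u := nnsfun_approx measurableT mf.
rewrite (_ : (\int[m]_y f y = \int[m]_y limn (fun n => (u n y)%:E))%E); last first.
 apply: eq_integral => y _; apply/esym/cvg_lim => //.
 apply: cvg_nnsfun_approx => // ? _; side.
apply: cvg_monotone_convergence => //.
- side.
- side.
- by move=> y _ a b ab; rewrite lee_fin; exact/lefP/nd_nnsfun_approx.
Qed.

Lemma le_int_approx (f : T -> \bar R) (mf : measfun f)
  (m : {measure set T -> \bar R}) n : (forall y, (0 <= f y)%E) ->
 (\int[m]_y (nnsfun_approx measurableT mf n y)%:E <= \int[m]_y f y)%E.
Proof.
move=> f0; apply: ge0_le_integral => //.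
- side.
- side.
- move=> y _; rewrite nnsfun_approxE; apply: le_approx => // ? _; side.
Qed.

End simple.

Section kernel.
Import HBNNSimple.

Lemma kernel_mean_int d1 d2 (X : measurableType d1) (Y : measurableType d2) (R : realType)
  (m : {measure set X -> \bar R}) (k : R.-ker X ~> Y) (nu : {measure set Y -> \bar R})
  (f : Y -> \bar R) : (forall B, measurable B -> \int[m]_x k x B = nu B)%E ->
 measfun f -> (forall y, (0 <= f y)%E) ->
 (\int[m]_x \int[k x]_y f y = \int[nu]_y f y)%E.
Proof.
move=> mk mf f0.
pose u := nnsfun_approx measurableT mf.
have mku n : measfun (fun x => \int[k x]_y (u n y)%:E)%E.
 apply: measurable_fun_integral_kernel.
 - by move=> U mU; exact: measurable_kernel.
 - side.
 - side.
have e n : (\int[m]_x \int[k x]_y (u n y)%:E = \int[nu]_y (u n y)%:E)%E.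
 have pi (M : {measure set Y -> \bar R}) : (\int[M]_y (u n y)%:E =
   \sum_(i : levels (u n)) (val i)%:E * M (u n @^-1` [set val i]))%E.
  have := @int_simple _ _ _ (u n) (fun x => `|x|) M (normr0 _) (@normr_ge0 _ _).
  under eq_integral do rewrite ger0_norm//.
  move=> ->; apply: eq_bigr => i _; rewrite gtr0_norm//; exact: levels_neq0.
 under eq_integral do rewrite pi.
 rewrite pi ge0_integral_sum//.
 - apply: eq_bigr => i _; rewrite ge0_integralZl//.
  + by rewrite mk.
  + exact: measurable_kernel.
  + by rewrite lee_fin ltW// levels_neq0.
 - by move=> i; apply: measurable_funeM; exact: measurable_kernel.
 - by move=> i x _; apply: mule_ge0 => //; rewrite lee_fin ltW// levels_neq0.
have h1 : (\int[m]_x \int[k x]_y (u n y)%:E)%E @[n --> \oo] --> (\int[m]_x \int[k x]_y f y)%E.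
 rewrite (_ : (\int[m]_x \int[k x]_y f y = \int[m]_x limn (fun n => \int[k x]_y (u n y)%:E))%E); last first.
  by apply: eq_integral => x _; apply/esym/cvg_lim => //; exact: cvg_int_approx.
 apply: cvg_monotone_convergence => //.
 - side.
 - move=> x _ a b ab; apply: ge0_le_integral => //.
  + side.
  + side.
  + side.
  + by move=> y _; rewrite lee_fin; exact/lefP/nd_nnsfun_approx.
rewrite -(cvg_lim _ h1)//; apply/cvg_lim => //.
by rewrite (_ : (fun n => _) = (fun n => \int[nu]_y (u n y)%:E)%E);
 [exact: cvg_int_approx|apply/funext => n; exact: e].
Qed.

End kernel.

Lemma cvg_fin_sum (R : realType) (I : Type) (r : seq I) (u : I -> nat -> R) (l : I -> R) :
 (forall i, u i n @[n --> \oo] --> l i) ->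
 (\sum_(i <- r) u i n) @[n --> \oo] --> \sum_(i <- r) l i.
Proof.
move=> ul; elim: r => [|i r IHr].
 by under eq_fun do rewrite big_nil; rewrite big_nil; exact: cvg_cst.
by under eq_fun do rewrite big_cons; rewrite big_cons; apply: cvgD.
Qed.

Section poisson.
Context d d' (Om : measurableType d) (T : measurableType d') (R : realType) (K : finType).
Variables (P : probability Om R) (ppm : K -> R.-ker Om ~> T) (nu : {measure set T -> \bar R}).
Hypotheses (poi : forall j, is_poisson_measure P (ppm j) nu)
 (ind : independent_systems P (fun j => <<s noise_events (ppm j) setT >>)).
Import HBNNSimple.

Lemma noise_sigma_measurable (k : R.-ker Om ~> T) D : <<s noise_events k D >> `<=` measurable.
Proof. by apply: smallest_sub; [exact: sigma_algebra_measurable|exact: noise_events_measurable]. Qed.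

Lemma int_countM (j j' : K) (B B' : set T) : measurable B -> measurable B' ->
 (nu B < +oo)%E -> (nu B' < +oo)%E -> j != j' \/ B `&` B' = set0 ->
 (\int[P]_w (count (ppm j) B w * count (ppm j') B' w)%:E = nu B * nu B')%E.
Proof.
move=> mB mB' Boo Boo' jB.
under eq_integral do rewrite EFinM.
rewrite indep_ge0_intM.
- by rewrite (poisson_mean (poi j))// (poisson_mean (poi j')).
- by apply/measurable_EFinP; exact: meas_count.
- by apply/measurable_EFinP; exact: meas_count.
- by move=> w; rewrite lee_fin count_ge0.
- by move=> w; rewrite lee_fin count_ge0.
move=> C C' mC mC'.
have mf : measfun (fun x : \bar R => (fine x)%:E) by side.
pose D := (fun x : \bar R => (fine x)%:E) @^-1` C.
pose D' := (fun x : \bar R => (fine x)%:E) @^-1` C'.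
have mD : measurable D by rewrite -[X in measurable X]setTI; exact: mf.
have mD' : measurable D' by rewrite -[X in measurable X]setTI; exact: mf.
rewrite -[(fun w => _) @^-1` C]/[set w | D (ppm j w B)].
rewrite -[(fun w => _) @^-1` C']/[set w | D' (ppm j' w B')].
case: jB => [jj|BB].
 apply: (indep_systems2 _ ind jj); first by move=> i; exact: noise_sigma_measurable.
  by apply: sub_sigma_algebra; exists B, D.
 by apply: sub_sigma_algebra; exists B', D'.
have [jj|jj] := eqVneq j j'; last first.
 apply: (indep_systems2 _ ind jj); first by move=> i; exact: noise_sigma_measurable.
  by apply: sub_sigma_algebra; exists B, D.
 by apply: sub_sigma_algebra; exists B', D'.
subst j'.
have := (poi j).2 2 (fun i => if i == ord0 then B else B').
have mBB (i : 'I_2) : measurable (if i == ord0 then B else B') by case: ifP.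
have tBB : trivIset setT (fun i : 'I_2 => if i == ord0 then B else B').
 move=> a b _ _ [x []]; case: ifPn => a0; case: ifPn => b0 => Bx Bx'.
 - by rewrite (eqP a0) (eqP b0).
 - by have : (B `&` B') x by []; rewrite BB.
 - by have : (B `&` B') x by []; rewrite BB.
 - move: a b a0 b0 {Bx Bx'}; case=> -[|[|//]] ai; case=> -[|[|//]] bi // _ _; exact: val_inj.
move=> /(_ mBB tBB) i2.
apply: (indep_systems2 (i := ord0) (j := lift ord0 ord0) _ i2) => //.
- by move=> i; exact: count_sigma_measurable.
- exists D => //; side.
- exists D' => //; side.
Qed.

(** The counts indexed by a noise and a level are pairwise uncorrelated, each with variance equal to
    its mean, so the variance of the sum is [#|K|] times the integral of u^2. *)
Lemma poisson_deviation_simple (u : {nnsfun T >-> R}) (e : R) : 0 < e ->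
 (forall i : levels u, nu (u @^-1` [set val i]) < +oo)%E ->
 (\int[P]_w (`|\sum_j (fine (\int[ppm j w]_y (u y)%:E) - fine (\int[nu]_y (u y)%:E))|)%:E <=
  ((e * (#|K|%:R * fine (\int[nu]_y (u y ^+ 2)%:E)) + e^-1) / 2)%R%:E)%E.
Proof.
move=> e0 Boo; pose B (i : levels u) := u @^-1` [set val i].
have mB i : measurable (B i) by exact: measurable_funPTI.
pose X (l : K * levels u) := count (ppm l.1) (B l.2).
have mX l : measfun (X l) by exact: meas_count.
have tB i i' : i != i' -> B i `&` B i' = set0.
 move=> ii; apply/seteqP; split => y //= [h1 h2].
 by move/eqP : ii; apply; apply: val_inj; rewrite /= -h1.
have fnu i : (fine (nu (B i)))%:E = nu (B i) by rewrite fineK// ge0_fin_numE//; exact: Boo.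
have EX l : (\int[P]_w (X l w)%:E = (fine (nu (B l.2)))%:E)%E.
 by rewrite fnu; apply: (poisson_mean (poi l.1)) => //; exact: Boo.
have EXX l m : (\int[P]_w (X l w * X m w)%:E =
  (fine (nu (B l.2)) * fine (nu (B m.2)) + (l == m)%:R * fine (nu (B l.2)))%:E)%E.
 have [->|lm] := eqVneq l m.
  under eq_integral do rewrite -expr2.
  by rewrite (poisson_second_moment (poi m.1) (mB _) (Boo _)) mul1r -expr2.
 rewrite (int_countM (mB _) (mB _) (Boo _) (Boo _)); last first.
  have [l1|ne] := eqVneq l.1 m.1; [right|by left].
  apply: tB; apply: contra_neq lm => h.
  by rewrite (surjective_pairing l) (surjective_pairing m) l1 h.
 by rewrite mul0r addr0 EFinM !fnu.
have int1 (m : {measure set T -> \bar R}) :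
  (\int[m]_y (u y)%:E = \sum_(i : levels u) (val i)%:E * m (B i))%E.
 have := @int_simple _ _ _ u (fun x => `|x|) m (normr0 _) (@normr_ge0 _ _).
 under eq_integral do rewrite ger0_norm//.
 by move=> ->; apply: eq_bigr => i _; rewrite gtr0_norm//; exact: levels_neq0.
have int2 : (\int[nu]_y (u y ^+ 2)%:E = (\sum_(i : levels u) val i ^+ 2 * fine (nu (B i)))%:E)%E.
 rewrite (@int_simple _ _ _ u (fun x => x ^+ 2)) ?expr0n//; last side.
 by rewrite -sumEFin; apply: eq_bigr => i _; rewrite [RHS]EFinM fnu.
pose S w := \sum_l val l.2 * (X l w - fine (nu (B l.2))).
have := orthogonal_sum_abs (fun l => val l.2) mX (fun l w => count_ge0 _ _ _) EX EXX e0.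
rewrite (_ : \sum_l _ = #|K|%:R * fine (\int[nu]_y (u y ^+ 2)%:E)); last first.
 rewrite int2 /= -(pair_bigA _ (fun (j : K) (i : levels u) => val i ^+ 2 * fine (nu (B i))))/=.
 rewrite sumr_const mulr_natl; side.
apply: le_trans.
rewrite le_eqVlt; apply/orP; left; apply/eqP.
have aec : {ae P, forall w, forall l : K * levels u, is_count (ppm l.1 w (B l.2))}.
 apply: ae_forall_fin => l; exact: (poisson_ae_count (poi l.1) (mB _) (Boo _)).
apply: ae_eq_integral => //.
- apply/measurable_EFinP; apply: mcomp => //; apply: measurable_sum => j.
 apply: measurable_funB => //; apply: mcomp => //.
 apply: measurable_fun_integral_kernel.
 + by move=> U mU; exact: measurable_kernel.
 + side.
 + side.
- apply/measurable_EFinP; apply: mcomp => //; apply: measurable_sum => l.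
 by apply: measurable_funM => //; exact: measurable_funB.
- apply: filterS aec => w cw _ /=; congr (`| _ |%:E).
 rewrite -(pair_bigA _ (fun (j : K) (i : levels u) => val i * (X (j, i) w - fine (nu (B i)))))/=.
 apply: eq_bigr => j _; rewrite !int1.
 under eq_bigr do rewrite mulrBr.
 rewrite sumrB; congr (_ - _).
  rewrite (eq_bigr (fun i => (val i * X (j, i) w)%:E)) ?sumEFin//.
  by move=> i _; rewrite EFinM /X /count; have [k kE] := cw (j, i); rewrite /= in kE; rewrite kE.
 by rewrite (eq_bigr (fun i => (val i * fine (nu (B i)))%:E)) ?sumEFin// => i _; rewrite EFinM fnu.
Qed.

Lemma poisson_campbell (f : T -> \bar R) j : (forall B, measurable B ->
  \int[P]_w ppm j w B = nu B)%E -> measfun f -> (forall y, (0 <= f y)%E) ->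
 (\int[P]_w \int[ppm j w]_y f y = \int[nu]_y f y)%E.
Proof. exact: kernel_mean_int. Qed.

(** Simple functions increase to [f], and the bound for them is at most the one for [f]. The
    integrals against the noise are almost surely finite by [poisson_campbell], hence converge, and
    Fatou's lemma concludes. *)
Lemma poisson_deviation (f : T -> R) (e : R) : 0 < e -> measfun f ->
 (forall y, 0 <= f y) -> (forall j B, measurable B -> \int[P]_w ppm j w B = nu B)%E ->
 (\int[nu]_y (f y)%:E < +oo)%E -> (\int[nu]_y (f y ^+ 2)%:E < +oo)%E ->
 (\int[P]_w (`|\sum_j (fine (\int[ppm j w]_y (f y)%:E) - fine (\int[nu]_y (f y)%:E))|)%:E <=
  ((e * (#|K|%:R * fine (\int[nu]_y (f y ^+ 2)%:E)) + e^-1) / 2)%R%:E)%E.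
Proof.
move=> e0 mf f0 mean If If2.
have mfE : measfun (EFin \o f) by side.
have fE0 y : (0 <= (EFin \o f) y)%E by side.
pose u := nnsfun_approx measurableT mfE.
have uf n y : u n y <= f y.
 rewrite -lee_fin /u nnsfun_approxE; apply: (@le_approx _ _ _ _ (EFin \o f)) => // ? _; side.
have Iu n : (\int[nu]_y (u n y)%:E < +oo)%E.
 by apply: le_lt_trans If; exact: le_int_approx.
have Bu n (i : levels (u n)) : (nu (u n @^-1` [set val i]) < +oo)%E.
 rewrite ltNge leye_eq; apply/eqP => Boo.
 have := Iu n; rewrite ltNge => /negP; apply.
 have mB : measurable (u n @^-1` [set val i]) by side.
 apply: (@le_trans _ _ (\int[nu]_y ((val i)%:E * (\1_(u n @^-1` [set val i]) y)%:E))%E).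
  rewrite ge0_integralZl//; last 2 first.
  - side.
  - by rewrite lee_fin ltW// levels_neq0.
  by rewrite integral_indic// setIT Boo gt0_muley// lte_fin levels_neq0.
 apply: ge0_le_integral => //.
 - by move=> y _; rewrite -EFinM lee_fin mulr_ge0// ltW// levels_neq0.
 - apply: measurable_funeM; side.
 - side.
 - move=> y _; rewrite -EFinM lee_fin indicE; case: (boolP (y \in _)) => [|_].
   by rewrite inE /= => ->; rewrite mulr1.
  by rewrite mulr0.
pose g_ n w := (`|\sum_j (fine (\int[ppm j w]_y (u n y)%:E) - fine (\int[nu]_y (u n y)%:E))|)%:E.
pose g w := (`|\sum_j (fine (\int[ppm j w]_y (f y)%:E) - fine (\int[nu]_y (f y)%:E))|)%:E.
set c := (X in (_ <= X)%E).
have mint j (F : T -> \bar R) : measfun F -> (forall y, (0 <= F y)%E) ->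
  measfun (fun w => \int[ppm j w]_y F y)%E.
 by move=> mF F0; apply: measurable_fun_integral_kernel => // U mU; exact: measurable_kernel.
have mg_ n : measfun (g_ n).
 apply/measurable_EFinP; apply: mcomp => //; apply: measurable_sum => j.
 apply: measurable_funB => //; apply: mcomp => //; apply: mint.
  side.
 side.
have mg : measfun g.
 apply/measurable_EFinP; apply: mcomp => //; apply: measurable_sum => j.
 by apply: measurable_funB => //; apply: mcomp => //; exact: mint.
have gc n : (\int[P]_w g_ n w <= c)%E.
 apply: (le_trans (poisson_deviation_simple e0 (Bu n))).
 rewrite /c lee_fin ler_pM2r// lerD2r ler_pM2l// ler_wpM2l//.
 have le2 : (\int[nu]_y (u n y ^+ 2)%:E <= \int[nu]_y (f y ^+ 2)%:E)%E.
  apply: ge0_le_integral => //.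
  - side.
  - by apply/measurable_EFinP; exact: measurable_funX.
  - by apply/measurable_EFinP; exact: measurable_funX.
  - by move=> y _; rewrite lee_fin ler_pXn2r// nnegrE.
 have ge2 n' : (0 <= \int[nu]_y (n' y ^+ 2)%:E)%E by side.
 by apply: fine_le => //; rewrite ge0_fin_numE// (le_lt_trans le2).
have Iff j w : (0 <= \int[ppm j w]_y (f y)%:E)%E by side.
have aefin : {ae P, forall w, forall j, (\int[ppm j w]_y (f y)%:E < +oo)%E}.
 apply: ae_forall_fin => j.
 have h := poisson_campbell (mean j) mfE fE0.
 have : P.-integrable setT (fun w => \int[ppm j w]_y (f y)%:E)%E.
  apply/integrableP; split; first exact: mint.
  rewrite (eq_integral (fun w => \int[ppm j w]_y (f y)%:E)%E) ?h//.
  move=> w _; rewrite gee0_abs//; side.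
 move=> /(integrable_ae measurableT); apply: filterS => w /(_ I).
 rewrite ge0_fin_numE//; side.
have -> : (\int[P]_w g w = \int[P]_w limn_einf (g_^~ w))%E.
 apply: ae_eq_integral => //.
  rewrite /limn_einf; apply: mcomp => //.
  by apply: measurable_fun_limn_esup => n; apply: mcomp.
 apply: filterS aefin => w fw _.
 suff /cvg_limn_einf_sup[-> _] : g_^~ w @ \oo --> g w by [].
 rewrite /g_ /g; apply: cvg_EFin; first by apply: nearW.
 apply: cvg_norm; apply: cvg_fin_sum => j; apply: cvgB; apply: fine_cvg; rewrite fineK.
 - exact: cvg_int_approx.
 - rewrite ge0_fin_numE//; side.
 - exact: cvg_int_approx.
 - rewrite ge0_fin_numE//; side.
apply: (@le_trans _ _ (limn_einf (fun n => \int[P]_w g_ n w)%E)); first by apply: fatou => // n w _; rewrite /g_ lee_fin.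
rewrite limn_einf_lim; apply: lime_le; first exact: is_cvg_einfs.
apply: nearW => n; apply: le_trans (gc n); apply: ereal_inf_lbound.
by exists n => /=.
Qed.

End poisson.

Section mean.
Context d1 d2 (X : measurableType d1) (Y : measurableType d2) (R : realType).
Variables (m : {measure set X -> \bar R}) (k : R.-ker X ~> Y).
Local Open Scope ereal_scope.

Definition mean_measure (B : set Y) : \bar R := \int[m]_x k x B.

Let mean_measure0 : mean_measure set0 = 0.
Proof. rewrite /mean_measure integral0_eq// => x _; side. Qed.

Let mean_measure_ge0 B : 0 <= mean_measure B.
Proof. side. Qed.

Let mean_measure_sigma_additive : semi_sigma_additive mean_measure.
Proof.
move=> A mA tA mUA.
rewrite [X in _ --> X](_ : _ = \sum_(n <oo) mean_measure (A n)).
 apply: is_cvg_nneseries => n _ _; side.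
rewrite /mean_measure -integral_nneseries//; last by move=> n; exact: measurable_kernel.
by apply: eq_integral => x _; rewrite measure_semi_bigcup.
Qed.

HB.instance Definition _ := isMeasure.Build _ _ _ mean_measure
 mean_measure0 mean_measure_ge0 mean_measure_sigma_additive.

Lemma mean_measure_int (f : Y -> \bar R) : measfun f ->
 (forall y, 0 <= f y) -> \int[m]_x \int[k x]_y f y = \int[mean_measure]_y f y.
Proof. by move=> mf f0; exact: kernel_mean_int. Qed.

End mean.

Section quad.
Context d (Om : measurableType d) (R : realType) (P : probability Om R).
Variable ppm : R.-ker Om ~> plane R.
Hypothesis poi : is_poisson_measure P ppm (quadrant_lebesgue R).

Lemma quad_mean B : measurable B -> (\int[P]_w ppm w B = nu B)%E.
Proof.
move=> mB.
have mI n : measurable (B `&` box n) by side.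
have Ioo n : (nu (B `&` box n) < +oo)%E.
 apply: le_lt_trans (quad_leb_box R n); apply: le_measure; rewrite ?inE//.
 side.
have BE (m : {measure set (plane R) -> \bar R}) : m (B `&` box n) @[n --> \oo] --> m B.
 rewrite (_ : m B = m (\bigcup_n (B `&` box n))); last first.
  by rewrite -setI_bigcupr box_cover setIT.
 apply: nondecreasing_cvg_mu => //; first side.
 by move=> i j ij; apply/subsetPset; apply: setIS; apply/subsetPset; exact: box_nd.
have h1 : (\int[P]_w ppm w (B `&` box n))%E @[n --> \oo] --> (\int[P]_w ppm w B)%E.
 rewrite (_ : (\int[P]_w ppm w B = \int[P]_w limn (fun n => ppm w (B `&` box n)))%E); last first.
  apply: eq_integral => w _; apply/esym/cvg_lim => //; side.
 apply: cvg_monotone_convergence => //.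
 - by move=> n; exact: measurable_kernel.
 - move=> w _ i j ij; apply: le_measure; rewrite ?inE//.
  by apply: setIS; apply/subsetPset; exact: box_nd.
rewrite -(cvg_lim _ h1)//; apply/cvg_lim => //.
rewrite (_ : (fun n => _) = fun n => nu (B `&` box n)); first side.
apply/funext => n; rewrite -(poisson_mean poi (mI n) (Ioo n)).
apply: ae_eq_integral => //.
- exact: measurable_kernel.
- by apply/measurable_EFinP; exact: meas_count.
- by apply: filterS (poisson_ae_count poi (mI n) (Ioo n)) => w [m mE] _; rewrite /count mE.
Qed.

End quad.

(** * The predictable sigma-algebra *)

Section predictable.
Context d (Om : measurableType d) (R : realType).
Local Notation E := (measurableTypeR R).
Variable F : R -> set_system Om.
Hypothesis fF : is_filtration F.

Definition predictable_events : set_system (Om * E) :=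
 [set S | exists A (a b : R), [/\ 0 <= a, F a A & S = A `*` `]a, b]%classic]].

(** The generating rectangles live in positive times, so points of nonpositive time are not
    separated and a measurable real function is constant on them. *)
Definition predictable := g_sigma_algebraType predictable_events.

Lemma filtration_sigma t : 0 <= t -> sigma_algebra setT (F t).
Proof. by move=> t0; have [/(_ t t0)[]] := fF. Qed.

Lemma filtration_measurable t : 0 <= t -> F t `<=` measurable.
Proof. by move=> t0; have [/(_ t t0)[]] := fF. Qed.

Lemma filtrationT t : 0 <= t -> F t setT.
Proof. by move=> /filtration_sigma[F0 FC _]; rewrite -(setD0 setT); exact: FC. Qed.

Lemma predictable_measurable (S : set predictable) : measurable S ->
 @measurable _ (Om * E)%type S.
Proof.
apply: smallest_sub; first exact: sigma_algebra_measurable.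
move=> _ [A [a [b [a0 FA ->]]]]; apply: measurableX; last side.
exact: filtration_measurable FA.
Qed.

Lemma meas_to_predictable : measfun (idfun : Om * E -> predictable).
Proof. by move=> _ S mS; rewrite setTI; exact: predictable_measurable. Qed.

Lemma predictable_sec (S : set predictable) t : 0 <= t -> measurable S ->
 F t [set w | S (w, t)].
Proof.
move=> t0; have [F0 FC FU] := filtration_sigma t0.
apply: (@smallest_sub _ _ _ [set S : set predictable | F t [set w | S (w, t)]]).
 split => /=.
 - side.
 - by move=> A FA; exact: FC FA.
 - move=> A FA; rewrite (_ : [set w | _] = \bigcup_n [set w | A n (w, t)]); first exact: FU.
  side.
move=> _ [A [a [b [a0 FA ->]]]] /=.
have [tab|tab] := boolP (t \in `]a, b]).
 rewrite (_ : [set w | _] = A); last by apply/seteqP; split => w /=; [case|].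
 have [_] := fF; apply; [exact: a0| |side].
 by move: tab; rewrite in_itv/= => /andP[/ltW].
rewrite (_ : [set w | _] = set0)//; apply/seteqP; split => // w /= [_]; side.
Qed.

Lemma predictable_after (A : set Om) a : 0 <= a -> F a A ->
 measurable ([set x | A x.1 /\ a < x.2] : set predictable).
Proof.
move=> a0 FA.
rewrite (_ : [set x | _] = \bigcup_n (A `*` `]a, a + n%:R]%classic)); last first.
 apply/seteqP; split => -[w s] /=; last by move=> [n _ [/= ?]]; rewrite in_itv/= => /andP[].
 move=> [Aw as_]; exists (Num.truncn (s - a)).+1 => //; split => //=.
 rewrite in_itv/= as_/= -lerBlDl; apply: ltW; exact: truncnS_gt.
by apply: bigcupT_measurable => n; apply: sub_sigma_algebra; exists A, a, (a + n%:R).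
Qed.

Lemma meas_predictable_slice w : measfun (fun s : E => (w, s) : predictable).
Proof.
apply: (@mcomp _ _ _ _ _ _ (idfun : Om * E -> predictable) _ (fun s => (w, s))) => //.
exact: meas_to_predictable.
side.
Qed.

Lemma predictable_lt (q : R) : 0 <= q -> measurable ([set x | q < x.2] : set predictable).
Proof.
move=> q0; have := predictable_after q0 (filtrationT q0).
congr measurable; side.
Qed.

Lemma meas_before :
 measurable ([set z | 0 < z.2.1 < z.1.2] : set (predictable * plane R)).
Proof.
rewrite (_ : [set z | _] = (setT `*` (`]0, +oo[%classic `*` setT)) `&` \bigcup_q
  (if 0 <= ratr q :> R then [set x : predictable | ratr q < x.2] `*` (`]-oo, ratr q]%classic `*` setT) else set0)); last first.
 apply/seteqP; split => -[[w s] [u z]] /=.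
  move=> /andP[u0 us]; split; first by rewrite in_itv/= u0.
  have /rat_in_itvoo[q] := us; rewrite in_itv/= => /andP[uq qs].
  exists q => //; rewrite (ltW (lt_trans u0 uq)) /=; split => //.
  by rewrite in_itv/= ltW.
 rewrite in_itv/= andbT => -[[_ [u0 _]] [q _]]; case: ifPn => // q0 /= [qs].
 by rewrite in_itv/= u0 => -[uq _]; exact: le_lt_trans qs.
apply: measurableI.
 apply: measurableX => //; side.
apply: bigcupT_measurable_rat => q; case: ifPn => // q0.
apply: measurableX; first exact: predictable_lt.
side.
Qed.

(** The reason why an intensity computed from past points is predictable: looking up a predictable
    set at a time u < s is measurable jointly in (w, s) and u, since an event [A] of [F a] met at a
    time u > a is already known at time s. *)
Lemma meas_past (S : set predictable) : measurable S ->
 measurable ([set z | 0 < z.2.1 < z.1.2 /\ S (z.1.1, z.2.1)] : set (predictable * plane R)).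
Proof.
have mb := meas_before.
apply: (@smallest_sub _ _ _ [set S : set predictable |
 measurable ([set z | 0 < z.2.1 < z.1.2 /\ S (z.1.1, z.2.1)] : set (predictable * plane R))]).
 split => /=.
 - rewrite (_ : [set z | _] = set0)//; side.
 - move=> A mA.
  rewrite (_ : [set z | _] = [set z | 0 < z.2.1 < z.1.2] `\`
   [set z | 0 < z.2.1 < z.1.2 /\ A (z.1.1, z.2.1)]); first side.
  side.
 - move=> A mA.
  rewrite (_ : [set z | _] = \bigcup_n [set z | 0 < z.2.1 < z.1.2 /\ A n (z.1.1, z.2.1)]).
   side.
  by apply/seteqP; split => z /= [h]; [move=> [n _ An]; exists n|move=> _ [? ?]; split => //; exists h].
move=> _ [A [a [b [a0 FA ->]]]] /=.
rewrite (_ : [set z | _] = [set z | 0 < z.2.1 < z.1.2] `&`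
  ([set x : predictable | A x.1 /\ a < x.2] `*` (`]a, b]%classic `*` setT))).
 apply: measurableI => //; apply: measurableX; first exact: predictable_after.
 apply: measurableX => //; side.
apply/seteqP; split => -[[w s] [u z]] /= [us].
 move=> [Aw uab]; split => //; split => //; split => //.
 by move: us uab; rewrite in_itv/= => /andP[_ us] /andP[au _]; exact: lt_trans us.
by move=> [[Aw _] [uab _]].
Qed.

Lemma meas_fun_past d' (T : measurableType d') (g : predictable -> T) (c : T) :
 measfun g ->
 measfun (fun z : predictable * plane R =>
  if 0 < z.2.1 < z.1.2 then g (z.1.1, z.2.1) else c).
Proof.
move=> mg _ B mB; rewrite setTI.
have mgB : @measurable _ predictable (g @^-1` B) by rewrite -[X in measurable X]setTI; exact: mg.
rewrite (_ : _ @^-1` B = [set z | 0 < z.2.1 < z.1.2 /\ (g @^-1` B) (z.1.1, z.2.1)] `|`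
  (~` [set z | 0 < z.2.1 < z.1.2] `&` [set z | B c])).
 apply: measurableU; first exact: meas_past.
 apply: measurableI; first by apply: measurableC; exact: meas_before.
 have [Bc|Bc] := pselect (B c).
  rewrite (_ : [set z | B c] = setT)//; side.
 rewrite (_ : [set z | B c] = set0)//; side.
apply/seteqP; split => z /=.
 by case: ifPn => h Bz; [left|right; split => //; exact/negP].
by case: ifPn => h [[]|[]].
Qed.

End predictable.

Section past.
Context d (Om : measurableType d) (R : realType) (F : R -> set_system Om).
Local Notation E := (measurableTypeR R).
Hypothesis fF : is_filtration F.
Variable k : R.-ker Om ~> plane R.
Hypotheses (kc : forall w, count_measure (k w))
 (kad : forall t, 0 <= t -> noise_events k (`[0%R, t] `*` `[0%R, +oo[) `<=` F t).
Local Notation PT := (predictable F).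

Definition strip_before (s : R) : set (plane R) := `]0, s[%classic `*` `[0%R, +oo[%classic.

Lemma meas_strip_before s : measurable (strip_before s).
Proof. apply: measurableX; side. Qed.

Definition past (x : PT) : {measure set (plane R) -> \bar R} :=
 mrestr (k x.1) (meas_strip_before x.2).

(** Left continuity in time: the count strictly before [s] exceeds [c] if and only if the count up
    to some rational [q < s] does, and the latter is an event of [F q]. *)
Lemma meas_pastE B : measurable B -> measfun (past ^~ B).
Proof.
move=> mB.
apply: (measurability _ (ErealGenOInfty.measurableE R)) => _ [_ [c ->] <-].
rewrite setTI.
have [c0|c0] := ltP c 0.
 rewrite (_ : _ @^-1` _ = setT)//; apply/seteqP; split => // x _ /=.
 by rewrite in_itv/= andbT (lt_le_trans _ (measure_ge0 _ _))// lte_fin.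
pose Q (q : R) : set (plane R) := B `&` (`]0, q]%classic `*` `[0%R, +oo[%classic).
have mQ q : measurable (Q q) by side.
rewrite (_ : _ @^-1` _ = \bigcup_q (if 0 <= ratr q :> R then
  [set x : PT | [set w | k w (Q (ratr q)) \in `]c%:E, +oo[] x.1 /\ ratr q < x.2] else set0)).
 apply: bigcupT_measurable_rat => q; case: ifPn => // q0.
 apply: predictable_after => //; apply: kad => //.
 exists (Q (ratr q)), [set y | y \in `]c%:E, +oo[]; split => //.
 - by move=> [u z] [_ [/=]]; rewrite !in_itv/= => /andP[/ltW -> ->].
 - exact: emeasurable_itv.
apply/seteqP; split => -[w s] /=.
 rewrite in_itv/= andbT /past /mrestr /= => cs.
 have s0 : 0 < s.
  rewrite ltNge; apply/negP => s0; move: cs; rewrite (_ : _ `&` _ = set0) ?measure0 ?lte_fin ?ltNge ?c0//.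
  apply/seteqP; split => // -[u z] [_ [/=]]; rewrite in_itv/= => /andP[u0 us].
  by have := lt_le_trans (lt_trans u0 us) s0; rewrite ltxx.
 (* A sequence of nonnegative times that increases to [s] and stays strictly below it. *)
 pose v (n : nat) : R := s - s / n.+2%:R.
 have vs n : v n < s by rewrite /v ltrBlDr ltrDl divr_gt0.
 have v0 n : 0 <= v n.
  by rewrite /v subr_ge0 ler_pdivrMr// ler_peMr ?(ltW s0)// ler1n.
 have vnd : nondecreasing_seq v.
  move=> i j ij; rewrite /v lerD2l lerN2 ler_wpM2l ?(ltW s0)// lef_pV2 ?posrE//.
  by rewrite ler_nat.
 have : k w (Q (v n)) @[n --> \oo] --> k w (\bigcup_n Q (v n)).
  apply: nondecreasing_cvg_mu => //; first side.
  move=> i j ij; apply/subsetPset => -[u z] [Bu [/=]]; rewrite !in_itv/= => /andP[u0 ui] z0.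
  by split => //; split => //=; rewrite in_itv/= u0 (le_trans ui)// vnd.
 have -> : \bigcup_n Q (v n) = B `&` strip_before s.
  apply/seteqP; split => -[u z] /=.
   move=> [n _ [Bu [/=]]]; rewrite !in_itv/= => /andP[u0 un] z0.
   by split => //; split => //=; rewrite in_itv/= u0 (le_lt_trans un).
  move=> [Bu [/=]]; rewrite !in_itv/= => /andP[u0 us] z0.
  exists (Num.truncn (s / (s - u))) => //; split => //; split => //=.
  rewrite in_itv/= u0/= /v lerBrDl -lerBrDr ler_pdivrMr//.
  have su : 0 < s - u by rewrite subr_gt0.
  rewrite -ler_pdivrMl// mulrC.
  apply: ltW; rewrite (lt_le_trans (truncnS_gt _))// ler_nat.
  side.
 move=> kcv; have [n cn] : exists n, (c%:E < k w (Q (v n)))%E.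
  apply: contrapT => h; move: cs; rewrite ltNge => /negP; apply.
  rewrite -(cvg_lim _ kcv)//; apply: lime_le; first by apply/cvg_ex; exists (k w (B `&` strip_before s)).
  by apply: nearW => n; rewrite leNgt; apply/negP => ?; apply: h; exists n.
 have /rat_in_itvoo[q] := vs n; rewrite in_itv/= => /andP[nq qs].
 exists q => //; rewrite (le_trans (v0 n) (ltW nq)); split => //=.
 rewrite in_itv/= andbT (lt_le_trans cn)//; apply: le_measure; rewrite ?inE//.
 move=> [u z] [Bu [/=]]; rewrite !in_itv/= => /andP[u0 ui] z0.
 by split => //; split => //=; rewrite in_itv/= u0 (le_trans ui)// ltW.
move=> [q _]; case: ifPn => // q0 [/= + qs].
rewrite !in_itv/= !andbT => cq; apply: (lt_le_trans cq); rewrite /past /mrestr /=.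
apply: le_measure; rewrite ?inE//.
 apply: measurableI => //; side.
move=> [u z] [Bu [/=]]; rewrite !in_itv/= => /andP[u0 ui] z0.
by split => //; split => //=; rewrite in_itv/= u0 (le_lt_trans ui).
Qed.

HB.instance Definition _ := isKernel.Build _ _ PT (plane R) R past meas_pastE.

Lemma meas_past_int (f : PT * plane R -> \bar R) :
 measfun f -> (forall z, (0 <= f z)%E) ->
 measfun (fun x : PT => \int[past x]_y f (x, y))%E.
Proof.
apply: (meas_kernel_int (k := past) (@meas_box R) (@box_nd R) (@box_cover R)).
move=> x n; have [kb _ _] := kc x.1; apply: le_lt_trans (kb n).
apply: le_measure; rewrite ?inE//.
- apply: measurableI; side.
- side.
Qed.

End past.

(** * The compensation formula *)

Section compensation.
Context d (Om : measurableType d) (R : realType) (P : probability Om R) (F : R -> set_system Om).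
Local Notation E := (measurableTypeR R).
Local Notation PT := (predictable F).
Hypothesis fF : is_filtration F.

(** Attaches the outcome to the time of a point, so that an integrand depending on the outcome
    becomes a fixed function on [PT * E] and the noise a kernel into that space. *)
Definition spread (y : Om * plane R) : PT * E := ((y.1, y.2.1), y.2.2).

Lemma meas_spread : measfun spread.
Proof.
apply: measurable_fun_pair; last exact: mcomp.
apply: (@mcomp _ _ _ _ _ _ (idfun : Om * E -> PT) _ (fun y : Om * plane R => (y.1, y.2.1))).
 exact: meas_to_predictable.
by apply: measurable_fun_pair => //; exact: mcomp.
Qed.

Lemma meas_spread_slice w : measfun (fun y => spread (w, y)).
Proof.
apply: (mcomp meas_spread).
side.
Qed.

Section spread.
Variable k : R.-ker Om ~> plane R.
Hypothesis kfin : forall w n, (k w (box n) < +oo)%E.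

Definition spread_ker of (forall w n, (k w (box n) < +oo)%E) :
  Om -> {measure set (PT * E) -> \bar R} :=
 fun w => image_mu (k w) (meas_spread_slice w).

Lemma meas_spread_kernel B : measurable B -> measfun (spread_ker kfin ^~ B).
Proof.
move=> mB.
have mA : measurable (spread @^-1` B).
 by rewrite -[X in measurable X]setTI; exact: meas_spread.
have := meas_kernel_xsection (k := k) (@meas_box R) (@box_nd R) (@box_cover R) kfin mA.
congr (measurable_fun _); apply/funext => w; rewrite /spread_ker /image_mu/= /pushforward.
by congr (k w _); apply/seteqP; split => y; rewrite /xsection /= ?inE.
Qed.

HB.instance Definition _ := isKernel.Build _ _ Om (PT * E)%type R (spread_ker kfin)
 meas_spread_kernel.

Lemma spread_kernel_int (f : PT * E -> \bar R) w : measfun f ->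
 (forall z, (0 <= f z)%E) ->
 (\int[spread_ker kfin w]_z f z = \int[k w]_y f (spread (w, y)))%E.
Proof. by move=> mf f0; rewrite /spread_ker ge0_int_image_measure. Qed.

End spread.

Variables (k : R.-ker Om ~> plane R).
Hypotheses (kc : forall w, count_measure (k w)) (kp : is_poisson_measure P k nu)
 (kfut : forall t, 0 <= t -> forall A B, F t A ->
   noise_events k (`]t, +oo[ `*` `[0%R, +oo[) B -> (P (A `&` B) = P A * P B)%E).

Let kfin w n : (k w (box n) < +oo)%E. Proof. by have [] := kc w. Qed.

Definition constant_kernel : Om -> {measure set (plane R) -> \bar R} := fun=> nu.

Let meas_constant_kernel B : measurable B -> measfun (constant_kernel ^~ B).
Proof. side. Qed.

HB.instance Definition _ := isKernel.Build _ _ Om (plane R) R constant_kernel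
 meas_constant_kernel.

Let cfin w n : (constant_kernel w (box n) < +oo)%E. Proof. exact: quad_leb_box. Qed.

(** The band of nonpositive times is added to the generators so that they exhaust the space, as
    uniqueness of measures requires; both measures to be compared vanish on it. *)
Definition rect_events : set_system (PT * E) :=
 [set S | exists A C, [/\ predictable_events F A \/ A = setT `*` `]-oo, 0%R]%classic,
  measurable C & S = A `*` C]].

Lemma rect_eventsE : @measurable _ (PT * E)%type = <<s rect_events >>.
Proof.
pose H := g_sigma_algebraType rect_events.
have gen A C : predictable_events F A \/ A = setT `*` `]-oo, 0%R]%classic -> measurable C ->
  @measurable _ H (A `*` C).
 by move=> hA mC; apply: sub_sigma_algebra; exists A, C.
have mNn : @measurable _ PT (setT `*` `]-oo, 0%R]%classic).
 rewrite (_ : _ `*` _ = ~` [set x | 0 < x.2]); first by apply: measurableC; exact: predictable_lt.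
 by apply/seteqP; split => -[w s] /=; rewrite in_itv/= leNgt; [move=> [_ /negP]|move=> /negP].
apply/seteqP; split; last first.
 apply: smallest_sub; first exact: sigma_algebra_measurable.
 move=> _ [A [C [hA mC ->]]]; apply: measurableX => //.
 by case: hA => [hA|->//]; exact: sub_sigma_algebra.
rewrite measurable_prod_measurableType; apply: smallest_sub; first side.
move=> _ [A mA [C mC <-]]; move: A mA.
have TC : @measurable _ H (setT `*` C).
 rewrite (_ : _ `*` _ = ((setT `*` `]-oo, 0%R]%classic) `*` C) `|`
   \bigcup_n ((setT `*` `]0%R, n%:R]%classic) `*` C)).
  apply: measurableU; first by apply: gen => //; right.
  apply: bigcupT_measurable => n; apply: gen => //; left; exists setT, 0, n%:R; split => //.
  exact: (filtrationT fF).
 apply/seteqP; split => -[[w s] z] /=; last by move=> [[_ ?]|[n _ [_ ?]]].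
 move=> [_ Cz]; have [s0|s0] := leP s 0; first by left; rewrite in_itv.
 right; exists (Num.truncn s).+1 => //; rewrite /= in_itv/= s0; split => //; split => //.
 by apply: ltW; exact: truncnS_gt.
apply: (@smallest_sub _ _ _ [set A : set PT | @measurable _ H (A `*` C)]).
 split => /=.
 - rewrite set0X; side.
 - move=> A mA; rewrite (_ : _ `*` _ = (setT `*` C) `\` (A `*` C)); first side.
  side.
 - move=> G mG; rewrite setX_bigcupl; side.
by move=> A hA; apply: gen => //; left.
Qed.

Lemma rect_eventsI : setI_closed rect_events.
Proof.
have p0 : predictable_events F set0.
 exists setT, 0, 0; split => //; first exact: (filtrationT fF).
 by apply/seteqP; split => // -[w s] /= [_]; rewrite in_itv/= => /andP[/lt_le_trans h /h]; rewrite ltxx.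
move=> _ _ [A [C [hA mC ->]]] [A' [C' [hA' mC' ->]]]; exists (A `&` A'), (C `&` C'); split; last first.
- side.
- side.
have pN A1 : predictable_events F A1 -> A1 `&` (setT `*` `]-oo, 0%R]%classic) = set0.
 move=> [A0 [a [b [a0 _ ->]]]]; apply/seteqP; split => // -[w s] /= [[_ +] [_]].
 by rewrite !in_itv/= => /andP[as_ _] /(lt_le_trans as_); rewrite ltNge a0.
case: hA => [hA|->]; case: hA' => [hA'|->].
- left; case: hA hA' => [A0 [a [b [a0 FA ->]]]] [A0' [a' [b' [a0' FA' ->]]]].
 exists (A0 `&` A0'), (Num.max a a'), (Num.min b b'); split.
 + by rewrite le_max a0.
 + have sF : sigma_algebra setT (F (Num.max a a')) by apply: filtration_sigma; rewrite // le_max a0.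
  have [_ nd] := fF.
  have h1 : F (Num.max a a') A0 by apply: nd FA; rewrite // le_max lexx.
  have h2 : F (Num.max a a') A0' by apply: nd FA'; rewrite // le_max lexx orbT.
  have := @measurableI _ (g_sigma_algebraType (F (Num.max a a'))) A0 A0'.
  by rewrite /measurable /= sigma_algebra_id//; exact.
 + apply/seteqP; split => -[w s] /=; rewrite !in_itv/= gt_max le_min.
   by move=> [[? /andP[-> ->]] [? /andP[-> ->]]].
  by move=> [[? ?] /andP[/andP[-> ->] /andP[-> ->]]].
- by left; rewrite pN.
- by left; rewrite setIC pN.
- right; side.
Qed.

Lemma indep_indic_count (A : set Om) t (B : set (plane R)) : 0 <= t -> F t A -> measurable B ->
 B `<=` `]t, +oo[ `*` `[0%R, +oo[ ->
 (\int[P]_w ((\1_A w)%:E * k w B) = P A * nu B)%E.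
Proof.
move=> t0 FA mB Bt; have mA := filtration_measurable fF t0 FA.
rewrite indep_ge0_intM//.
- by rewrite integral_indic// setIT (quad_mean kp).
- side.
- exact: measurable_kernel.
move=> D D' mD mD'; apply: (kfut t0); last by exists B, D'.
have [F0 FC _] := filtration_sigma fF t0.
rewrite (_ : _ @^-1` D = [set w | D (\1_A w)%:E])//.
have FT := filtrationT fF t0.
have [D1|D1] := pselect (D 1%E); have [D0|D0] := pselect (D 0%E).
- rewrite (_ : [set w | _] = setT)//; apply/seteqP; split => // w _ /=.
 by rewrite indicE; case: (_ \in _).
- rewrite (_ : [set w | _] = A)//; apply/seteqP; split => w /=; rewrite indicE.
  by case: (boolP (w \in A)) => // /set_mem.
 by move=> /mem_set ->.
- rewrite (_ : [set w | _] = setT `\` A); first exact: FC.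
 apply/seteqP; split => w /=; rewrite indicE; case: (boolP (w \in A)) => //.
 + by move=> /negP wA _; split => // /mem_set.
 + by move=> /set_mem ? [].
- rewrite (_ : [set w | _] = set0)//; apply/seteqP; split => // w /=.
 by rewrite indicE; case: (_ \in _).
Qed.

Lemma measure_positive (m : {measure set (plane R) -> \bar R}) B :
 m (~` @positive_quad R) = 0%E -> measurable B -> m B = m (B `&` @positive_quad R).
Proof.
move=> m0 mB; have mQ := @meas_positive_quad R.
rewrite (measureDI m mB mQ) [X in (X + _)%E](_ : _ = 0%E) ?add0e//.
apply/eqP; rewrite eq_le measure_ge0 andbT -m0; apply: le_measure; rewrite ?inE//.
- side.
- side.
Qed.

(** On a product of [A] in [F a], []a, b]] and [C], the noise is taken after time a, hence is
    independent of [A], and both sides are the probability of [A] times the intensity of the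
    rectangle. Such products form a generating pi-system. *)
Lemma compensation_set (B : set (PT * E)) : measurable B ->
 mean_measure P (spread_ker kfin) B = mean_measure P (spread_ker cfin) B.
Proof.
pose Nn : set PT := setT `*` `]-oo, 0%R]%classic.
have FT := filtrationT fF (lexx 0).
have pT (n : nat) : predictable_events F (setT `*` `]0%R, n%:R]%classic).
 by exists setT, 0, n%:R.
have zero (m : {measure set (plane R) -> \bar R}) w C : measurable C ->
  m (~` @positive_quad R) = 0%E -> image_mu m (meas_spread_slice w) (Nn `*` C) = 0%E.
 move=> mC m0; rewrite /image_mu /= /pushforward; apply/eqP.
 rewrite (_ : _ @^-1` _ = `]-oo, 0%R]%classic `*` C); last first.
  by apply/seteqP; split => -[s z] /=; [move=> [[]]|move=> []].
 rewrite eq_le measure_ge0 andbT -m0; apply: le_measure; rewrite ?inE.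
 - side.
 - apply: measurableC; side.
 - by move=> [s z] /= [+ _] [/=]; rewrite !in_itv/= andbT leNgt => /negP.
(* One sequence serves both kinds of exhausting sets: bounded slabs of positive times at odd ranks,
   the band of nonpositive times at even ranks. *)
pose g (n : nat) : set (PT * E) := if odd n then (setT `*` `]0%R, n%:R]%classic) `*` `[- n%:R, n%:R]%classic
 else Nn `*` setT.
apply: (measure_unique rect_events g).
- exact: rect_eventsE.
- exact: rect_eventsI.
- move=> n; rewrite /g; case: ifP => _.
  exists (setT `*` `]0%R, n%:R]%classic), `[- n%:R, n%:R]%classic; split => //; by left.
 by exists Nn, setT; split => //; right.
- apply/seteqP; split => // -[[w s] z] _.
 have [s0|s0] := leP s 0; first by exists 0%N => //; rewrite /g /=; split => //; split => //=; rewrite in_itv.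
 pose n := maxn (Num.truncn s).+1 (Num.truncn `|z|).+1.
 have hs : s <= n.*2.+1%:R.
  rewrite (ltW (lt_le_trans (truncnS_gt s) _))// ler_nat.
  by rewrite (leq_trans (leq_maxl _ (Num.truncn `|z|).+1))// -/n -addnn -addnS leq_addr.
 have hz : `|z| <= n.*2.+1%:R.
  rewrite (ltW (lt_le_trans (truncnS_gt `|z|) _))// ler_nat.
  by rewrite (leq_trans (leq_maxr (Num.truncn s).+1 _))// -/n -addnn -addnS leq_addr.
 exists n.*2.+1 => //; rewrite /g /= odd_double /=; split; last by rewrite /= in_itv/= -ler_norml.
 by split => //=; rewrite in_itv/= s0.
- move=> _ [A [C [hA mC ->]]]; rewrite /= /mean_measure.
 case: hA => [|->]; last first.
  rewrite !integral0_eq//.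
   by move=> w _; apply: zero => //; exact: quad_leb_positive.
  by move=> w _; apply: zero => //; have [] := kc w.
 move=> [A0 [a [b [a0 FA ->]]]].
 pose D : set (plane R) := `]a, b]%classic `*` (C `&` `[0%R, +oo[%classic).
 have mI : measurable (C `&` `[0%R, +oo[%classic) by side.
 have mD : measurable D by side.
 have key (m : {measure set (plane R) -> \bar R}) w : m (~` @positive_quad R) = 0%E ->
   image_mu m (meas_spread_slice w) ((A0 `*` `]a, b]%classic) `*` C) = ((\1_A0 w)%:E * m D)%E.
  move=> m0; rewrite /image_mu /= /pushforward indicE.
  case: (boolP (w \in A0)) => [/set_mem wA|/negP wA]; last first.
   rewrite mul0e (_ : _ @^-1` _ = set0) ?measure0//.
   by apply/seteqP; split => // -[s z] /= [[/mem_set]].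
  rewrite mul1e (_ : _ @^-1` _ = `]a, b]%classic `*` C); last first.
   side.
  have mS : measurable (`]a, b]%classic `*` C : set (plane R)) by side.
  rewrite (measure_positive m0 mS); congr (m _); apply/seteqP; split => -[s z]; rewrite /D /positive_quad /= !in_itv/= ?andbT.
   by move=> [[-> ?] [_ ->]].
  by move=> [/andP[as_ ->] [? ->]]; rewrite as_ (le_lt_trans a0 as_).
 have Dt : D `<=` `]a, +oo[ `*` `[0%R, +oo[.
  by move=> [s z]; rewrite /D /= !in_itv/= !andbT => -[/andP[-> _] [_ ->]].
 have mA0 : measurable A0 by exact: filtration_measurable FA.
 transitivity (P A0 * nu D)%E.
  rewrite -(indep_indic_count a0 FA mD Dt); apply: eq_integral => w _.
  by apply: key; have [] := kc w.
 transitivity (\int[P]_w ((\1_A0 w)%:E * nu D))%E.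
  rewrite ge0_integralZr//; last side.
  by rewrite integral_indic ?setIT.
 by apply: eq_integral => w _; apply/esym/key; exact: quad_leb_positive.
- move=> n; rewrite /mean_measure/=; rewrite /g; case: ifP => _; last first.
  rewrite /mean_measure integral0_eq ?ltry// => w _; apply: zero => //; have [] := kc w; exact.
 rewrite /mean_measure; apply: (@le_lt_trans _ _ (\int[P]_w k w (box n))%E).
  apply: ge0_le_integral => //.
  + apply: meas_spread_kernel; apply: measurableX.
    by apply: sub_sigma_algebra.
   side.
  + apply: measurable_kernel; side.
  + move=> w _; set S := (X in spread_ker _ _ X).
   change (k w ((fun y => spread (w, y)) @^-1` S) <= k w (box n))%E.
   apply: le_measure; rewrite ?inE.
   * rewrite -[X in measurable X]setTI; apply: meas_spread_slice => //; apply: measurableX.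
     by apply: sub_sigma_algebra.
    side.
   * side.
   * move=> [s z] /= [[_ +]]; rewrite /box /= !in_itv/= => /andP[s0 ->] ->; split => //.
    by rewrite andbT (le_trans _ (ltW s0))// oppr_le0.
 by rewrite (quad_mean kp)//; [exact: quad_leb_box|side].
Qed.

Lemma compensation (f : PT * E -> \bar R) : measfun f -> (forall z, (0 <= f z)%E) ->
 (\int[P]_w \int[k w]_y f ((w, y.1), y.2) = \int[P]_w \int[nu]_y f ((w, y.1), y.2))%E.
Proof.
move=> mf f0.
have h1 := mean_measure_int P (spread_ker kfin) mf f0.
have h2 := mean_measure_int P (spread_ker cfin) mf f0.
transitivity (\int[P]_w \int[spread_ker kfin w]_z f z)%E.
 by apply: eq_integral => w _; rewrite spread_kernel_int.
rewrite h1 (eq_measure_integral (mean_measure P (spread_ker cfin))); last first.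
 by move=> A mA _; exact: compensation_set.
by rewrite -h2; apply: eq_integral => w _; rewrite spread_kernel_int.
Qed.

End compensation.

Lemma expR_ge1 (R : realType) (x : R) : 0 <= x -> 1 <= expR x.
Proof. by move=> x0; rewrite -expR0 ler_expR. Qed.

Lemma meas_restr (R : realType) (D : set (measurableTypeR R)) (f : measurableTypeR R -> \bar R) :
 measurable D -> measfun f -> measfun (f \_ D).
Proof. move=> mD mf; apply/(measurable_restrictT _ mD); side. Qed.

Lemma cvg_geometric0 (R : realType) (K : R) : (fun n => K * 2^-1 ^+ n) @ \oo --> (0 : R).
Proof.
rewrite -(mulr0 K); apply: cvgM; first exact: cvg_cst.
by apply: cvg_expr; rewrite ger0_norm// invf_lt1// ltr1n.
Qed.

(** The sequences obtained by adding and subtracting 2 K / 2^n are monotone and bound each other,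
    which gives the limit together with the rate. *)
Lemma geometric_limit (R : realType) (u : nat -> R) (K : R) :
 (forall m, `|u m.+1 - u m| <= K * 2^-1 ^+ m) ->
 exists2 l, u @ \oo --> l & forall m, `|u m - l| <= 2 * K * 2^-1 ^+ m.
Proof.
move=> hu; pose a n := u n + 2 * K * 2^-1 ^+ n; pose b n := u n - 2 * K * 2^-1 ^+ n.
have K0 : 0 <= K by have := hu 0%N; rewrite expr0 mulr1; exact: le_trans.
have p0 n : 0 <= K * 2^-1 ^+ n by side.
have na : nonincreasing_seq a.
 apply/nonincreasing_seqP => n; rewrite /a exprS.
 by have := hu n; rewrite ler_norml => /andP[_ h]; lra.
have nb : nondecreasing_seq b.
 apply/nondecreasing_seqP => n; rewrite /b exprS.
 by have := hu n; rewrite ler_norml => /andP[h _]; lra.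
have ba n m : b n <= a m.
 have := nb _ _ (leq_maxl n m); have := na _ _ (leq_maxr n m).
 have := p0 (maxn n m); rewrite /a /b; lra.
have ca : cvgn a.
 apply: nonincreasing_is_cvgn => //; exists (b 0%N) => _ [n _ <-]; side.
have h0 := cvg_geometric0 (2 * K).
exists (limn a).
 rewrite (_ : u = a - (fun n => 2 * K * 2^-1 ^+ n)).
  by rewrite -[X in _ --> X]subr0; apply: cvgB.
 by apply/funext => n; rewrite /a -[RHS]/(u n + 2 * K * 2^-1 ^+ n - 2 * K * 2^-1 ^+ n) addrK.
move=> m; rewrite ler_norml; apply/andP; split.
 by have := nonincreasing_cvgn_ge na ca m; rewrite /a; lra.
have : b m <= limn a by apply: limr_ge => //; apply: nearW.
by rewrite /b; lra.
Qed.

(** * Convolution inequalities and the limiting rate *)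

Section renewal.
Context (R : realType).
Local Notation E := (measurableTypeR R).
Variable phi : R -> R.
Hypothesis phi_loc : locally_square_integrable phi.

(** [phi] is assumed measurable on [0, oo[ only, so its values at negative arguments are
    overwritten. *)
Definition phi0 (v : R) : R := if 0 <= v then phi v else 0.

Lemma phi0E v : 0 <= v -> phi0 v = phi v.
Proof. by rewrite /phi0 => ->. Qed.

Lemma meas_phi0 : measfun phi0.
Proof.
have [mphi _] := phi_loc.
rewrite (_ : phi0 = phi \_ `[0, +oo[%classic).
 apply/(measurable_restrictT _ _).1 => //; side.
apply/funext => v; rewrite /phi0 patchE; case: ifPn => v0.
 by rewrite mem_set//= in_itv/= v0.
by rewrite memNset//= in_itv/= andbT; exact/negP.
Qed.

Lemma sq_phi0 T : (\int[leb]_(v in `[0%R, T]) (phi0 v ^+ 2)%:E < +oo)%E.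
Proof.
have [_ h] := phi_loc.
have [T0|T0] := ltP 0 T; last first.
 apply: le_lt_trans (_ : 0 < +oo)%E => //.
 have m0 : leb `[0%R, T]%classic = 0%E.
  by rewrite lebesgue_measure_itv/= lte_fin ltNge T0.
 by rewrite (null_set_integral _ _ m0)//; apply/measurable_EFinP; apply: measurable_funX;
  exact: measurable_funTS meas_phi0.
rewrite (eq_integral (fun v : E => (phi v ^+ 2)%:E)); first exact: h.
by move=> v; rewrite inE/= in_itv/= => /andP[v0 _]; rewrite phi0E.
Qed.

Lemma l1_phi0 T : (\int[leb]_(v in `[0%R, T]) `|phi0 v|%:E < +oo)%E.
Proof.
have mI : measurable (`[0%R, T]%classic : set E) by side.
apply: (@le_lt_trans _ _ (\int[leb]_(v in `[0%R, T]) (1%:E + (phi0 v ^+ 2)%:E))%E).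
 apply: ge0_le_integral => //.
 - by apply/measurable_EFinP; apply: mcomp => //; exact: measurable_funTS meas_phi0.
 - apply: emeasurable_funD => //; apply/measurable_EFinP; apply: measurable_funX.
  exact: measurable_funTS meas_phi0.
 - move=> v _; rewrite -EFinD lee_fin -[X in _ <= 1 + X]real_normK ?num_real//.
  set x := `|_|; have := sqr_ge0 (x - 1 / 2); nra.
rewrite ge0_integralD//; last 2 first.
- side.
- by apply/measurable_EFinP; apply: measurable_funX; exact: measurable_funTS meas_phi0.
rewrite lte_add_pinfty//; last exact: sq_phi0.
rewrite integral_cst// mul1e; have : (leb `[0%R, T]%classic < +oo)%E; last exact.
by rewrite lebesgue_measure_itv/=; case: ifP; rewrite ltry.
Qed.

(** Dominated convergence as the rate of the exponential weight grows. The value 1 / 2 is the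
    contraction factor of all the estimates below. *)
Lemma phi_decay (L T : R) : 0 <= L -> exists2 b, 0 <= b &
 (L%:E * \int[leb]_(v in `[0%R, T]) (expR (- (b * v)) * `|phi0 v|)%:E <= (1 / 2)%:E)%E.
Proof.
move=> L0.
have mI : measurable (`[0%R, T]%classic : set E) by side.
have mf (b : R) : measurable_fun `[0%R, T]%classic (fun v : R => (expR (- (b * v)) * `|phi0 v|)%:E).
 apply/measurable_EFinP; apply: measurable_funM.
  by apply: measurable_funTS; apply: mcomp => //; apply: mcomp => //.
 by apply: mcomp => //; exact: measurable_funTS meas_phi0.
have mphi : measurable_fun `[0%R, T]%classic (fun v => `|phi0 v|%:E).
 by apply/measurable_EFinP; apply: mcomp => //; exact: measurable_funTS meas_phi0.
have : (\int[leb]_(v in `[0%R, T]) (expR (- (n%:R * v)) * `|phi0 v|)%:E)%E @[n --> \oo] --> 0%E.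
 have [|||_ _] := @dominated_convergence _ _ _ leb `[0%R, T]%classic mI
  (fun n v => (expR (- (n%:R * v)) * `|phi0 v|)%:E) (fun=> 0%E) (fun v => `|phi0 v|%:E)
  (fun n => mf _) (measurable_cst _); last by rewrite integral0.
 (* At v = 0 the weight stays equal to 1; this single point is negligible. *)
 - exists [set 0%R]; split => //; first exact: lebesgue_measure_set1.
  move=> v /= hv; apply: contrapT => v0; apply: hv; rewrite /= in_itv/= => /andP[v0' _].
  have {}v0 : 0 < v by rewrite lt_neqAle v0' andbT eq_sym; exact/eqP.
  apply: cvg_EFin; first by apply: nearW.
  rewrite -(mul0r `|phi0 v|); apply: cvgM; last exact: cvg_cst.
  rewrite (_ : (fun n : nat => expR (- (n%:R * v))) = (fun n => expR (- v) ^+ n)).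
   by apply: cvg_expr; rewrite gtr0_norm ?expR_gt0// expR_lt1 oppr_lt0.
  by apply/funext => n; rewrite -expRM_natl mulrN.
 - apply/integrableP; split => //.
  by under eq_integral do rewrite abse_EFin normr_id; exact: l1_phi0.
 - apply: aeW => v n; rewrite /= in_itv/= => /andP[v0 _].
  rewrite lee_fin normrM normr_id gtr0_norm ?expR_gt0// ler_piMl//.
  by rewrite expR_le1 oppr_le0 mulr_ge0.
move=> h.
have [L00|Lp] := eqVneq L 0; first by exists 0 => //; rewrite L00 mul0e lee_fin.
have {}Lp : 0 < L by rewrite lt_neqAle eq_sym Lp.
have [n hn] : exists n : nat, (\int[leb]_(v in `[0%R, T]) (expR (- (n%:R * v)) * `|phi0 v|)%:E <= (1 / 2 / L)%:E)%E.
 apply: contrapT => hn; have : ((1 / 2 / L)%:E <= 0 :> \bar R)%E.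
  rewrite -(cvg_lim _ h)//; apply: lime_ge; first by apply/cvg_ex; exists 0%E.
  by apply: nearW => n; apply: ltW; rewrite ltNge; apply/negP => ?; apply: hn; exists n.
 by rewrite leNgt lte_fin divr_gt0.
exists n%:R => //; apply: (le_trans (lee_wpmul2l _ hn)); first side.
by rewrite -EFinM lee_fin mulrC divfK// gt_eqF.
Qed.

Lemma ge0_int_reflect (s : R) (f : R -> \bar R) : measfun f ->
 (forall u, (0 <= f u)%E) -> (\int[leb]_u f (s - u)%R = \int[leb]_v f v)%E.
Proof.
move=> mf f0.
have mr : measfun (fun u : E => s - u : E) by exact: measurable_funB.
rewrite -(ge0_int_image_measure leb mr)//; apply: eq_measure_integral => A mA _.
rewrite /image_mu /pushforward/=.
have mA2 : measurable ([set x | A (s + x)] : set E).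
 rewrite -[X in measurable X]setTI.
 have ma : measfun (fun u : E => s + u : E) by exact: measurable_funD.
 exact: ma.
transitivity (pushforward leb (-%R : E -> E) [set x | A (s + x)]); first by [].
rewrite lebesgue_measureN//.
have := @lebesgue_measure_affine R 1 s _ ltr01 mA; rewrite invr1 mul1e => <-; congr (leb _).
by apply/seteqP; split => x /=; rewrite mul1r addrC.
Qed.

Lemma ge0_int_shift (s : R) (f : R -> \bar R) : measfun (f : E -> \bar R) ->
 (forall u, (0 <= f u)%E) -> (\int[leb]_u f (u - s)%R = \int[leb]_v f v)%E.
Proof.
move=> mf f0.
have mr : measfun (fun u : E => u - s : E) by exact: measurable_funB.
rewrite -(ge0_int_image_measure leb mr)//; apply: eq_measure_integral => A mA _.
rewrite /image_mu /pushforward/=.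
have := @lebesgue_measure_affine R 1 (- s) _ ltr01 mA; rewrite invr1 mul1e => <-; congr (leb _).
by apply/seteqP; split => x /=; rewrite mul1r.
Qed.

Definition renewal (s : R) (g : R -> \bar R) : \bar R :=
 (\int[leb]_(u in `[0%R, s]) (`|phi0 (s - u)|%:E * g u))%E.

Lemma meas_phi0_shift s : measfun (fun u : E => `|phi0 (s - u)|).
Proof.
apply: mcomp => //; apply: (mcomp meas_phi0).
exact: measurable_funB.
Qed.

Lemma renewal_ge0 s g : (forall u, (0 <= g u)%E) -> (0 <= renewal s g)%E.
Proof. side. Qed.

Lemma le_renewal s (g g' : R -> \bar R) : measfun (g : E -> \bar R) ->
 measfun (g' : E -> \bar R) -> (forall u, (0 <= g u)%E) ->
 (forall u, (0 <= g' u)%E) -> (forall u, 0 <= u <= s -> (g u <= g' u)%E) ->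
 (renewal s g <= renewal s g')%E.
Proof.
move=> mg mg' g0 g'0 gg'.
have m f : measfun (f : E -> \bar R) ->
  measurable_fun `[0%R, s]%classic (fun u : E => (`|phi0 (s - u)|%:E * f u)%E).
 move=> mf; apply: measurable_funTS; apply: emeasurable_funM => //.
 by apply/measurable_EFinP; exact: meas_phi0_shift.
apply: ge0_le_integral => //.
- side.
- exact: m.
- exact: m.
- by move=> u; rewrite /= in_itv/= => us; rewrite lee_wpmul2l//; exact: gg'.
Qed.

(** Exponentials are almost eigenfunctions of a convolution: the substitution v = s - u takes exp (b
    s) out of the integral. *)
Lemma renewal_exp (b c s T : R) : 0 <= c -> s <= T ->
 (renewal s (fun u => (c * expR (b * u))%:E) <=
  (c * expR (b * s))%:E * \int[leb]_(v in `[0%R, T]) (expR (- (b * v)) * `|phi0 v|)%:E)%E.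
Proof.
move=> c0 sT.
have mI (t : R) : measurable (`[0%R, t]%classic : set E) by side.
pose f (v : E) : \bar R := ((c * expR (b * s))%:E * (expR (- (b * v)) * `|phi0 v|)%:E)%E.
have mexp : measfun (fun v : E => (expR (- (b * v)) * `|phi0 v|)%:E).
 apply/measurable_EFinP; apply: measurable_funM.
  by apply: mcomp => //; apply: mcomp.
 by apply: mcomp => //; exact: meas_phi0.
have mf : measfun f by exact: measurable_funeM.
have f0 u : (0 <= f u)%E by side.
pose fs := f \_ `[0%R, s]%classic.
have mfs : measfun fs by exact: meas_restr.
have fs0 u : (0 <= fs u)%E by rewrite /fs patchE; case: ifP.
rewrite (_ : renewal s _ = \int[leb]_u fs u)%E.
 rewrite -integral_mkcond -ge0_integralZl//; last 2 first.
 - exact: measurable_funTS.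
 - side.
 apply: ge0_subset_integral => //; first side.
 by move=> x /=; rewrite !in_itv/= => /andP[-> /le_trans]; exact.
rewrite -(ge0_int_reflect s mfs fs0) /renewal integral_mkcond.
apply: eq_integral => u _; rewrite /fs !patchE.
have -> : ((s - u)%R \in `[0%R, s]%classic) = (u \in `[0%R, s]%classic).
 by apply/idP/idP; rewrite !inE/= !in_itv/= => /andP[? ?]; apply/andP; split; lra.
case: ifP => // _; rewrite /f -!EFinM; congr EFin.
have -> : expR (b * u) = expR (b * s) * expR (- (b * (s - u))).
 by rewrite -expRD; congr expR; ring.
by ring.
Qed.

Lemma picard_bound (L b c T : R) (dm : nat -> R -> \bar R) : 0 <= c -> 0 <= L -> 0 <= b ->
 (L%:E * \int[leb]_(v in `[0%R, T]) (expR (- (b * v)) * `|phi0 v|)%:E <= (1 / 2)%:E)%E ->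
 (forall m, measfun (dm m : E -> \bar R)) -> (forall m u, (0 <= dm m u)%E) ->
 (forall u, 0 <= u <= T -> (dm 0%N u <= c%:E)%E) ->
 (forall m s, 0 <= s <= T -> (dm m.+1 s <= L%:E * renewal s (dm m))%E) ->
 forall m s, 0 <= s <= T -> (dm m s <= (c * 2^-1 ^+ m * expR (b * s))%:E)%E.
Proof.
move=> c0 L0 b0 Lb md d0 dc dS; elim=> [|m IHm] s /andP[s0 sT].
 apply: (le_trans (dc s _)); first by rewrite s0.
 rewrite lee_fin expr0 mulr1; apply: ler_peMr => //; apply: expR_ge1; side.
have cm0 : 0 <= c * 2^-1 ^+ m by side.
apply: (le_trans (dS m s _)); first by rewrite s0.
have h : (renewal s (dm m) <= renewal s (fun u => (c * 2^-1 ^+ m * expR (b * u))%:E))%E.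
 apply: le_renewal => //.
 - apply/measurable_EFinP; apply: measurable_funM => //.
  apply: mcomp => //; side.
 - side.
 - by move=> u /andP[u0 us]; apply: IHm; rewrite u0 (le_trans us).
apply: (le_trans (lee_wpmul2l _ (le_trans h (renewal_exp b cm0 sT)))); first side.
rewrite muleCA; apply: (le_trans (lee_wpmul2l _ Lb)).
 side.
by rewrite -EFinM lee_fin exprS; lra.
Qed.

(** Young's inequality for the norm with weight exp (- b s) on [0, T], by Tonelli's theorem. [H]
    integrates over the whole line a kernel jointly measurable in (s, u), which provides a
    measurable extension of the weighted convolution. *)
Lemma weighted_renewal (b T : R) (g : R -> \bar R) : measfun (g : E -> \bar R) ->
 (forall u, (0 <= g u)%E) -> exists H : E -> \bar R, [/\ measfun H,
  forall s, (0 <= H s)%E,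
  forall s, 0 <= s <= T -> ((expR (- (b * s)))%:E * renewal s g = H s)%E &
  (\int[leb]_s H s <= (\int[leb]_(v in `[0%R, T]) (expR (- (b * v)) * `|phi0 v|)%:E) *
    \int[leb]_(s in `[0%R, T]) ((expR (- (b * s)))%:E * g s))%E].
Proof.
move=> mg g0.
pose I := `[0%R, T]%classic : set E.
have mII : measurable I by side.
pose w (s : E) := expR (- (b * s)).
have w0 s : 0 <= w s by side.
have mw : measfun w.
 by apply: mcomp => //; apply: mcomp.
pose G (u : E) : \bar R := (g \_ I) u.
have mG : measfun G by apply: meas_restr; [side|exact: mg].
have G0 u : (0 <= G u)%E by rewrite /G patchE; case: ifP.
have mwg : measfun (fun s : E => (w s)%:E * g s)%E.
 apply: emeasurable_funM => //; side.
pose wI : E -> \bar R := (fun s : E => (w s)%:E) \_ I.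
have mwI : measfun wI by apply: meas_restr => //; exact/measurable_EFinP.
have wI0 s : (0 <= wI s)%E by rewrite /wI patchE; case: ifP => // _; rewrite lee_fin.
pose k (x : E * E) : \bar R := (wI x.1 * (`|phi0 (x.1 - x.2)|%:E * G x.2))%E.
have mk : measfun k.
 apply: emeasurable_funM; first exact: mcomp.
 apply: emeasurable_funM; last exact: mcomp.
 apply/measurable_EFinP; apply: mcomp => //.
 apply: (mcomp meas_phi0); exact: measurable_funB.
have k0 x : (0 <= k x)%E by side.
have mF : measfun (fun s : E => \int[leb]_u k (s, u))%E.
 by apply: (measurable_fun_fubini_tonelli_F (m2 := leb) k).
have mH : measfun (fun u : E => \int[leb]_s k (s, u))%E.
 by apply: (measurable_fun_fubini_tonelli_G (m1 := leb) k).
have wkE s : 0 <= s <= T -> ((w s)%:E * renewal s g = \int[leb]_u k (s, u))%E.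
 move=> sT'; have Is : I s by rewrite /I /= in_itv.
 rewrite /renewal integral_mkcond -ge0_integralZl//; last 3 first.
 - apply: meas_restr => //; apply: emeasurable_funM => //.
  by apply/measurable_EFinP; exact: meas_phi0_shift.
 - move=> u _; rewrite patchE; case: ifP => // _; side.
 - side.
 have sI : s \in I by rewrite inE.
 apply: eq_integral => u _; rewrite /k /wI /G /= !patchE sI.
 congr (_ * _)%E; have := Is; rewrite /I /= in_itv/= => /andP[s0 sT].
 case: ifPn => [|us].
  rewrite inE /= in_itv/= => /andP[u0 us].
  by have -> : u \in I by rewrite inE /I /= in_itv/= u0 (le_trans us).
 case: ifPn => [uI|_]; last by rewrite mule0.
 rewrite /phi0 ifF ?normr0 ?mul0e//; apply/negP => su.
 move/negP : us; apply; rewrite inE /= in_itv/=.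
 by move: uI; rewrite inE /I /= in_itv/= => /andP[-> _] /=; rewrite -subr_ge0 su.
exists (fun s => \int[leb]_u k (s, u))%E; split => //.
 side.
rewrite (fubini_tonelli (m1 := leb) (m2 := leb) k)//.
set J := (X in (_ <= X * _)%E).
have J0 : (0 <= J)%E by side.
pose f : E -> \bar R := (fun v : E => (w v * `|phi0 v|)%:E) \_ I.
have mf : measfun f.
 apply: meas_restr => //; apply/measurable_EFinP; apply: measurable_funM => //.
 by apply: mcomp => //; exact: meas_phi0.
have f0 v : (0 <= f v)%E by rewrite /f patchE; case: ifP => // _; rewrite lee_fin mulr_ge0.
rewrite [X in (_ <= _ * X)%E]integral_mkcond -ge0_integralZl//; last 2 first.
- exact: meas_restr.
- move=> u _; rewrite patchE; case: ifP => // _; side.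
apply: ge0_le_integral => //.
- side.
- by apply: emeasurable_funM => //; exact: meas_restr.
move=> u _; have [uI|uI] := boolP (u \in I); last first.
 rewrite integral0_eq; last by move=> s _; rewrite /k /= /G patchE (negbTE uI) !mule0.
 by rewrite patchE (negbTE uI) mule0.
rewrite patchE uI.
have /andP[u0 uT] : 0 <= u <= T by move: uI; rewrite inE /I /= in_itv.
have mfu : measfun (fun s : E => f (s - u)%R).
 by apply: (mcomp mf); exact: measurable_funB.
apply: (@le_trans _ _ (((w u)%:E * g u) * \int[leb]_s f (s - u)%R)%E); last first.
 by rewrite (ge0_int_shift u mf f0) /f -integral_mkcond muleC.
rewrite -ge0_integralZl//; last side.
apply: ge0_le_integral => //.
- exact: measurable_fun_pair1 mk.
- side.
move=> s _; rewrite /k /wI /= patchE; case: ifPn => [sI|_]; last by rewrite mul0e mule_ge0// mule_ge0// lee_fin.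
have /andP[s0 sT] : 0 <= s <= T by move: sI; rewrite inE /I /= in_itv.
rewrite /G patchE uI.
have [su|su] := leP 0 (s - u); last first.
 by rewrite {1}/phi0 ifF ?normr0 ?mul0e ?mule0 ?mule_ge0 ?mule_ge0 ?lee_fin//; apply/negbTE; rewrite -ltNge.
rewrite /f patchE mem_set; last by rewrite /I /= in_itv/= su; lra.
rewrite /w (_ : expR (- (b * s)) = expR (- (b * u)) * expR (- (b * (s - u)))); last first.
 by rewrite -expRD; congr expR; ring.
rewrite !EFinM muleACA [leLHS](_ : _ = (((expR (- (b * u)))%:E * g u) * ((expR (- (b * (s - u))))%:E * `|phi0 (s - u)|%:E))%E)//.
by rewrite muleACA [RHS]muleACA; congr (_ * _)%E; exact: muleC.
Qed.

(** In the weighted norm the inequality reads W <= W / 2 + c T, and W / 2 is absorbed because W is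
    finite; removing the weight costs exp (b T). The constant is fixed before [c] and [g], whence
    bounds uniform in the number of vertices. *)
Lemma gronwall (L T : R) : 0 <= L -> 0 <= T -> exists2 C, 0 <= C &
 forall (c : R) (g : R -> \bar R), 0 <= c -> measfun (g : E -> \bar R) ->
  (forall u, (0 <= g u)%E) ->
  (forall s, 0 <= s <= T -> (g s <= L%:E * renewal s g + c%:E)%E) ->
  (\int[leb]_(s in `[0%R, T]) g s < +oo)%E ->
  (\int[leb]_(s in `[0%R, T]) g s <= (C * c)%:E)%E.
Proof.
move=> L0 T0; have [b b0 Lb] := phi_decay T L0.
exists (2 * T * expR (b * T)); first side.
move=> c g c0 mg g0 gren gfin.
have mI (t : R) : measurable (`[0%R, t]%classic : set E) by side.
pose I := `[0%R, T]%classic : set E.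
have mII : measurable I := mI T.
pose w (s : E) := expR (- (b * s)).
have w0 s : 0 <= w s by side.
have mw : measfun w.
 by apply: mcomp => //; apply: mcomp.
pose W := (\int[leb]_(s in I) ((w s)%:E * g s))%E.
have mwg : measfun (fun s : E => (w s)%:E * g s)%E.
 apply: emeasurable_funM => //; side.
have w1 s : I s -> w s <= 1.
 by rewrite /I /= in_itv/= => /andP[s0 _]; rewrite /w expR_le1 oppr_le0 mulr_ge0.
have Wfin : (W < +oo)%E.
 apply: le_lt_trans gfin; apply: ge0_le_integral => //.
 - side.
 - side.
 - side.
 - by move=> s Is; rewrite -[leRHS]mul1e lee_wpmul2r// lee_fin w1.
have W0 : (0 <= W)%E by side.
have [H [mH H0 HE Hle]] := weighted_renewal b T mg g0.
have hI : leb I = T%:E.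
 rewrite /I lebesgue_measure_itv/= lte_fin; case: ltP => h; rewrite ?sube0//.
 by congr EFin; apply/eqP; rewrite eq_le h T0.
have {}Wle : (W <= (1 / 2)%:E * W + (c * T)%:E)%E.
 apply: (@le_trans _ _ (\int[leb]_(s in I) (L%:E * H s + c%:E))%E).
  apply: ge0_le_integral => //.
  - side.
  - side.
  - apply: measurable_funTS; side.
  move=> s Is; have sT : 0 <= s <= T by move: Is; rewrite /I /= in_itv.
  apply: (@le_trans _ _ ((w s)%:E * (L%:E * renewal s g + c%:E))%E).
   by rewrite lee_wpmul2l ?lee_fin//; exact: gren.
  rewrite ge0_muleDr ?lee_fin//; last side.
  apply: leeD; first by rewrite muleCA HE.
  by rewrite -[leRHS]mul1e lee_wpmul2r ?lee_fin// w1.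
 rewrite ge0_integralD//; last 2 first.
 - side.
 - side.
 apply: leeD; last first.
  by rewrite integral_cst// [leLHS](_ : _ = (c * T)%:E)// EFinM; congr (_ * _)%E.
 rewrite ge0_integralZl//; last side.
 apply: (@le_trans _ _ (L%:E * \int[leb]_s H s)%E).
  by rewrite lee_wpmul2l ?lee_fin//; apply: ge0_subset_integral.
 apply: (le_trans (lee_wpmul2l _ Hle)); first side.
 by rewrite muleA; apply: lee_wpmul2r.
have Wf : W \is a fin_num by rewrite ge0_fin_numE.
have {}Wle : (W <= (2 * (c * T))%:E)%E.
 move: Wle; rewrite -(fineK Wf) -EFinM -EFinD !lee_fin; lra.
apply: (@le_trans _ _ ((expR (b * T))%:E * W)%E).
 rewrite /W -ge0_integralZl//; last 2 first.
 - side.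
 - side.
 apply: ge0_le_integral => //.
 - side.
 - side.
 move=> s; rewrite /= in_itv/= => /andP[s0 sT].
 rewrite muleA -[leLHS]mul1e lee_wpmul2r// -EFinM lee_fin /w -expRD expR_ge1//.
 by rewrite -mulrBr mulr_ge0// subr_ge0.
apply: (le_trans (lee_wpmul2l _ Wle)); first side.
by rewrite -EFinM lee_fin; lra.
Qed.

Variables (h : R -> R) (L : R).
Hypotheses (h0 : forall x, 0 <= h x) (L0 : 0 <= L)
 (hL : lip L h).

Lemma meas_lip : measfun h.
Proof.
apply: continuous_measurable_fun => x; apply/cvgrPdist_lt => e e0.
have Lp : 0 < L + 1 by rewrite ltr_wpDl.
near=> y; apply: (le_lt_trans (hL x y)).
apply: (@le_lt_trans _ _ ((L + 1) * `|x - y|)); first by rewrite ler_wpM2r// lerDl.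
rewrite -ltr_pdivlMl// mulrC; near: y; apply: (@cvgr_dist_lt _ _ _ (nbhs x) _ id x) => //.
side.
Unshelve. all: by end_near. Qed.

Lemma renewal_bounded s (lam : R -> R) M : measfun (lam : E -> R) ->
 (forall u, 0 <= u <= s -> 0 <= lam u <= M) -> (0 <= M) ->
 leb.-integrable `[0%R, s]%classic (fun u : E => (phi0 (s - u) * lam u)%:E).
Proof.
move=> ml lM M0; have mI : measurable (`[0%R, s]%classic : set E) by exact: measurable_itv.
have ms : measfun (fun u : E => phi0 (s - u)).
 by apply: (mcomp meas_phi0); exact: measurable_funB.
apply/integrableP; split.
 apply: measurable_funTS; side.
apply: (@le_lt_trans _ _ (renewal s (fun=> (M * expR (0 * s))%:E))).
 apply: ge0_le_integral => //.
 - apply: measurable_funTS; apply/measurable_EFinP; apply: mcomp => //.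
  exact: measurable_funM.
 - apply: measurable_funTS; apply: emeasurable_funM => //; apply/measurable_EFinP.
  exact: meas_phi0_shift.
 - move=> u; rewrite /= in_itv/= => /lM/andP[l0 lM'].
  by rewrite lee_fin normrM mul0r expR0 mulr1 ler_wpM2l// ger0_norm.
have := renewal_exp 0 M0 (lexx s).
rewrite (_ : (fun u : R => _) = (fun=> (M * expR (0 * s))%:E)); last first.
 by apply/funext => u; rewrite !mul0r.
move=> /le_lt_trans; apply; apply: lte_mul_pinfty; rewrite ?lee_fin ?mulr_ge0 ?expR_ge0//.
under eq_integral do rewrite mul0r oppr0 expR0 mul1r.
exact: l1_phi0.
Qed.

Definition drive (lam : R -> R) (s : R) : R :=
 \int[leb]_(u in `[0%R, s]) (phi0 (s - u) * lam u).

Lemma drive_dist s (lam lam' : R -> R) M : measfun (lam : E -> R) ->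
 measfun (lam' : E -> R) ->
 (forall u, 0 <= u <= s -> 0 <= lam u <= M) -> (forall u, 0 <= u <= s -> 0 <= lam' u <= M) ->
 0 <= M -> ((`|h (drive lam s) - h (drive lam' s)|)%:E <=
  L%:E * renewal s (fun u => (`|lam u - lam' u|)%:E))%E.
Proof.
move=> ml ml' lM lM' M0; have mI : measurable (`[0%R, s]%classic : set E) by exact: measurable_itv.
have i1 := renewal_bounded ml lM M0; have i2 := renewal_bounded ml' lM' M0.
apply: (@le_trans _ _ (L * `|drive lam s - drive lam' s|)%:E); first side.
rewrite EFinM lee_wpmul2l ?lee_fin// /drive -RintegralB//.
have ms : measfun (fun u : E => phi0 (s - u)).
 by apply: (mcomp meas_phi0); exact: measurable_funB.
have i3 : leb.-integrable `[0%R, s]%classic (fun u : E => (phi0 (s - u) * lam u - phi0 (s - u) * lam' u)%:E).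
 by have := integrableB mI i1 i2.
have -> : renewal s (fun u => (`|lam u - lam' u|)%:E) =
  (\int[leb]_(u in `[0%R, s]) `|(phi0 (s - u) * lam u - phi0 (s - u) * lam' u)%:E|)%E.
 by apply: eq_integral => u _; rewrite -mulrBr abse_EFin normrM EFinM.
rewrite /Rintegral -abse_EFin fineK; last exact: integrable_fin_num.
by apply: le_abse_integral => //; have /integrableP[] := i3.
Qed.

Lemma meas_drive (lam : R -> R) : measfun (lam : E -> R) ->
 measfun (drive lam : E -> R).
Proof.
move=> ml; pose lam1 (u : E) : R := if 0 <= u then lam u else 0.
have ml1 : measfun lam1.
 apply: measurable_fun_ifT => //; apply: measurable_fun_ler => //.
pose k (x : E * E) : \bar R := (phi0 (x.1 - x.2) * lam1 x.2)%:E.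
have mk : measfun k.
 apply/measurable_EFinP; apply: measurable_funM; last exact: mcomp.
 by apply: (mcomp meas_phi0); exact: measurable_funB.
rewrite (_ : drive lam = fun s => fine (\int[leb]_u k (s, u))%E).
 apply: mcomp => //.
 rewrite (_ : (fun s => _) = (fun s => \int[leb]_u k^\+ (s, u) - \int[leb]_u k^\- (s, u))%E).
  apply: emeasurable_funB.
   by apply: (measurable_fun_fubini_tonelli_F (m2 := leb) (k^\+)%E) => //; exact: measurable_funepos.
  by apply: (measurable_fun_fubini_tonelli_F (m2 := leb) (k^\-)%E) => //; exact: measurable_funeneg.
 by apply/funext => s; rewrite [LHS]integralE; congr (_ - _)%E;
  apply: eq_integral => u _; rewrite ?funeposE ?funenegE.
apply/funext => s; rewrite /drive /Rintegral; congr fine.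
rewrite integral_mkcond; apply: eq_integral => u _; rewrite patchE /k /lam1 /=.
case: ifPn => [|us]; first by rewrite inE /= in_itv/= => /andP[-> _].
case: ifPn => u0; last by rewrite mulr0.
rewrite /phi0 ifF ?mul0r//; apply/negP => su; move/negP : us; apply.
by rewrite inE /= in_itv/= u0 -subr_ge0.
Qed.

Fixpoint picard (m : nat) : R -> R :=
 if m is m'.+1 then fun s => h (drive (picard m') s) else fun=> 0.

Lemma meas_picard m : measfun (picard m : E -> R).
Proof.
elim: m => [|m IHm] /=; first side.
by apply: (mcomp meas_lip); exact: meas_drive.
Qed.

Lemma picard_ge0 m s : 0 <= picard m s.
Proof. by case: m => [|m] //=. Qed.

Lemma drive0 s : drive (fun=> 0) s = 0.
Proof.
rewrite /drive /Rintegral; under eq_integral do rewrite mulr0.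
by rewrite integral0.
Qed.

Lemma picard_locally_bounded m T : exists2 M, 0 <= M & forall u, 0 <= u <= T -> 0 <= picard m u <= M.
Proof.
elim: m => [|m [M M0 IHm]]; first by exists 0 => // u _ /=; rewrite lexx.
pose J := (\int[leb]_(v in `[0%R, T]) (expR (- (0 * v)) * `|phi0 v|)%:E)%E.
have J0 : (0 <= J)%E by side.
have Jf : J \is a fin_num.
 rewrite ge0_fin_numE// /J; under eq_integral do rewrite mul0r oppr0 expR0 mul1r.
 exact: l1_phi0.
exists (h 0 + L * (M * fine J)); first by rewrite addr_ge0// !mulr_ge0// fine_ge0.
move=> s /andP[s0 sT]; rewrite picard_ge0 /=.
have bs u : 0 <= u <= s -> 0 <= picard m u <= M.
 by move=> /andP[u0 us]; apply: IHm; rewrite u0 (le_trans us).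
have b0 u : 0 <= u <= s -> 0 <= (0 : R) <= M by rewrite lexx.
have := drive_dist (meas_picard m) (measurable_cst (0 : R)) bs b0 M0.
rewrite drive0 => hd.
have : ((`|h (drive (picard m) s) - h 0|)%:E <= (L * (M * fine J))%:E)%E.
 apply: (le_trans hd); rewrite EFinM lee_wpmul2l ?lee_fin//.
 apply: (@le_trans _ _ (renewal s (fun u => (M * expR (0 * u))%:E))).
  apply: le_renewal.
  - by apply/measurable_EFinP; apply: mcomp => //; apply: measurable_funB => //; exact: meas_picard.
  - apply/measurable_EFinP; apply: measurable_funM => //.
   apply: mcomp => //; side.
  - by [].
  - side.
  - move=> u /bs /andP[p0 pM]; rewrite lee_fin mul0r expR0 mulr1 subr0 ger0_norm//.
 apply: (le_trans (renewal_exp 0 M0 sT)).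
 by rewrite mul0r expR0 mulr1 EFinM fineK.
by rewrite lee_fin ler_norml => /andP[_]; lra.
Qed.

Lemma limit_rate_exists : exists lam : R -> R, [/\
 measfun (lam : E -> R), forall s, 0 <= lam s,
 loc_bounded lam &
 forall s, 0 <= s -> lam s = h (drive lam s)].
Proof.
pose dm m (u : R) : \bar R := (`|picard m.+1 u - picard m u|)%:E.
have mdm m : measfun (dm m : E -> \bar R).
 apply/measurable_EFinP; apply: mcomp => //.
 by apply: measurable_funB; [exact: (meas_picard m.+1)|exact: meas_picard].
have dm0 m u : (0 <= dm m u)%E by side.
have bound T : exists2 b, 0 <= b &
  (L%:E * \int[leb]_(v in `[0%R, T]) (expR (- (b * v)) * `|phi0 v|)%:E <= (1 / 2)%:E)%E /\
  forall m s, 0 <= s <= T -> `|picard m.+1 s - picard m s| <= h 0 * expR (b * s) * 2^-1 ^+ m.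
 have [b b0 Lb] := phi_decay T L0; exists b => //; split => // m s sT.
 rewrite -lee_fin mulrAC.
 have := @picard_bound L b (h 0) T dm (h0 0) L0 b0 Lb mdm dm0 _ _ m s sT; apply.
  by move=> u _; rewrite /dm /= drive0 subr0 ger0_norm.
 move=> {}m {}s {sT} /andP[s0 sT].
 have [M M0 hM] := picard_locally_bounded m T; have [M' M'0 hM'] := picard_locally_bounded m.+1 T.
 apply: (@drive_dist s (picard m.+1) (picard m) (Num.max M M')).
 - exact: (meas_picard m.+1).
 - exact: meas_picard.
 - move=> u /andP[u0 us]; have /hM' /andP[-> h2] : 0 <= u <= T by rewrite u0 (le_trans us).
  by rewrite /= le_max h2 orbT.
 - move=> u /andP[u0 us]; have /hM /andP[-> h2] : 0 <= u <= T by rewrite u0 (le_trans us).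
  by rewrite /= le_max h2.
 - by rewrite le_max M0.
have conv s : exists2 K, 0 <= K & forall m, `|picard m.+1 s - picard m s| <= K * 2^-1 ^+ m.
 have [s0|s0] := leP 0 s.
  have [b b0 [_ hb]] := bound s; exists (h 0 * expR (b * s)); first side.
  by move=> m; apply: hb; rewrite s0 lexx.
 (* At negative times the drive is an integral over the empty interval, so the iterates equal [h 0]
    from the first on. *)
 have d0 lam : drive lam s = 0.
  rewrite /drive /Rintegral (_ : `[0%R, s]%classic = set0) ?integral_set0//.
  by apply/seteqP; split => // u /=; rewrite in_itv/= => /andP[u0 /(le_trans u0)]; rewrite leNgt s0.
 exists (h 0) => // -[|m] /=; first by rewrite expr0 mulr1 d0 subr0 ger0_norm.
 by rewrite !d0 subrr normr0 mulr_ge0// exprn_ge0.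
pose lam s := limn (picard ^~ s).
have cl s : picard ^~ s @ \oo --> lam s.
 by have [K _ /geometric_limit[l hl _]] := conv s; rewrite /lam (cvg_lim _ hl).
have rate T : 0 <= T -> exists2 b, 0 <= b &
  (L%:E * \int[leb]_(v in `[0%R, T]) (expR (- (b * v)) * `|phi0 v|)%:E <= (1 / 2)%:E)%E /\
  forall m s, 0 <= s <= T -> `|picard m s - lam s| <= 2 * (h 0 * expR (b * s)) * 2^-1 ^+ m.
 move=> T0; have [b b0 [Lb hb]] := bound T; exists b => //; split => // m s sT.
 have [l hl hm] := geometric_limit (fun m => hb m s sT).
 by rewrite /lam (cvg_lim _ hl).
have mlam : measfun (lam : E -> R).
 apply: (measurable_fun_cvg meas_picard) => s _; side.
have lam0 s : 0 <= lam s.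
 by apply: limr_ge; [apply/cvg_ex; exists (lam s)|apply: nearW => m; exact: picard_ge0].
have lamb T : exists2 M, 0 <= M & forall u, 0 <= u <= T -> 0 <= lam u <= M.
 have [T0|T0] := leP 0 T; last first.
  by exists 0 => // u /andP[u0 /(le_trans u0)]; rewrite leNgt T0.
 have [b b0 [_ hb]] := rate T T0; exists (2 * (h 0 * expR (b * T))).
  side.
 move=> u /andP[u0 uT]; rewrite lam0 /=.
 have := hb 0%N u; rewrite u0 uT => /(_ isT); rewrite /= sub0r normrN ger0_norm// expr0 mulr1.
 move=> /le_trans; apply; rewrite ler_pM2l// ler_wpM2l// ler_expR ler_wpM2l//.
exists lam; split => // s s0.
have [b b0 [Lb hb]] := rate s s0.
have [M M0 hM] := lamb s.
(* The same sequence is shown to converge to [h (drive lam s)], by the contraction estimate applied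
   to the geometric error of the iterates. *)
apply/esym/(cvg_unique _ _ (_ : (fun m => picard m.+1 s) @ \oo --> lam s)) => //; last first.
 rewrite (cvg_shiftS (picard ^~ s)); side.
have lim0 := cvg_geometric0 (2 * (h 0 * expR (b * s))).
 apply/cvgrPdist_le => e e0.
move/cvgrPdist_le : lim0 => /(_ e e0); apply: filterS => m.
rewrite sub0r normrN => /(le_trans (ler_norm _)); apply: le_trans.
have [M' M'0 hM'] := picard_locally_bounded m s.
rewrite -lee_fin; have := @drive_dist s lam (picard m) (Num.max M M') mlam (meas_picard m).
move=> /(_ _ _ _) hd; apply: (le_trans (hd _ _ _)) => {hd}.
- by move=> u /hM /andP[-> h2]; rewrite /= le_max h2.
- by move=> u /hM' /andP[-> h2]; rewrite /= le_max h2 orbT.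
- by rewrite le_max M0.
pose c := 2 * h 0 * 2^-1 ^+ m.
have c0 : 0 <= c by side.
apply: (@le_trans _ _ (L%:E * renewal s (fun u => (c * expR (b * u))%:E))%E).
 rewrite lee_wpmul2l ?lee_fin//; apply: le_renewal => //.
 - apply/measurable_EFinP; apply: mcomp => //; apply: measurable_funB => //.
  exact: meas_picard.
 - apply/measurable_EFinP; apply: measurable_funM => //.
  apply: mcomp => //; side.
 - side.
 - by move=> u us; rewrite lee_fin distrC (le_trans (hb m u us))// /c; lra.
apply: (le_trans (lee_wpmul2l _ (renewal_exp b c0 (lexx s)))); first side.
rewrite muleCA; apply: (le_trans (lee_wpmul2l _ Lb)); first side.
rewrite -EFinM lee_fin /c.
have : 0 <= h 0 * expR (b * s) * 2^-1 ^+ m by side.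
by move: (2^-1 ^+ m) (expR _) => x y; lra.
Qed.

End renewal.

Ltac side_more m ::= first [exact: meas_box | exact: meas_phi0].

Section measurable.
Context d (T : measurableType d) (R : realType).

Lemma meas_set_bool (f : T -> bool) : measfun f -> measurable [set x | f x].
Proof.
move=> mf; rewrite -[X in measurable X]setTI (_ : [set x | f x] = f @^-1` [set true]).
 exact: mf.
side.
Qed.

Lemma meas_set_le (f g : T -> R) : measfun f -> measfun g ->
 measurable [set x | f x <= g x].
Proof. by move=> mf mg; apply: meas_set_bool; exact: measurable_fun_ler. Qed.

Lemma meas_set_lt (f g : T -> R) : measfun f -> measfun g ->
 measurable [set x | f x < g x].
Proof. by move=> mf mg; apply: meas_set_bool; exact: measurable_fun_ltr. Qed.

Lemma meas_set_lte (f g : T -> \bar R) : measfun f -> measfun g ->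
 measurable [set x | (f x < g x)%E].
Proof. by move=> mf mg; apply: meas_set_bool; exact: measurable_fun_lte. Qed.
End measurable.

(** * Paths that count the points of a region *)

Section counting.
Context (R : realType).
Local Notation E := (measurableTypeR R).

Definition upto (t : R) : set (plane R) := [set y | y.1 <= t].

Lemma meas_upto t : measurable (upto t).
Proof.
rewrite (_ : upto t = `]-oo, t]%classic `*` setT); first side.
side.
Qed.

Lemma upto_subset s t : s <= t -> upto s `<=` upto t.
Proof. by move=> st y /= /le_trans; exact. Qed.

Variables (m : {measure set (plane R) -> \bar R}) (S : set (plane R)).

Definition admissible := [/\ measurable S, m (S `&` [set y | y.1 < 0]) = 0%E &
 forall n : nat, (m (S `&` upto n%:R) < +oo)%E].

Definition tally (t : R) : R := fine (m (S `&` upto t)).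

Hypothesis adm : admissible.

Let mS : measurable S. Proof. by have [] := adm. Qed.

Let mSu t : measurable (S `&` upto t).
Proof. by apply: measurableI => //; exact: meas_upto. Qed.

Lemma tally_lt_pinfty t : (m (S `&` upto t) < +oo)%E.
Proof.
have [_ _ /(_ (Num.truncn t).+1)] := adm; apply: le_lt_trans; apply: le_measure; rewrite ?inE//.
by apply: setIS; apply: upto_subset; exact/ltW/truncnS_gt.
Qed.

Lemma tallyE t : (tally t)%:E = m (S `&` upto t).
Proof. by rewrite fineK// ge0_fin_numE// tally_lt_pinfty. Qed.

Lemma tally_nd : nondecreasing tally.
Proof.
move=> s t st; rewrite -lee_fin !tallyE; apply: le_measure; rewrite ?inE//.
by apply: setIS; exact: upto_subset.
Qed.

Lemma tally_lt0 t : t < 0 -> tally t = 0.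
Proof.
move=> t0; apply: EFin_inj; rewrite tallyE; apply/eqP; rewrite eq_le measure_ge0 andbT.
have [_ S0 _] := adm; rewrite -[leRHS]S0; apply: le_measure; rewrite ?inE//.
 apply: measurableI => //; rewrite (_ : [set _ | _] = `]-oo, 0%R[%classic `*` setT).
  side.
 side.
by apply: setIS => y /= /le_lt_trans; exact.
Qed.

Lemma tally_right_continuous t : tally x @[x --> t^'+] --> tally t.
Proof.
have cv : (fun n : nat => tally (t + n.+1%:R^-1)) @ \oo --> tally t.
 have : (m \o (fun n : nat => S `&` upto (t + n.+1%:R^-1))) @ \oo -->
   m (\bigcap_n (S `&` upto (t + n.+1%:R^-1))).
  apply: nonincreasing_cvg_mu => //; first exact: tally_lt_pinfty.
   side.
  move=> i j ij; apply/subsetPset; apply: setIS; apply: upto_subset.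
  by rewrite lerD2l lef_pV2 ?posrE// ler_nat.
 rewrite (_ : \bigcap_n _ = S `&` upto t); last first.
  rewrite bigcapIr; last side.
  congr setI; apply/seteqP; split => [y hy|y yt n _]; last first.
   by apply: upto_subset yt; rewrite lerDl.
  rewrite /upto /=; apply/ler_addgt0Pr => e e0.
  have [n ne] : exists n : nat, n.+1%:R^-1 < e.
   exists (Num.truncn e^-1); rewrite invf_plt ?posrE//; exact: truncnS_gt.
  by apply: (le_trans (hy n _)) => //; rewrite lerD2l ltW.
 rewrite -tallyE => /fine_cvgP[_]; exact.
apply/cvgrPdist_le => e e0.
have /cvgrPdist_le/(_ e e0)[N _ /(_ N (leqnn N))] := cv.
rewrite distrC ger0_norm ?subr_ge0; last by apply: tally_nd; rewrite lerDl.
move=> hN; near=> x.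
have tx : t < x by side.
rewrite distrC ger0_norm ?subr_ge0; last by apply: tally_nd; exact: ltW.
apply: le_trans hN; rewrite lerD2r; apply: tally_nd; apply: ltW; near: x.
by apply: nbhs_right_lt; rewrite ltrDl invr_gt0.
Unshelve. all: by end_near. Qed.

Lemma tally_cadlag : is_cadlag tally.
Proof.
split=> [|t _|t _]; first exact: tally_lt0; first exact: tally_right_continuous.
apply: nondecreasing_at_left_is_cvgr; near=> x.
 by move=> a b _ _; exact: tally_nd.
exists (tally t) => _ [y + <-]; rewrite /= in_itv/= => /andP[_ yt].
apply: tally_nd; side.
Unshelve. all: by end_near. Qed.

(** Both are measures with the same values on the intervals []a, b]]. This turns the integrals
    against dZ of the equations into integrals over the accepted points of the noise. *)
Lemma stieltjes_tally (B : set E) : measurable B ->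
 stieltjes tally B = m (S `&` (fst @^-1` B)).
Proof.
move=> mB; rewrite /stieltjes; case: pselect => [[nd rc]|]; last first.
 by case; split; [exact: tally_nd|move=> t; exact: tally_right_continuous].
pose mu := image_mu (mrestr m mS) (@measurable_fst _ _ E E).
have muE A : mu A = m (S `&` fst @^-1` A) by rewrite /= /pushforward /mrestr setIC.
rewrite -muE; apply: (@lebesgue_stieltjes_measure_unique R (cumulative_of nd rc) mu) => // X [[a b] _ <-] /=.
change (lebesgue_stieltjes_measure (cumulative_of nd rc) `]a, b]%classic = mu `]a, b]%classic).
rewrite muE; have [ba|ab] := leP b a.
 rewrite (_ : `]a, b]%classic = set0) ?measure0 ?preimage_set0 ?setI0 ?measure0//.
 by rewrite set_itv_ge// bnd_simp -leNgt.
rewrite /lebesgue_stieltjes_measure /measure_extension measurable_mu_extE/=; last exact: is_ocitv.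
rewrite wlength_itv_bnd; last side.
rewrite /cumulative_of EFinB !tallyE.
rewrite (_ : S `&` upto b = (S `&` upto a) `|` (S `&` fst @^-1` `]a, b]%classic)); last first.
 rewrite -setIUr; congr setI; apply/seteqP; split => y; rewrite /upto /= in_itv/=.
  by move=> yb; have [ya|ay] := leP y.1 a; [left|right].
 move=> [/le_trans|/andP[]//]; apply; side.
rewrite measureU//.
- by rewrite addeAC subee ?add0e// ge0_fin_numE// tally_lt_pinfty.
- apply: measurableI => //; rewrite -[X in measurable X]setTI.
 apply: measurable_fst => //; side.
- apply/seteqP; split => // y [[_ ya] [_ +]]; rewrite /= in_itv/= => /andP[/lt_le_trans/(_ ya)].
 by rewrite ltxx.
Qed.

Lemma ge0_int_stieltjes_tally (g : E -> \bar R) : measfun g ->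
 (forall u, 0 <= g u)%E -> (\int[stieltjes tally]_u g u = \int[m]_(y in S) g y.1)%E.
Proof.
move=> mg g0.
rewrite (@eq_measure_integral _ _ _ _ (image_mu (mrestr m mS) (@measurable_fst _ _ E E))); last first.
 by move=> A mA _; rewrite stieltjes_tally//= /pushforward /mrestr setIC.
rewrite ge0_int_image_measure// ge0_int_mrestr//.
apply: mcomp => //; side.
Qed.

Lemma int_stieltjes_tally (D : set E) (g : E -> R) : measurable D -> measfun g ->
 \int[stieltjes tally]_(u in D) g u = \int[m]_(y in S `&` (fst @^-1` D)) g y.1.
Proof.
move=> mD mg; rewrite /Rintegral; congr fine.
have key (f : E -> \bar R) : measfun f -> (forall u, 0 <= f u)%E ->
  (\int[stieltjes tally]_(u in D) f u = \int[m]_(y in S `&` (fst @^-1` D)) f y.1)%E.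
 move=> mf f0; rewrite integral_mkcond ge0_int_stieltjes_tally; last 2 first.
  exact: meas_restr.
  by move=> u; rewrite patchE; case: ifP.
 rewrite integral_mkcondr; apply: eq_integral => y _; rewrite !patchE.
 side.
have mg' : measfun (EFin \o g) by side.
rewrite integralE key ?[in LHS]key; [|exact: measurable_funeneg|side|
 exact: measurable_funepos|exact: funepos_ge0].
by rewrite [in RHS]integralE; congr (_ - _)%E; apply: eq_integral => y _; rewrite ?funeposE ?funenegE.
Qed.

Definition is_step_path (x : R -> R) := is_cadlag x /\ nondecreasing x /\ forall t, exists n : nat, x t = n%:R.

End counting.

Section counting.
Context (R : realType).
Local Notation E := (measurableTypeR R).

Definition tally_path (m : {measure set (plane R) -> \bar R}) (S : set (plane R)) : skorokhod R :=
 match pselect (admissible m S) with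
 | left H => Skorokhod (tally_cadlag H)
 | right _ => Skorokhod (@is_cadlag0 R)
 end.

Lemma tally_pathE m S : admissible m S -> tally_path m S = tally m S :> (R -> R).
Proof. by rewrite /tally_path; case: pselect. Qed.

(** Valid for every outcome, because the default path of a non-admissible region is a step path too;
    the coding of paths below relies on this. *)
Lemma tally_path_step m S : count_measure m -> is_step_path (tally_path m S).
Proof.
move=> [_ mc _]; rewrite /tally_path; case: pselect => [H|H] /=; last first.
 split; [exact: is_cadlag0|split => // t; by exists 0%N].
split; [exact: tally_cadlag|split; [exact: tally_nd|move=> t]].
have mS : measurable (S `&` upto t) by have [? _ _] := H; apply: measurableI => //; exact: meas_upto.
have := tally_lt_pinfty H t; rewrite /tally; case: (mc _ mS) => [->|[n ->]] // _.
by exists n.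
Qed.

Lemma meas_to_skorokhod d (X : measurableType d) (f : X -> skorokhod R) :
 (forall t, 0 <= t -> measfun (fun x => f x t)) -> measfun f.
Proof.
move=> mf; apply: (measurability (@coordinate_events R)) => // _ [_ [t [B [t0 mB ->]]] <-].
by rewrite setTI; have := mf t t0 measurableT B mB; rewrite setTI.
Qed.

Lemma meas_coordinate t : measfun (fun z : skorokhod R => z t).
Proof.
have [t0|t0] := leP 0 t.
 move=> _ B mB; rewrite setTI; apply: sub_sigma_algebra; exists t, B; split => //.
rewrite (_ : (fun z => _) = cst 0); first side.
by apply/funext => z; have [/(_ _ t0)] := skorokhod_cadlag z.
Qed.

Section measurability.
Context d (X : measurableType d) (k : X -> {measure set (plane R) -> \bar R}) (S : set (X * plane R)).
Hypotheses (mS : measurable S) (mI : forall B : set (plane R), measurable B ->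
 measfun (fun x => k x (xsection S x `&` B))).

Lemma meas_adm : measurable [set x | admissible (k x) (xsection S x)].
Proof.
have mneg : measurable ([set y | y.1 < 0] : set (plane R)).
 rewrite (_ : [set _ | _] = `]-oo, 0%R[%classic `*` setT).
  side.
 side.
rewrite (_ : [set x | _] = [set x | k x (xsection S x `&` [set y | y.1 < 0]) = 0%E] `&`
  \bigcap_n [set x | (k x (xsection S x `&` upto n%:R) < +oo)%E]); last first.
 apply/seteqP; split => x /=; first by move=> [_ ? h]; split => // n _; exact: h.
 by move=> [? h]; split => //; [exact: measurable_xsection|move=> n; exact: h].
apply: measurableI.
 rewrite -[X in measurable X]setTI; exact: (mI mneg measurableT (emeasurable_set1 0)).
apply: bigcapT_measurable => n; apply: meas_set_lte; [exact: mI (@meas_upto R n%:R)|side].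
Qed.

Lemma meas_tally_path_of : measfun (fun x => tally_path (k x) (xsection S x)).
Proof.
apply: meas_to_skorokhod => t t0.
rewrite (_ : (fun x => _) = fun x => if x \in [set x | admissible (k x) (xsection S x)]
  then fine (k x (xsection S x `&` upto t)) else 0); last first.
 apply/funext => x; rewrite /tally_path; case: pselect => [H|H] /=.
  by rewrite mem_set.
 by rewrite memNset.
apply: measurable_fun_ifT => //; last first.
 by apply: mcomp => //; exact: mI (@meas_upto R t).
apply: (measurable_fun_bool true); rewrite setTI (_ : _ @^-1` _ = [set x | admissible (k x) (xsection S x)]).
 exact: meas_adm.
by apply/seteqP; split => x /=; [exact: set_mem|exact: mem_set].
Qed.
End measurability.

Lemma meas_tally_path d (X : measurableType d) (k : R.-ker X ~> plane R) (S : set (X * plane R)) :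
 (forall x n, (k x (box n) < +oo)%E) -> measurable S ->
 measfun (fun x => tally_path (k x) (xsection S x)).
Proof.
move=> kfin mS; apply: meas_tally_path_of => // B mB.
rewrite (_ : (fun x => _) = fun x => k x (xsection (S `&` (setT `*` B)) x)); last first.
 apply/funext => x; congr (k x _); apply/seteqP; split => y; rewrite /xsection /= !inE /=.
  by move=> [].
 by move=> [? []].
apply: (meas_kernel_xsection (k := k) (D := @box R)) => //; [side|exact: box_nd|exact: box_cover|].
side.
Qed.
End counting.

Section rates.
Context (R : realType).
Local Notation E := (measurableTypeR R).

Definition rate_reg (lam : R -> R) : set (plane R) := [set y | 0 <= y.1 /\ 0 <= y.2 <= lam y.1].

Lemma thinningE (m : {measure set (plane R) -> \bar R}) (lam : R -> R) t :
 measurable (rate_reg lam) -> thinning m lam t = m (rate_reg lam `&` upto t).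
Proof.
move=> mS; rewrite /thinning.
pose D : set (plane R) := `[0, t]%classic `*` `[0, +oo[%classic.
have mD : measurable D by side.
have e : rate_reg lam `&` upto t = (rate_reg lam `&` upto t) `&` D.
 apply/seteqP; split => [[u z] /= [[u0 /andP[z0 zl]] ut]|y []//].
 split; first by split => //; split => //=; rewrite z0.
 rewrite /D /= !in_itv/= u0 z0; side.
rewrite e -integral_indic//; last by apply: measurableI => //; exact: meas_upto.
apply: eq_integral => -[u z] /set_mem; rewrite /D /= !in_itv/= andbT => -[/andP[u0 ut] z0].
rewrite !indicE; have [zl|zl] := leP z (lam u).
 rewrite !mem_set//; split => //; split => //=; by rewrite z0.
by rewrite !memNset//= ?(leNgt z) ?zl// => -[[_ /= /andP[_]]]; rewrite leNgt zl.
Qed.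

Lemma meas_region (lam : R -> R) : measfun (lam : E -> R) ->
 measurable (rate_reg lam).
Proof.
move=> ml.
rewrite (_ : rate_reg lam = (`[0, +oo[%classic `*` `[0, +oo[%classic) `&`
  [set y : plane R | y.2 <= lam y.1]); last first.
 apply/seteqP; split => -[u z] /=; rewrite !in_itv/= !andbT.
  by move=> [-> /andP[-> ->]].
 by rewrite /rate_reg /= => -[[-> ->] ->].
apply: measurableI; first side.
apply: meas_set_le; first side.
apply: mcomp => //; side.
Qed.

Lemma quad_int (f : plane R -> \bar R) : measfun f -> (forall y, (0 <= f y)%E) ->
 (\int[nu]_y f y = \int[leb]_(u in `[0%R, +oo[) \int[leb]_(z in `[0%R, +oo[) f (u, z))%E.
Proof.
move=> mf f0; rewrite /quadrant_lebesgue ge0_int_mrestr//.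
rewrite integral_mkcond.
rewrite (fubini_tonelli1 (m1 := leb) (m2 := leb))//; last 2 first.
 apply/(measurable_restrictT f) => //; first side.
 side.
 by move=> y; rewrite patchE; case: ifP.
rewrite [RHS]integral_mkcond; apply: eq_integral => u _; rewrite patchE /fubini_F.
case: ifPn => [/set_mem u0|/negP u0]; last first.
 by apply: integral0_eq => z _; rewrite patchE ifF//; apply/negP => /set_mem[/= ? _]; apply: u0; exact: mem_set.
rewrite [RHS]integral_mkcond; apply: eq_integral => z _; rewrite !patchE.
rewrite (_ : ((u, z) \in _) = (z \in `[0%R, +oo[%classic))//.
by apply/idP/idP => /set_mem h; apply: mem_set; [case: h|split].
Qed.
End rates.

Ltac side_more m ::= first
 [ exact: meas_upto | exact: meas_box | exact: meas_phi0 | exact: meas_coordinate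
 | exact: meas_region | apply: meas_set_le; side_rec m | apply: meas_set_lt; side_rec m ].

Section quadrant.
Context (R : realType).
Local Notation E := (measurableTypeR R).

Lemma int_rate_slice (c a : R) : 0 <= a ->
 (\int[leb]_(z in `[0%R, +oo[) (c * (0 <= z <= a)%R%:R)%:E = (c * a)%:E)%E.
Proof.
move=> a0; pose I : set E := `[0, a]%classic.
have mI : measurable I by side.
transitivity (\int[leb]_(z in I) (cst c%:E) z)%E.
 rewrite integral_mkcond [RHS]integral_mkcond; apply: eq_integral => z _; rewrite !patchE.
 have [za|za] := boolP (0 <= z <= a).
  rewrite !mem_set ?mulr1//= in_itv/= ?za//; by move: za => /andP[->].
 rewrite mulr0 if_same ifF//; apply/negP => /set_mem; rewrite /I /= in_itv/=; exact/negP.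
have IE : leb I = a%:E.
 rewrite /I lebesgue_measure_itv/= lte_fin -EFinB subr0.
 by case: ltgtP a0 => // <-.
rewrite (integral_cst leb mI); change (c%:E * leb I = (c * a)%:E)%E; by rewrite IE.
Qed.

Lemma quad_rate_int (lam : R -> R) (g : R -> \bar R) :
 measfun (lam : E -> R) -> (forall u, 0 <= u -> 0 <= lam u) ->
 measfun (g : E -> \bar R) -> (forall u, (0 <= g u)%E) ->
 (\int[nu]_(y in rate_reg lam) g y.1 = \int[leb]_(u in `[0%R, +oo[) (g u * (lam u)%:E))%E.
Proof.
move=> ml l0 mg g0; have mS := meas_region ml.
have mg1 : measfun (fun y : plane R => g y.1) by apply: mcomp => //; exact: measurable_fst.
rewrite integral_mkcond quad_int; last 2 first.
- apply/(measurable_restrictT _ mS); side.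
- by move=> y; rewrite patchE; case: ifP.
apply: eq_integral => u /set_mem; rewrite /= in_itv/= andbT => u0.
transitivity (\int[leb]_(z in `[0%R, +oo[) (g u * (1 * (0 <= z <= lam u)%R%:R)%:E))%E.
 apply: eq_integral => z /set_mem; rewrite /= in_itv/= andbT => z0.
 rewrite patchE mul1r; have [zl|zl] := boolP (0 <= z <= lam u).
  by rewrite mem_set ?mule1//; split.
 by rewrite memNset ?mule0//= => -[_] /=; exact/negP.
rewrite ge0_integralZl//; first by rewrite int_rate_slice ?mul1r//; exact: l0.
apply/measurable_EFinP; apply: measurable_funM => //; apply: measurable_funTS.
apply: (@mcomp _ _ _ _ _ _ (fun b : bool => b%:R : R)) => //.
by apply: measurable_and; apply: measurable_fun_ler.
Qed.

Lemma quad_rate_upto (lam : R -> R) t :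
 measfun (lam : E -> R) -> (forall u, 0 <= u -> 0 <= lam u) ->
 (nu (rate_reg lam `&` upto t) = \int[leb]_(u in `[0%R, t]) (lam u)%:E)%E.
Proof.
move=> ml l0; have mS := meas_region ml.
have mI : measurable (`]-oo, t]%classic : set E) by side.
rewrite -[LHS]mul1e -integral_cst//; last side.
transitivity (\int[nu]_(y in rate_reg lam) ((cst 1 : E -> \bar R) \_ `]-oo, t]%classic) y.1)%E.
 rewrite integral_mkcondr; apply: eq_integral => y _; rewrite !patchE /=.
 side.
rewrite quad_rate_int//; last 2 first.
 by apply: meas_restr.
 by move=> u; rewrite patchE; case: ifP.
rewrite integral_mkcond [RHS]integral_mkcond; apply: eq_integral => u _; rewrite !patchE.
have [u0|u0] := leP 0 u.
 rewrite [in X in if X then _ else _]mem_set/=; last by rewrite /= in_itv/= u0.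
 have [ut|ut] := leP u t; first by rewrite !mem_set ?mul1e//= in_itv/= ?u0 ut.
 by rewrite !memNset ?mul0e//= in_itv/= ?u0 /= leNgt ut.
by rewrite !memNset//= in_itv/= leNgt u0.
Qed.
End quadrant.

Section stieltjes.
Context (R : realType).
Local Notation E := (measurableTypeR R).

Lemma stieltjes_box_fin (f : R -> R) (n : nat) :
 (stieltjes f (`](- n%:R)%R, n%:R]%classic : set E) < +oo)%E.
Proof.
rewrite /stieltjes; case: pselect => [H|H]; last by rewrite /mzero ltry.
change (lebesgue_stieltjes_measure (cumulative_of H.1 H.2) `](- n%:R)%R, n%:R]%classic < +oo)%E.
rewrite /lebesgue_stieltjes_measure /measure_extension measurable_mu_extE/=; last exact: is_ocitv.
by rewrite wlength_itv_bnd ?ltry// (le_trans (y := 0))// oppr_le0.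
Qed.

(** The sections of [G] are the domains of integration, which allows both the closed interval of the
    limit equation and the half-open one of the Hawkes equation. *)
Lemma meas_stieltjes_conv (f psi : R -> R) (G : set (E * E)) :
 measurable G -> measfun psi ->
 measfun (fun s : E => \int[stieltjes f]_(u in xsection G s) psi (s - u)).
Proof.
move=> mG mpsi.
pose D (n : nat) : set E := `](- n%:R)%R, n%:R]%classic.
have D1 n : measurable (D n) by side.
have D2 : nondecreasing_seq D.
 move=> i j ij; apply/subsetPset => x; rewrite /D /= !in_itv/= => /andP[x1 x2].
 have := ij; rewrite -(ler_nat R) => {}ij; apply/andP; split; lra.
have D3 : \bigcup_n D n = setT.
 apply/seteqP; split => // x _; exists (Num.truncn `|x|).+1 => //.
 have := truncnS_gt `|x|; rewrite /D /= in_itv/= => /ltr_normlP[h1 h2].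
 by rewrite (ltW h2) andbT ltrNl.
pose sm : E -> {measure set E -> \bar R} := fun=> stieltjes f.
have msm B : measurable B -> measfun (sm ^~ B) by side.
pose K : R.-ker E ~> E := HB.pack sm (isKernel.Build _ _ E E R sm msm).
have key (e : E * E -> \bar R) : measfun e -> (forall z, 0 <= e z)%E ->
  measfun (fun s => \int[stieltjes f]_u e (s, u))%E.
 move=> me e0; apply: (meas_kernel_int (k := K) (D := D)) => // x n.
 exact: stieltjes_box_fin.
pose e (x : E * E) : \bar R := (if x \in G then psi (x.1 - x.2) else 0)%:E.
have me : measfun e.
 apply/measurable_EFinP; apply: measurable_fun_ifT => //.
  apply: (measurable_fun_bool true); rewrite setTI (_ : _ @^-1` _ = G)//.
  by apply/seteqP; split => x /=; [exact: set_mem|exact: mem_set].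
 by apply: (mcomp mpsi); exact: measurable_funB.
rewrite (_ : (fun s => _) = fun s => fine (\int[stieltjes f]_u e^\+ (s, u) - \int[stieltjes f]_u e^\- (s, u))%E).
 apply: mcomp => //; apply: emeasurable_funB.
  by apply: key => //; exact: measurable_funepos.
 by apply: key => //; exact: measurable_funeneg.
apply/funext => s; rewrite /Rintegral; congr fine; rewrite integral_mkcond.
transitivity (\int[stieltjes f]_u e (s, u))%E.
 apply: eq_integral => u _; rewrite patchE /e mem_xsection; by case: ifP.
by rewrite [LHS]integralE; congr (_ - _)%E; apply: eq_integral => u _; rewrite ?funeposE ?funenegE.
Qed.
End stieltjes.

(** * The limit equation *)

Section limit.
Context (R : realType).
Local Notation E := (measurableTypeR R).
Variables (h phi : R -> R) (L : R).
Hypotheses (phi_loc : locally_square_integrable phi) (h0 : forall x, 0 <= h x) (L0 : 0 <= L)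
 (hL : lip L h).

Let mphi : measfun (phi0 phi). Proof. side. Qed.

Let mshift s : measfun (fun u : E => phi0 phi (s - u)).
Proof. by apply: (mcomp mphi); exact: measurable_funB. Qed.

(** The tally of the region below [lam] for the intensity measure is the primitive of [lam], so
    integrating against its differential amounts to integrating against [lam u] du. *)
Lemma drive_stieltjes (lam : R -> R) s : measfun (lam : E -> R) ->
 (forall u, 0 <= u -> 0 <= lam u) -> admissible nu (rate_reg lam) ->
 \int[stieltjes (tally nu (rate_reg lam))]_(u in `[0, s]) phi (s - u) = drive phi lam s.
Proof.
move=> ml l0 adm; pose I : set E := `[0, s]%classic.
have mI : measurable I by side.
transitivity (\int[stieltjes (tally nu (rate_reg lam))]_(u in I) phi0 phi (s - u)).
 apply: eq_Rintegral => u; rewrite inE /I /= in_itv/= => /andP[_ us].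
 by rewrite phi0E// subr_ge0.
rewrite (int_stieltjes_tally adm mI (mshift s)) /drive /Rintegral; congr fine.
have key (g : E -> \bar R) : measfun g -> (forall u, 0 <= g u)%E ->
  (\int[nu]_(y in rate_reg lam `&` fst @^-1` I) g y.1 = \int[leb]_(u in I) (g u * (lam u)%:E))%E.
 move=> mg g0; rewrite integral_mkcondr.
 transitivity (\int[nu]_(y in rate_reg lam) (g \_ I) y.1)%E.
  side.
 rewrite quad_rate_int//; [|exact: meas_restr|by move=> u; rewrite patchE; case: ifP].
 rewrite integral_mkcond [RHS]integral_mkcond; apply: eq_integral => u _; rewrite !patchE.
 have [uI|uI] := boolP (u \in I); last by rewrite mul0e if_same.
 by rewrite ifT//; move: uI => /set_mem uI; apply/mem_set; move: uI; rewrite /I /= !in_itv/= => /andP[->].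
have mgp : measfun (fun u : E => (phi0 phi (s - u))%:E) by side.
rewrite integralE [RHS]integralE; congr (_ - _)%E.
 transitivity (\int[leb]_(u in I) (((fun u : E => (phi0 phi (s - u))%:E)^\+ u) * (lam u)%:E))%E.
  rewrite -key; [|exact: measurable_funepos|side].
  by apply: eq_integral => y _; rewrite !funeposE.
 apply: eq_integral => u; rewrite inE /I /= in_itv/= => /andP[u0 us].
 by rewrite !funeposE -!EFin_max -EFinM; congr EFin; rewrite maxr_pMl ?mul0r// l0.
transitivity (\int[leb]_(u in I) (((fun u : E => (phi0 phi (s - u))%:E)^\- u) * (lam u)%:E))%E.
 rewrite -key; [|exact: measurable_funeneg|side].
 by apply: eq_integral => y _; rewrite !funenegE.
apply: eq_integral => u; rewrite inE /I /= in_itv/= => /andP[u0 us].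
by rewrite !funenegE -!EFinN -!EFin_max -EFinM; congr EFin; rewrite maxr_pMl ?mul0r ?mulNr// l0.
Qed.

Variable lam : R -> R.
Hypotheses (ml : measfun (lam : E -> R)) (l0 : forall s, 0 <= lam s)
 (lb : loc_bounded lam)
 (lfix : forall s, 0 <= s -> lam s = h (drive phi lam s)).

Let mS : measurable (rate_reg lam). Proof. side. Qed.

Lemma rate_region_box (t : R) : exists n : nat, rate_reg lam `&` upto t `<=` @box R n.
Proof.
have [M M0 lM] := lb t.
exists (maxn (Num.truncn `|t|).+1 (Num.truncn M).+1) => -[u z] [[/= u0 /andP[z0 zl]]]; rewrite /upto /= => ut.
have := lM u; rewrite u0 ut => /(_ isT)/andP[_ uM].
have tn := truncnS_gt `|t|; have Mn := truncnS_gt M.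
have tt := ler_norm t.
rewrite /box /= !in_itv/= natr_max !le_max.
have lemax (a b : R) : a <= Num.max a b by rewrite le_max lexx.
have lemax' (a b : R) : b <= Num.max a b by rewrite le_max lexx orbT.
have x0 : 0 <= Num.max (Num.truncn `|t|).+1%:R ((Num.truncn M).+1%:R : R) by side.
split; apply/andP; split.
- apply: le_trans u0; side.
- by rewrite (le_trans ut)// (le_trans tt) ?ltW.
- apply: le_trans z0; side.
- by rewrite orbC (le_trans zl)// (le_trans uM) ?ltW.
Qed.

Lemma adm_rate (m : {measure set (plane R) -> \bar R}) :
 (forall n, (m (box n) < +oo)%E) -> admissible m (rate_reg lam).
Proof.
move=> mb; split => //.
 rewrite (_ : _ `&` _ = set0) ?measure0//; apply/seteqP; split => // y [[y0 _] /=].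
 by rewrite ltNge y0.
move=> n; have [N hN] := rate_region_box n%:R; apply: le_lt_trans (mb N).
apply: le_measure; rewrite ?inE//; side.
Qed.

Section solution.
Context d (Om : measurableType d) (P : probability Om R).
Variable ppm : R.-ker Om ~> plane R.
Hypothesis poi : is_poisson_measure P ppm nu.

Lemma mean_region (S : set (plane R)) t (X : {RV P >-> skorokhod R}) : measurable S ->
 {ae P, forall w, (X w t)%:E = ppm w (S `&` upto t)} ->
 ('E_P[fun w => X w t] = nu (S `&` upto t))%E.
Proof.
move=> mS' XE; have mSt : measurable (S `&` upto t) by apply: measurableI => //; exact: meas_upto.
rewrite unlock /expectation -(quad_mean poi mSt); apply: ae_eq_integral => //.
- apply/measurable_EFinP; apply: (mcomp (meas_coordinate t)) => //.
- exact: measurable_kernel.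
- by apply: filterS XE => w e _.
Qed.

(** A solution is the thinning at its own rate [lam'], and the mean of that thinning makes [lam'] a
    fixed point; Gronwall's inequality with [c = 0] compares it with [lam]. A priori [lam'] is only
    locally integrable, so the two rates are first equal almost everywhere, then everywhere by the
    fixed point equation. *)
Lemma limit_solution_unique (X : {RV P >-> skorokhod R}) : is_limit_solution h phi ppm X ->
 {ae P, forall w, forall t, 0 <= t -> X w t = tally (ppm w) (rate_reg lam) t}.
Proof.
move=> [Xb Xeq].
pose lz (s : R) : R := h (\int[stieltjes (mean_path X)]_(u in `[0, s]) phi (s - u)).
pose lam' (s : R) : R := h (\int[stieltjes (mean_path X)]_(u in `[0, s]) phi0 phi (s - u)).
have lE : lz = lam'.
 apply/funext => s; congr h; apply: eq_Rintegral => u; rewrite inE /= in_itv/= => /andP[_ us].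
 by rewrite phi0E// subr_ge0.
have ml' : measfun (lam' : E -> R).
 apply: (mcomp (meas_lip L0 hL)).
 pose G : set (E * E) := [set x | 0 <= x.2 <= x.1].
 have mG : measurable G.
  apply: meas_set_bool; apply: measurable_and; apply: measurable_fun_ler => //.
 rewrite (_ : (fun s => _) = fun s : E => \int[stieltjes (mean_path X)]_(u in xsection G s) phi0 phi (s - u)).
  exact: meas_stieltjes_conv.
 apply/funext => s; congr (\int[_]_(u in _) _); apply/seteqP; split => u.
  by rewrite /= in_itv/= => us; apply/xsectionP.
 move=> /xsectionP; side.
have l0' s : 0 <= lam' s by exact: h0.
have mS' := meas_region ml'.
have Xeq' : {ae P, forall w, forall t, 0 <= t -> (X w t)%:E = ppm w (rate_reg lam' `&` upto t)}.
 by apply: filterS Xeq => w h1 t t0; rewrite h1// -/lz lE thinningE.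
have XE t : 0 <= t -> ('E_P[fun w => X w t] = nu (rate_reg lam' `&` upto t))%E.
 by move=> t0; apply: mean_region => //; apply: filterS Xeq' => w; exact.
have adm : admissible nu (rate_reg lam').
 split => //.
  rewrite (_ : _ `&` _ = set0) ?measure0//; apply/seteqP; split => // y [[y0 _] /=].
  by rewrite ltNge y0.
 move=> n; rewrite -XE//; have [M hM] := Xb n%:R (ler0n _ _).
 have := hM n%:R; rewrite lexx ler0n => /(_ isT); rewrite XE// gee0_abs// => /le_lt_trans; apply.
 exact: ltry.
clearbody lam'.
have mpE : mean_path X = tally nu (rate_reg lam').
 apply/funext => t; rewrite /mean_path; have [t0|t0] := leP 0 t; first by rewrite XE.
 rewrite (tally_lt0 adm t0) unlock /expectation integral0_eq// => w _ /=.
 by have [/(_ _ t0) ->] := skorokhod_cadlag (X w).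
have fix' s : lam' s = h (drive phi lam' s).
 have -> : lam' s = lz s by rewrite lE.
 rewrite /lz mpE; congr h; apply: drive_stieltjes => //.
pose g (u : R) := (`|lam' u - lam u|)%:E.
have mg : measfun (g : E -> \bar R).
 by apply/measurable_EFinP; apply: mcomp => //; exact: measurable_funB.
have g0 u : (0 <= g u)%E by side.
(* The factor [L + 1] is positive, so the inequality is trivial where the convolution is infinite;
   where it is finite, [lam'] is integrable against the kernel and the Lipschitz bound applies. *)
have gL s : 0 <= s -> (g s <= (L + 1)%:E * renewal phi s g + 0%:E)%E.
 move=> s0; rewrite adde0 /g fix' lfix//.
 have mI : measurable (`[0%R, s]%classic : set E) by side.
 have [M M0 lM] := lb s.
 have i2 := renewal_bounded phi_loc ml lM M0.
 have [roo|roo] := eqVneq (renewal phi s g) +oo%E.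
  rewrite -/g roo mulry; by rewrite gtr0_sg ?mul1e ?leey// ltr_wpDl.
 have mprod (l : E -> R) : measfun l -> measfun (fun u : E => phi0 phi (s - u) * l u).
  by move=> ?; apply: measurable_funM.
 have i3 : leb.-integrable `[0%R, s]%classic (fun u : E => (phi0 phi (s - u) * (lam' u - lam u))%:E).
  apply/integrableP; split.
   by apply: measurable_funTS; apply/measurable_EFinP; apply: mprod; exact: measurable_funB.
  under eq_integral do rewrite abse_EFin normrM EFinM.
  by rewrite ltey.
 have i1 : leb.-integrable `[0%R, s]%classic (fun u : E => (phi0 phi (s - u) * lam' u)%:E).
  have := integrableD mI i3 i2; apply: eq_integrable => // u _ /=.
  by rewrite -EFinD -mulrDr subrK.
 apply: (@le_trans _ _ (L * `|drive phi lam' s - drive phi lam s|)%:E); first side.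
 apply: (@le_trans _ _ (L%:E * renewal phi s g)%E); last first.
  by rewrite lee_wpmul2r ?renewal_ge0// lee_fin lerDl.
 rewrite EFinM lee_wpmul2l ?lee_fin// /drive -RintegralB//.
 have -> : renewal phi s g = (\int[leb]_(u in `[0%R, s]) `|(phi0 phi (s - u) * (lam' u - lam u))%:E|)%E.
  by apply: eq_integral => u _; rewrite abse_EFin normrM EFinM.
 rewrite (_ : \int[leb]_(x in `[0, s]) _ = \int[leb]_(u in `[0, s]) (phi0 phi (s - u) * (lam' u - lam u))); last first.
  by apply: eq_Rintegral => u _; rewrite mulrBr.
 rewrite /Rintegral -abse_EFin fineK; last exact: integrable_fin_num.
 by apply: le_abse_integral => //; have /integrableP[] := i3.
have int0 T : 0 <= T -> (\int[leb]_(s in `[0%R, T]) g s = 0)%E.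
 move=> T0; have mI : measurable (`[0%R, T]%classic : set E) by exact: measurable_itv.
 have L1 : 0 <= L + 1 by side.
 have [C C0 /(_ 0 g (lexx 0) mg g0)] := gronwall phi_loc L1 T0.
 rewrite mulr0 => hC; apply/eqP; rewrite eq_le integral_ge0// andbT; apply: hC.
  by move=> s /andP[s0 _]; exact: gL.
 apply: (@le_lt_trans _ _ (\int[leb]_(u in `[0%R, T]) ((lam' u)%:E + (lam u)%:E))%E).
  apply: ge0_le_integral => //.
  - exact: measurable_funTS.
  - apply: measurable_funTS; apply: emeasurable_funD; side.
  - move=> u _; rewrite -EFinD lee_fin; apply: (le_trans (ler_normB _ _)).
   by rewrite !ger0_norm.
 rewrite ge0_integralD//; last 4 first.
 - side.
 - apply: measurable_funTS; side.
 - side.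
 - apply: measurable_funTS; side.
 rewrite -(quad_rate_upto T ml' (fun u _ => l0' u)) -(quad_rate_upto T ml (fun u _ => l0 u)).
 apply: lte_add_pinfty; apply: tally_lt_pinfty => //.
 by apply: adm_rate => n; exact: quad_leb_box.
have eqg s : 0 <= s -> lam' s = lam s.
 move=> s0; have r0 : renewal phi s g = 0%E.
  have mI : measurable (`[0%R, s]%classic : set E) by side.
  have gz : ae_eq leb `[0%R, s]%classic g (cst 0%E).
   apply/ae_eq_integral_abs => //; first exact: measurable_funTS.
   by rewrite -(int0 s s0); apply: eq_integral => u _; rewrite gee0_abs.
  rewrite /renewal (ae_eq_integral (cst 0%E))//; first exact: integral0.
   apply: measurable_funTS; apply: emeasurable_funM => //; apply/measurable_EFinP.
   exact: meas_phi0_shift.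
  by apply: filterS gz => u h1 us; rewrite h1//= mule0.
 have := gL s s0; rewrite r0 mule0 adde0 lee_fin normr_le0 subr_eq0 => /eqP; exact.
apply: filterS Xeq' => w hw t t0.
have -> : rate_reg lam = rate_reg lam'.
 by apply/seteqP; split => y [y0 +]; split => //; [rewrite eqg|rewrite -eqg].
by rewrite /tally -hw.
Qed.

Lemma limit_solutionP (k : R.-ker Om ~> plane R) (X : {RV P >-> skorokhod R}) :
 (forall w, count_measure (k w)) ->
 {ae P, forall w, (k w : {measure set _ -> \bar R}) = ppm w} ->
 (forall w, X w = tally_path (k w) (rate_reg lam)) -> is_limit_solution h phi ppm X.
Proof.
move=> kc kp XE.
have adm w : admissible (k w) (rate_reg lam) by apply: adm_rate => n; have [] := kc w.
have admn : admissible nu (rate_reg lam) by apply: adm_rate => n; exact: quad_leb_box.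
have XE' : {ae P, forall w, forall t, (X w t)%:E = ppm w (rate_reg lam `&` upto t)}.
 by apply: filterS kp => w e t; rewrite XE tally_pathE// tallyE// e.
have EX t : ('E_P[fun w => X w t] = nu (rate_reg lam `&` upto t))%E.
 by apply: mean_region => //; apply: filterS XE' => w; exact.
have mpE : mean_path X = tally nu (rate_reg lam) by apply/funext => t; rewrite /mean_path EX.
split.
 move=> T T0; exists (tally nu (rate_reg lam) T) => t /andP[t0 tT].
 by rewrite EX gee0_abs// -tallyE// lee_fin; exact: tally_nd.
apply: filterS XE' => w e t t0; rewrite e mpE.
pose lam' (s : R) : R := h (\int[stieltjes (tally nu (rate_reg lam))]_(u in `[0, s]) phi (s - u)).
have rE : rate_reg lam' = rate_reg lam.
 by apply/seteqP; split => y [y0 h1]; split => //; move: h1; rewrite /lam' drive_stieltjes// -lfix.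
by rewrite -/lam' thinningE rE.
Qed.

Lemma limit_solution_exists : exists X : {RV P >-> skorokhod R}, is_limit_solution h phi ppm X.
Proof.
have [k [_ kc kE]] := count_version poi.
have mX : measfun (fun w => tally_path (k w) (rate_reg lam)).
 rewrite (_ : (fun w => _) = fun w => tally_path (k w) (xsection (setT `*` rate_reg lam) w)).
  by apply: meas_tally_path => [w n|]; [have [] := kc w|side].
 apply/funext => w; congr tally_path; apply/seteqP; split => y; first by move=> ?; apply/xsectionP.
 by move=> /xsectionP[].
exists (mfun_Sub (mem_set mX)); apply: (limit_solutionP kc) => //.
Qed.
End solution.
End limit.

Section count.
Context (R : realType) (m : {measure set (plane R) -> \bar R}).
Hypothesis mc : count_measure m.

(* The measures of the sets [D `&` [set y | k < |f y|]] are integers that decrease to 0, so that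
f is bounded almost everywhere on D. *)
Lemma count_integrable (D : set (plane R)) (f : plane R -> R) : measurable D -> (m D < +oo)%E ->
 measfun f -> m.-integrable D (EFin \o f).
Proof.
move=> mD Doo mf; have [_ cm _] := mc.
pose B (k : nat) := D `&` [set y | k%:R < `|f y|].
have mB k : measurable (B k).
 by apply: measurableI => //; apply: meas_set_lt => //; exact: mcomp.
have mB0 : (m \o B) @ \oo --> m (\bigcap_k B k).
 apply: nonincreasing_cvg_mu => //.
 - by apply: le_lt_trans Doo; apply: le_measure; rewrite ?inE//; move=> y [].
 - side.
 - move=> i j ij; apply/subsetPset => y [Dy /= yj]; split => //=.
  by apply: le_lt_trans yj; rewrite ler_nat.
have [K BK] : exists K, m (B K) = 0%E.
 have E0 : \bigcap_k B k = set0.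
  apply/seteqP; split => // y /(_ (Num.truncn `|f y|).+1 I)[_ /=].
  by rewrite ltNge (ltW (truncnS_gt _)).
 move: mB0; rewrite E0 measure0 => /fine_cvgP[_ /cvgrPdist_lt/(_ 1 ltr01)[K _ /(_ K (leqnn K)) p]].
 exists K; have : (m (B K) < +oo)%E.
  by apply: le_lt_trans Doo; apply: le_measure; rewrite ?inE//; move=> y [].
 move: p; rewrite /= sub0r normrN; case: (cm _ (mB K)) => [->//|[q ->]].
 by rewrite /= normr_nat -[X in _ < X](mulr1n 1) ltr_nat ltnS leqn0 => /eqP ->.
apply/integrableP; split; first side.
have mg : measurable_fun D (fun y => `|(EFin \o f) y|%E).
 apply: measurable_funTS; apply: mcomp => //; side.
rewrite (@ge0_negligible_integral _ _ _ m D (B K))//.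
apply: (@le_lt_trans _ _ (\int[m]_(y in D `\` B K) (K%:R)%:E)%E).
 apply: ge0_le_integral => //.
 - side.
 - by apply: measurable_funS mg => // y [].
 - move=> y [Dy nB]; rewrite lee_fin leNgt; apply/negP => h; apply: nB; by split.
rewrite integral_cst; last side.
rewrite lte_mul_pinfty ?lee_fin//; apply: le_lt_trans Doo; apply: le_measure; rewrite ?inE//.
 side.
Qed.
End count.

(** * Points between two random rates *)

Section gap.
Context (R : realType).
Local Notation E := (measurableTypeR R).

(** The exclusive disjunction of [z <= a] and [z <= b]: a point at height [z] is accepted by one of
    the two rates only. *)
Definition gapb (a b z : R) : bool := if z <= a then b < z else z <= b.

Lemma gapbC a b z : gapb a b z = gapb b a z.
Proof. by rewrite /gapb; case: (leP z a); case: (leP z b). Qed.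

Lemma lebesgue_gap (a b : R) :
 leb ([set z | 0 <= z /\ gapb a b z] : set E) = (`|Num.max a 0 - Num.max b 0|)%:E.
Proof.
wlog ab : a b / a <= b.
 move=> h; have [/h//|/ltW/h ba] := leP a b.
 by rewrite distrC -ba; congr (leb _); apply/funext => z; rewrite /= gapbC.
have gE z : gapb a b z = (a < z <= b).
 by rewrite /gapb; case: (leP z a) => za //=; rewrite ltNge (le_trans za ab).
have [a0|a0] := leP 0 a.
 have b0 : 0 <= b := le_trans a0 ab.
 rewrite (_ : [set z | _] = `]a, b]%classic); last first.
  apply/seteqP; split => z; rewrite /= in_itv/= gE; first by case.
  by move=> /[dup] + ->; move=> /andP[/ltW/(le_trans a0)].
 rewrite ?max_l// lebesgue_measure_itv/= lte_fin -EFinB distrC ger0_norm ?subr_ge0//.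
 by move: ab; rewrite le_eqVlt => /predU1P[->|->//]; rewrite ltxx subrr.
have [b0|b0] := leP 0 b; last first.
 rewrite subrr normr0 (_ : [set z | _] = set0) ?measure0//.
 apply/seteqP; split => // z [z0]; rewrite gE => /andP[_ /(le_trans z0)].
 by rewrite leNgt b0.
rewrite (_ : [set z | _] = `[0, b]%classic); last first.
 apply/seteqP; split => z; rewrite /= in_itv/= gE; first by move=> [-> /andP[_ ->]].
 by move=> /andP[z0 ->]; rewrite z0 (lt_le_trans a0 z0).
rewrite lebesgue_measure_itv/= lte_fin -EFinB subr0 sub0r normrN ?max_l// ger0_norm//.
by move: b0; rewrite le_eqVlt => /predU1P[<-|->//]; rewrite ltxx.
Qed.

Lemma meas_gapb d (T : measurableType d) (f g h : T -> R) : measfun f ->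
 measfun g -> measfun h -> measfun (fun x => gapb (f x) (g x) (h x)).
Proof.
move=> mf mg mh; apply: measurable_fun_ifT; [exact: measurable_fun_ler|exact: measurable_fun_ltr|].
exact: measurable_fun_ler.
Qed.

Lemma max0_dist (x y : R) : `|Num.max x 0 - Num.max y 0| <= `|x - y|.
Proof.
have h (u v : R) : u <= v -> `|Num.max u 0 - Num.max v 0| <= `|u - v|.
 move=> uv; rewrite ler0_norm ?[leRHS]ler0_norm ?subr_le0//.
  by case: (leP 0 u); case: (leP 0 v); lra.
 by case: (leP 0 u); case: (leP 0 v); lra.
have [/h//|/ltW/h] := leP x y.
by rewrite distrC [X in _ <= X -> _]distrC.
Qed.
End gap.

Section hawkes.
Context d (Om : measurableType d) (R : realType) (P : probability Om R) (F : R -> set_system Om)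
 (n : nat) (ppm : 'I_n.+1 -> R.-ker Om ~> plane R).
Local Notation E := (measurableTypeR R).
Local Notation PT := (predictable F).
Hypotheses (fF : is_filtration F) (noise : is_poisson_noise P F ppm)
 (kc : forall i w, count_measure (ppm i w)).

(** Taking the constant -1, which lies below all heights, for [l'] gives the points accepted by [l];
    one notion thus serves both for comparing two thinnings and for counting the points of one. *)
Definition gap (l l' : PT -> R) (w : Om) : set (plane R) :=
 [set y | 0 < y.1 /\ 0 <= y.2 /\ gapb (l (w, y.1)) (l' (w, y.1)) y.2].

Lemma meas_slice_fun (l : PT -> R) w : measfun l ->
 measfun (fun y : plane R => l (w, y.1)).
Proof.
move=> ml; apply: (mcomp ml).
apply: (mcomp (meas_predictable_slice fF w)); exact: measurable_fst.
Qed.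

Lemma meas_gap l l' w : measfun l -> measfun l' -> measurable (gap l l' w).
Proof.
move=> ml ml'; apply: measurableI; first side.
apply: measurableI; first side.
apply: meas_set_bool; apply: meas_gapb; [exact: meas_slice_fun|exact: meas_slice_fun|].
side.
Qed.

Definition mean_gap (l l' : PT -> R) (u : R) : \bar R :=
 (\int[P]_w (`|Num.max (l (w, u)) 0 - Num.max (l' (w, u)) 0|)%:E)%E.

Let mjoint (l : PT -> R) : measfun l -> measfun ((fun x => l x) : Om * E -> R).
Proof. by move=> ml; apply: (mcomp ml); exact: meas_to_predictable. Qed.

Let mgapj (l l' : PT -> R) : measfun l -> measfun l' ->
 measfun (fun x : Om * E => (`|Num.max (l x) 0 - Num.max (l' x) 0|)%:E).
Proof.
move=> ml ml'; apply/measurable_EFinP; apply: mcomp => //; apply: measurable_funB;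
 apply: measurable_maxr => //; exact: mjoint.
Qed.

Lemma meas_mean_gap l l' : measfun l -> measfun l' ->
 measfun (mean_gap l l' : E -> \bar R).
Proof.
move=> ml ml'; exact: (measurable_fun_fubini_tonelli_G (m1 := P) _ (mgapj ml ml')).
Qed.

Lemma mean_gap_ge0 l l' u : (0 <= mean_gap l l' u)%E.
Proof. side. Qed.

Let gap_fun (psi : R -> \bar R) (l l' : PT -> R) (z : PT * E) : \bar R :=
 (psi (Num.max z.1.2 0)%R * ((0 < z.1.2) && ((0 <= z.2) && gapb (l z.1) (l' z.1) z.2))%R%:R%:E)%E.

Lemma meas_time : measfun (fun x : PT => Num.max x.2 0).
Proof.
apply: (measurability _ (RGenOInfty.measurableE R)) => _ [_ [c ->] <-]; rewrite setTI.
have [c0|c0] := leP 0 c.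
 rewrite (_ : _ @^-1` _ = [set x : PT | c < x.2]); first exact: predictable_lt.
 apply/seteqP; split => x /=; rewrite in_itv/= andbT lt_max (ltNge c 0) c0 orbF//.
rewrite (_ : _ @^-1` _ = setT)//; apply/seteqP; split => // x _ /=.
by rewrite in_itv/= andbT lt_max c0 orbT.
Qed.

Let mgap_fun psi (l l' : PT -> R) : measfun (psi : E -> \bar R) -> measfun l ->
 measfun l' -> measfun (gap_fun psi l l').
Proof.
move=> mpsi ml ml'; apply: emeasurable_funM.
 apply: (mcomp mpsi); apply: (mcomp meas_time); exact: measurable_fst.
apply/measurable_EFinP; apply: (@mcomp _ _ _ _ _ _ (fun b : bool => b%:R : R)) => //.
have mlt : measfun (fun x : PT => 0 < x.2).
 apply: (measurable_fun_bool true); rewrite setTI; exact: (predictable_lt fF (lexx 0)).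
apply: measurable_and; first by apply: (mcomp mlt); exact: measurable_fst.
apply: measurable_and; first by apply: measurable_fun_ler => //; exact: (@measurable_snd _ _ PT E).
apply: meas_gapb; [| |side];
 by apply: mcomp => //; exact: measurable_fst.
Qed.

Let gap_funE (m : {measure set (plane R) -> \bar R}) psi (l l' : PT -> R) w :
 (\int[m]_(y in gap l l' w) psi y.1 = \int[m]_y gap_fun psi l l' ((w, y.1), y.2))%E.
Proof.
rewrite integral_mkcond; apply: eq_integral => y _; rewrite patchE /gap_fun /=.
have [yg|yg] := boolP ((0 < y.1) && ((0 <= y.2) && gapb (l (w, y.1)) (l' (w, y.1)) y.2)).
 move: yg => /and3P[y1 y2 g]; by rewrite mule1 mem_set// max_l// ltW.
by rewrite mule0 memNset// => -[y1 [y2 g]]; move: yg; rewrite y1 y2 g.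
Qed.

Lemma meas_gap_int j psi (l l' : PT -> R) : measfun (psi : E -> \bar R) ->
 (forall u, (0 <= psi u)%E) -> measfun l -> measfun l' ->
 measfun (fun w => \int[ppm j w]_(y in gap l l' w) psi y.1)%E.
Proof.
move=> mpsi psi0 ml ml'; have mf := mgap_fun mpsi ml ml'.
under eq_fun do rewrite gap_funE.
have kf w q : (ppm j w (box q) < +oo)%E by have [] := kc j w.
have ms : measfun (fun z => gap_fun psi l l' (spread F z)).
 by apply: (mcomp mf); exact: meas_spread.
have s0 z : (0 <= gap_fun psi l l' (spread F z))%E by side.
exact: (meas_kernel_int (@meas_box R) (@box_nd R) (@box_cover R) kf ms s0).
Qed.

(** Compensation replaces the noise by ds dz, and at a fixed time the heights between the two rates
    have for length the distance of their positive parts. *)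
Lemma gap_mean j (psi : R -> \bar R) (l l' : PT -> R) : measfun (psi : E -> \bar R) ->
 (forall u, (0 <= psi u)%E) -> measfun l -> measfun l' ->
 (\int[P]_w \int[ppm j w]_(y in gap l l' w) psi y.1 =
  \int[leb]_(u in `]0%R, +oo[) (psi u * mean_gap l l' u))%E.
Proof.
move=> mpsi psi0 ml ml'; have [poi _ _ fut] := noise.
pose f := gap_fun psi l l'; have mf : measfun f := mgap_fun mpsi ml ml'.
have f0 z : (0 <= f z)%E by side.
transitivity (\int[P]_w \int[ppm j w]_y f ((w, y.1), y.2))%E.
 apply: eq_integral => w _; side.
rewrite (compensation fF (kc j) (poi j) _ mf f0); last first.
 move=> t t0 A B FA hB; apply: (fut t t0) => //; apply: sub_sigma_algebra; by exists j.
have ms w : measfun (fun y : plane R => f ((w, y.1), y.2)).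
 apply: (mcomp mf); apply: measurable_fun_pair; last side.
 apply: (mcomp (meas_predictable_slice fF w)); exact: measurable_fst.
pose q (x : Om * E) : \bar R := (((psi \_ `]0%R, +oo[%classic) x.2) * (`|Num.max (l x) 0 - Num.max (l' x) 0|)%:E)%E.
have mI : measurable (`]0%R, +oo[%classic : set E) by side.
have mq : measfun q.
 apply: emeasurable_funM; last exact: mgapj.
 apply: (mcomp (f := psi \_ `]0%R, +oo[%classic : E -> \bar R)); last side.
 exact: meas_restr.
have q0 x : (0 <= q x)%E by rewrite mule_ge0// patchE; case: ifP.
transitivity (\int[P]_w \int[leb]_u q (w, u))%E.
 apply: eq_integral => w _; rewrite (quad_int (ms w))// integral_mkcond.
 apply: eq_integral => u _; rewrite patchE /q /= patchE; have [u0|u0] := ltP 0 u; last first.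
  rewrite [X in (_ = X * _)%E]ifF ?mul0e; last by apply/negP => /set_mem; rewrite /= in_itv/= ltNge u0.
  case: ifP => // _; apply: integral0_eq => z _; rewrite /f /gap_fun /= (ltNge 0 u) u0 /= mule0.
  by [].
 rewrite mem_set; last by rewrite /= in_itv/= ltW.
 rewrite mem_set; last by rewrite /= in_itv/= u0.
 pose A : set E := [set z | 0 <= z /\ gapb (l (w, u)) (l' (w, u)) z].
 have mA : measurable A.
  apply: measurableI; first side.
  by apply: meas_set_bool; apply: meas_gapb.
 have -> : (`|Num.max (l (w, u)) 0 - Num.max (l' (w, u)) 0|)%:E = (\int[leb]_z (\1_A z)%:E)%E.
  by rewrite integral_indic// setIT; exact/esym/lebesgue_gap.
 rewrite -ge0_integralZl//; last first.
  side.
 rewrite [LHS]integral_mkcond; apply: eq_integral => z _; rewrite patchE /f /gap_fun /= u0 /= indicE max_l; last side.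
 have [z0|z0] := boolP (0 <= z); last first.
  rewrite (memNset (A := A)); last by move=> []; rewrite (negbTE z0).
  by rewrite mule0; case: ifP.
 rewrite mem_set/=; last by rewrite in_itv/= z0.
 congr (_ * _%:R%:E)%E; congr nat_of_bool; apply/idP/idP; first by move=> g; apply/mem_set.
 by move=> /set_mem[].
rewrite (fubini_tonelli (m1 := P) (m2 := leb) q)// [RHS]integral_mkcond; apply: eq_integral => u _.
rewrite /q patchE /=; case: ifPn => uI; last first.
 by apply: integral0_eq => w _; rewrite patchE (negbTE uI) mul0e.
transitivity (\int[P]_w (psi u * (`|Num.max (l (w, u)) 0 - Num.max (l' (w, u)) 0|)%:E))%E.
 by apply: eq_integral => w _; rewrite patchE uI.
rewrite ge0_integralZl//.
apply: (mcomp (mgapj ml ml')); side.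
Qed.

Definition hit (l : PT -> R) (w : Om) (s : R) : set (plane R) :=
 [set y | 0 < y.1 /\ y.1 < s /\ 0 <= y.2 /\ y.2 <= l (w, y.1)].

Lemma meas_hit l w s : measfun l -> measurable (hit l w s).
Proof.
move=> ml; apply: measurableI; first side.
apply: measurableI.
 side.
apply: measurableI; first side.
apply: meas_set_le; [side|exact: meas_slice_fun].
Qed.

Lemma hit_gap l w s : hit l w s = gap l (cst (-1)) w `&` [set y | y.1 < s].
Proof.
apply/seteqP; split => y; rewrite /hit /gap /gapb /=.
 by move=> [y1 [ys [y2 ->]]]; split => //; split => //; split => //; rewrite (lt_le_trans _ y2)// ltrN10.
move=> [[y1 [y2 q]] ys]; split => //; split => //; split => //; move: q.
by case: ifP => // _ /(le_trans y2); rewrite leNgt ltrN10.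
Qed.

Variables (h phi : R -> R) (L : R).
Hypotheses (phi_loc : locally_square_integrable phi) (h0 : forall x, 0 <= h x) (L0 : 0 <= L)
 (hL : lip L h).

Let mphi : measfun (phi0 phi). Proof. side. Qed.

(** One Picard step on random rates: the intensity produced when every vertex accepts the points
    below [l]. In the mean-field model it is common to all vertices. *)
Definition intensity (l : PT -> R) (x : PT) : R :=
 h (n.+1%:R^-1 * \sum_j \int[ppm j x.1]_(y in hit l x.1 x.2) phi0 phi (x.2 - y.1)).

Lemma meas_hit_int j (l : PT -> R) (psi : E -> \bar R) : measfun l ->
 measfun psi -> (forall v, 0 <= psi v)%E ->
 measfun (fun x : PT => \int[ppm j x.1]_(y in hit l x.1 x.2) psi (x.2 - y.1)%R)%E.
Proof.
move=> ml mpsi psi0; have [_ _ kad _] := noise.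
(* Outside the past the value -1 accepts no point of the quadrant. *)
pose g (z : PT * plane R) : R := if 0 < z.2.1 < z.1.2 then l (z.1.1, z.2.1) else -1.
have mg : measfun g := meas_fun_past fF (-1 : R) ml.
pose e (z : PT * plane R) : \bar R :=
 (psi (Num.max z.1.2 0 - z.2.1)%R * (z.2.2 <= g z)%R%:R%:E)%E.
have me : measfun e.
 apply: emeasurable_funM.
  apply: (mcomp mpsi); apply: measurable_funB.
   apply: (mcomp meas_time); exact: measurable_fst.
  apply: (mcomp (@measurable_fst _ _ E E)); side.
 apply/measurable_EFinP; apply: (@mcomp _ _ _ _ _ _ (fun b : bool => b%:R : R)) => //.
 apply: measurable_fun_ler => //.
 apply: (mcomp (@measurable_snd _ _ E E)); side.
have e0 z : (0 <= e z)%E by side.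
have := meas_past_int (kc j) (kad j) me e0.
rewrite [X in measurable_fun _ X -> _](_ : _ = fun x : PT => \int[ppm j x.1]_(y in hit l x.1 x.2) psi (x.2 - y.1)%R)%E//.
apply/funext => x; rewrite ge0_int_mrestr//; last first.
 apply: (mcomp me); side.
rewrite integral_mkcond [RHS]integral_mkcond; apply: eq_integral => -[u z] _; rewrite !patchE /e /g /=.
have [|us] := boolP ((u, z) \in strip_before x.2).
 move=> /set_mem; rewrite /strip_before /= !in_itv/= andbT => -[us z0].
 rewrite us max_l; last by case/andP: us => u0 us; exact/ltW/(lt_trans u0).
 case/andP: us => u0 us; have [zl|zl] := boolP (z <= l (x.1, u)).
  by rewrite mule1 mem_set.
 by rewrite mule0 memNset// => -[_ [_ [_]]] /=; exact/negP.
rewrite memNset// => -[/= u0 [us' [z0 _]]]; move/negP : us; apply; apply/mem_set.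
by rewrite /strip_before /= !in_itv/= u0 us' z0.
Qed.

Lemma meas_rate (l : PT -> R) : measfun l -> measfun (intensity l).
Proof.
move=> ml; apply: (mcomp (meas_lip L0 hL)); apply: measurable_funM => //.
apply: measurable_sum => j.
rewrite (_ : (fun x => _) = fun x : PT => fine (\int[ppm j x.1]_(y in hit l x.1 x.2) (EFin \o phi0 phi)^\+ (x.2 - y.1)%R -
  \int[ppm j x.1]_(y in hit l x.1 x.2) (EFin \o phi0 phi)^\- (x.2 - y.1)%R)%E).
 apply: mcomp => //; apply: emeasurable_funB; apply: meas_hit_int => //.
 - apply: measurable_funepos; side.
 - apply: measurable_funeneg; side.
apply/funext => x; rewrite /Rintegral; congr fine; rewrite [LHS]integralE; congr (_ - _)%E;
 by apply: eq_integral => y _; rewrite ?funeposE ?funenegE.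
Qed.

Let lag (s u : R) : \bar R := (`|phi0 phi (s - u)| * (u < s)%R%:R)%:E.

Let lag_ge0 s u : (0 <= lag s u)%E. Proof. side. Qed.

Let mlag s : measfun (lag s : E -> \bar R).
Proof.
apply/measurable_EFinP; apply: measurable_funM; first exact: meas_phi0_shift.
apply: (@mcomp _ _ _ _ _ _ (fun b : bool => b%:R : R)) => //.
exact: measurable_fun_ltr.
Qed.

(** The points accepted by both rates cancel in the difference of the two drives, which leaves the
    points of the gap. Finiteness of the counts makes both drives integrable, so that they may be
    subtracted. *)
Lemma rate_dist (l l' : PT -> R) w s : measfun l -> measfun l' ->
 (forall j, (ppm j w (hit l w s) < +oo)%E) -> (forall j, (ppm j w (hit l' w s) < +oo)%E) ->
 ((`|intensity l (w, s) - intensity l' (w, s)|)%:E <=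
  L%:E * \sum_(j < n.+1) ((n.+1%:R^-1)%:E * \int[ppm j w]_(y in gap l l' w) lag s y.1))%E.
Proof.
move=> ml ml' fl fl'.
pose q j (l0 : PT -> R) := \int[ppm j w]_(y in hit l0 w s) phi0 phi (s - y.1).
have key j : ((`|q j l - q j l'|)%:E <= \int[ppm j w]_(y in gap l l' w) lag s y.1)%E.
 pose D := hit l w s `|` hit l' w s.
 have mh := meas_hit w s ml; have mh' := meas_hit w s ml'.
 have mD : measurable D by side.
 have Doo : (ppm j w D < +oo)%E.
  by apply: (le_lt_trans (measureU2 _ mh mh')); apply: lte_add_pinfty; [exact: fl|exact: fl'].
 have mps : measfun (fun y : plane R => phi0 phi (s - y.1)).
  apply: (mcomp mphi); apply: measurable_funB => //; exact: (@measurable_fst _ _ E E).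
 have restr (l0 : PT -> R) : measfun l0 -> hit l0 w s `<=` D ->
   q j l0 = \int[ppm j w]_(y in D) (phi0 phi (s - y.1) * \1_(hit l0 w s) y).
  move=> ml0 hD; rewrite /q /Rintegral; congr fine.
  rewrite -[in LHS](setIidr hD) integral_mkcondr; apply: eq_integral => y _.
  by rewrite patchE indicE; case: ifP; rewrite ?mulr1 ?mulr0.
 have int (l0 : PT -> R) : measfun l0 ->
   (ppm j w).-integrable D (EFin \o (fun y => phi0 phi (s - y.1) * \1_(hit l0 w s) y)).
  move=> ml0; apply: (count_integrable (kc j w) mD Doo); apply: measurable_funM => //.
  by apply: measurable_indic; exact: meas_hit.
 rewrite (restr l)//; last by move=> y; left.
 rewrite (restr l')//; last by move=> y; right.
 rewrite -RintegralB//; [|exact: int|exact: int].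
 have i3 : (ppm j w).-integrable D (EFin \o (fun y => phi0 phi (s - y.1) * \1_(hit l w s) y -
   phi0 phi (s - y.1) * \1_(hit l' w s) y)).
  by have := integrableB mD (int _ ml) (int _ ml').
 rewrite /Rintegral -abse_EFin fineK; last exact: integrable_fin_num.
 apply: (le_trans (le_abse_integral _ mD _)); first by have /integrableP[] := i3.
 rewrite integral_mkcond [leRHS]integral_mkcond; apply: ge0_le_integral => //.
 - by move=> y _; rewrite patchE; case: ifP.
 - apply/(measurable_restrictT _ mD); apply: mcomp => //.
  by have /integrableP[] := i3.
 - apply/(measurable_restrictT _ (meas_gap w ml ml')); apply: measurable_funTS.
  apply: (mcomp (mlag s)); exact: measurable_fst.
 - move=> y _; rewrite !patchE; case: ifPn => [/set_mem yD|_]; last by case: ifP.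
  rewrite /= -mulrBr normrM !indicE.
  have [y1 [ys y2]] : 0 < y.1 /\ y.1 < s /\ 0 <= y.2 by case: yD => -[? [? [? _]]].
  have hE (l0 : PT -> R) : (y \in hit l0 w s) = (y.2 <= l0 (w, y.1)).
   by apply/idP/idP => [/set_mem[_ [_ []]]//|yl]; apply/mem_set.
  have gE : (y \in gap l l' w) = gapb (l (w, y.1)) (l' (w, y.1)) y.2.
   by apply/idP/idP => [/set_mem[_ []]//|yl]; apply/mem_set.
  rewrite !hE gE /gapb /lag ys mulr1.
  case: (leP y.2 (l (w, y.1))) => _; case: (leP y.2 (l' (w, y.1))) => _ /=;
   by rewrite ?subrr ?subr0 ?sub0r ?normrN ?normr0 ?normr1 ?mulr0 ?mulr1.
apply: (@le_trans _ _ (L * `|n.+1%:R^-1 * \sum_j q j l - n.+1%:R^-1 * \sum_j q j l'|)%:E).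
 by rewrite lee_fin; exact: hL.
rewrite EFinM lee_wpmul2l ?lee_fin//.
rewrite -mulrBr normrM ger0_norm ?invr_ge0// -sumrB.
apply: (@le_trans _ _ (\sum_(j < n.+1) (n.+1%:R^-1 * `|q j l - q j l'|)%:E)%E).
 rewrite sumEFin lee_fin -mulr_sumr ler_wpM2l ?invr_ge0//; exact: ler_norm_sum.
by apply: lee_sum => j _; rewrite EFinM lee_wpmul2l// lee_fin invr_ge0.
Qed.

(** By [gap_mean] each of the [n.+1] noises contributes the same convolution, and the weights add up
    to 1: the bound is free of [n]. *)
Lemma rate_mean (l l' : PT -> R) s : measfun l -> measfun l' ->
 {ae P, forall w, forall j, (ppm j w (hit l w s) < +oo)%E} ->
 {ae P, forall w, forall j, (ppm j w (hit l' w s) < +oo)%E} ->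
 (\int[P]_w (`|intensity l (w, s) - intensity l' (w, s)|)%:E <=
  L%:E * renewal phi s (mean_gap l l'))%E.
Proof.
move=> ml ml' fl fl'.
pose G j w := (\int[ppm j w]_(y in gap l l' w) lag s y.1)%E.
have mG j : measfun (G j) by exact: meas_gap_int.
have G0 j w : (0 <= G j w)%E by side.
have mi (l0 : PT -> R) : measfun l0 -> measfun (fun w => intensity l0 (w, s)).
 move=> ml0; apply: (mcomp (mjoint (meas_rate ml0))); exact: measurable_pair2.
have N0 : (0 <= (n.+1%:R^-1 : R)%:E)%E by side.
apply: (@le_trans _ _ (\int[P]_w (L%:E * \sum_(j < n.+1) ((n.+1%:R^-1)%:E * G j w)))%E).
 apply: ae_ge0_le_integral => //.
 - by apply/measurable_EFinP; apply: mcomp => //; apply: measurable_funB; exact: mi.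
 - side.
 - by apply: measurable_funeM; apply: emeasurable_sum => j; exact: measurable_funeM.
 - by apply: filterS2 fl fl' => w h1 h2 _; exact: rate_dist.
rewrite ge0_integralZl//; last 2 first.
- by apply: emeasurable_sum => j; exact: measurable_funeM.
- side.
rewrite lee_wpmul2l ?lee_fin// ge0_integral_sum//; last 2 first.
- by move=> j; exact: measurable_funeM.
- side.
apply: (@le_trans _ _ (\sum_(j < n.+1) ((n.+1%:R^-1)%:E * renewal phi s (mean_gap l l')))%E).
 apply: lee_sum => j _; rewrite ge0_integralZl// lee_wpmul2l// (gap_mean _ (mlag s))//.
 rewrite integral_mkcond /renewal [leRHS]integral_mkcond; apply: ge0_le_integral => //.
 - move=> u _; rewrite patchE; case: ifP => // _; side.
 - apply: meas_restr; first side.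
  by apply: emeasurable_funM => //; exact: meas_mean_gap.
 - apply: meas_restr; first side.
  apply: emeasurable_funM; last exact: meas_mean_gap.
  by apply/measurable_EFinP; exact: meas_phi0_shift.
 - move=> u _; rewrite !patchE; case: ifPn => [/set_mem|_]; last first.
   case: ifP => // _; side.
  rewrite /= in_itv/= andbT => u0; rewrite /lag.
  have [us|us] := ltP u s; first by rewrite mulr1 mem_set//= in_itv/= !ltW.
  rewrite mulr0 mul0e; case: ifP => // _; side.
rewrite -ge0_sume_distrl; last by [].
rewrite sumEFin sumr_const card_ord -(mulr_natr n.+1%:R^-1) mulVf ?mul1e// pnatr_eq0//.
Qed.
End hawkes.

(** * Construction of the Hawkes intensity *)

Section geometric.
Context (R : realType).

Lemma geometric_nneseries (a : nat -> \bar R) (K : R) : 0 <= K -> (forall m, (0 <= a m)%E) ->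
 (forall m, (a m <= (K * 2^-1 ^+ m)%:E)%E) -> (\sum_(m <oo) a m <= (2 * K)%:E)%E.
Proof.
move=> K0 a0 aK; apply: lime_le; first exact: is_cvg_nneseries.
apply: nearW => N; apply: (@le_trans _ _ (\sum_(0 <= m < N) (K * 2^-1 ^+ m)%:E)%E).
 apply: lee_sum => m _; side.
rewrite sumEFin lee_fin.
suff -> : \sum_(0 <= m < N) K * 2^-1 ^+ m = 2 * K - 2 * K * 2^-1 ^+ N.
 by rewrite gerBl mulr_ge0 ?exprn_ge0 ?invr_ge0// mulr_ge0.
elim: N => [|N IH]; first by rewrite big_nil expr0 mulr1 subrr.
by rewrite big_nat_recr//= IH exprS; field.
Qed.

(** The tails of a finite sum fall below 1, and an integer below 1 is 0. *)
Lemma nneseries_count_eventually0 (a : nat -> \bar R) : (forall m, a m = +oo%E \/ is_count (a m)) ->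
 (\sum_(m <oo) a m < +oo)%E -> exists m0, forall m, (m0 <= m)%N -> a m = 0%E.
Proof.
move=> ac aoo.
have a0 m : (0 <= a m)%E by case: (ac m) => [->|[k ->]] //; rewrite lee_fin.
have [e] : exists e : nat, (\sum_(e <= m <oo) a m < 1)%E.
 have tl := nneseries_tail_cvg aoo (fun m _ => a0 m).
 have /fine_cvgP[fN] := tl.
 move=> /cvgrPdist_lt/(_ 1 ltr01) h.
 near \oo => N; exists N; have fNN : (\sum_(N <= m <oo) a m)%E \is a fin_num by near: N.
 rewrite -(fineK fNN) lte_fin.
 have : `|0 - fine (\sum_(N <= m <oo) a m)%E| < 1 by near: N.
 by rewrite sub0r normrN => /(le_lt_trans (ler_norm _)).
move=> tl; exists e => m em.
have : (a m < 1)%E.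
 apply: le_lt_trans tl; apply: (@le_trans _ _ (\sum_(e <= i < m.+1) a i)%E); last first.
  by apply: nneseries_lim_ge.
 by rewrite big_nat_recr//= leeDr// sume_ge0.
case: (ac m) => [->//|[k ->]]; rewrite lte_fin -[X in _ < X](mulr1n 1) ltr_nat ltnS leqn0 => /eqP ->.
by [].
Unshelve. all: by end_near. Qed.
End geometric.

Section hawkes.
Context d (Om : measurableType d) (R : realType) (P : probability Om R) (F : R -> set_system Om)
 (n : nat) (ppm : 'I_n.+1 -> R.-ker Om ~> plane R).
Local Notation E := (measurableTypeR R).
Local Notation PT := (predictable F).
Hypotheses (fF : is_filtration F) (noise : is_poisson_noise P F ppm)
 (kc : forall i w, count_measure (ppm i w)).
Local Notation gap := (@gap d Om R F).
Local Notation mean_gap := (@mean_gap d Om R P F).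
Local Notation hit := (@hit d Om R F).

Definition bounded_mean (l : PT -> R) := forall T, exists2 M, 0 <= M &
 forall s, 0 <= s <= T -> (\int[P]_w `|l (w, s)|%:E <= M%:E)%E.

Let mslice (l : PT -> R) s : measfun l -> measfun (fun w => l (w, s)).
Proof.
move=> ml; have mj : measfun (fun x : Om * E => l x).
 by apply: (mcomp ml); exact: meas_to_predictable.
apply: (mcomp mj); side.
Qed.

Lemma mean_gap_le (l l' : PT -> R) u : measfun l -> measfun l' ->
 (mean_gap l l' u <= \int[P]_w `|l (w, u) - l' (w, u)|%:E)%E.
Proof.
move=> ml ml'; apply: ge0_le_integral => //.
- apply/measurable_EFinP; apply: mcomp => //; apply: measurable_funB;
  apply: measurable_maxr => //; exact: mslice.
- by apply/measurable_EFinP; apply: mcomp => //; apply: measurable_funB; exact: mslice.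
- by move=> w _; rewrite lee_fin; exact: max0_dist.
Qed.

Lemma mean_gap_m1 (l : PT -> R) u : measfun l ->
 (mean_gap l (cst (-1)%R) u <= \int[P]_w `|l (w, u)|%:E)%E.
Proof.
move=> ml; apply: ge0_le_integral => //.
- apply/measurable_EFinP; apply: mcomp => //; apply: measurable_funB;
  apply: measurable_maxr => //; (exact: (mslice u ml) || exact: measurable_cst).
- by apply/measurable_EFinP; apply: mcomp => //; exact: mslice.
- move=> w _; rewrite lee_fin (max_r (x := -1)) ?lerN10//.
 by apply: (le_trans (y := `|Num.max (l (w, u)) 0 - Num.max 0 0|)); [rewrite maxxx|rewrite (le_trans (max0_dist _ _))// subr0].
Qed.

Lemma gap_count_mean j (l l' : PT -> R) T : measfun l -> measfun l' ->
 (\int[P]_w ppm j w (gap l l' w `&` upto T) <= \int[leb]_(u in `[0%R, T]) mean_gap l l' u)%E.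
Proof.
move=> ml ml'; pose psi (u : R) : \bar R := (u <= T)%R%:R%:E.
have mpsi : measfun (psi : E -> \bar R).
 apply/measurable_EFinP; apply: (@mcomp _ _ _ _ _ _ (fun b : bool => b%:R : R)) => //.
 exact: measurable_fun_ler.
rewrite (eq_integral (fun w => \int[ppm j w]_(y in gap l l' w) psi y.1)%E); last first.
 move=> w _; rewrite setIC -integral_indic; [|exact: meas_gap|side].
 apply: eq_integral => y _; rewrite indicE /psi; congr (_%:R%:E); congr nat_of_bool.
 by apply/idP/idP => [/set_mem//|yT]; exact: mem_set.
have psi0 u : (0 <= psi u)%E by side.
rewrite (gap_mean fF noise kc j mpsi psi0 ml ml') integral_mkcond [leRHS]integral_mkcond.
apply: ge0_le_integral => //.
- move=> u _; rewrite patchE; case: ifP => // _; side.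
- apply: meas_restr; first side.
 by apply: emeasurable_funM => //; exact: meas_mean_gap.
- by apply: meas_restr; [side|exact: meas_mean_gap].
- move=> u _; rewrite !patchE; case: ifPn => [/set_mem|_]; last by case: ifP => // _; exact: mean_gap_ge0.
 rewrite /= in_itv/= andbT => u0; rewrite /psi; have [uT|uT] := leP u T.
  by rewrite mul1e mem_set//= in_itv/= ltW.
 rewrite mul0e; case: ifP => // _; side.
Qed.

Lemma meas_gap_count j (l l' : PT -> R) T : measfun l -> measfun l' ->
 measfun (fun w => ppm j w (gap l l' w `&` upto T)).
Proof.
move=> ml ml'; pose psi (u : R) : \bar R := (u <= T)%R%:R%:E.
have mpsi : measfun (psi : E -> \bar R).
 apply/measurable_EFinP; apply: (@mcomp _ _ _ _ _ _ (fun b : bool => b%:R : R)) => //.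
 exact: measurable_fun_ler.
have psi0 u : (0 <= psi u)%E by side.
have := meas_gap_int fF kc j mpsi psi0 ml ml'.
rewrite [X in measurable_fun _ X -> _](_ : _ = fun w => ppm j w (gap l l' w `&` upto T))//.
apply/funext => w; rewrite setIC -integral_indic; [|exact: meas_gap|side].
apply: eq_integral => y _; rewrite indicE /psi; congr (_%:R%:E); congr nat_of_bool.
by apply/idP/idP => [yT|/set_mem//]; exact: mem_set.
Qed.

Lemma gap_finite (l : PT -> R) : measfun l -> bounded_mean l ->
 {ae P, forall w, forall j T, (ppm j w (gap l (cst (-1)%R) w `&` upto T) < +oo)%E}.
Proof.
move=> ml lb.
have : {ae P, forall w, forall j (k : nat), (ppm j w (gap l (cst (-1)%R) w `&` upto k%:R) < +oo)%E}.
 apply: ae_forall_fin => j; apply: ae_foralln => k.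
 have [M M0 lM] := lb k%:R.
 have mi := @meas_gap_count j l (cst (-1)%R) k%:R ml (measurable_cst _).
 have : P.-integrable setT (fun w => ppm j w (gap l (cst (-1)%R) w `&` upto k%:R)).
  apply/integrableP; split => //.
  rewrite (eq_integral (fun w => ppm j w (gap l (cst (-1)%R) w `&` upto k%:R))); last first.
   by move=> w _; rewrite gee0_abs.
  apply: (le_lt_trans (gap_count_mean j _ ml (measurable_cst _))).
  apply: (@le_lt_trans _ _ (\int[leb]_(u in `[0%R, k%:R]) (cst M%:E) u)%E).
   apply: ge0_le_integral => //.
   - side.
   - by apply: measurable_funTS; apply: meas_mean_gap.
   - move=> u; rewrite /= in_itv/= => uk; apply: (le_trans (mean_gap_m1 u ml)); exact: lM.
  rewrite (integral_cst leb); last side.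
  rewrite lte_mul_pinfty ?lee_fin//.
  by rewrite [X in (X < _)%E](_ : _ = leb `[0%R, k%:R]%classic)// lebesgue_measure_itv/=; case: ifP; rewrite ?ltry.
 move=> /(integrable_ae measurableT); apply: filterS => w /(_ I).
 by rewrite ge0_fin_numE.
apply: filterS => w hw j T; apply: le_lt_trans (hw j (Num.truncn T).+1).
have mg := meas_gap fF w ml (measurable_cst (-1 : R)).
apply: le_measure; rewrite ?inE; [|side|].
 side.
by apply: setIS; apply: upto_subset; exact/ltW/truncnS_gt.
Qed.

Lemma hit_finite (l : PT -> R) : measfun l -> bounded_mean l ->
 {ae P, forall w, forall s j, (ppm j w (hit l w s) < +oo)%E}.
Proof.
move=> ml lb; apply: filterS (gap_finite ml lb) => w hw s j.
apply: le_lt_trans (hw j s); apply: le_measure; rewrite ?inE.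
- exact: meas_hit.
- apply: measurableI; last side.
 by apply: meas_gap.
- by rewrite hit_gap; apply: setIS => y /= /ltW.
Qed.

Variables (h phi : R -> R) (L : R).
Hypotheses (phi_loc : locally_square_integrable phi) (h0 : forall x, 0 <= h x) (L0 : 0 <= L)
 (hL : lip L h).
Local Notation intensity := (@intensity d Om R F n ppm h phi).

Let mphi : measfun (phi0 phi). Proof. side. Qed.

Lemma rate_m1 (x : PT) : intensity (cst (-1)%R) x = h 0.
Proof.
rewrite /intensity big1 ?mulr0// => j _.
rewrite (_ : hit _ _ _ = set0); first by rewrite Rintegral_set0.
by apply/seteqP; split => // y [_ [_ [y2 /(le_trans y2)]]]; rewrite /= leNgt ltrN10.
Qed.

Lemma mintensity (l : PT -> R) : measfun l -> measfun (intensity l).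
Proof. exact: (meas_rate fF noise kc phi_loc L0 hL). Qed.

Lemma bounded_mean_rate (l : PT -> R) : measfun l -> bounded_mean l ->
 bounded_mean (intensity l).
Proof.
move=> ml lb T; have [M M0 lM] := lb T.
pose K := (\int[leb]_(v in `[0%R, T]) `|phi0 phi v|%:E)%E.
have Koo : (K < +oo)%E := l1_phi0 phi_loc T.
have K0 : (0 <= K)%E by side.
have Kf : K \is a fin_num by rewrite ge0_fin_numE.
exists (h 0 + L * (M * fine K)); first by rewrite addr_ge0// !mulr_ge0// fine_ge0.
move=> s /andP[s0 sT].
(* The rate -1 accepts no point and produces the constant intensity [h 0], which serves as the
   reference. *)
apply: (@le_trans _ _ (\int[P]_w ((h 0)%:E + `|intensity l (w, s) - intensity (cst (-1)%R) (w, s)|%:E))%E).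
 apply: ge0_le_integral => //.
 - by apply/measurable_EFinP; apply: mcomp => //; exact: (mslice s (mintensity ml)).
 - apply: emeasurable_funD => //; apply/measurable_EFinP; apply: mcomp => //.
  apply: measurable_funB; [exact: (mslice s (mintensity ml))|].
  by apply: (mslice s (mintensity _)).
 - move=> w _; rewrite rate_m1 -EFinD lee_fin -[leLHS](ger0_norm (normr_ge0 _)) normr_id.
  rewrite -{1}(subrK (h 0) (intensity l (w, s))) addrC.
  by apply: (le_trans (ler_normD _ _)); rewrite (ger0_norm (h0 0)).
rewrite ge0_integralD//; last 2 first.
- side.
- apply/measurable_EFinP; apply: mcomp => //.
 apply: measurable_funB; [exact: (mslice s (mintensity ml))|].
 by apply: (mslice s (mintensity _)).
rewrite int_prob_cst EFinD leeD2l//.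
have f1 : {ae P, forall w, forall j, (ppm j w (hit l w s) < +oo)%E}.
 by apply: filterS (hit_finite ml lb) => w; exact.
have f2 : {ae P, forall w, forall j, (ppm j w (hit (cst (-1)%R) w s) < +oo)%E}.
 apply: aeW => w j; rewrite (_ : hit _ _ _ = set0) ?measure0//.
 by apply/seteqP; split => // y [_ [_ [y2 /(le_trans y2)]]]; rewrite /= leNgt ltrN10.
apply: (le_trans (rate_mean fF noise kc phi_loc L0 hL ml (measurable_cst _) f1 f2)).
rewrite EFinM lee_wpmul2l ?lee_fin//.
apply: (@le_trans _ _ (renewal phi s (fun u => (M * expR (0 * u))%:E))).
 apply: le_renewal => //.
 - by apply: meas_mean_gap.
 - apply/measurable_EFinP; apply: measurable_funM => //; apply: mcomp => //; exact: measurable_funM.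
 - side.
 - side.
 - move=> u /andP[u0 us]; rewrite mul0r expR0 mulr1; apply: (le_trans (mean_gap_m1 u ml)).
  by apply: lM; rewrite u0 (le_trans us).
apply: (le_trans (renewal_exp phi_loc 0 M0 sT)).
rewrite mul0r expR0 mulr1 EFinM lee_wpmul2l ?lee_fin// fineK//.
apply: ge0_le_integral => //.
- apply: measurable_funTS; apply/measurable_EFinP; apply: measurable_funM; last exact: mcomp.
 apply: mcomp => //; apply: measurable_funN; side.
- by apply: measurable_funTS; apply/measurable_EFinP; exact: mcomp.
- by move=> v _; rewrite mul0r oppr0 expR0 mul1r.
Qed.

(** An intensity depends on the rate only through the points that it accepts. *)
Lemma rate_gap0 (l l' : PT -> R) w s : measfun l -> measfun l' ->
 (forall j, ppm j w (gap l l' w `&` upto s) = 0%E) -> intensity l (w, s) = intensity l' (w, s).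
Proof.
move=> ml ml' g0; congr h; congr (_ * _); apply: eq_bigr => j _; rewrite /Rintegral; congr fine.
have mps : measfun (fun y : plane R => (phi0 phi (s - y.1))%:E).
 apply/measurable_EFinP; apply: (mcomp mphi); exact: measurable_funB.
rewrite integral_mkcond [RHS]integral_mkcond; apply: ae_eq_integral => //.
- by apply/(measurable_restrictT _ (meas_hit fF w s ml)); exact: measurable_funTS.
- by apply/(measurable_restrictT _ (meas_hit fF w s ml')); exact: measurable_funTS.
exists (gap l l' w `&` upto s); split.
- by apply: measurableI; [exact: meas_gap|side].
- side.
- move=> y ne; apply: contrapT => ny; apply: ne => _; rewrite !patchE /=.
 suff -> : (y \in hit l w s) = (y \in hit l' w s) by [].
 have gn (y1 : 0 < y.1) (ys : y.1 <= s) (y2 : 0 <= y.2) : gapb (l (w, y.1)) (l' (w, y.1)) y.2 = false.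
  apply/negP => g; apply: ny; side.
 apply/idP/idP => /set_mem[/= y1 [ys [y2 yl]]]; apply/mem_set; split => //; split => //; split => //.
  by have := gn y1 (ltW ys) y2; rewrite /gapb yl leNgt => ->.
 by have := gn y1 (ltW ys) y2; rewrite /gapb yl leNgt; case: ltP.
Qed.

Fixpoint iterate m : PT -> R := if m is m'.+1 then intensity (iterate m') else cst (-1)%R.

Lemma meas_iterate m : measfun (iterate m).
Proof. by elim: m => [|m IH] /=; [side|exact: mintensity]. Qed.
Let mit := meas_iterate.

Lemma bounded_mean_iterate m : bounded_mean (iterate m).
Proof.
elim: m => [|m IH] /=; last exact: bounded_mean_rate.
move=> T; exists 1 => // s _; rewrite (eq_integral (cst 1%E)) ?int_prob_cst//.
by move=> w _; rewrite /= normrN1.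
Qed.

Let dist m u := (\int[P]_w `|iterate m.+1 (w, u) - iterate m (w, u)|%:E)%E.

Let mdist m : measfun (dist m : E -> \bar R).
Proof.
have mj : measfun (fun x : Om * E => (`|iterate m.+1 x - iterate m x|)%:E).
 have mi k : measfun (fun x : Om * E => iterate k x).
  by apply: (mcomp (mit k)); exact: meas_to_predictable.
 apply/measurable_EFinP; apply: mcomp => //; apply: measurable_funB; side.
apply: (measurable_fun_fubini_tonelli_G (m1 := P) _ mj) => x; side.
Qed.

Let dist_bound T : exists2 K, 0 <= K &
 forall m s, 0 <= s <= T -> (dist m s <= (K * 2^-1 ^+ m)%:E)%E.
Proof.
have [b b0 hb] := phi_decay phi_loc T L0.
have c0 : 0 <= h 0 + 1 by side.
exists ((h 0 + 1) * expR (b * T)); first side.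
have pb := @picard_bound R phi phi_loc L b (h 0 + 1) T dist c0 L0 b0 hb mdist.
move=> m s /andP[s0 sT]; apply: (@le_trans _ _ ((h 0 + 1) * 2^-1 ^+ m * expR (b * s))%:E); last first.
 rewrite lee_fin mulrAC ler_wpM2r ?exprn_ge0 ?invr_ge0// ler_wpM2l//.
 by rewrite ler_expR ler_wpM2l.
apply: pb; last by rewrite s0.
- side.
- move=> u _; rewrite /dist (eq_integral (cst (h 0 + 1)%:E)) ?int_prob_cst// => w _.
 by rewrite /= rate_m1 opprK ger0_norm.
- move=> i u u0.
 have f (k : nat) : {ae P, forall w, forall j, (ppm j w (hit (iterate k) w u) < +oo)%E}.
  by apply: filterS (hit_finite (mit k) (@bounded_mean_iterate k)) => w; exact.
 apply: (le_trans (rate_mean fF noise kc phi_loc L0 hL (mit i.+1) (mit i) (f _) (f _))).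
 rewrite lee_wpmul2l ?lee_fin//; apply: le_renewal => //.
 + exact: meas_mean_gap.
 + side.
 + side.
 + by move=> v _; exact: mean_gap_le.
Qed.

(** The mean numbers of points between successive iterates decay geometrically, so the sum of these
    counts is almost surely finite and its terms eventually vanish. *)
Let stabilise : {ae P, forall w, forall j (T : nat), exists m0, forall m, (m0 <= m)%N ->
 ppm j w (gap (iterate m.+1) (iterate m) w `&` upto T%:R) = 0%E}.
Proof.
apply: ae_forall_fin => j; apply: ae_foralln => T.
pose a m w := ppm j w (gap (iterate m.+1) (iterate m) w `&` upto T%:R).
have ma m : measfun (a m) by exact: meas_gap_count.
have [K K0 hK] := dist_bound T%:R.
have : P.-integrable setT (fun w => \sum_(m <oo) a m w)%E.
 apply/integrableP; split; first by apply: ge0_emeasurable_sum => // m w _ _.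
 rewrite (eq_integral (fun w => \sum_(m <oo) a m w)%E); last first.
  by move=> w _; rewrite gee0_abs// nneseries_ge0.
 rewrite integral_nneseries//.
 apply: (@le_lt_trans _ _ (2 * (K * T%:R))%:E); last exact: ltry.
 apply: geometric_nneseries; first side.
  side.
 move=> m; apply: (le_trans (gap_count_mean j _ (mit m.+1) (mit m))).
 apply: (@le_trans _ _ (\int[leb]_(u in `[0%R, T%:R]) (cst (K * 2^-1 ^+ m)%:E) u)%E).
  apply: ge0_le_integral => //.
  - side.
  - by apply: measurable_funTS; exact: meas_mean_gap.
  - by move=> u; rewrite /= in_itv/= => uT; apply: (le_trans (mean_gap_le _ (mit m.+1) (mit m))); exact: hK.
 rewrite (integral_cst leb); last side.
 rewrite [X in (_ * X)%E](_ : _ = T%:R%:E) ?lee_fin ?mulrA; last first.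
  transitivity (@lebesgue_measure R `[0%R, T%:R]%classic) => //; rewrite lebesgue_measure_itv/= lte_fin -EFinB subr0.
  by case: ltgtP (ler0n R T) => // <-.
 by rewrite mulrAC.
move=> /(integrable_ae measurableT); apply: filterS => w /(_ I) fw.
apply: (@nneseries_count_eventually0 _ (fun m => a m w)).
 move=> m; have [_ h1 _] := kc j w; apply: h1; apply: measurableI; last side.
 exact: meas_gap.
by rewrite -ge0_fin_numE// nneseries_ge0.
Qed.

(** An upper limit is predictable on all of [PT]; almost surely it is the value at which the
    iterates stabilise. *)
Definition limit_rate (x : PT) : R := fine (limn_esup (fun m => (iterate m x)%:E)).

Lemma meas_limit_rate : measfun limit_rate.
Proof.
apply: mcomp => //; apply: measurable_fun_limn_esup => m; apply/measurable_EFinP; exact: mit.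
Qed.

Lemma limit_rate_stable : {ae P, forall w, forall T : R, exists m0, forall m s, (m0 <= m)%N -> s <= T ->
 iterate m (w, s) = limit_rate (w, s)}.
Proof.
apply: filterS stabilise => w st T.
have /choice[m1 hm1] : forall j, exists m0, forall m, (m0 <= m)%N ->
  ppm j w (gap (iterate m.+1) (iterate m) w `&` upto (Num.truncn T).+1%:R) = 0%E by side.
exists (\max_j m1 j).+1.
have step m s : (\max_j m1 j < m)%N -> s <= T -> iterate m.+1 (w, s) = iterate m (w, s).
 case: m => // m; rewrite ltnS => mm sT; apply: (rate_gap0 (mit m.+1) (mit m)) => j.
 apply/eqP; rewrite eq_le measure_ge0 andbT -(hm1 j m); last by apply: leq_trans mm; exact: leq_bigmax.
 have mg := meas_gap fF w (mit m.+1) (mit m).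
 apply: le_measure; rewrite ?inE; [by apply: measurableI => //; exact: meas_upto..|].
 by apply: setIS; apply: upto_subset; apply: (le_trans sT); exact/ltW/truncnS_gt.
move=> m s mm sT; rewrite /limit_rate.
have const k : (m <= k)%N -> iterate k (w, s) = iterate m (w, s).
 elim: k => [|k IH]; first by rewrite leqn0 => /eqP <-.
 rewrite leq_eqVlt => /predU1P[->//|mk]; rewrite step ?IH//; exact: leq_trans mm _.
have cv : (fun k => (iterate k (w, s))%:E) @ \oo --> (iterate m (w, s))%:E.
 by apply: cvg_near_cst; exists m => // k /= /const ->.
rewrite is_cvg_limn_esupE ?(cvg_lim _ cv)//; side.
Qed.

(** The equation holds at a finite rank: on times up to [s] the limit rate equals a late iterate, so
    both accept the same points before [s] and the next iterate is the limit as well. *)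
Lemma limit_rate_fix : {ae P, forall w, forall s, limit_rate (w, s) = intensity limit_rate (w, s)}.
Proof.
apply: filterS limit_rate_stable => w st s; have [m0 hm] := st s.
rewrite -(hm m0.+1)//=; congr h; congr (_ * _); apply: eq_bigr => j _; congr (\int[_]_(y in _) _).
apply/seteqP; split => y [/= y1 [ys [y2 yl]]]; split => //; split => //; split => //.
 by rewrite -(hm m0)// ltW.
by rewrite (hm m0)// ltW.
Qed.

Lemma bounded_mean_limit : bounded_mean limit_rate.
Proof.
move=> T; have [K K0 hK] := dist_bound T; exists (1 + 2 * K); first side.
move=> s sT.
pose a m w := (`|iterate m.+1 (w, s) - iterate m (w, s)|)%:E.
have ma m : measfun (a m).
 by apply/measurable_EFinP; apply: mcomp => //; apply: measurable_funB; exact: mslice.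
have a0 m w : (0 <= a m w)%E by side.
apply: (@le_trans _ _ (\int[P]_w (1 + \sum_(m <oo) a m w))%E).
 apply: ae_ge0_le_integral => //.
 - by apply/measurable_EFinP; apply: mcomp => //; apply: mslice; exact: meas_limit_rate.
 - by move=> w _; rewrite adde_ge0// nneseries_ge0.
 - by apply: emeasurable_funD => //; apply: ge0_emeasurable_sum.
 - apply: filterS limit_rate_stable => w st _; have [m0 hm] := st s.
  rewrite -(hm m0)//.
  apply: (@le_trans _ _ (1 + \sum_(0 <= m < m0) a m w)%E); last first.
   by rewrite leeD2l//; apply: nneseries_lim_ge.
  elim: m0 {hm} => [|k IH]; first by rewrite big_nil adde0 /= normrN1.
  rewrite big_nat_recr//= addeA; apply: le_trans (leeD2r _ IH).
  rewrite -EFinD lee_fin addrC.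
  by have := ler_normD (iterate k.+1 (w, s) - iterate k (w, s)) (iterate k (w, s)); rewrite subrK.
rewrite ge0_integralD//; last 2 first.
- by move=> w _; rewrite nneseries_ge0.
- by apply: ge0_emeasurable_sum.
rewrite int_prob_cst EFinD leeD2l// integral_nneseries//.
apply: geometric_nneseries => //; first side.
by move=> m; exact: hK.
Qed.
End hawkes.

(** * The Hawkes process *)

Section hawkes.
Context d (Om : measurableType d) (R : realType) (P : probability Om R) (F : R -> set_system Om)
 (n : nat) (ppm : 'I_n.+1 -> R.-ker Om ~> plane R).
Local Notation E := (measurableTypeR R).
Local Notation PT := (predictable F).
Hypotheses (fF : is_filtration F) (noise : is_poisson_noise P F ppm)
 (kc : forall i w, count_measure (ppm i w)).
Local Notation gap := (@gap d Om R F).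
Local Notation hit := (@hit d Om R F).
Variables (h phi : R -> R) (L : R).
Hypotheses (phi_loc : locally_square_integrable phi) (h0 : forall x, 0 <= h x) (L0 : 0 <= L)
 (hL : lip L h).
Local Notation intensity := (@intensity d Om R F n ppm h phi).
Variable lam : PT -> R.
Hypotheses (ml : measfun lam)
 (lfix : {ae P, forall w, forall s, lam (w, s) = intensity lam (w, s)})
 (lb : bounded_mean P lam).

Definition below (w : Om) : set (plane R) := rate_reg (fun s => lam (w, s)).

Lemma meas_below w : measurable (below w).
Proof.
apply: meas_region; apply: (mcomp ml).
exact: (meas_predictable_slice fF w).
Qed.

Lemma below_gap w : below w `&` @positive_quad R = gap lam (cst (-1)%R) w.
Proof.
apply/seteqP; split => y; rewrite /gap /below /gapb /positive_quad /rate_reg /= !in_itv/= !andbT.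
 move=> [[y1 /andP[y2 yl]] [y1' _]]; split => //; split => //; rewrite yl.
 by rewrite (lt_le_trans _ y2)// ltrN10.
move=> [y1 [y2 yl]]; split => //; split; first side.
by rewrite y2 /=; move: yl; case: ifP => // _ /(le_trans y2); rewrite leNgt ltrN10.
Qed.

Lemma below_count j w t : ppm j w (below w `&` upto t) = ppm j w (gap lam (cst (-1)%R) w `&` upto t).
Proof.
have [_ _ m0] := kc j w.
rewrite (measure_positive m0); last by apply: measurableI; [exact: meas_below|side].
by rewrite setIAC below_gap.
Qed.

Lemma below_adm : {ae P, forall w, forall j, admissible (ppm j w) (below w)}.
Proof.
apply: filterS (gap_finite fF noise kc ml lb) => w hw j; split; first exact: meas_below.
 rewrite (_ : _ `&` _ = set0) ?measure0//; apply/seteqP; split => // y [[y0 _] /=].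
 by rewrite ltNge y0.
by move=> k; rewrite below_count.
Qed.

Lemma meas_hawkes_path i : measfun (fun w => tally_path (ppm i w) (below w)).
Proof.
pose S : set (Om * plane R) := [set x | below x.1 x.2].
have mS : measurable S.
 apply: measurableI.
  apply: meas_set_le; first side.
  apply: (mcomp (@measurable_fst _ _ E E)); side.
 apply: meas_set_bool.
 have m2 : measfun (fun x : Om * plane R => x.2.2).
  apply: (mcomp (@measurable_snd _ _ E E)); side.
 apply: measurable_and; first exact: measurable_fun_ler.
 apply: measurable_fun_ler => //; apply: (mcomp ml).
 apply: (mcomp (meas_to_predictable fF)); apply: measurable_fun_pair => //.
 apply: (mcomp (@measurable_fst _ _ E E)); side.
rewrite (_ : (fun w => _) = fun w => tally_path (ppm i w) (xsection S w)).
 by apply: meas_tally_path => // w q; have [] := kc i w.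
apply/funext => w; congr tally_path; apply/seteqP; split => y; first by move=> ?; apply/xsectionP.
by move=> /xsectionP.
Qed.

Definition hawkes_path i : {RV P >-> skorokhod R} := mfun_Sub (mem_set (meas_hawkes_path i)).

Lemma hawkes_pathE i w : hawkes_path i w = tally_path (ppm i w) (below w).
Proof. by []. Qed.

Lemma stieltjes_below j w s : admissible (ppm j w) (below w) ->
 \int[stieltjes (tally (ppm j w) (below w))]_(u in `[0, s[) (n.+1%:R^-1 * phi (s - u)) =
 n.+1%:R^-1 * \int[ppm j w]_(y in hit lam w s) phi0 phi (s - y.1).
Proof.
move=> adm; pose D : set E := `[0, s[%classic.
have mD : measurable D by side.
have mp : measfun (fun u : E => phi0 phi (s - u)).
 by apply: (mcomp (meas_phi0 phi_loc)); exact: measurable_funB.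
transitivity (\int[stieltjes (tally (ppm j w) (below w))]_(u in D) (n.+1%:R^-1 * phi0 phi (s - u))).
 apply: eq_Rintegral => u; rewrite inE /D /= in_itv/= => /andP[_ us].
 by rewrite phi0E// subr_ge0 ltW.
have mp1 : measfun (fun y : plane R => phi0 phi (s - y.1)).
 apply: (mcomp mp); side.
rewrite (int_stieltjes_tally adm mD); last exact: measurable_funM.
have mh := meas_hit fF w s ml.
have mA : measurable (below w `&` fst @^-1` D).
 apply: measurableI; first exact: meas_below.
 by rewrite -[X in measurable X]setTI; apply: (@measurable_fst _ _ E E).
rewrite -RintegralZl//; last first.
 apply: (count_integrable (kc j w)) => //; apply: le_lt_trans (tally_lt_pinfty adm s).
 apply: le_measure; rewrite ?inE//; first by apply: measurableI; [exact: meas_below|side].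
 move=> y [y1 [ys [y2 yl]]]; split; last exact: ltW.
 by split; [side|rewrite y2].
rewrite /Rintegral; congr fine; rewrite integral_mkcond [RHS]integral_mkcond.
have mf : measfun (fun y : plane R => (n.+1%:R^-1 * phi0 phi (s - y.1))%:E).
 by apply/measurable_EFinP; exact: measurable_funM.
have [_ _ m0] := kc j w.
apply: ae_eq_integral => //.
- by apply/(measurable_restrictT _ mA); exact: measurable_funTS.
- by apply/(measurable_restrictT _ mh); exact: measurable_funTS.
exists (~` @positive_quad R); split => //.
 apply: measurableC; side.
move=> y ne yq; apply: ne => _; rewrite !patchE.
suff -> : (y \in below w `&` fst @^-1` D) = (y \in hit lam w s) by [].
move: yq; rewrite /positive_quad /= !in_itv/= !andbT => -[y1 y2].
apply/idP/idP => /set_mem; rewrite /D /hit /below /rate_reg /= => hy; apply/mem_set.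
 by move: hy => [[_ /andP[_ yl]]] /=; rewrite in_itv/= => /andP[_ ys].
move: hy => [_ [ys [_ yl]]]; split; last by rewrite /= in_itv/= ys ltW.
by split; [side|rewrite y2].
Qed.

Lemma hawkes_path_equation : {ae P, forall w, forall i t, 0 <= t ->
 (hawkes_path i w t)%:E = thinning (ppm i w) (fun s => h (\sum_(j < n.+1 | true)
   \int[stieltjes (hawkes_path j w)]_(u in `[0, s[) (n.+1%:R^-1 * phi (s - u)))) t}.
Proof.
apply: filterS2 below_adm lfix => w adm fx i t t0.
pose lz (s : R) : R := h (\sum_(j < n.+1 | true)
   \int[stieltjes (hawkes_path j w)]_(u in `[0, s[) (n.+1%:R^-1 * phi (s - u))).
rewrite hawkes_pathE tally_pathE// tallyE//.
have lzE s : lz s = lam (w, s).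
 rewrite fx; congr h; rewrite mulr_sumr; apply: eq_bigr => j _.
 by rewrite hawkes_pathE tally_pathE// stieltjes_below.
have -> : below w = rate_reg lz.
 by apply/seteqP; split => y [y0 hy]; split => //; move: hy; rewrite lzE.
rewrite -thinningE//; rewrite (_ : rate_reg lz = below w); first exact: meas_below.
by apply/seteqP; split => y [y0 hy]; split => //; move: hy; rewrite lzE.
Qed.

Lemma hawkes_path_le i w t : ((hawkes_path i w t)%:E <= ppm i w (gap lam (cst (-1)%R) w `&` upto t))%E.
Proof.
rewrite hawkes_pathE /tally_path; case: pselect => [adm|_] /=; last side.
by rewrite tallyE// below_count.
Qed.

Lemma hawkes_path_ge0 i w t : 0 <= hawkes_path i w t.
Proof. by rewrite hawkes_pathE /tally_path; case: pselect => [adm|_] //=; exact: fine_ge0. Qed.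

Lemma hawkes_path_mean i t : ('E_P[fun w => hawkes_path i w t] < +oo)%E.
Proof.
rewrite unlock; have [M M0 lM] := lb t.
have mm1 : measfun (cst (-1)%R : PT -> R) by side.
apply: (@le_lt_trans _ _ (\int[P]_w ppm i w (gap lam (cst (-1)%R) w `&` upto t))%E).
 apply: ge0_le_integral => //.
 - by move=> w _; rewrite lee_fin hawkes_path_ge0.
 - by apply/measurable_EFinP; apply: (mcomp (meas_coordinate t)).
 - exact: (meas_gap_count fF kc).
 - by move=> w _; exact: hawkes_path_le.
apply: (le_lt_trans (gap_count_mean fF noise kc i t ml mm1)).
apply: (@le_lt_trans _ _ (\int[leb]_(u in `[0%R, t]) (cst M%:E) u)%E).
 apply: ge0_le_integral => //.
 - side.
 - by apply: measurable_funTS; apply: meas_mean_gap.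
 - move=> u; rewrite /= in_itv/= => uk; apply: (le_trans (mean_gap_m1 P fF u ml)); exact: lM.
rewrite (integral_cst leb); last side.
rewrite lte_mul_pinfty ?lee_fin//.
by rewrite [X in (X < _)%E](_ : _ = leb `[0%R, t]%classic)// lebesgue_measure_itv/=; case: ifP; rewrite ?ltry.
Qed.

Hypothesis Fnull : null_complete P F.

Lemma vertical_line0 t : quadrant_lebesgue R ([set t] `*` setT) = 0%E.
Proof.
rewrite quad_lebX//.
rewrite [X in (X * _)%E](_ : _ = 0%E) ?mul0e//.
apply/eqP; rewrite eq_le measure_ge0 andbT -(lebesgue_measure_set1 t).
apply: le_measure; rewrite ?inE; [|side|by move=> x []].
side.
Qed.

(** The number of accepted points strictly before [t] is a section of a predictable function, hence
    [F t]-measurable. Almost surely no point has time [t] exactly, so it equals the path at [t] off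
    a null set, which null completeness allows. *)
Lemma hawkes_path_adapted i t : 0 <= t ->
 preimage_set_system [set: Om] (fun w => hawkes_path i w t) (measurable : set (set R)) `<=` F t.
Proof.
move=> t0 _ [B mB <-]; rewrite setTI; have [poi _ _ _] := noise.
pose q (x : PT) := (\int[ppm i x.1]_(y in hit lam x.1 x.2) (cst 1%E : E -> \bar R) (x.2 - y.1)%R)%E.
have mq : measfun q by exact: (meas_hit_int fF noise kc).
have qE x : q x = ppm i x.1 (hit lam x.1 x.2).
 rewrite /q (integral_cst (ppm i x.1) (meas_hit fF x.1 x.2 ml)); exact: mul1e.
have mT : measurable [set t] by side.
have mL : measurable ([set t] `*` setT : set (plane R)) by side.
have e : {ae P, forall w, hawkes_path i w t = fine (q (w, t))}.
 apply: filterS2 below_adm (poisson_ae0 (poi i) mL (vertical_line0 t)) => w adm l0.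
 rewrite hawkes_pathE tally_pathE// /tally qE; congr fine.
 have mb : measurable (below w `&` upto t) by apply: measurableI; [exact: meas_below|side].
 have mh := meas_hit fF w t ml.
 apply/eqP; rewrite eq_le; apply/andP; split.
  rewrite below_count; apply: (@le_trans _ _ (ppm i w (hit lam w t `|` ([set t] `*` setT)))).
   apply: le_measure; rewrite ?inE.
   - by apply: measurableI; [exact: meas_gap|side].
   - side.
   - move=> y [[y1 [y2 g]]]; rewrite /upto /= le_eqVlt => /predU1P[yt|yt]; [right|left].
     side.
    by rewrite hit_gap; split.
  apply: (le_trans (measureU2 _ mh mL)).
  by rewrite [X in (_ + X)%E](_ : _ = 0%E) ?adde0.
 apply: le_measure; rewrite ?inE//.
 move=> y [y1 [ys [y2 yl]]]; split; last exact: ltW.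
 by split; [side|rewrite y2].
have mA0 : measurable ((fun x : PT => fine (q x)) @^-1` B).
 by have := mcomp (@fine_measurable R setT measurableT) mq measurableT mB; rewrite setTI.
have FA := predictable_sec fF t0 mA0.
have [N [mN N0 NP]] := e.
apply: (Fnull t0 FA).
 by have := (mcomp (meas_coordinate t) (meas_hawkes_path i)) measurableT B mB; rewrite setTI.
have mFA := filtration_measurable fF t0 FA.
have mB' : measurable ((fun w => hawkes_path i w t) @^-1` B).
 by have := (mcomp (meas_coordinate t) (meas_hawkes_path i)) measurableT B mB; rewrite setTI.
apply: (measure0_le _ mN _ N0); first side.
by move=> w hw; apply: NP => /= ew; move: hw; rewrite /preimage /= ew => -[[]|[]].
Qed.

Lemma hawkes_path_hawkes : is_mean_field_hawkes h phi F ppm hawkes_path.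
Proof.
split; [exact: hawkes_path_adapted| |exact: hawkes_path_equation].
by move=> i t _; exact: hawkes_path_mean.
Qed.
End hawkes.

(** * Distance between the Hawkes rate and the limiting rate *)

Section coupling.
Context (R : realType).
Local Notation E := (measurableTypeR R).
Variables (h phi : R -> R) (L : R).
Hypotheses (phi_loc : locally_square_integrable phi) (h0 : forall x, 0 <= h x) (L0 : 0 <= L)
 (hL : lip L h).
Variable lam0 : R -> R.
Hypotheses (ml0 : measfun (lam0 : E -> R)) (l00 : forall s, 0 <= lam0 s)
 (lb0 : loc_bounded lam0)
 (lfix0 : forall s, 0 <= s -> lam0 s = h (drive phi lam0 s)).

Let mphi : measfun (phi0 phi). Proof. side. Qed.

Definition strict_region (s : R) : set (plane R) :=
 [set y | 0 < y.1 /\ y.1 < s /\ 0 <= y.2 /\ y.2 <= lam0 y.1].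

Lemma meas_strict_region s : measurable (strict_region s).
Proof.
apply: measurableI; first side.
apply: measurableI.
 side.
apply: measurableI; first side.
apply: meas_set_le; first side.
apply: mcomp => //; side.
Qed.

Lemma strict_region_int s (g : E -> \bar R) : measfun g -> (forall u, (0 <= g u)%E) ->
 (\int[nu]_y (g y.1 * (\1_(strict_region s) y)%:E) = \int[leb]_(u in `[0%R, s]) (g u * (lam0 u)%:E))%E.
Proof.
move=> mg g0; have mI : measurable (`]0%R, s[%classic : set E) by exact: measurable_itv.
transitivity (\int[nu]_(y in rate_reg lam0) (g \_ `]0%R, s[%classic) y.1)%E.
 rewrite [RHS]integral_mkcond; apply: eq_integral => y _; rewrite !patchE indicE.
 have [yr|yr] := boolP (y \in strict_region s).
  have [y1 [ys [y2 yl]]] := set_mem yr.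
  rewrite mule1 mem_set; last by split; [side|rewrite y2].
  by rewrite mem_set//= in_itv/= y1.
 rewrite mule0; case: ifPn => // /set_mem[y1 /andP[y2 yl]]; case: ifPn => // /set_mem.
 rewrite /= in_itv/= => /andP[y1' ys]; move/negP : yr => []; apply/mem_set.
 side.
rewrite quad_rate_int//; [|exact: meas_restr|by move=> u; rewrite patchE; case: ifP].
transitivity (\int[leb]_(u in `]0%R, s[) (g u * (lam0 u)%:E))%E; last first.
 apply/esym/(@integral_itv_bndoo R 0 s (fun u => g u * (lam0 u)%:E)%E true false).
 apply: measurable_funTS; apply: emeasurable_funM => //; side.
rewrite integral_mkcond [RHS]integral_mkcond; apply: eq_integral => u _; rewrite !patchE.
have [us|us] := boolP (u \in `]0%R, s[%classic); last by rewrite mul0e if_same.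
by rewrite mem_set//; move: us => /set_mem; rewrite /= !in_itv/= andbT => /andP[/ltW].
Qed.

Section bounds.
Variables (T M : R).
Hypotheses (M0 : 0 <= M) (hM : forall u, 0 <= u <= T -> 0 <= lam0 u <= M).

Definition square_mass : R := fine (\int[leb]_(v in `[0%R, T]) (phi0 phi v ^+ 2)%:E)%E.

Lemma square_mass_ge0 : 0 <= square_mass.
Proof. apply: fine_ge0; side. Qed.

Section signed.
Variable psi : R -> R.
Hypotheses (mpsi : measfun psi) (psi0 : forall v, 0 <= psi v)
 (psi_le : forall v, psi v <= `|phi0 phi v|).

(** The contribution of a point to the drive at time [s]. The deviation bound concerns nonnegative
    integrands, so [psi] will be the positive or the negative part of [phi0 phi]. *)
Definition response (s : R) (y : plane R) : R := psi (s - y.1) * \1_(strict_region s) y.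

Lemma response_ge0 s y : 0 <= response s y.
Proof. side. Qed.

Lemma meas_response s : measfun (response s).
Proof.
apply: measurable_funM; last by apply: measurable_indic; exact: meas_strict_region.
by apply: (mcomp mpsi); exact: measurable_funB.
Qed.

Let mshift s : measfun (fun u : E => psi (s - u)).
Proof. by apply: (mcomp mpsi); exact: measurable_funB. Qed.

Lemma response_int s : (\int[nu]_y (response s y)%:E =
 \int[leb]_(u in `[0%R, s]) (psi (s - u) * lam0 u)%:E)%E.
Proof.
rewrite (_ : (fun u : E => (psi (s - u) * lam0 u)%:E) = fun u : E => ((psi (s - u))%:E * (lam0 u)%:E)%E); last first.
 side.
rewrite -strict_region_int//; last side.
side.
Qed.

Lemma response_finite s : s <= T -> (\int[nu]_y (response s y)%:E < +oo)%E.
Proof.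
move=> sT; rewrite response_int.
have lM u : 0 <= u <= s -> 0 <= lam0 u <= M by move=> /andP[u0 us]; apply: hM; rewrite u0 (le_trans us).
have /integrableP[_] := renewal_bounded phi_loc ml0 lM M0.
apply: le_lt_trans; apply: ge0_le_integral => //.
- side.
- by apply: measurable_funTS; apply/measurable_EFinP; exact: measurable_funM.
- apply: measurable_funTS; apply: mcomp => //; apply/measurable_EFinP; apply: measurable_funM => //.
 by apply: (mcomp mphi); exact: measurable_funB.
- by move=> u _; rewrite lee_fin normrM (ger0_norm (l00 u)) ler_wpM2r.
Qed.

Lemma response_square s : s <= T -> (\int[nu]_y (response s y ^+ 2)%:E <= (M * square_mass)%:E)%E.
Proof.
move=> sT.
have mq : measfun (fun v : E => (phi0 phi v ^+ 2)%:E).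
 by apply/measurable_EFinP; apply: measurable_funX.
pose J : set E := `[0%R, T]%classic.
have mJ : measurable J by side.
apply: (@le_trans _ _ (\int[nu]_y ((psi (s - y.1) ^+ 2)%:E * (\1_(strict_region s) y)%:E))%E).
 apply: ge0_le_integral => //.
 - side.
 - by apply/measurable_EFinP; apply: measurable_funX; exact: meas_response.
 - apply: emeasurable_funM; apply/measurable_EFinP.
   apply: measurable_funX; apply: (mcomp mpsi); exact: measurable_funB.
  by apply: measurable_indic; exact: meas_strict_region.
 - move=> y _; rewrite -EFinM lee_fin /response exprMn indicE.
  by case: (_ \in _); rewrite ?expr1n ?expr0n.
rewrite (strict_region_int s (g := fun u : E => (psi (s - u) ^+ 2)%:E))//; last 2 first.
- by apply/measurable_EFinP; exact: measurable_funX.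
- side.
rewrite /square_mass EFinM fineK; last first.
 rewrite ge0_fin_numE; first exact: (sq_phi0 phi_loc T).
 side.
rewrite -ge0_integralZl//; last 2 first.
- exact: measurable_funTS.
- side.
pose G : R -> \bar R := (fun v : E => M%:E * (phi0 phi v ^+ 2)%:E)%E \_ J.
have mG : measfun (G : E -> \bar R).
 by apply: meas_restr => //; exact: measurable_funeM.
have G0 v : (0 <= G v)%E by rewrite /G patchE; case: ifP => // _; rewrite mule_ge0// lee_fin sqr_ge0.
rewrite [leRHS]integral_mkcond -(ge0_int_reflect s mG G0) [leLHS]integral_mkcond.
apply: ge0_le_integral => //.
- move=> u _; rewrite patchE; case: ifP => // _; side.
- apply: meas_restr; first side.
 by apply: emeasurable_funM; apply/measurable_EFinP => //; exact: measurable_funX.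
- by apply: (mcomp mG); exact: measurable_funB.
- move=> u _; rewrite patchE; case: ifPn => // /set_mem; rewrite /= in_itv/= => /andP[u0 us].
 rewrite /G patchE mem_set; last by rewrite /J /= in_itv/= subr_ge0 us lerBlDr (le_trans sT)// lerDl.
 rewrite -!EFinM lee_fin mulrC; apply: ler_pM => //; first side.
  by have /andP[] : 0 <= lam0 u <= M by apply: hM; rewrite u0 (le_trans us sT).
 by rewrite -(real_normK (num_real (phi0 phi _))); apply: lerXn2r; rewrite ?nnegrE.
Qed.

Lemma response_deviation d (Om : measurableType d) (P : probability Om R) n
  (ppm : 'I_n.+1 -> R.-ker Om ~> plane R) s : s <= T ->
 (forall j, is_poisson_measure P (ppm j) nu) ->
 independent_systems P (fun j => <<s noise_events (ppm j) setT >>) ->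
 (\int[P]_w (`|\sum_j (fine (\int[ppm j w]_y (response s y)%:E) - fine (\int[nu]_y (response s y)%:E))|)%:E <=
  (Num.sqrt n.+1%:R * (M * square_mass + 1) / 2)%:E)%E.
Proof.
move=> sT poi ind; set q : R := Num.sqrt n.+1%:R.
have q0 : 0 < q by rewrite sqrtr_gt0.
have qq : q * q = n.+1%:R by rewrite -expr2 sqr_sqrtr.
(* The free parameter is the inverse of the square root of N, where N = n + 1: both terms of the
   bound are then of the order of the square root of N, the size of a sum of N independent centred
   terms. *)
have q10 : 0 < q^-1 by side.
have sq := response_square sT; have sqoo := le_lt_trans sq (ltry _).
apply: (le_trans (poisson_deviation poi ind q10 (meas_response s) (response_ge0 s) _ _ sqoo)).
- by move=> j B mB; exact: (quad_mean (poi j)).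
- exact: response_finite.
rewrite lee_fin ler_wpM2r ?invr_ge0// invrK card_ord mulrDr mulr1 lerD2r.
rewrite mulrA -qq mulrA mulVf ?gt_eqF// mul1r; apply: ler_wpM2l; first side.
rewrite -lee_fin fineK// ge0_fin_numE//.
side.
Qed.
End signed.

Lemma drive_response s : s <= T -> drive phi lam0 s =
 fine (\int[nu]_y (response (fun v => Num.max (phi0 phi v) 0) s y)%:E) -
 fine (\int[nu]_y (response (fun v => Num.max (- phi0 phi v) 0) s y)%:E).
Proof.
move=> sT; have mp1 : measfun (fun v : R => Num.max (phi0 phi v) 0) by exact: measurable_maxr.
have mp2 : measfun (fun v : R => Num.max (- phi0 phi v) 0).
 by apply: measurable_maxr => //; exact: measurable_funN.
have g1 v : 0 <= Num.max (phi0 phi v) 0 by rewrite le_max lexx orbT.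
have g2 v : 0 <= Num.max (- phi0 phi v) 0 by rewrite le_max lexx orbT.
have n1 v : Num.max (phi0 phi v) 0 <= `|phi0 phi v| by rewrite ge_max ler_norm normr_ge0.
have n2 v : Num.max (- phi0 phi v) 0 <= `|phi0 phi v|.
 by rewrite ge_max normr_ge0 andbT -normrN ler_norm.
have f1 := response_finite mp1 g1 n1 sT; have f2 := response_finite mp2 g2 n2 sT.
rewrite !response_int// in f1 f2 *.
rewrite -fineB; last 2 first.
- rewrite ge0_fin_numE//; side.
- rewrite ge0_fin_numE//; side.
rewrite /drive /Rintegral; congr fine; rewrite integralE; congr (_ - _)%E; apply: eq_integral => u _.
 by rewrite funeposE -EFin_max; congr EFin; rewrite maxr_pMl ?mul0r// l00.
by rewrite funenegE -EFinN -EFin_max; congr EFin; rewrite maxr_pMl ?mul0r ?mulNr// l00.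
Qed.

Lemma count_response (m : {measure set (plane R) -> \bar R}) s : count_measure m ->
 \int[m]_(y in strict_region s) phi0 phi (s - y.1) =
 fine (\int[m]_y (response (fun v => Num.max (phi0 phi v) 0) s y)%:E) -
 fine (\int[m]_y (response (fun v => Num.max (- phi0 phi v) 0) s y)%:E).
Proof.
move=> mc; have mS := meas_strict_region s.
have Soo : (m (strict_region s) < +oo)%E.
 have mb : forall q, (m (box q) < +oo)%E by have [] := mc.
 have := tally_lt_pinfty (adm_rate ml0 lb0 mb) s; apply: le_lt_trans.
 apply: le_measure; rewrite ?inE//.
  side.
 by move=> y [y1 [ys [y2 yl]]]; split; [split; [side|rewrite y2]|exact: ltW].
have eqr (psi : R -> R) : (\int[m]_y (response psi s y)%:E = \int[m]_(y in strict_region s) (psi (s - y.1))%:E)%E.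
 rewrite [RHS]integral_mkcond; apply: eq_integral => y _; rewrite patchE /response indicE.
 by case: ifP => _; rewrite ?mulr1 ?mulr0.
have mpy (psi : R -> R) : measfun psi -> measfun (fun y : plane R => psi (s - y.1)).
 by move=> mpsi; apply: (mcomp mpsi); exact: measurable_funB.
have ff (psi : R -> R) : measfun psi ->
  (\int[m]_(y in strict_region s) (psi (s - y.1))%:E)%E \is a fin_num.
 by move=> mpsi; apply: integrable_fin_num => //; apply: (count_integrable mc) => //; exact: mpy.
have mp1 : measfun (fun v : R => Num.max (phi0 phi v) 0) by exact: measurable_maxr.
have mp2 : measfun (fun v : R => Num.max (- phi0 phi v) 0).
 by apply: measurable_maxr => //; exact: measurable_funN.
rewrite !eqr -fineB; [|exact: (ff _ mp1)|exact: (ff _ mp2)].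
rewrite /Rintegral; congr fine; rewrite integralE; congr (_ - _)%E; apply: eq_integral => y _.
 by rewrite funeposE -EFin_max.
by rewrite funenegE -EFinN -EFin_max.
Qed.

Section system.
Context d (Om : measurableType d) (P : probability Om R) (F : R -> set_system Om)
 (n : nat) (ppm : 'I_n.+1 -> R.-ker Om ~> plane R).
Local Notation PT := (predictable F).
Hypotheses (fF : is_filtration F) (noise : is_poisson_noise P F ppm)
 (kc : forall i w, count_measure (ppm i w)).
Local Notation intensity := (@intensity d Om R F n ppm h phi).

(** The limiting rate as a predictable function; truncating the time makes it constant on
    nonpositive times. *)
Definition clock_rate (x : PT) : R := lam0 (Num.max x.2 0).

Lemma meas_clock_rate : measfun clock_rate.
Proof. by apply: (mcomp ml0); exact: meas_time. Qed.

Lemma hit_clock_rate w s : hit clock_rate w s = strict_region s.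
Proof.
by apply/seteqP; split => y [y1 [ys [y2 yl]]]; split => //; split => //; split => //;
 move: yl; rewrite /clock_rate /= max_l// ltW.
Qed.

Lemma bounded_mean_clock_rate : bounded_mean P clock_rate.
Proof.
move=> S; have [K K0 hK] := lb0 S; exists K => // s /andP[s0 sS].
rewrite (eq_integral (cst (lam0 s)%:E)) ?int_prob_cst ?lee_fin.
 by have := hK s; rewrite s0 sS => /(_ isT)/andP[].
by move=> w _; rewrite /clock_rate /= max_l// ger0_norm.
Qed.

(** At the limiting rate the accepted points of different noises are independent, and the intensity
    is [h] of an average centred at [drive phi lam0 s]. The positive and negative parts each deviate
    by half of the final constant. *)
Lemma clock_rate_fluctuation s : 0 <= s <= T ->
 (\int[P]_w (`|intensity clock_rate (w, s) - lam0 s|)%:E <=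
  (L * (M * square_mass + 1) / Num.sqrt n.+1%:R)%:E)%E.
Proof.
move=> /andP[s0 sT]; have [poi ind _ _] := noise.
pose p1 v := Num.max (phi0 phi v) 0; pose p2 v := Num.max (- phi0 phi v) 0.
have mp1 : measfun p1 by exact: measurable_maxr.
have mp2 : measfun p2 by apply: measurable_maxr => //; exact: measurable_funN.
have g1 v : 0 <= p1 v by rewrite le_max lexx orbT.
have g2 v : 0 <= p2 v by rewrite le_max lexx orbT.
have n1 v : p1 v <= `|phi0 phi v| by rewrite ge_max ler_norm normr_ge0.
have n2 v : p2 v <= `|phi0 phi v| by rewrite ge_max normr_ge0 andbT -normrN ler_norm.
have d1 := response_deviation mp1 g1 n1 sT poi ind.
have d2 := response_deviation mp2 g2 n2 sT poi ind.
pose X p w := `|\sum_j (fine (\int[ppm j w]_y (response p s y)%:E) - fine (\int[nu]_y (response p s y)%:E))|.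
have mX (p : R -> R) : measfun p -> (forall v, 0 <= p v) -> measfun (X p).
 move=> mp gp; apply: mcomp => //; apply: measurable_sum => j.
 apply: measurable_funB => //; apply: mcomp => //.
 have kf w q : (ppm j w (box q) < +oo)%E by have [] := kc j w.
 have mr : measfun (fun z : Om * plane R => (response p s z.2)%:E).
  apply/measurable_EFinP; apply: (mcomp (meas_response mp s)); side.
 have r0 (z : Om * plane R) : (0 <= (response p s z.2)%:E)%E by side.
 exact: (meas_kernel_int (@meas_box R) (@box_nd R) (@box_cover R) kf mr r0).
have X0 p w : (0 <= (X p w)%:E)%E by rewrite lee_fin /X normr_ge0.
have mX1 := mX p1 mp1 g1; have mX2 := mX p2 mp2 g2.
have c0 : 0 <= L / n.+1%:R by side.
apply: (@le_trans _ _ (\int[P]_w ((L / n.+1%:R)%:E * ((X p1 w)%:E + (X p2 w)%:E)))%E).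
 apply: ge0_le_integral => //.
 - apply/measurable_EFinP; apply: mcomp => //; apply: measurable_funB => //.
  apply: (mcomp (f := fun x : Om * E => intensity clock_rate x)); last side.
  apply: (mcomp (meas_rate fF noise kc phi_loc L0 hL meas_clock_rate)).
  exact: meas_to_predictable.
 - apply: measurable_funeM; apply: emeasurable_funD; side.
 - move=> w _; rewrite -EFinD -EFinM lee_fin lfix0// /intensity.
  apply: (le_trans (hL _ _)); rewrite -mulrA ler_wpM2l//.
  have -> : drive phi lam0 s = n.+1%:R^-1 * \sum_(j < n.+1) drive phi lam0 s.
   by rewrite sumr_const card_ord -[X in _ = _ * X]mulr_natl mulrA mulVf ?mul1r// pnatr_eq0.
  rewrite -mulrBr normrM ger0_norm ?invr_ge0// ler_wpM2l ?invr_ge0// -sumrB.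
  apply: (le_trans _ (ler_normB _ _)); rewrite -sumrB le_eqVlt; apply/orP; left; apply/eqP.
  congr (`|_|); apply: eq_bigr => j _; rewrite hit_clock_rate (count_response s (kc j w)) drive_response//.
  by rewrite /p1 /p2; ring.
rewrite ge0_integralZl//; last 2 first.
- apply: emeasurable_funD; side.
- by move=> w _; rewrite -EFinD lee_fin /X addr_ge0.
rewrite ge0_integralD//; [|side|exact/measurable_EFinP].
apply: (@le_trans _ _ ((L / n.+1%:R)%:E * (((Num.sqrt n.+1%:R * (M * square_mass + 1) / 2)%:E) +
  ((Num.sqrt n.+1%:R * (M * square_mass + 1) / 2)%:E)))%E).
 apply: lee_wpmul2l; first side.
 apply: leeD; [exact: d1|side].
rewrite -EFinD -EFinM lee_fin le_eqVlt; apply/orP; left; apply/eqP.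
have q0 : Num.sqrt n.+1%:R != 0 :> R by side.
have qq : Num.sqrt n.+1%:R * Num.sqrt n.+1%:R = n.+1%:R :> R by rewrite -expr2 sqr_sqrtr.
by rewrite -[in L / _]qq; field.
Qed.
End system.
End bounds.

(** The intensity produced by the limiting rate is inserted between the two rates: its distance to
    the Hawkes rate is the convolution term of [rate_mean], its distance to [lam0] the fluctuation.
    The constant is chosen before the probability space and [n]. *)
Lemma coupling_gap T : 0 <= T -> exists2 C, 0 <= C & forall d (Om : measurableType d)
  (P : probability Om R) (F : R -> set_system Om) n (ppm : 'I_n.+1 -> R.-ker Om ~> plane R),
 is_filtration F -> is_poisson_noise P F ppm -> (forall i w, count_measure (ppm i w)) ->
 forall lam : predictable F -> R, measfun lam ->
 {ae P, forall w, forall s, lam (w, s) = intensity ppm h phi lam (w, s)} -> bounded_mean P lam ->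
 (\int[leb]_(s in `[0%R, T]) mean_gap P lam (@clock_rate _ _ F) s <= (C / Num.sqrt n.+1%:R)%:E)%E.
Proof.
move=> T0; have [M M0 hM] := lb0 T; have [C C0 hC] := gronwall phi_loc L0 T0.
have s0 := square_mass_ge0 T.
have D0 : 0 <= L * (M * square_mass T + 1) by side.
exists (C * (L * (M * square_mass T + 1))); first side.
move=> d Om P F n ppm fF noise kc lam ml lfix lb.
have mc := @meas_clock_rate d Om F fF.
have mi (l : predictable F -> R) s : measfun l -> measfun (fun w => l (w, s)).
 move=> ml'; apply: (mcomp (f := fun x : Om * E => l x)); last side.
 by apply: (mcomp ml'); exact: meas_to_predictable.
rewrite -mulrA; apply: hC.
- side.
- exact: meas_mean_gap.
- side.
- move=> s /andP[s0' sT]; apply: (le_trans (mean_gap_le P fF s ml mc)).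
 have mI := meas_rate fF noise kc phi_loc L0 hL.
 have m1 : measfun (fun w => (`|intensity ppm h phi lam (w, s) - intensity ppm h phi (@clock_rate _ _ F) (w, s)|)%:E).
  by apply/measurable_EFinP; apply: mcomp => //; apply: measurable_funB; apply: mi; exact: mI.
 have m2 : measfun (fun w => (`|intensity ppm h phi (@clock_rate _ _ F) (w, s) - lam0 s|)%:E).
  by apply/measurable_EFinP; apply: mcomp => //; apply: measurable_funB => //; apply: mi; exact: mI.
 apply: (@le_trans _ _ (\int[P]_w ((`|intensity ppm h phi lam (w, s) - intensity ppm h phi (@clock_rate _ _ F) (w, s)|)%:E +
   (`|intensity ppm h phi (@clock_rate _ _ F) (w, s) - lam0 s|)%:E))%E).
  apply: ae_ge0_le_integral => //.
  + by apply/measurable_EFinP; apply: mcomp => //; apply: measurable_funB; exact: mi.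
  + side.
  + exact: emeasurable_funD.
  + apply: filterS lfix => w fx _; have ce : clock_rate (F := F) (w, s) = lam0 s by rewrite /clock_rate /= max_l.
   rewrite -EFinD lee_fin fx ce.
   exact: ler_distD.
 rewrite ge0_integralD//; apply: leeD.
  apply: (rate_mean fF noise kc phi_loc L0 hL ml mc).
   by apply: filterS (hit_finite fF noise kc ml lb) => w; exact.
  by apply: filterS (hit_finite fF noise kc mc (bounded_mean_clock_rate P F)) => w; exact.
 by apply: (clock_rate_fluctuation M0 hM fF noise kc); rewrite s0'.
- have [M1 M10 lM1] := lb T.
 have [M2 M20 lM2] := bounded_mean_clock_rate P F T.
 apply: (@le_lt_trans _ _ (\int[leb]_(u in `[0%R, T]) (cst (M1 + M2)%:E) u)%E).
  apply: ge0_le_integral => //.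
  + side.
  + by apply: measurable_funTS; exact: meas_mean_gap.
  + move=> u; rewrite /= in_itv/= => uT; apply: (le_trans (mean_gap_le P fF u ml mc)).
   apply: (@le_trans _ _ (\int[P]_w (`|lam (w, u)|%:E + `|clock_rate (F := F) (w, u)|%:E))%E).
    apply: ge0_le_integral => //.
    * by apply/measurable_EFinP; apply: mcomp => //; apply: measurable_funB; exact: mi.
    * by apply: emeasurable_funD; apply/measurable_EFinP; apply: mcomp => //; exact: mi.
    * by move=> w _; rewrite -EFinD lee_fin; exact: ler_normB.
   rewrite ge0_integralD//; last 2 first.
   * by apply/measurable_EFinP; apply: mcomp => //; exact: mi.
   * by apply/measurable_EFinP; apply: mcomp => //; exact: mi.
   by rewrite EFinD; apply: leeD; [exact: lM1|exact: lM2].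
 rewrite (integral_cst leb); last side.
 rewrite lte_mul_pinfty ?lee_fin ?addr_ge0//.
 by rewrite [X in (X < _)%E](_ : _ = leb `[0%R, T]%classic)// lebesgue_measure_itv/=; case: ifP; rewrite ?ltry.
Qed.
End coupling.

(** Compares the simple functions below [f] and [g]; it is meant for the integrand of (ii), a
    supremum over uncountably many times. *)
Lemma le_int_majorant d (T : measurableType d) (R : realType) (m : {measure set T -> \bar R})
  (f g : T -> \bar R) : (forall x, 0 <= f x)%E -> (forall x, f x <= g x)%E ->
 (\int[m]_x f x <= \int[m]_x g x)%E.
Proof.
move=> f0 fg; have g0 x : (0 <= g x)%E := le_trans (f0 x) (fg x).
rewrite !ge0_integralTE//; apply: le_ereal_sup => _ [q qf <-]; exists q => // x.
by apply: le_trans (qf x) (fg x).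
Qed.

Lemma ae_le_int_majorant d (T : measurableType d) (R : realType) (m : {measure set T -> \bar R})
  (f g : T -> \bar R) : (forall x, 0 <= f x)%E -> measfun g ->
 {ae m, forall x, (f x <= g x)%E} -> (\int[m]_x f x <= \int[m]_x g x)%E.
Proof.
move=> f0 mg [N [mN N0 NP]].
(* Raising [g] to [+oo] on a measurable null set makes the comparison hold everywhere. *)
pose g' x := if x \in N then +oo%E else g x.
apply: (@le_trans _ _ (\int[m]_x g' x)%E).
 apply: le_int_majorant => // x; rewrite /g'; case: ifPn => [_|/negP xN]; first exact: leey.
 by apply: contrapT => h; apply: xN; apply/mem_set; exact: NP.
rewrite le_eqVlt; apply/orP; left; apply/eqP; apply: ae_eq_integral => //.
 apply: measurable_fun_ifT => //; apply: (measurable_fun_bool true); rewrite setTI (_ : _ @^-1` _ = N)//.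
 by apply/seteqP; split => x /=; [exact: set_mem|exact: mem_set].
exists N; split => // x ne; apply: contrapT => xN; apply: ne => _.
by rewrite /g' memNset.
Qed.

Lemma skorokhod_eq (R : realType) (x y : skorokhod R) : (forall t, 0 <= t -> x t = y t) -> x = y.
Proof.
case: x y => x xc [y yc] /= xy.
have e : x = y.
 apply/funext => t; have [t0|t0] := leP 0 t; first exact: xy.
 by have [-> // _ _] := xc; have [-> //] := yc.
subst y; congr Skorokhod; side.
Qed.

(** * Laws of thinned paths *)

Section path.
Context (R : realType) d (Om : measurableType d) (P : probability Om R) d' (Om' : measurableType d')
 (P' : probability Om' R) (k : R.-ker Om ~> plane R) (k' : R.-ker Om' ~> plane R).
Hypotheses (poi : is_poisson_measure P k nu) (poi' : is_poisson_measure P' k' nu)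
 (kc : forall w, count_measure (k w)) (kc' : forall w, count_measure (k' w)).
Variable S : set (plane R).
Hypotheses (mS : measurable S) (adm : forall m : {measure set (plane R) -> \bar R},
 (forall n, (m (box n) < +oo)%E) -> admissible m S).

Let kadm w : admissible (k w) S. Proof. by apply: adm => n; have [] := kc w. Qed.
Let kadm' w : admissible (k' w) S. Proof. by apply: adm => n; have [] := kc' w. Qed.

Lemma joint_count m (B : 'I_m -> set (plane R)) (D : 'I_m -> R) : (forall i, measurable (B i)) ->
 trivIset setT B -> (forall i, (nu (B i) < +oo)%E) ->
 P [set w | forall i, k w (B i) = (D i)%:E] = P' [set w | forall i, k' w (B i) = (D i)%:E].
Proof.
move=> mB tB Boo.
have capE (T : Type) (kk : T -> 'I_m -> \bar R) : [set w | forall i, kk w i = (D i)%:E] =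
  \bigcap_(i in [set` [set: 'I_m]%SET]) [set w | kk w i = (D i)%:E].
 by apply/seteqP; split => w h i; [move=> _; exact: (h i)|apply: (h i); rewrite /= finset.in_setT].
have ind e (O : measurableType e) (Q : probability O R) (q : R.-ker O ~> plane R) :
  is_poisson_measure Q q nu -> (forall w, count_measure (q w)) ->
  fine (Q [set w | forall i, q w (B i) = (D i)%:E]) =
   \prod_(i < m) fine (Q [set w | q w (B i) = (D i)%:E]).
 move=> [_ qi] qc; rewrite (capE _ (fun w i => q w (B i))).
 rewrite (qi m B mB tB [set: 'I_m]%SET (fun i => [set w | q w (B i) = (D i)%:E])); last first.
  move=> i _; exists [set (D i)%:E]; side.
 by apply: eq_bigl => i; rewrite finset.in_setT.
rewrite -[LHS]fineK; last first.
 apply: fin_num_measure; rewrite (capE _ (fun w i => k w (B i))); apply: bigcap_finset_measurable => i _.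
 by have := measurable_kernel k (B i) (mB i) measurableT _ (emeasurable_set1 (D i)%:E); rewrite setTI.
rewrite -[RHS]fineK; last first.
 apply: fin_num_measure; rewrite (capE _ (fun w i => k' w (B i))); apply: bigcap_finset_measurable => i _.
 by have := measurable_kernel k' (B i) (mB i) measurableT _ (emeasurable_set1 (D i)%:E); rewrite setTI.
rewrite (ind _ _ _ _ poi kc) (ind _ _ _ _ poi' kc'); congr (_%:E); apply: eq_bigr => i _; congr fine.
(* A prescribed value that is not an integer gives the empty event on both sides. *)
have [[q Dq]|nD] := pselect (exists q : nat, D i = q%:R).
 by rewrite Dq (poi.1 _ (mB i) (Boo i)) (poi'.1 _ (mB i) (Boo i)).
have emp (T : Type) (kk : T -> {measure set (plane R) -> \bar R}) : (forall w, count_measure (kk w)) ->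
  [set w | kk w (B i) = (D i)%:E] = set0.
 move=> kkc; apply/seteqP; split => // w /= e; have [_ h _] := kkc w.
 by case: (h _ (mB i)); rewrite e// => -[q [Dq]]; apply: nD; exists q.
by rewrite (emp _ k)// (emp _ k')// !measure0.
Qed.

(** Prescribing the values of the path at increasing times amounts to prescribing the counts of the
    disjoint parts of [S] between consecutive times, whose joint law is that of [joint_count]. *)
Lemma sorted_path_law (s : seq (R * nat)) : sorted (fun p q => p.1 <= q.1) s ->
 P [set w | forall p, p \in s -> tally (k w) S p.1 = p.2%:R] =
 P' [set w | forall p, p \in s -> tally (k' w) S p.1 = p.2%:R].
Proof.
move=> srt; pose m := size s.
pose t i := (nth (0, 0%N) s i).1; pose v i : R := (nth (0, 0%N) s i).2%:R.
pose C i := if i is j.+1 then upto (t i) `\` upto (t j) else upto (t 0%N).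
pose B (i : 'I_m) := S `&` C i.
pose D (i : 'I_m) := if val i is j.+1 then v i - v j else v 0%N.
have tnd i j : (i <= j < m)%N -> t i <= t j.
 move=> /andP[ij jm]; have tr : transitive (fun p q : R * nat => p.1 <= q.1) by move=> a b c; exact: le_trans.
 by apply: (sorted_leq_nth tr _ _ srt) => //; rewrite ?inE ?(leq_ltn_trans ij).
have mC i : measurable (C i) by case: i => [|i]; [side|apply: measurableD; exact: meas_upto].
have mB i : measurable (B i) by side.
have tB : trivIset setT B.
 apply/trivIsetP => i j _ _; wlog ij : i j / (i < j)%N.
  move=> h ne; have [/h/(_ ne)//|] := ltnP i j; rewrite leq_eqVlt => /predU1P[e|ji].
   by case/eqP : ne; exact/val_inj.
  by rewrite setIC; apply: h => //; rewrite eq_sym.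
 move=> _; apply/seteqP; split => // y [[_ yi] [_ yj]].
 move: ij yj; rewrite /C; case: (val j) (ltn_ord j) => // j' jm ij [_ h]; apply: h.
 suff : upto (t i) y by apply: upto_subset; apply: tnd; rewrite -ltnS ij ltnW.
 by move: yi; rewrite /C; case: (val i) => // i' [].
have Boo i : (nu (B i) < +oo)%E.
 have na : admissible nu S by apply: adm => n; exact: quad_leb_box.
 apply: le_lt_trans (tally_lt_pinfty na (t i)); apply: le_measure; rewrite ?inE//.
  side.
 by apply: setIS; rewrite /C; case: (val i) => // i' y [].
have key (q : {measure set (plane R) -> \bar R}) : admissible q S ->
  (forall p, p \in s -> tally q S p.1 = p.2%:R) <-> (forall i, q (B i) = (D i)%:E).
 move=> qa.
 have idx : (forall p, p \in s -> tally q S p.1 = p.2%:R) <-> (forall i, (i < m)%N -> tally q S (t i) = v i).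
  split => [h i im|h p ps]; first by apply: h; exact: mem_nth.
  by have := h (index p s); rewrite index_mem => /(_ ps); rewrite /t /v nth_index.
 have step i (im : (i.+1 < m)%N) : (tally q S (t i.+1))%:E = (tally q S (t i))%:E + q (S `&` C i.+1).
  rewrite !tallyE// -measureU//.
  - congr (q _); rewrite -setIUr; congr setI; rewrite /C.
   apply/seteqP; split => y; first by move=> yt; have [|?] := pselect (upto (t i) y); [left|right].
   by case=> [|[]//]; apply: upto_subset; apply: tnd; rewrite leqnSn.
  - side.
  - side.
  - side.
 split => [/idx h [i im]|h].
  rewrite /B /D /=; case: i im => [|i] im; first by rewrite -tallyE// h.
  have := step i im; rewrite !h//; last exact: ltnW.
  move=> e; have fi : q (S `&` C i.+1) \is a fin_num.
   rewrite ge0_fin_numE//; apply: le_lt_trans (tally_lt_pinfty qa (t i.+1)); apply: le_measure; rewrite ?inE//.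
    side.
    side.
   side.
  move: e; rewrite -(fineK fi) -EFinD => -[e]; congr EFin; rewrite e; ring.
 apply/idx => i; elim: i => [|i IH] im.
  by have := h (Ordinal im); rewrite /B /D /= -tallyE// => -[].
 have := step i im; have := h (Ordinal im); rewrite /B /D /= => ->.
 by rewrite IH ?(ltnW im)// -EFinD => -[->]; ring.
rewrite (_ : [set w | _] = [set w | forall i, k w (B i) = (D i)%:E]); last first.
 by apply/seteqP; split => w /= /(key _ (kadm w)).
rewrite joint_count//; congr (P' _).
by apply/seteqP; split => w /= /(key _ (kadm' w)).
Qed.

Definition finite_cylinders : set_system (skorokhod R) :=
 [set A | exists s : seq (R * nat), (forall p, p \in s -> 0 <= p.1) /\
  A = [set z : skorokhod R | forall p, p \in s -> z p.1 = p.2%:R]].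

Let Y w := tally_path (k w) S.
Let Y' w := tally_path (k' w) S.

Lemma cylinder_path_law (A : set (skorokhod R)) : <<s finite_cylinders >> A ->
 P (Y @^-1` A) = P' (Y' @^-1` A).
Proof.
have cyl (B : set (skorokhod R)) : finite_cylinders B -> measurable B.
 move=> [s [s0 ->]].
 elim: s s0 => [|p s IH] s0.
  by rewrite (_ : mkset _ = setT)//; apply/seteqP; split.
 have -> : [set z : skorokhod R | forall q, q \in p :: s -> z q.1 = q.2%:R] =
   [set z : skorokhod R | z p.1 = p.2%:R] `&` [set z : skorokhod R | forall q, q \in s -> z q.1 = q.2%:R].
  apply/seteqP; split => z /=.
   by move=> h; split => [|q qs]; apply: h; rewrite inE ?eqxx ?qs ?orbT.
  by move=> [h1 h2] q; rewrite inE => /predU1P[->//|]; exact: h2.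
 apply: measurableI; last by apply: IH => q qs; apply: s0; rewrite inE qs orbT.
 have := @meas_coordinate R p.1 measurableT [set p.2%:R] (measurable_set1 _).
 by rewrite setTI.
have mY : measfun Y.
 rewrite /Y (_ : (fun w => _) = fun w => tally_path (k w) (xsection (setT `*` S) w)).
  by apply: meas_tally_path => [w n|]; [have [] := kc w|side].
 apply/funext => w; congr tally_path; apply/seteqP; split => y; first by move=> ?; apply/xsectionP.
 by move=> /xsectionP[].
have mY' : measfun Y'.
 rewrite /Y' (_ : (fun w => _) = fun w => tally_path (k' w) (xsection (setT `*` S) w)).
  by apply: meas_tally_path => [w n|]; [have [] := kc' w|side].
 apply/funext => w; congr tally_path; apply/seteqP; split => y; first by move=> ?; apply/xsectionP.
 by move=> /xsectionP[].
have sm : <<s finite_cylinders >> `<=` @measurable _ (skorokhod R).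
 by apply: smallest_sub => //; exact: sigma_algebra_measurable.
have pm (B : set (skorokhod R)) : <<s finite_cylinders >> B -> measurable (Y @^-1` B).
 by move=> /sm mB; have := mY measurableT B mB; rewrite setTI.
have pm' (B : set (skorokhod R)) : <<s finite_cylinders >> B -> measurable (Y' @^-1` B).
 by move=> /sm mB; have := mY' measurableT B mB; rewrite setTI.
apply: (@dynkin_induction _ (g_sigma_algebraType finite_cylinders) finite_cylinders
 (fun A => P (Y @^-1` A) = P' (Y' @^-1` A))) => //.
- move=> A1 A2 [s1 [h1 ->]] [s2 [h2 ->]]; exists (s1 ++ s2); split.
  by move=> p; rewrite mem_cat => /orP[]; [exact: h1|exact: h2].
 apply/seteqP; split => z /=.
  by move=> [e1 e2] p; rewrite mem_cat => /orP[]; [exact: e1|exact: e2].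
 by move=> e; split => p ps; apply: e; rewrite mem_cat ps ?orbT.
- by rewrite !preimage_setT !probability_setT.
- move=> _ [s [s0 ->]].
 pose le1 (p q : R * nat) := p.1 <= q.1.
 have := sorted_path_law (sort_sorted (leT := le1) (fun p q => le_total p.1 q.1) s).
 have E (T : Type) (kk : T -> {measure set (plane R) -> \bar R}) : (forall w, admissible (kk w) S) ->
   [set w | forall p, p \in sort le1 s -> tally (kk w) S p.1 = p.2%:R] =
   (fun w => tally_path (kk w) S) @^-1` [set z | forall p, p \in s -> z p.1 = p.2%:R].
  move=> ka; apply/seteqP; split => w h p /=.
   by move=> ps; rewrite tally_pathE//; apply: h; rewrite mem_sort.
  by rewrite mem_sort => ps; have := h p ps; rewrite tally_pathE.
 by rewrite (E _ k)// (E _ k').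
- move=> B mB PB; change (P (~` (Y @^-1` B)) = P' (~` (Y' @^-1` B))).
 rewrite probability_setC; last exact: pm.
 by rewrite probability_setC; [rewrite PB|exact: pm'].
- move=> B mB tB PB.
 change (P (\bigcup_i (Y @^-1` B i)) = P' (\bigcup_i (Y' @^-1` B i))).
 rewrite !measure_semi_bigcup.
 + by apply: eq_eseriesr => i _; exact: PB.
 + by move=> i; exact: (pm' _ (mB i)).
 + by move=> i j _ _ [w [/= h1 h2]]; apply: (tB i j) => //; exists (Y' w).
 + by apply: bigcupT_measurable => i; exact: (pm' _ (mB i)).
 + by move=> i; exact: (pm _ (mB i)).
 + by move=> i j _ _ [w [/= h1 h2]]; apply: (tB i j) => //; exists (Y w).
 + by apply: bigcupT_measurable => i; exact: (pm _ (mB i)).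
Qed.

(** The cylinders with integer values generate the coordinate events modulo the set [N] of paths
    with a non-integer value, and step paths avoid [N]. Laws can thus be carried from one
    probability space to another. *)
Lemma path_law (A : set (skorokhod R)) : measurable A -> P (Y @^-1` A) = P' (Y' @^-1` A).
Proof.
pose N : set (skorokhod R) := [set z | ~ forall t, exists n : nat, z t = n%:R].
move=> mA; have : exists2 B, <<s finite_cylinders >> B & B `\` N = A `\` N.
 apply: (@sigma_modulo _ (skorokhod R) N finite_cylinders (@coordinate_events R)) mA.
 move=> _ [t [B [t0 mB ->]]].
 exists (\bigcup_(n in [set n : nat | B n%:R]) [set z : skorokhod R | z t = n%:R]).
  apply: (@bigcup_measurable _ (g_sigma_algebraType finite_cylinders)) => n _.
  apply: sub_sigma_algebra; exists [:: (t, n)]; split => [p|]; first by rewrite inE => /eqP ->.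
  apply/seteqP; split => z /=; first by move=> zt p; rewrite inE => /eqP ->.
  by move=> /(_ (t, n)); apply; rewrite inE.
 apply/seteqP; split => z [h nN]; split => //.
  by move: h => [n Bn /= ->].
 have /contrapT/(_ t)[n zn] := nN; exists n => //=; by rewrite -zn.
move=> [B sB BA].
have e (T : Type) (X : T -> skorokhod R) : (forall w, is_step_path (X w)) -> X @^-1` A = X @^-1` B.
 move=> Xs; apply/seteqP; split => w /= h; have [_ [_ st]] := Xs w; have nN : ~ N (X w) by apply.
  by have [] : (B `\` N) (X w) by rewrite BA.
 by have [] : (A `\` N) (X w) by rewrite -BA.
rewrite (e _ Y); last by move=> w; exact: tally_path_step.
by rewrite (e _ Y'); [exact: cylinder_path_law|move=> w; exact: tally_path_step].
Qed.
End path.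

(** * The coupling *)

Section system.
Context (R : realType).
Local Notation E := (measurableTypeR R).
Variables (h phi : R -> R) (L : R).
Hypotheses (phi_loc : locally_square_integrable phi) (h0 : forall x, 0 <= h x) (L0 : 0 <= L)
 (hL : lip L h).
Variable lam0 : R -> R.
Hypotheses (ml0 : measfun (lam0 : E -> R)) (l00 : forall s, 0 <= lam0 s)
 (lb0 : loc_bounded lam0)
 (lfix0 : forall s, 0 <= s -> lam0 s = h (drive phi lam0 s)).

Section limit.
Context d (Om : measurableType d) (P : probability Om R) (k : R.-ker Om ~> plane R).
Hypothesis kc : forall w, count_measure (k w).

Lemma meas_limit_path : measfun (fun w => tally_path (k w) (rate_reg lam0)).
Proof.
have mS : measurable (rate_reg lam0) by side.
rewrite (_ : (fun w => _) = fun w => tally_path (k w) (xsection (setT `*` rate_reg lam0) w)).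
 by apply: meas_tally_path => [w n|]; [have [] := kc w|side].
apply/funext => w; congr tally_path; apply/seteqP; split => y; first by move=> ?; apply/xsectionP.
by move=> /xsectionP[].
Qed.

Definition limit_path : {RV P >-> skorokhod R} := mfun_Sub (mem_set meas_limit_path).

Lemma limit_pathE w : limit_path w = tally_path (k w) (rate_reg lam0).
Proof. by []. Qed.

Lemma limit_path_tally w t : (limit_path w t)%:E = k w (rate_reg lam0 `&` upto t).
Proof.
have adm : admissible (k w) (rate_reg lam0) by apply: adm_rate => // q; have [] := kc w.
by rewrite limit_pathE tally_pathE// tallyE.
Qed.

Lemma limit_path_noise (A : set (skorokhod R)) : measurable A ->
 <<s noise_events k setT >> (limit_path @^-1` A).
Proof.
move=> mA; pose T0 := g_sigma_algebraType (noise_events k setT).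
have mS : measurable (rate_reg lam0) by side.
have : measfun (fun w : T0 => limit_path w).
 apply: meas_to_skorokhod => t t0 _ B mB; rewrite setTI.
 apply: sub_sigma_algebra; exists (rate_reg lam0 `&` upto t), (fine @^-1` B); split => //.
 - side.
 - by have := @fine_measurable R setT measurableT measurableT B mB; rewrite setTI.
 - by apply/seteqP; split => w /=; rewrite -limit_path_tally.
by move=> /(_ measurableT A mA); rewrite setTI.
Qed.
End limit.

(** Each copy is a function of its own noise, whence independence; equality in law is an instance of
    [path_law]. *)
Lemma limit_paths_iid d (Om : measurableType d) (P : probability Om R) n
  (ppm : 'I_n.+1 -> R.-ker Om ~> plane R) (kc : forall i w, count_measure (ppm i w)) :
 (forall i, is_poisson_measure P (ppm i) nu) ->
 independent_systems P (fun i => <<s noise_events (ppm i) setT >>) ->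
 iid (fun i => limit_path P (kc i)).
Proof.
move=> poi ind; split.
 apply: indep_systems_sub ind => i _ [A mA <-]; rewrite setTI; exact: limit_path_noise.
move=> i j A mA.
have mS : measurable (rate_reg lam0) by side.
exact: (path_law (poi i) (poi j) (kc i) (kc j) mS (fun m => adm_rate ml0 lb0 (m := m)) mA).
Qed.

Section agreement.
Context d (Om : measurableType d) (P : probability Om R) (F : R -> set_system Om)
 (n : nat) (ppm : 'I_n.+1 -> R.-ker Om ~> plane R).
Local Notation PT := (predictable F).
Hypotheses (fF : is_filtration F) (noise : is_poisson_noise P F ppm)
 (kc : forall i w, count_measure (ppm i w)).
Variable lam : PT -> R.
Hypotheses (ml : measfun lam) (lb : bounded_mean P lam).

Definition mismatch T i w : \bar R := ppm i w (gap lam (@clock_rate R lam0 _ _ F) w `&` upto T).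

Lemma meas_mismatch T i : measfun (mismatch T i).
Proof. by apply: meas_gap_count => //; exact: meas_clock_rate. Qed.

Lemma mismatch_count T i w : mismatch T i w = +oo%E \/ is_count (mismatch T i w).
Proof.
have [_ h1 _] := kc i w; apply: h1; apply: measurableI; last side.
by apply: meas_gap => //; exact: meas_clock_rate.
Qed.

(** A point counted by one path and not by the other lies in the gap, and all times up to [T] are
    covered by the same count. *)
Lemma mismatch_bound : {ae P, forall w, forall i T t, 0 <= t <= T ->
 ((`|tally_path (ppm i w) (below lam w) t - tally_path (ppm i w) (rate_reg lam0) t|)%:E <= mismatch T i w)%E}.
Proof.
apply: filterS (below_adm fF noise kc ml lb) => w adm i T t /andP[t0 tT].
have adm0 : admissible (ppm i w) (rate_reg lam0) by apply: adm_rate => // q; have [] := kc i w.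
rewrite !tally_pathE//.
have mc := @meas_clock_rate R lam0 ml0 d Om F fF.
have mG : measurable (gap lam (@clock_rate R lam0 _ _ F) w `&` upto T).
 by apply: measurableI; [exact: meas_gap|side].
have [_ _ m0] := kc i w.
have one (A B : set (plane R)) : admissible (ppm i w) A -> admissible (ppm i w) B ->
  (A `\` B) `&` upto t `&` @positive_quad R `<=` gap lam (@clock_rate R lam0 _ _ F) w `&` upto T ->
  ((tally (ppm i w) A t)%:E <= (tally (ppm i w) B t)%:E + mismatch T i w)%E.
 move=> aA aB sub; have [mA _ _] := aA; have [mB _ _] := aB.
 have mAt : measurable (A `&` upto t) by side.
 have mBt : measurable (B `&` upto t) by side.
 have mD : measurable ((A `\` B) `&` upto t) by side.
 rewrite !tallyE//; apply: (@le_trans _ _ (ppm i w ((B `&` upto t) `|` ((A `\` B) `&` upto t)))).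
  apply: le_measure; rewrite ?inE//; first side.
  by move=> y [Ay yt]; have [By|By] := pselect (B y); [left|right].
 have le1 : (ppm i w ((A `\` B) `&` upto t) <= mismatch T i w)%E.
  rewrite (measure_positive m0 mD); apply: le_measure; rewrite ?inE//.
  by apply: measurableI => //; exact: meas_positive_quad.
 by apply: (le_trans (measureU2 _ mBt mD)); exact: leeD2l.
have gA (y : plane R) : @positive_quad R y -> 0 < y.1 /\ 0 <= y.2.
 by rewrite /positive_quad /= !in_itv/= !andbT.
have c1 : ((tally (ppm i w) (below lam w) t)%:E <= (tally (ppm i w) (rate_reg lam0) t)%:E + mismatch T i w)%E.
 apply: one => // y [[[yA yB] yt] /gA[y1 y2]]; split; last exact: (upto_subset tT).
 split => //; split => //; rewrite /gapb.
 case: yA => _ /andP[_ ->]; rewrite ltNge /clock_rate /= max_l; last side.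
 by apply/negP => yl; apply: yB; split; [side|rewrite y2].
have c2 : ((tally (ppm i w) (rate_reg lam0) t)%:E <= (tally (ppm i w) (below lam w) t)%:E + mismatch T i w)%E.
 apply: one => // y [[[yA yB] yt] /gA[y1 y2]]; split; last exact: (upto_subset tT).
 split => //; split => //; rewrite /gapb.
 have -> : (y.2 <= lam (w, y.1)) = false.
  by apply/negP => yl; apply: yB; split; [side|rewrite y2].
 by rewrite /clock_rate /= max_l; [case: yA => _ /andP[]|side].
have mm0 : (0 <= mismatch T i w)%E by side.
move: c1 c2 mm0; case: (mismatch T i w) => [r| |//]; last by move=> *; rewrite leey.
by rewrite -!EFinD !lee_fin => c1 c2 _; rewrite ler_norml; apply/andP; split; lra.
Qed.
End agreement.

(** [G] counts the points between the two rates. It bounds the supremum of (ii); being an integer,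
    it also makes the two paths equal on [0, T] off an event of probability at most its mean, as
    needed for (iii). *)
Lemma hawkes_coupling : exists2 C : R -> R, (forall T, 0 <= C T) &
 forall d (Om : measurableType d) (P : probability Om R) (F : R -> set_system Om)
  n (ppm : 'I_n.+1 -> R.-ker Om ~> plane R),
 is_filtration F -> is_poisson_noise P F ppm -> null_complete P F ->
 (forall i w, count_measure (ppm i w)) ->
 exists (Z : 'I_n.+1 -> {RV P >-> skorokhod R}) (G : R -> 'I_n.+1 -> Om -> \bar R),
  [/\ is_mean_field_hawkes h phi F ppm Z, forall i w, is_step_path (Z i w),
   forall T i, measfun (G T i) /\ forall w, G T i w = +oo%E \/ is_count (G T i w),
   {ae P, forall w, forall i T t, 0 <= t <= T ->
    ((`|Z i w t - tally_path (ppm i w) (rate_reg lam0) t|)%:E <= G T i w)%E} &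
   forall T i, 0 <= T -> (\int[P]_w G T i w <= (C T / Num.sqrt n.+1%:R)%:E)%E].
Proof.
have /choice[C hC] : forall T, exists C, 0 <= C /\ (0 <= T -> forall d (Om : measurableType d)
  (P : probability Om R) (F : R -> set_system Om) n (ppm : 'I_n.+1 -> R.-ker Om ~> plane R),
 is_filtration F -> is_poisson_noise P F ppm -> (forall i w, count_measure (ppm i w)) ->
 forall lam : predictable F -> R, measfun lam ->
 {ae P, forall w, forall s, lam (w, s) = intensity ppm h phi lam (w, s)} -> bounded_mean P lam ->
 (\int[lebesgue_measure]_(s in `[0%R, T]) mean_gap P lam (@clock_rate _ lam0 _ _ F) s <= (C / Num.sqrt n.+1%:R)%:E)%E).
 move=> T; have [T0|T0] := leP 0 T; last by exists 0; split.
 have [C C0 hC] := coupling_gap phi_loc L0 hL ml0 l00 lb0 lfix0 T0.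
 by exists C.
exists C => [T|d Om P F n ppm fF noise Fnull kc]; first by have [] := hC T.
have ml := meas_limit_rate fF noise kc phi_loc L0 hL.
have lfix := limit_rate_fix fF noise kc phi_loc h0 L0 hL.
have lb := bounded_mean_limit fF noise kc phi_loc h0 L0 hL.
have mc := @meas_clock_rate R lam0 ml0 d Om F fF.
exists (hawkes_path P fF kc ml), (mismatch (F := F) ppm (limit_rate ppm h phi)); split.
- exact: (hawkes_path_hawkes fF noise kc phi_loc ml lfix lb Fnull).
- by move=> i w; rewrite hawkes_pathE; exact: tally_path_step.
- by move=> T i; split; [exact: meas_mismatch|move=> w; exact: mismatch_count].
- by apply: filterS (mismatch_bound fF noise kc ml lb) => w hw i T t tT; rewrite hawkes_pathE; exact: hw.
- move=> T i T0; apply: (le_trans (gap_count_mean fF noise kc i T ml mc)).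
 have [_ hT] := hC T; exact: (hT T0 _ _ _ _ _ _ fF noise kc _ ml lfix lb).
Qed.
End system.

Section part.
Context (R : realType).
Variables (h phi : R -> R) (L : R).
Hypotheses (phi_loc : locally_square_integrable phi) (h0 : forall x, 0 <= h x) (L0 : 0 <= L)
 (hL : lip L h).

Lemma coupling_on_one_space : exists C : R -> R, forall n : nat,
 exists (d : measure_display) (Om : measurableType d)
  (P : probability Om R) (F : R -> set_system Om)
  (ppm : 'I_n.+1 -> R.-ker Om ~> plane R)
  (Z Zbar : 'I_n.+1 -> {RV P >-> skorokhod R}),
  [/\ is_filtration F /\ is_poisson_noise P F ppm,
    is_mean_field_hawkes h phi F ppm Z,
    forall i, exists ppm' : R.-ker Om ~> plane R,
     is_poisson_measure P ppm' (quadrant_lebesgue R) /\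
     is_limit_solution h phi ppm' (Zbar i),
    iid Zbar &
    forall T, 0 < T -> forall i,
     (\int[P]_w ereal_sup
       [set (`|Z i w t - Zbar i w t|)%:E | t in `[0%R, T]]
      <= (C T / Num.sqrt n.+1%:R)%:E)%E].
Proof.
have [lam0 [ml0 l00 lb0 lfix0]] := limit_rate_exists phi_loc h0 L0 hL.
have [C C0 hC] := hawkes_coupling phi_loc h0 L0 hL ml0 l00 lb0 lfix0.
exists C => n.
have [F [ppm [fF noise Fnull kc _]]] := good_noise (slice_filtrationP R n) (slice_noise R n).
have [Z [G [hZ _ mG agree intG]]] := hC _ _ _ _ _ _ fF noise Fnull kc.
have [poi ind _ _] := noise.
exists _, _, (@unif R), F, ppm, Z, (fun i => limit_path ml0 (@unif R) (kc i)); split => //.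
- move=> i; exists (ppm i); split; first side.
 apply: (limit_solutionP phi_loc ml0 l00 lb0 lfix0 (poi i) (kc i)) => //.
 exact: aeW.
- exact: limit_paths_iid.
- move=> T T0 i; apply: le_trans (intG T i (ltW T0)).
 have [mGi _] := mG T i.
 apply: ae_le_int_majorant => //.
  move=> w; apply: (@le_trans _ _ (`|Z i w 0 - limit_path ml0 (@unif R) (kc i) w 0|)%:E); first side.
  by apply: ereal_sup_ubound; exists 0 => //; rewrite /= in_itv/= lexx ltW.
 apply: filterS agree => w hw; apply: ge_ereal_sup => _ [t + <-].
 by rewrite /= in_itv/= => tT; exact: hw.
Qed.
End part.

(** * Closed sets and inner regularity in the Cantor space *)

Section binary.

Definition code := nat -> bool.
HB.instance Definition _ := gen_eqMixin code.
HB.instance Definition _ := gen_choiceMixin code.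
HB.instance Definition _ := isPointed.Build code (fun=> false).

Definition agree n (a b : code) := forall i, (i < n)%N -> a i = b i.

(** Closedness in the product topology of the Cantor space, expressed by prefixes; compactness
    enters through the projection lemma only. *)
Definition bit_closed (L : set code) := forall a, (forall n, exists2 b, L b & agree n a b) -> L a.

Definition bit_events : set_system code := [set A | exists i, A = [set c : code | c i]].

Local Notation bits := (g_sigma_algebraType bit_events).

Definition even_bits (c : code) : code := fun i => c i.*2.
Definition odd_bits (c : code) : code := fun i => c i.*2.+1.
Definition merge (a b : code) : code := fun i => if odd i then b i./2 else a i./2.

Lemma even_merge a b : even_bits (merge a b) = a.
Proof. by apply/funext => i; rewrite /even_bits /merge odd_double doubleK. Qed.

Lemma odd_merge a b : odd_bits (merge a b) = b.
Proof. by apply/funext => i; rewrite /odd_bits /merge /= odd_double uphalf_double. Qed.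

Lemma merge_agree n a b c : agree n a (even_bits c) -> agree n b (odd_bits c) -> agree n (merge a b) c.
Proof.
move=> ha hb i ilt; rewrite /merge -[in RHS](odd_double_half i).
have il : (i./2 < n)%N by apply: leq_ltn_trans ilt; rewrite -divn2 leq_div.
by case: (odd i); [rewrite hb|rewrite ha].
Qed.

Definition upd (b : code) n v : code := fun i => if i == n then v else b i.

Lemma meas_bit i : measurable ([set c : code | c i] : set bits).
Proof. by apply: sub_sigma_algebra; exists i. Qed.

Lemma determined_measurable n (D : set bits) : (forall a a', agree n a a' -> D a -> D a') -> measurable D.
Proof.
elim: n D => [|n IH] D h.
 have [[a Da]|D0] := pselect (exists a, D a).
  rewrite (_ : D = setT)//; apply/seteqP; split => // a' _; by apply: (h a); [move=> i; rewrite ltn0|].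
 by rewrite (_ : D = set0)//; apply/seteqP; split => // a Da; apply: D0; exists a.
pose Dv v : set bits := [set a | D (upd a n v)].
have mDv v : measurable (Dv v).
 apply: IH => a a' aa; apply: h => i; rewrite ltnS leq_eqVlt => /predU1P[->|il]; rewrite /upd ?eqxx//.
 by rewrite ltn_eqF// aa.
have upd_id (a : code) : upd a n (a n) = a by apply/funext => i; rewrite /upd; case: eqP => [->|].
rewrite (_ : D = ([set c : code | c n] `&` Dv true) `|` (~` [set c : code | c n] `&` Dv false)).
 apply: measurableU; apply: measurableI => //; first exact: meas_bit.
 by apply: measurableC; exact: meas_bit.
apply/seteqP; split => a.
 move=> Da; case E : (a n); [left|right]; split; rewrite /Dv /= ?E//; by rewrite -E upd_id.
move=> [[/= an]|[/= an]]; rewrite /Dv /= ; first by rewrite -{1}an upd_id.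
by move/negP/negbTE : an => an; rewrite -{1}an upd_id.
Qed.

Lemma bit_closed_measurable (L : set bits) : bit_closed L -> measurable L.
Proof.
move=> cL; rewrite (_ : L = \bigcap_n [set a : bits | exists2 b, L b & agree n a b]).
 apply: bigcapT_measurable => n; apply: (determined_measurable (n := n)) => a a' aa [b Lb ab].
 by exists b => // i il; rewrite -aa// ab.
apply/seteqP; split => a; first by move=> La n _; exists a.
by move=> h; apply: cL => n; exact: h.
Qed.

Lemma bit_closedU (L L' : set code) : bit_closed L -> bit_closed L' -> bit_closed (L `|` L').
Proof.
move=> cL cL' a h; apply: contrapT => nLL.
have hn (M : set code) : bit_closed M -> ~ M a -> exists n, forall b, M b -> ~ agree n a b.
 move=> cM nM; apply: contrapT => hM; apply: nM; apply: cM => n; apply: contrapT => nb.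
 by apply: hM; exists n => b Mb ab; apply: nb; exists b.
have [n hL] := hn L cL (fun x => nLL (or_introl x)).
have [n' hL'] := hn L' cL' (fun x => nLL (or_intror x)).
have [b [Lb|Lb] ab] := h (maxn n n').
 by apply: (hL b Lb) => i il; apply: ab; rewrite (leq_trans il)// leq_maxl.
by apply: (hL' b Lb) => i il; apply: ab; rewrite (leq_trans il)// leq_maxr.
Qed.

Lemma bit_closed_bigcap (L : nat -> set code) : (forall k, bit_closed (L k)) -> bit_closed (\bigcap_k L k).
Proof.
move=> cL a h k _; apply: cL => n; have [b Lb ab] := h n; by exists b => //; exact: Lb.
Qed.

Lemma bit_closed0 : bit_closed set0.
Proof. by move=> a /(_ 0%N)[]. Qed.

(* Koenig's lemma: a branch of the tree of the prefixes of b such that, for every m, some point of L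
agrees with a up to m and with the prefix. *)
Lemma bit_closed_projection (L : set code) : bit_closed L ->
 bit_closed [set a | exists2 c, L c & even_bits c = a].
Proof.
move=> cL a h.
pose Q n (b : code) := forall m, exists2 c, L c & agree m a (even_bits c) /\ agree n b (odd_bits c).
have Q0 b : Q 0%N b.
 move=> m; have [_ [c Lc <-] ac] := h m; exists c => //; split => // i; by rewrite ltn0.
have Qmono n b v : Q n.+1 (upd b n v) \/ Q n.+1 (upd b n (~~ v)) \/ ~ Q n b.
 have [Qb|] := pselect (Q n b); last by right; right.
 have [|n1] := pselect (Q n.+1 (upd b n v)); first by left.
 have [|n2] := pselect (Q n.+1 (upd b n (~~ v))); first by right; left.
 have neg (e : bool) : ~ Q n.+1 (upd b n e) -> exists m, forall c, L c -> agree m a (even_bits c) ->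
   ~ agree n.+1 (upd b n e) (odd_bits c).
  move=> nQ; apply: contrapT => hQ; apply: nQ => m; apply: contrapT => nc; apply: hQ; exists m => c Lc ac bc.
  by apply: nc; exists c.
 have [m1 h1] := neg _ n1; have [m2 h2] := neg _ n2.
 have [c Lc [ac bc]] := Qb (maxn m1 m2).
 have ac1 : agree m1 a (even_bits c) by move=> i il; apply: ac; rewrite (leq_trans il)// leq_maxl.
 have ac2 : agree m2 a (even_bits c) by move=> i il; apply: ac; rewrite (leq_trans il)// leq_maxr.
 have ub e : odd_bits c n = e -> agree n.+1 (upd b n e) (odd_bits c).
  move=> ce i; rewrite ltnS leq_eqVlt /upd => /predU1P[->|il]; first by rewrite eqxx.
  by rewrite ltn_eqF// bc.
 have [cv|cv] := eqVneq (odd_bits c n) v; first by case: (h1 c Lc ac1); exact: ub.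
 by case: (h2 c Lc ac2); apply: ub; move: cv; case: (odd_bits c n); case: (v).
pose v n b := `[< Q n.+1 (upd b n true) >].
pose B := fix B n := if n is n'.+1 then upd (B n') n' (v n' (B n')) else (fun=> false) : code.
have QB n : Q n (B n).
 elim: n => [|n IH]; first side.
 rewrite /= /v; case: asboolP => // nQ; case: (Qmono n (B n) true) => [//|[//|nB]].
 side.
pose b i := B i.+1 i.
have bB n : agree n b (B n).
 elim: n => [i|n IH i]; first side.
 by rewrite ltnS leq_eqVlt => /predU1P[->//|il]; rewrite IH//= /upd ltn_eqF.
exists (merge a b); last exact: even_merge.
apply: cL => n; have [c Lc [ac bc]] := QB n n.
by exists c => //; apply: merge_agree => // i il; rewrite (bB n i il) bc.
Qed.

Section regularity.
Context (R : realType) (mu : probability bits R).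

Let approx (A : set bits) := forall e : R, 0 < e -> exists2 L, bit_closed L &
 L `<=` A /\ (mu (A `\` L) <= e%:E)%E.

(** The sets that can be approximated from inside together with their complements form a
    sigma-algebra, and a bit event is both closed and open. For a countable union finitely many of
    the closed sets are kept, for its complement all of them are intersected. *)
Lemma bit_inner_regular (A : set bits) : measurable A -> forall e : R, 0 < e ->
 exists2 L, bit_closed L & L `<=` A /\ (mu (A `\` L) <= e%:E)%E.
Proof.
have mcl L : bit_closed L -> @measurable _ bits L := @bit_closed_measurable L.
suff h : @measurable _ bits `<=` [set A | measurable A /\ approx A /\ approx (~` A)].
 by move=> mA; have [_ []] := h A mA.
apply: smallest_sub.
 split => /=.
 - split => //; split => e e0; [exists set0; first exact: bit_closed0|exists setT => //].
   by split => //; rewrite setD0 measure0 lee_fin ltW.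
  by split; rewrite ?setC0// setDv measure0 lee_fin ltW.
 - by move=> B [mB [h1 h2]]; rewrite setTD; split; [side|rewrite setCK].
 - move=> {}A AP; have mA k : measurable (A k : set bits) by have [] := AP k.
  split; first side.
  split => e e0.
   (* These errors sum to e / 2; the other half of [e] pays for truncating the union. *)
   have ek k : 0 < e / 2 * 2^-1 ^+ k.+1 by side.
   have /choice[L LP] : forall k, exists L, bit_closed L /\ L `<=` A k /\
     (mu (A k `\` L) <= (e / 2 * 2^-1 ^+ k.+1)%:E)%E.
    by move=> k; have [_ [/(_ _ (ek k))[L cL ?] _]] := AP k; exists L.
   pose U n := \bigcup_(k in `I_n) L k.
   have cU n : bit_closed (U n).
    elim: n => [|n IH]; first by rewrite /U II0 bigcup_set0; exact: bit_closed0.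
    rewrite /U IIS bigcup_setU bigcup_set1; apply: bit_closedU => //; by have [] := LP n.
   have mU n : measurable (U n : set bits) := mcl _ (cU n).
   pose W := \bigcup_k L k.
   have mL k : measurable (L k : set bits) by apply: mcl; have [] := LP k.
   have mW : measurable (W : set bits) by side.
   have cv : (mu \o (fun n => W `\` U n)) @ \oo --> mu (\bigcap_n (W `\` U n)).
    apply: nonincreasing_cvg_mu => //.
    - rewrite -ge0_fin_numE//; apply: fin_num_measure; side.
    - side.
    - side.
    - move=> i j ij; apply/subsetPset => c [Wc nU]; split => // -[k /= ki Lk]; apply: nU.
     by exists k => //=; exact: leq_trans ij.
   have E0 : \bigcap_n (W `\` U n) = set0.
    apply/seteqP; split => // c h; have [[k _ Lk] _] := h 0%N I.
    by have [_] := h k.+1 I; apply; exists k => /=.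
   move: cv; rewrite E0 measure0 => /fine_cvgP[[N0 _ hN0] /cvgrPdist_le/(_ (e / 2))].
   move=> /(_ (divr_gt0 e0 (ltr0n _ 2)))[N1 _ hN1].
   pose n := maxn N0 N1.
   have WU : (mu (W `\` U n) <= (e / 2)%:E)%E.
    have := hN1 n (leq_maxr _ _); rewrite /= sub0r normrN => h1.
    have fn : mu (W `\` U n) \is a fin_num := hN0 n (leq_maxl _ _).
    by rewrite -(fineK fn) lee_fin (le_trans (ler_norm _)).
   exists (U n) => //; split.
    by move=> c [k _ Lk]; exists k => //; have [_ [h1 _]] := LP k; exact: h1.
   have mUA : measurable (\bigcup_k A k : set bits) by side.
   have mAL : measurable (\bigcup_k (A k `\` L k) : set bits) by side.
   have mWU : measurable (W `\` U n : set bits) by side.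
   apply: (@le_trans _ _ (mu ((\bigcup_k (A k `\` L k)) `|` (W `\` U n)))).
    apply: le_measure; rewrite ?inE; [side|exact: measurableU|].
    move=> c [[k _ Ak] nU]; have [Lk|nL] := pselect (L k c); last by left; exists k.
    by right; split => //; exists k.
   apply: (le_trans (measureU2 mu mAL mWU)).
   rewrite [e in (_ <= e%:E)%E](splitr e) EFinD; apply: leeD => //.
   have mD k : measurable (A k `\` L k : set bits) by side.
   apply: (le_trans (measure_sigma_subadditive mu mD mAL (@subset_refl _ _))).
   rewrite -[leRHS](_ : (2 * (e / 4))%:E = _); last by congr EFin; field.
   apply: geometric_nneseries => [|k|k]; first side.
    side.
   have [_ [_ h1]] := LP k; apply: (le_trans h1); rewrite lee_fin exprS; lra.
  have ek k : 0 < e / 2 * 2^-1 ^+ k by side.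
  have /choice[L LP] : forall k, exists L, bit_closed L /\ L `<=` ~` A k /\
    (mu (~` A k `\` L) <= (e / 2 * 2^-1 ^+ k)%:E)%E.
   by move=> k; have [_ [_ /(_ _ (ek k))[L cL ?]]] := AP k; exists L.
  have mL k : measurable (L k : set bits) by apply: mcl; have [] := LP k.
  exists (\bigcap_k L k); first by apply: bit_closed_bigcap => k; have [] := LP k.
  split.
   by move=> c h [k _ Ak]; have [_ [h1 _]] := LP k; apply: (h1 c) => //; exact: h.
  apply: (@le_trans _ _ (mu (\bigcup_k (~` A k `\` L k)))).
   apply: le_measure; rewrite ?inE.
   + side.
   + side.
   + move=> c [nA nL]; apply: contrapT => h; apply: nL => k _; apply: contrapT => nLk; apply: h.
    by exists k => //; split => // Ak; apply: nA; exists k.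
  have mD k : measurable (~` A k `\` L k : set bits) by side.
  have sub := @measure_sigma_subadditive _ _ _ mu _ (fun k => ~` A k `\` L k) mD (bigcupT_measurable _ mD)
   (fun c => id).
  apply: (le_trans sub).
  rewrite -[leRHS](_ : (2 * (e / 2))%:E = _); last by congr EFin; field.
  apply: geometric_nneseries => [|k|k]; first side.
   side.
  by have [_ []] := LP k.
move=> _ [i ->].
have c1 : bit_closed [set c : code | c i].
 by move=> a h; have [b bi ab] := h i.+1; rewrite /= (ab i (leqnn _)).
have c2 : bit_closed (~` [set c : code | c i]).
 by move=> a h; have [b bi ab] := h i.+1; rewrite /= (ab i (leqnn _)).
split; first exact: meas_bit.
by split => e e0; [exists [set c : code | c i]|exists (~` [set c : code | c i])] => //; split => //;
 rewrite setDv measure0 lee_fin ltW.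
Qed.
End regularity.
End binary.

(** * Coding of step paths *)

Section path.
Context (R : realType).
Local Notation E := (measurableTypeR R).
Local Notation bits := (g_sigma_algebraType bit_events).

(* Bit number (q, k) of the code of a step path x tells whether q comes before the (k+1)-st jump
of x. *)
Definition path_code (x : skorokhod R) : code := fun i =>
 if @unpickle (rat * nat)%type i is Some (q, k) then x (ratr q) < k.+1%:R else false.

Lemma path_codeE x q k : path_code x (pickle (q : rat, k : nat)) = (x (ratr q) < k.+1%:R).
Proof. by rewrite /path_code pickleK. Qed.

Lemma meas_to_bits d (T : measurableType d) (f : T -> bits) :
 (forall i, measurable [set x | f x i]) -> measfun f.
Proof. by move=> mf; apply: (@measurability _ _ T bits setT f bit_events (erefl _)) => // _ [_ [i ->] <-]; rewrite setTI; exact: mf. Qed.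

Lemma meas_path_code : measfun (path_code : skorokhod R -> bits).
Proof.
apply: meas_to_bits => i; rewrite /path_code.
case: (unpickle i) => [[q k]|]; last by rewrite (_ : mkset _ = set0)//; apply/seteqP; split.
side.
Qed.

Definition jump (k : nat) (c : bits) : \bar R :=
 ereal_sup [set (ratr q)%:E | q in [set q : rat | c (pickle (q, k))]].

Lemma meas_jump k : measfun (jump k).
Proof.
apply: (measurability _ (ErealGenOInfty.measurableE R)) => _ [_ [x ->] <-]; rewrite setTI.
rewrite (_ : _ @^-1` _ = \bigcup_q (if x < ratr q then [set c : bits | c (pickle (q : rat, k))] else set0)).
 by apply: bigcupT_measurable_rat => q; case: ifP => // _; exact: meas_bit.
apply/seteqP; split => c /=; rewrite in_itv/= andbT.
 move=> h; apply: contrapT => nh; move: h; rewrite ltNge => /negP; apply.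
 apply: ge_ereal_sup => _ [q /= cq <-]; rewrite lee_fin leNgt; apply/negP => xq.
 by apply: nh; exists q => //; rewrite xq.
move=> [q _]; case: ifP => // xq cq; apply: (@lt_le_trans _ _ (ratr q)%:E); first side.
by apply: ereal_sup_ubound; exists q.
Qed.

(** A jump that does not occur is placed at time -1, outside [future], and is therefore not
    counted. *)
Definition jump_point (k : nat) (c : bits) : plane R :=
 (if (0 <= jump k c < +oo)%E then fine (jump k c) else -1, 0).

Lemma meas_jump_point k : measfun (jump_point k).
Proof.
apply: measurable_fun_pair => //; apply: measurable_fun_ifT => //.
 apply: measurable_and; [apply: measurable_fun_lee|apply: measurable_fun_lte] => //; exact: meas_jump.
by apply: mcomp => //; exact: meas_jump.
Qed.

Definition jump_measure (c : bits) : {measure set (plane R) -> \bar R} :=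
 mseries (fun k => \d_(jump_point k c)) 0.

Definition future : set (plane R) := [set y | 0 <= y.1].

(** The path is rebuilt by counting its jump times, so measurability comes from that of
    [tally_path]. Every code is decoded to some cadlag path, and codes of step paths are decoded
    correctly. *)
Definition decode (c : bits) : skorokhod R := tally_path (jump_measure c) future.

Lemma meas_decode : measfun decode.
Proof.
have mS : measurable (setT `*` future : set (bits * plane R)) by side.
have sE (c : bits) : xsection (setT `*` future) c = future.
 by apply/seteqP; split => y; [move=> /xsectionP[]|move=> ?; apply/xsectionP].
rewrite (_ : decode = fun c => tally_path (jump_measure c) (xsection (setT `*` future) c)); last first.
 by apply/funext => c; rewrite sE.
apply: meas_tally_path_of => // B mB; under eq_fun do rewrite sE.
apply: ge0_emeasurable_sum => // k _; apply/measurable_EFinP.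
have mFB : measurable (future `&` B) by side.
exact: (mcomp (measurable_indic mFB) (@meas_jump_point k)).
Qed.

Section decode.
Variable x : skorokhod R.
Hypothesis xs : is_step_path x.

Lemma step_path_right t : 0 <= t -> exists2 e, 0 < e & forall u, t <= u < t + e -> x u = x t.
Proof.
move=> t0; have [[_ xr _] [xnd xi]] := xs.
have /cvgrPdist_lt/(_ 1 ltr01) [e /= e0 he] := xr t t0.
exists e => // u /andP[tu ue]; move: tu; rewrite le_eqVlt => /predU1P[<-//|tu].
have := he u; rewrite /ball/= distrC ger0_norm ?subr_ge0 ?ltW// ltrBlDl => /(_ ue tu).
have := xnd _ _ (ltW tu); have [a ->] := xi t; have [b ->] := xi u.
rewrite ler_nat => ab; rewrite distrC ger0_norm ?subr_ge0 ?ler_nat// ltrBlDl natr1 ltr_nat ltnS => ba.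
by congr (_%:R); apply/eqP; rewrite eqn_leq ab ba.
Qed.

Lemma jump_code_ge0 k : (0 <= jump k (path_code x))%E.
Proof.
rewrite leNgt; apply/negP => j0; have [[x0 _ _] _] := xs.
have [r jr] : exists2 r : R, r < 0 & (jump k (path_code x) <= r%:E)%E.
 move: j0; case: (jump k (path_code x)) => [r| |] // r0; first by exists r.
 by exists (-1); [rewrite ltrN10|rewrite leNye].
move=> /[dup] jr' ; apply/negP; rewrite -ltNge.
have /rat_in_itvoo[q] := jr; rewrite in_itv/= => /andP[rq q0].
apply: (@lt_le_trans _ _ (ratr q)%:E); first side.
by apply: ereal_sup_ubound; exists q => //=; rewrite path_codeE x0.
Qed.

(** Right continuity is what rules out a jump strictly after [t] being coded at [t]: a step path is
    constant just after [t], where a rational time can be found. *)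
Lemma jump_code_le k t : 0 <= t -> (jump k (path_code x) <= t%:E)%E = (k.+1%:R <= x t).
Proof.
move=> t0; have [[x0 _ _] [xnd xi]] := xs; apply/idP/idP => [jt|xt].
 rewrite leNgt; apply/negP => xt.
 have [e e0 he] := step_path_right t0.
 have /rat_in_itvoo[q] : t < t + e by rewrite ltrDl.
 rewrite in_itv/= => /andP[tq qe].
 have : ((ratr q)%:E <= jump k (path_code x))%E.
  apply: ereal_sup_ubound; exists q => //=; rewrite path_codeE he//.
  by rewrite (ltW tq) qe.
 by move=> /le_trans/(_ jt); rewrite lee_fin leNgt tq.
apply: ge_ereal_sup => _ [q /= + <-]; rewrite path_codeE => xq; rewrite lee_fin leNgt; apply/negP => tq.
by move: (le_trans xt (xnd _ _ (ltW tq))); rewrite leNgt xq.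
Qed.

Lemma jump_measure_upto t : 0 <= t -> jump_measure (path_code x) (future `&` upto t) = (x t)%:E.
Proof.
move=> t0; have [_ [_ xi]] := xs; have [m xm] := xi t.
have E k : (\d_(jump_point k (path_code x)) (future `&` upto t) = (if (k < m)%N then 1 else 0) :> \bar R)%E.
 have -> : (k < m)%N = (jump k (path_code x) <= t%:E)%E by rewrite jump_code_le// xm ler_nat.
 have jge0 := jump_code_ge0 k.
 have [jt|jt] := leP (jump k (path_code x)) t%:E.
  rewrite diracE mem_set//; have joo : (jump k (path_code x) < +oo)%E := le_lt_trans jt (ltry _).
  rewrite /future /upto /jump_point; split; rewrite /= jge0 joo /=; first exact: fine_ge0.
  by rewrite -lee_fin fineK// ge0_fin_numE.
 rewrite diracE memNset// => -[]; rewrite /future /upto /jump_point /= jge0 /=.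
 case: ifPn => [joo _|]; last by rewrite oppr_ge0 leNgt ltr01.
 by move: jt; rewrite -[jump _ _]fineK ?ge0_fin_numE// lte_fin ltNge => /negbTE ->.
rewrite /jump_measure /= /mseries xm -[LHS]/(\sum_(0 <= k <oo) \d_(jump_point k (path_code x)) (future `&` upto t))%E.
rewrite (eq_eseriesr (g := fun k => if (k < m)%N then 1%E else 0%E)); last side.
rewrite (nneseries_split _ m)//; last by move=> k _; case: ifP.
rewrite add0n eseries0 ?adde0; last by move=> k mk _; rewrite ltnNge mk.
rewrite big_mkord (eq_bigr (fun=> 1%E)); last by move=> k _; rewrite ltn_ord.
by rewrite sumEFin sumr_const card_ord.
Qed.

Lemma jump_measure_past n : jump_measure (path_code x) (future `&` upto n%:R) = (x n%:R)%:E.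
Proof. by apply: jump_measure_upto. Qed.

Lemma jump_measure_adm : admissible (jump_measure (path_code x)) future.
Proof.
split; first side.
 rewrite (_ : _ `&` _ = set0) ?measure0//; apply/seteqP; split => // y [].
 by rewrite /future /= => y0; rewrite ltNge y0.
by move=> n; rewrite jump_measure_past ltry.
Qed.

Lemma path_codeK : decode (path_code x) = x.
Proof.
have adm := jump_measure_adm.
apply: skorokhod_eq => t t0; rewrite /decode tally_pathE//.
by rewrite /tally jump_measure_upto.
Qed.
End decode.
End path.

(** Otherwise there would be paths outside [V] agreeing with [x] up to larger and larger times, and
    these converge to [x] uniformly on compact sets. *)
Lemma skorokhod_nbhs_agree (R : realType) (x : skorokhod R) (V : set (skorokhod R)) : nbhs x V ->
 exists T : nat, forall z : skorokhod R, (forall t, t < T%:R -> z t = x t) -> V z.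
Proof.
move=> Vx; apply: contrapT => nT.
have /choice[z zP] : forall T : nat, exists z : skorokhod R,
  (forall t, t < T%:R -> z t = x t) /\ ~ V z.
 move=> T; apply: contrapT => nz; apply: nT; exists T => z zx; apply: contrapT => nV.
 by apply: nz; exists z.
have [U [[W oW WU] Ux UV]] : exists U, [/\ open U, U x & U `<=` V] by side.
have Wx : nbhs (skorokhod_incl x) W.
 by apply: open_nbhs_nbhs; split => //; move: Ux; rewrite -WU.
have cv : (fun T => skorokhod_incl (z T)) @ \oo --> skorokhod_incl x.
 apply/fam_cvgP => A cA Q /uniform_nbhs[e [entE eQ]].
 have [M [Mr hM]] := compact_bounded cA.
 have hM1 t : A t -> `|t| <= M + 1 by apply: hM; rewrite ltrDl.
 exists (Num.truncn (M + 1)).+1 => // n /= Mn; apply: eQ => t At.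
 have [zx _] := zP n; rewrite /skorokhod_incl zx; first exact: entourage_refl.
 apply: le_lt_trans (ler_norm _) (le_lt_trans (hM1 t At) _).
 by apply: (lt_le_trans (truncnS_gt _)); rewrite ler_nat.
have [n _ /(_ n (leqnn _)) Wn] := cv _ Wx.
by have [_] := zP n; apply; apply: UV; rewrite -WU.
Qed.

Lemma skorokhod_eq_rat (R : realType) (x y : skorokhod R) (T : R) :
 (forall q : rat, ratr q < T -> x (ratr q) = y (ratr q)) -> forall t, t < T -> x t = y t.
Proof.
move=> xy t tT; have [t0|t0] := ltP t 0.
 by have [x0 _ _] := skorokhod_cadlag x; have [y0 _ _] := skorokhod_cadlag y; rewrite x0// y0.
have [_ /(_ t t0) xr _] := skorokhod_cadlag x; have [_ /(_ t t0) yr _] := skorokhod_cadlag y.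
apply: contrapT => /eqP ne; pose e := `|x t - y t| / 2.
have e0 : 0 < e by rewrite divr_gt0// normr_gt0 subr_eq0.
have /cvgrPdist_lt/(_ e e0) [d1 /= d10 h1] := xr.
have /cvgrPdist_lt/(_ e e0) [d2 /= d20 h2] := yr.
have /rat_in_itvoo[q] : t < Num.min T (t + Num.min d1 d2) by rewrite lt_min tT ltrDl lt_min d10.
rewrite in_itv/= lt_min => /andP[tq /andP[qT qd]].
have nd : `|t - ratr q| = ratr q - t by rewrite distrC ger0_norm// subr_ge0 ltW.
have qd' : ratr q - t < Num.min d1 d2 by rewrite ltrBlDl.
move: qd'; rewrite lt_min => /andP[q1 q2].
have := h1 (ratr q); rewrite /ball/= nd => /(_ q1 tq) k1.
have := h2 (ratr q); rewrite /ball/= nd => /(_ q2 tq) k2.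
have : `|x t - y t| < e + e.
 rewrite [ltLHS](_ : _ = `|(x t - x (ratr q)) - (y t - y (ratr q))|); last by congr `|_|; rewrite xy//; ring.
 by apply: (le_lt_trans (ler_normB _ _)); exact: ltrD.
by rewrite -splitr ltxx.
Qed.

(** * Continuous test functions of coupled paths *)

Section far_paths.
Context d (T : measurableType d) (R : realType) (f : test_function R) (p q : T -> skorokhod R).
Hypotheses (mp : measfun p) (mq : measfun q).

Definition agree_upto (m : nat) : set T :=
 \bigcap_(r : rat) [set c : T | ratr r < m%:R :> R -> q c (ratr r) = p c (ratr r)].

Lemma meas_far eta : measurable [set c : T | eta < `|f (q c) - f (p c)|].
Proof.
apply: meas_set_lt; first side.
apply: mcomp => //; apply: measurable_funB.
 exact: (mcomp (@test_fun_measurable _ f) mq).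
exact: (mcomp (@test_fun_measurable _ f) mp).
Qed.

Lemma meas_agree_upto m : measurable (agree_upto m).
Proof.
rewrite /agree_upto -[X in measurable X]setCK setC_bigcap; apply: measurableC.
apply: bigcupT_measurable_rat => r; apply: measurableC.
have [rm|rm] := pselect (ratr r < m%:R :> R); last first.
 rewrite (_ : mkset _ = setT)//; side.
rewrite (_ : mkset _ = [set c : T | q c (ratr r) <= p c (ratr r)] `&`
  [set c : T | p c (ratr r) <= q c (ratr r)]).
 have m1 := mcomp (meas_coordinate (ratr r : R)) mp.
 have m2 := mcomp (meas_coordinate (ratr r : R)) mq.
 side.
apply/seteqP; split => c /=; first by move=> /(_ rm) ->.
by move=> [h1 h2] _; apply: le_anti; rewrite h1.
Qed.

End far_paths.

Section coupled.
Context (R : realType) (f : test_function R) (d : nat -> measure_display)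
 (Om : forall n, measurableType (d n)) (P : forall n, probability (Om n) R)
 (Y Z : forall n, {RV (P n) >-> skorokhod R}).
Hypotheses (Ys : forall n w, is_step_path (Y n w)) (Zs : forall n w, is_step_path (Z n w)).
Hypothesis law : forall n A, measurable A -> P n (Y n @^-1` A) = P 0%N (Y 0%N @^-1` A).
Hypothesis mismatch : forall (T : nat) (e : R), 0 < e -> exists N, forall n, (N <= n)%N ->
 exists D, [/\ measurable D, (P n D <= e%:E)%E & forall w, ~ D w -> forall t, t <= T%:R -> Z n w t = Y n w t].

Local Notation bits := (g_sigma_algebraType bit_events).

Lemma meas_even_bits : measfun (even_bits : bits -> bits).
Proof. by apply: meas_to_bits => i; exact: meas_bit. Qed.

Lemma meas_odd_bits : measfun (odd_bits : bits -> bits).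
Proof. by apply: meas_to_bits => i; exact: meas_bit. Qed.

Let fst_path (c : bits) : skorokhod R := decode R (even_bits c).
Let snd_path (c : bits) : skorokhod R := decode R (odd_bits c).

Let mfst : measfun fst_path.
Proof. exact: (mcomp (@meas_decode R) meas_even_bits). Qed.

Let msnd : measfun snd_path.
Proof. exact: (mcomp (@meas_decode R) meas_odd_bits). Qed.

Let far (eta : R) (m : nat) : set bits :=
 [set c : bits | eta < `|f (snd_path c) - f (fst_path c)|] `&` agree_upto fst_path snd_path m.

Let meas_far_codes eta m : measurable (far eta m).
Proof.
exact: (measurableI _ _ (meas_far f mfst msnd eta) (meas_agree_upto mfst msnd m)).
Qed.

Let joint n (w : Om n) : bits := merge (path_code (Y n w)) (path_code (Z n w)).

Let meas_joint n : measfun (joint (n := n)).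
Proof.
have mY := mcomp (@meas_path_code R) (@measurable_funPT _ _ _ _ (Y n)).
have mZ := mcomp (@meas_path_code R) (@measurable_funPT _ _ _ _ (Z n)).
apply: meas_to_bits => i; rewrite /joint /merge; case: (odd i).
 by have := mZ measurableT _ (meas_bit i./2); rewrite setTI.
by have := mY measurableT _ (meas_bit i./2); rewrite setTI.
Qed.

Let joint_paths n w : (fst_path (joint w) = Y n w) * (snd_path (joint w) = Z n w).
Proof. by rewrite /fst_path /snd_path /joint even_merge odd_merge !path_codeK. Qed.

Let far_joint n (w : Om n) eta (T : nat) : eta < `|f (Z n w) - f (Y n w)| ->
 (forall t, t <= T%:R -> Z n w t = Y n w t) -> far eta T (joint w).
Proof.
have [e1 e2] := joint_paths w; move=> h ZY; split.
 by change (eta < `|f (snd_path (joint w)) - f (fst_path (joint w))|); rewrite e1 e2.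
move=> q _; change (ratr q < T%:R :> R -> snd_path (joint w) (ratr q) = fst_path (joint w) (ratr q)).
rewrite e1 e2 => qT; apply: ZY; side.
Qed.

(* If the test function differed with probability at least e along a subsequence, tightness of the
codes would produce compact sets of pairs (y, z) with f(z) far from f(y), z = y on [0, j[, and whose
first projections have mass at least e / 4 for the common law of the Y n; a path y lying in infinitely many
of these projections contradicts the continuity of f at y. *)
Lemma coupled_test (eta e : R) : 0 < eta -> 0 < e -> exists N, forall n, (N <= n)%N ->
 (P n [set w | (eta < `|f (Z n w) - f (Y n w)|)%R] <= e%:E)%E.
Proof.
move=> eta0 e0; apply: contrapT => nN.
have bad N : exists2 n, (N <= n)%N & (e%:E < P n [set w | (eta < `|f (Z n w) - f (Y n w)|)%R])%E.
 apply: contrapT => nn; apply: nN; exists N => n Nn; rewrite leNgt; apply/negP => h.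
 by apply: nn; exists n.
have e2 : 0 < e / 2 by side.
have e4 : 0 < e / 4 by side.
have closed_set (j : nat) : exists L, [/\ bit_closed L, L `<=` far eta j &
  ((e / 4)%:E <= P 0%N [set w | exists2 c, L c & even_bits c = path_code (Y 0%N w)])%E].
 have [N hN] := mismatch j e2; have [n Nn hn] := bad N.
 have [D [mD De DZ]] := hN n Nn.
 pose mu := distribution (P n) (mfun_Sub (mem_set (meas_joint (n := n)))).
 have [L cL [Lf Le]] := bit_inner_regular mu (meas_far_codes eta j) e4.
 exists L; split => //.
 have mL : measurable (L : set bits) by exact: bit_closed_measurable.
 have mF : measurable (far eta j) := meas_far_codes eta j.
 pose pL : set bits := [set a : bits | exists2 c, L c & even_bits c = a].
 have mpL : measurable pL by apply: bit_closed_measurable; exact: bit_closed_projection.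
 have mpC : measurable (@path_code R @^-1` pL : set (skorokhod R)).
  by rewrite -[X in measurable X]setTI; exact: meas_path_code.
 rewrite -[leRHS](law n mpC).
 have mW A : measurable A -> measurable (joint (n := n) @^-1` A).
  by move=> mA; rewrite -[X in measurable X]setTI; exact: meas_joint.
 have mB : measurable [set w | eta < `|f (Z n w) - f (Y n w)|].
  by apply: meas_far.
 have mYp : measurable (Y n @^-1` (@path_code R @^-1` pL)).
  by rewrite -[X in measurable X]setTI; exact: measurable_funPT.
 have mdiff : measurable (joint (n := n) @^-1` (far eta j `\` L)) by apply: mW; exact: measurableD.
 have cover : [set w | eta < `|f (Z n w) - f (Y n w)|] `<=`
   D `|` (joint (n := n) @^-1` (far eta j `\` L) `|` Y n @^-1` (@path_code R @^-1` pL)).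
  move=> w hw; have [Dw|nD] := pselect (D w); [by left|right].
  have [Lw|nL] := pselect (L (joint w)).
   by right; exists (joint w) => //; rewrite even_merge.
  by left; exact: (conj (far_joint hw (DZ w nD)) nL).
 (* Out of a probability larger than [e], the mismatch takes at most e / 2 and the loss of inner
    regularity at most e / 4, which leaves at least e / 4 for the projection. *)
 have : (e%:E < (e / 2)%:E + ((e / 4)%:E + P n (Y n @^-1` (@path_code R @^-1` pL))))%E.
  apply: (lt_le_trans hn).
  apply: (le_trans (le_measure _ _ _ cover)); rewrite ?inE//.
   side.
  apply: (le_trans (measureU2 (P n) mD (measurableU _ _ mdiff mYp))); apply: leeD => //.
  apply: (le_trans (measureU2 (P n) mdiff mYp)); apply: leeD => //.
 have fn : P n (Y n @^-1` (@path_code R @^-1` pL)) \is a fin_num by exact: fin_num_measure.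
 rewrite -(fineK fn) -!EFinD lte_fin lee_fin; lra.
have {closed_set} /choice[L LP] := closed_set.
pose S j : set (Om 0%N) := [set w | exists2 c, L j c & even_bits c = path_code (Y 0%N w)].
have mS j : measurable (S j).
 have [cL _ _] := LP j.
 have mp := bit_closed_measurable (bit_closed_projection cL).
 have mC := mcomp (@meas_path_code R) (@measurable_funPT _ _ _ _ (Y 0%N)).
 by have := mC measurableT _ mp; rewrite setTI.
pose U k := \bigcup_(j in [set j | (k <= j)%N]) S j.
have mU k : measurable (U k) by apply: bigcup_measurable => j _.
have cv : (P 0%N \o U) @ \oo --> P 0%N (\bigcap_k U k).
 apply: nonincreasing_cvg_mu => //.
 - by rewrite -ge0_fin_numE//; exact: fin_num_measure.
 - side.
 - by move=> i j ij; apply/subsetPset => w [k /= jk Sk]; exists k => //=; exact: leq_trans jk.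
have : ((e / 4)%:E <= P 0%N (\bigcap_k U k))%E.
 rewrite -(cvg_lim (@ereal_hausdorff R) cv); apply: lime_ge.
  by apply/cvg_ex; exists (P 0%N (\bigcap_k U k)).
 apply: nearW => k; have [_ _ h] := LP k; apply: (le_trans h).
 by apply: le_measure; rewrite ?inE//; [exact: mS|move=> w Sw; exists k => /=].
(* A set of probability at least e / 4 is not empty, which provides one path lying in infinitely
   many projections. *)
have [[w Uw] _|U0] := pselect (exists w, (\bigcap_k U k) w); last first.
 rewrite (_ : \bigcap_k U k = set0) ?measure0 ?lee_fin ?leNgt ?e4//.
 by apply/seteqP; split => // w Uw; apply: U0; exists w.
pose x := Y 0%N w.
have : nbhs x [set z | `|f x - f z| < eta].
 have /cvgrPdist_lt/(_ eta eta0) := @test_fun_continuous _ f x; exact.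
move=> /skorokhod_nbhs_agree[T hT].
have [j /= Tj [c Lc ce]] := Uw T I.
have [_ /(_ c Lc)[/= far_c eq_c] _] := LP j.
have fx : fst_path c = x by rewrite /fst_path ce path_codeK.
have eq_q (q : rat) : ratr q < j%:R :> R -> snd_path c (ratr q) = x (ratr q).
 by move=> qj; rewrite -fx; exact: (eq_c q I qj).
have := hT (snd_path c); rewrite fx in far_c.
have zx t : t < T%:R -> snd_path c t = x t.
 move=> tT; apply: (@skorokhod_eq_rat _ _ _ j%:R) => [q qj|]; first exact: eq_q.
 by apply: (lt_le_trans tT); rewrite ler_nat.
by move=> /(_ zx)/=; rewrite distrC ltNge ltW.
Qed.
End coupled.

(** * Pathwise uniqueness for a fixed outcome of the noise *)

Section pathwise.
Context (R : realType) (h phi : R -> R) (L : R) (n : nat) (m : 'I_n.+1 -> {measure set (plane R) -> \bar R}).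
Hypotheses (phi_loc : locally_square_integrable phi) (h0 : forall x, 0 <= h x) (L0 : 0 <= L)
 (hL : lip L h) (mc : forall i, count_measure (m i)).
Local Notation E := (measurableTypeR R).

Definition after (tau e : R) : set (plane R) := [set y | tau < y.1] `&` [set y | y.1 < tau + e].

Lemma meas_before_time (t : R) : measurable [set y : plane R | y.1 < t].
Proof. side. Qed.

Lemma quiet_mono i (lam : R -> R) tau e e' : measfun (lam : E -> R) -> e <= e' ->
 m i (rate_reg lam `&` after tau e') = 0%E -> m i (rate_reg lam `&` after tau e) = 0%E.
Proof.
move=> ml ee; have mA x : measurable (rate_reg lam `&` after tau x).
 apply: measurableI; side.
apply: subset_measure0 => //; apply: setIS => y [/= ty yt]; split => //=; apply: (lt_le_trans yt).
by rewrite lerD2l.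
Qed.

Definition solves_hawkes (z : 'I_n.+1 -> skorokhod R) := forall i t, 0 <= t -> (z i t)%:E =
 thinning (m i) (fun s => h (\sum_(j | true) \int[stieltjes (z j)]_(u in `[0, s[) (n.+1%:R^-1 * phi (s - u)))) t.

Definition path_rate (z : 'I_n.+1 -> skorokhod R) (s : R) : R :=
 h (\sum_(j | true) \int[stieltjes (z j)]_(u in `[0, s[) (n.+1%:R^-1 * phi (s - u))).

Lemma meas_path_rate z : measfun (path_rate z : E -> R).
Proof.
pose psi v := n.+1%:R^-1 * phi0 phi v.
have mpsi : measfun psi by apply: measurable_funM => //; exact: meas_phi0.
pose G : set (E * E) := [set x | 0 <= x.2] `&` [set x | x.2 < x.1].
have mG : measurable G by side.
have GE s : xsection G s = `[0, s[%classic.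
 apply/seteqP; split => u.
  by move=> /xsectionP[/= u0 us]; rewrite in_itv/= u0.
 by rewrite /= in_itv/= => /andP[u0 us]; apply/xsectionP.
rewrite (_ : path_rate z = fun s => h (\sum_(j | true) \int[stieltjes (z j)]_(u in xsection G s) psi (s - u))).
 apply: (mcomp (meas_lip L0 hL)); apply: measurable_sum => j.
 exact: meas_stieltjes_conv.
apply/funext => s; rewrite /path_rate; congr h; apply: eq_bigr => j _; rewrite GE.
apply: eq_Rintegral => u; rewrite inE/= in_itv/= => /andP[u0 us].
by rewrite /psi phi0E// subr_ge0 ltW.
Qed.

Definition solution_rate (z : 'I_n.+1 -> skorokhod R) (lam : R -> R) := [/\ measfun (lam : E -> R),
 forall s, lam s = h (\sum_(j | true) \int[stieltjes (z j)]_(u in `[0, s[) (n.+1%:R^-1 * phi (s - u))) &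
 forall i t, 0 <= t -> (z i t)%:E = m i (rate_reg lam `&` upto t)].

Lemma path_rate_solution z : solves_hawkes z -> solution_rate z (path_rate z).
Proof.
move=> zs; have ml := meas_path_rate z; split => // i t t0.
rewrite zs//; exact: (thinningE (m i) t (meas_region ml)).
Qed.

Section solution.
Variables (z : 'I_n.+1 -> skorokhod R) (lam : R -> R).
Hypothesis zs : solution_rate z lam.

Let mreg : measurable (rate_reg lam).
Proof. have [ml _ _] := zs; side. Qed.

Let zE i t : 0 <= t -> (z i t)%:E = m i (rate_reg lam `&` upto t).
Proof. by have [_ _] := zs; exact. Qed.

Lemma solution_adm i : admissible (m i) (rate_reg lam).
Proof.
split => // [|k]; last by rewrite -zE// ltry.
rewrite (_ : _ `&` _ = set0) ?measure0//; apply/seteqP; split => // y [[y0 _]].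
by rewrite /= ltNge y0.
Qed.

Lemma solution_tally i : z i = tally_path (m i) (rate_reg lam).
Proof.
apply: skorokhod_eq => t t0; rewrite tally_pathE; last exact: solution_adm.
by rewrite /tally -zE.
Qed.

(** A right-continuous path with integer values is constant just after any time, so the noise has no
    accepted point there. *)
Lemma solution_quiet i (tau : R) : 0 <= tau -> exists2 e : R, 0 < e & m i (rate_reg lam `&` after tau e) = 0%E.
Proof.
move=> tau0; have adm := solution_adm i.
have [e e0 he] := step_path_right (tally_path_step (rate_reg lam) (mc i)) tau0.
have e20 : 0 < e / 2 by side.
exists (e / 2) => //; apply/eqP; rewrite -measure_le0.
have e2e : e / 2 < e by rewrite gtr_pMr// invf_lt1// ltr1n.
have := he (tau + e / 2); rewrite lerDl (ltW e20) ltrD2l e2e => /(_ isT).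
rewrite tally_pathE// => hE.
pose S := rate_reg lam.
have mU t : measurable (S `&` upto t) by side.
have D0 : m i ((S `&` upto (tau + e / 2)) `\` (S `&` upto tau)) = 0%E.
 have fin : (m i (S `&` upto (tau + e / 2)) < +oo)%E := tally_lt_pinfty adm _.
 have sub : S `&` upto tau `<=` S `&` upto (tau + e / 2).
  by apply: setIS; apply: upto_subset; rewrite lerDl ltW.
 rewrite (measureD (mU _) (mU _) fin) (setIidr sub).
 transitivity ((tally (m i) S (tau + e / 2))%:E - (tally (m i) S tau)%:E)%E; first by rewrite !(tallyE adm).
 by rewrite /S hE subee.
rewrite -D0; apply: le_measure; rewrite ?inE.
- apply: measurableI => //; side.
- side.
- move=> y [Sy [ty yt]]; split; first by split => //; rewrite /upto /= ltW.
 by move=> [_]; rewrite /upto /= leNgt ty.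
Qed.

Lemma solution_rateE s : lam s = h (\sum_(j | true)
 \int[m j]_(y in rate_reg lam `&` fst @^-1` `[0, s[%classic) (n.+1%:R^-1 * phi0 phi (s - y.1))).
Proof.
have [_ lamE _] := zs; rewrite lamE; congr h; apply: eq_bigr => j _.
have mg : measfun (fun u : E => n.+1%:R^-1 * phi0 phi (s - u)).
 by apply: measurable_funM => //; apply: (mcomp (meas_phi0 phi_loc)); exact: measurable_funB.
have mI : measurable (`[0, s[%classic : set E) by side.
have <- := int_stieltjes_tally (solution_adm j) mI mg.
rewrite solution_tally tally_pathE; last exact: solution_adm.
apply: eq_Rintegral => u; rewrite inE/= in_itv/= => /andP[u0 us].
by rewrite phi0E// subr_ge0 ltW.
Qed.

End solution.

Section two_solutions.
Variables (z z' : 'I_n.+1 -> skorokhod R) (lam lam' : R -> R).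
Hypotheses (zs : solution_rate z lam) (zs' : solution_rate z' lam').

(** The rates at time [s] are read off the accepted points strictly before [s], and up to null sets
    these are the same. *)
Lemma solution_rate_agree s :
 (forall i, m i ((rate_reg lam `\` rate_reg lam') `&` [set y | y.1 < s]) = 0%E) ->
 (forall i, m i ((rate_reg lam' `\` rate_reg lam) `&` [set y | y.1 < s]) = 0%E) ->
 lam s = lam' s.
Proof.
move=> d1 d2; rewrite (solution_rateE zs) (solution_rateE zs'); congr h; apply: eq_bigr => j _.
have [ml _ _] := zs; have [ml' _ _] := zs'.
pose S := rate_reg lam; pose S' := rate_reg lam'.
have mS : measurable S := meas_region ml.
have mS' : measurable S' := meas_region ml'.
pose g (y : plane R) := n.+1%:R^-1 * phi0 phi (s - y.1).
have mg : measfun g.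
 apply: measurable_funM => //; apply: (mcomp (meas_phi0 phi_loc)).
 apply: measurable_funB => //; side.
have mI : measurable (fst @^-1` (`[0, s[%classic : set E) : set (plane R)).
 rewrite -[X in measurable X]setTI; apply: (@measurable_fst _ _ E E) => //; side.
have mL := meas_before_time s.
have mSI : measurable (S `&` fst @^-1` (`[0, s[%classic : set E)) by side.
have mSI' : measurable (S' `&` fst @^-1` (`[0, s[%classic : set E)) by side.
have mEg D : measurable D -> measfun ((EFin \o g) \_ D).
 by move=> mD; apply/(measurable_restrictT _ _).1 => //; apply/measurable_EFinP; exact: measurable_funTS.
rewrite /Rintegral [in LHS]integral_mkcond [in RHS]integral_mkcond; congr fine.
apply: ae_eq_integral => //; [exact: mEg|exact: mEg|].
have mD : measurable ((S `\` S') `&` [set y : plane R | y.1 < s]) by side.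
have mD' : measurable ((S' `\` S) `&` [set y : plane R | y.1 < s]) by side.
exists (((S `\` S') `&` [set y | y.1 < s]) `|` ((S' `\` S) `&` [set y | y.1 < s])); split.
- side.
- apply/eqP; rewrite -measure_le0; apply: (le_trans (measureU2 (m j) mD mD')).
 by rewrite -[leRHS]adde0; apply: leeD; [rewrite -(d1 j)|rewrite -(d2 j)].
move=> y /= ne; apply: contrapT => nD; apply: ne => _; rewrite !patchE.
have [/andP[y0 ys]|ns] := boolP (0 <= y.1 < s); last first.
 by rewrite !memNset// => -[_]; rewrite /= in_itv/= (negbTE ns).
congr (if _ then _ else _); apply/idP/idP; rewrite !inE => -[Sy yI]; split => //; apply: contrapT => nS; apply: nD.
 by left.
by right.
Qed.

(* The two rates agree up to the first time tau at which they differ, and neither solution jumps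
immediately after tau, so that they agree slightly beyond tau. *)
Lemma solution_rate_unique s : 0 <= s -> lam s = lam' s.
Proof.
move=> s0; have [ml _ _] := zs; have [ml' _ _] := zs'; apply: contrapT => ne.
pose D := [set u | 0 <= u /\ lam u <> lam' u].
have lD : has_inf D by split; [exists s|exists 0 => u []].
pose tau := inf D.
have tau0 : 0 <= tau by apply: lb_le_inf; [exists s|move=> u []].
have before u : 0 <= u -> u < tau -> lam u = lam' u.
 move=> u0 ut; apply: contrapT => nu; move: ut; rewrite ltNge => /negP; apply.
 by apply: ge_inf; [exact: lD.2|].
have at_tau : lam tau = lam' tau.
 have Z A (B : set (plane R)) : (forall y, 0 <= y.1 -> y.1 < tau -> A y -> B y) -> (forall y, A y -> 0 <= y.1) ->
   (A `\` B) `&` [set y : plane R | y.1 < tau] = set0.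
  by move=> AB A0; apply/seteqP; split => // y [[Ay nB] yt]; apply: nB; apply: AB => //; exact: A0.
 apply: solution_rate_agree => i; rewrite Z ?measure0// => y; do ?[by case] => y0 yt [_ +];
  rewrite /rate_reg /= before//.
have quiet : exists2 e : R, 0 < e & forall i,
  m i (rate_reg lam `&` after tau e) = 0%E /\
  m i (rate_reg lam' `&` after tau e) = 0%E.
 have /choice[e eP] : forall i, exists e : R, 0 < e /\
   m i (rate_reg lam `&` after tau e) = 0%E /\
   m i (rate_reg lam' `&` after tau e) = 0%E.
  move=> i; have [e1 e10 h1] := solution_quiet zs i tau0; have [e2 e20 h2] := solution_quiet zs' i tau0.
  exists (Num.min e1 e2); split; first by rewrite lt_min e10.
  have le1 : Num.min e1 e2 <= e1 by rewrite ge_min lexx.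
  have le2 : Num.min e1 e2 <= e2 by rewrite ge_min lexx orbT.
  by split; [exact: quiet_mono ml le1 h1|exact: quiet_mono ml' le2 h2].
 exists (\big[Num.min/1]_i e i); first by apply: lt_bigmin => // i _; have [] := eP i.
 move=> i; have [_ [q1 q2]] := eP i.
 have le : \big[Num.min/1]_i e i <= e i by exact: bigmin_le_cond.
 by split; [exact: quiet_mono ml le q1|exact: quiet_mono ml' le q2].
have [e e0 eP] := quiet.
(* A time of disagreement before [tau + e]. Before [u] the two regions can differ only inside
   [after tau e], where neither solution has a point. *)
have [u [u0 nu] ut] := inf_adherent e0 lD.
have mS := meas_region ml; have mS' := meas_region ml'.
have region y : y.1 < u -> ~ after tau e y -> (rate_reg lam y <-> rate_reg lam' y).
 move=> yu na; have [y0|y0] := leP 0 y.1; last by split => -[]; rewrite leNgt y0.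
 have [yt|yt] := ltP y.1 tau; first by rewrite /rate_reg /= before.
 move: yt; rewrite le_eqVlt => /predU1P[yt|yt]; last by case: na; split => //; exact: lt_trans ut.
 by rewrite /rate_reg /= -yt at_tau.
apply: nu; apply: solution_rate_agree => i; have [q1 q2] := eP i.
- apply: (subset_measure0 _ _ _ q1).
 + side.
 + apply: measurableI; side.
 + move=> y [[Sy nS] yu]; split => //; apply: contrapT => na; apply: nS.
  exact: (region y yu na).1.
- apply: (subset_measure0 _ _ _ q2).
 + side.
 + apply: measurableI; side.
 + move=> y [[Sy nS] yu]; split => //; apply: contrapT => na; apply: nS.
  exact: (region y yu na).2.
Qed.
Lemma solution_path_unique : z = z'.
Proof.
have reg : rate_reg lam = rate_reg lam'.
 by apply/seteqP; split => y [y0]; [rewrite (solution_rate_unique y0)|rewrite -(solution_rate_unique y0)].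
by apply/funext => i; rewrite (solution_tally zs) (solution_tally zs') reg.
Qed.
End two_solutions.

(** A deterministic statement, so that it applies to a given process and to the constructed one
    although they are adapted to different filtrations. *)
Lemma hawkes_pathwise_unique z z' : solves_hawkes z -> solves_hawkes z' -> z = z'.
Proof.
by move=> /path_rate_solution zs /path_rate_solution zs'; exact: (solution_path_unique zs zs').
Qed.
End pathwise.

(** * Bounded observables and the law of large numbers *)

Section bounded.
Context d (T : measurableType d) (R : realType) (f : T -> R) (M : R).
Hypotheses (mf : measfun f) (fM : forall x, `|f x| <= M).

(** Adding [M] brings bounded observables under the results for nonnegative functions. *)
Lemma obs_shift_ge0 x : 0 <= f x + M.
Proof. by rewrite -lerBlDr sub0r; have := fM x; rewrite ler_norml => /andP[]. Qed.

Lemma obs_shift_le x : f x + M <= 2 * M.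
Proof. by rewrite mulr_natl mulr2n lerD2r (le_trans (ler_norm _)). Qed.

Lemma obs_int_shift (mu : probability T R) :
 ((\int[mu]_z f z + M)%:E = \int[mu]_z (f z + M)%:E)%E.
Proof.
have ic : mu.-integrable setT (EFin \o cst M) by exact: finite_measure_integrable_cst.
have iff : mu.-integrable setT (EFin \o f).
 apply: (le_integrable measurableT _ _ ic); first side.
 by move=> x _ /=; rewrite lee_fin (le_trans (fM x))// ler_norm.
rewrite [RHS](eq_integral (fun z => (f z)%:E + M%:E)%E)//.
transitivity (\int[mu]_z (f z)%:E + \int[mu]_z M%:E)%E; last exact: (esym (integralD measurableT iff ic)).
rewrite int_prob_cst EFinD /Rintegral fineK//.
exact: integrable_fin_num.
Qed.

Lemma obs_int_empirical n (x : 'I_n.+1 -> T) :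
 \int[empirical R x]_z f z = n.+1%:R^-1 * \sum_i f (x i).
Proof.
apply: (addIr M); apply: EFin_inj; rewrite obs_int_shift.
rewrite ge0_integral_mscale//=; [|side|by move=> z _; rewrite lee_fin obs_shift_ge0].
rewrite ge0_integral_measure_sum//; [|by move=> z _; rewrite lee_fin obs_shift_ge0|side].
rewrite (eq_bigr (fun i : 'I_n.+1 => (f (x i) + M)%:E)); last first.
 move=> i _; rewrite integral_dirac//; last side.
 by rewrite diracT mul1e inord_val.
rewrite sumEFin -EFinM big_split /= mulrDr sumr_const card_ord -[in M *+ _]mulr_natl mulrA mulVf ?mul1r// pnatr_eq0.
Qed.

End bounded.

Section iid_average.
Context d d' (Om : measurableType d) (T : measurableType d') (R : realType) (P : probability Om R) (n : nat)
 (Y : 'I_n.+1 -> {RV P >-> T}) (f : T -> R) (M : R).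
Hypotheses (mf : measfun f) (fM : forall x, `|f x| <= M) (iidY : iid Y).

Let g x := f x + M.
Let X i w := g (Y i w).

Let mg : measfun g.
Proof. exact: measurable_funD. Qed.

Let g0 x : 0 <= g x := obs_shift_ge0 fM x.

Let mX i : measfun (X i).
Proof. apply: mcomp => //; side. Qed.

Let same_law (G : T -> \bar R) i j : measfun G -> (forall x, 0 <= G x)%E ->
 (\int[P]_w G (Y i w) = \int[P]_w G (Y j w))%E.
Proof.
move=> mG G0.
rewrite -(ge0_integral_distribution (Y i) mG G0) -(ge0_integral_distribution (Y j) mG G0).
by apply: eq_measure_integral => A mA _; exact: (iidY.2 i j A mA).
Qed.

Let shift_pow k x : g x ^+ k <= (2 * M) ^+ k.
Proof.
by apply: lerXn2r; rewrite ?nnegrE; [side|exact: le_trans (g0 x) (obs_shift_le fM x)|exact: obs_shift_le].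
Qed.

Let moment_fin (k : nat) : (\int[P]_w (X ord0 w ^+ k)%:E < +oo)%E.
Proof.
apply: (@le_lt_trans _ _ (\int[P]_w ((2 * M) ^+ k)%:E)%E); last by rewrite int_prob_cst ltry.
apply: ge0_le_integral => //.
- by move=> w _; rewrite lee_fin exprn_ge0// g0.
- apply/measurable_EFinP; side.
- by move=> w _; rewrite lee_fin shift_pow.
Qed.

Let r := fine (\int[P]_w (X ord0 w)%:E).
Let q := fine (\int[P]_w (X ord0 w ^+ 2)%:E).

Let EX i : (\int[P]_w (X i w)%:E = r%:E)%E.
Proof.
rewrite /r fineK; last first.
 rewrite ge0_fin_numE; last by apply: integral_ge0 => w _; rewrite lee_fin g0.
 have := moment_fin 1; side.
apply: (same_law (G := fun x => (g x)%:E)); side.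
Qed.

Let EXX i j : (\int[P]_w (X i w * X j w)%:E = (r * r + (i == j)%:R * (q - r * r))%:E)%E.
Proof.
have [<-|ij] := eqVneq i j.
 rewrite mul1r addrC subrK /q fineK; last first.
  rewrite ge0_fin_numE; first side.
  side.
 under eq_integral do rewrite -expr2.
 apply: (same_law (G := fun x => (g x ^+ 2)%:E)); first side.
 side.
rewrite mul0r addr0; under eq_integral do rewrite EFinM.
rewrite indep_ge0_intM ?EX//.
- side.
- side.
- by move=> w; rewrite lee_fin g0.
- by move=> w; rewrite lee_fin g0.
move=> A B mA mB; have [ind _] := iidY.
have pre k (C : set (\bar R)) : measurable C ->
  preimage_set_system [set: Om] (Y k) measurable ((fun w => (X k w)%:E) @^-1` C).
 move=> mC; exists ((EFin \o g) @^-1` C); last side.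
 have mEg : measfun (EFin \o g) by side.
 by have := mEg measurableT C mC; rewrite setTI.
apply: (indep_systems2 _ ind ij); [|exact: pre|exact: pre].
by move=> k _ [C mC <-]; exact: measurable_funPT.
Qed.

Lemma iid_average_deviation :
 (\int[P]_w (`|n.+1%:R^-1 * \sum_i f (Y i w) - \int[distribution P (Y ord0)]_z f z|)%:E <=
  (((2 * M) ^+ 2 + 1) / Num.sqrt n.+1%:R)%:E)%E.
Proof.
pose s := Num.sqrt n.+1%:R : R.
have s0 : 0 < s by rewrite sqrtr_gt0 ltr0n.
have ss : s * s = n.+1%:R by rewrite -expr2 sqr_sqrtr.
have mean : \int[distribution P (Y ord0)]_z f z = r - M.
 apply/eqP; rewrite eq_sym subr_eq; apply/eqP; apply: EFin_inj.
 rewrite obs_int_shift// ge0_integral_distribution; first by rewrite -(EX ord0).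
 - side.
 - by move=> x; rewrite lee_fin obs_shift_ge0.
(* The free parameter is the square root of N, the inverse of the size of the deviation of an
   average of N terms. *)
have := orthogonal_sum_abs (fun=> n.+1%:R^-1) mX (fun i w => g0 _) EX EXX s0.
rewrite (eq_integral (fun w => (`|n.+1%:R^-1 * \sum_i f (Y i w) - \int[distribution P (Y ord0)]_z f z|)%:E)); last first.
 move=> w _; congr (`|_|%:E); rewrite mean -mulr_sumr sumrB big_split /= !sumr_const card_ord.
 rewrite -[in M *+ _]mulr_natl -[in r *+ _]mulr_natl; field; by rewrite -?natr1 ?nat1r pnatr_eq0.
move=> /le_trans; apply; rewrite lee_fin sumr_const card_ord -[X in s * X]mulr_natl.
have qM : q <= (2 * M) ^+ 2.
 rewrite -lee_fin /q fineK; last first.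
  rewrite ge0_fin_numE; first side.
  side.
 apply: (@le_trans _ _ (\int[P]_w ((2 * M) ^+ 2)%:E)%E); last by rewrite int_prob_cst.
 apply: ge0_le_integral => //.
 - side.
 - by apply/measurable_EFinP; exact: measurable_funX.
 - by move=> w _; rewrite lee_fin shift_pow.
have vM : q - r * r <= (2 * M) ^+ 2 by rewrite lerBlDr (le_trans qM)// lerDl -expr2 sqr_ge0.
rewrite (_ : _ / 2 = (q - r * r + 1) / 2 / s); last first.
 by rewrite -ss; field; rewrite lt0r_neq0.
rewrite ler_pM2r ?invr_gt0//.
have := sqr_ge0 (2 * M); lra.
Qed.

End iid_average.

Lemma ge0_markov d (Om : measurableType d) (R : realType) (mu : {measure set Om -> \bar R}) (X : Om -> \bar R) (a : R) :
 measfun X -> (forall w, 0 <= X w)%E -> 0 < a ->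
 (a%:E * mu [set w | a%:E <= X w] <= \int[mu]_w X w)%E.
Proof.
move=> mX X0 a0; have := @le_integral_comp_abse _ _ _ mu setT measurableT X a id.
move=> /(_ (@measurable_id _ _ _) (fun r h => h) (fun x y _ _ h => h) mX a0); rewrite setTI.
rewrite (_ : [set x | _] = [set w | (a%:E <= X w)%E]); last by apply/seteqP; split => w /=; rewrite gee0_abs.
by move=> /le_trans; apply; under eq_integral do rewrite gee0_abs//.
Qed.

Lemma inv_sqrt_small (R : realType) (K e : R) : 0 <= K -> 0 < e ->
 exists N, forall n, (N <= n)%N -> K / Num.sqrt n.+1%:R <= e.
Proof.
move=> K0 e0; exists (Num.truncn ((K / e) ^+ 2)) => n Nn.
have s0 : 0 < Num.sqrt n.+1%:R :> R by [].
rewrite ler_pdivrMr// mulrC -ler_pdivrMr//.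
have Ke : 0 <= K / e by side.
rewrite -(ger0_norm Ke) -sqrtr_sqr ler_sqrt ?ler0n//.
by apply/ltW; apply: (lt_le_trans (truncnS_gt _)); rewrite ler_nat.
Qed.

Section emp_deviation.
Context (R : realType) (d : nat -> measure_display) (Om : forall n, measurableType (d n))
 (P : forall n, probability (Om n) R) (Y Z : forall n, 'I_n.+1 -> {RV (P n) >-> skorokhod R})
 (l : probability (skorokhod R) R).
Hypotheses (Ys : forall n (i : 'I_n.+1) w, is_step_path (Y i w)) (Zs : forall n (i : 'I_n.+1) w, is_step_path (Z i w))
 (Yl : forall n (i : 'I_n.+1) A, measurable A -> P n (Y i @^-1` A) = l A) (iidY : forall n, iid (@Y n)).
Hypothesis mismatch : forall (T : nat) (e : R), 0 < e -> exists N, forall n, (N <= n)%N -> forall i : 'I_n.+1,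
 exists D, [/\ measurable D, (P n D <= e%:E)%E & forall w, ~ D w -> forall t, t <= T%:R -> Z i w t = Y i w t].
Variable f : test_function R.

Let dist n (i : 'I_n.+1) w := `|f (Z i w) - f (Y i w)|.

Let meas_obs n (X : {RV (P n) >-> skorokhod R}) : measfun (fun w => f (X w)).
Proof. apply: (mcomp (@test_fun_measurable _ f)); side. Qed.

Let meas_dist n (i : 'I_n.+1) : measfun (dist i).
Proof. apply: mcomp => //; apply: measurable_funB; side. Qed.

(** [coupled_test] concerns one index for each [n]. Uniformity comes from applying it to an index
    for which the bound fails, whenever there is one; all the copies having the same law, its
    hypotheses hold for any choice of indices. *)
Lemma uniform_coupled_test (eta e : R) : 0 < eta -> 0 < e -> exists N, forall n, (N <= n)%N -> forall i : 'I_n.+1,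
 (P n [set w | (eta < `|f (Z i w) - f (Y i w)|)%R] <= e%:E)%E.
Proof.
move=> eta0 e0.
pose bad n := [set i : 'I_n.+1 | (e%:E < P n [set w | (eta < `|f (Z i w) - f (Y i w)|)%R])%E].
pose j n : 'I_n.+1 := xget ord0 (bad n).
have [|N hN] := @coupled_test R f d Om P (fun n => Y (j n)) (fun n => Z (j n))
 (fun n w => Ys (j n) w) (fun n w => Zs (j n) w)
 (fun n A mA => etrans (Yl (j n) mA) (esym (Yl (j 0%N) mA))) _ eta e eta0 e0.
 by move=> T e1 e10; have [N hN] := mismatch T e10; exists N => n Nn; exact: hN.
exists N => n Nn i; rewrite leNgt; apply/negP => bi.
have : bad n (j n) by apply: xgetPex; exists i.
by rewrite /bad /= ltNge hN.
Qed.

Lemma emp_deviation (eta e : R) : 0 < eta -> 0 < e -> exists N, forall n, (N <= n)%N ->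
 exists D, [/\ measurable D, (P n D <= e%:E)%E & forall w, ~ D w ->
  `|n.+1%:R^-1 * \sum_(i < n.+1) f (Z i w) - \int[l]_z f z| < eta].
Proof.
move=> eta0 e0.
have [M M0 fM] : exists2 M, 0 < M & forall x, `|f x| <= M.
 have [M0 [_ hM]] := @test_fun_bounded _ f; exists (Num.max M0 0 + 1).
  by rewrite ltr_wpDl// le_max lexx orbT.
 by move=> x; apply: hM => //; rewrite (@le_lt_trans _ _ (Num.max M0 0)) ?le_max ?lexx// ltrDl.
have ee0 : 0 < eta * e by side.
(* The budget for Markov's inequality is eta e. Half of it goes to the law of large numbers; the
   other half bounds the mean distance of the observables, as eta e / 4 where they are close plus 2
   M times eta e / (8 M) where they are not. *)
have e1 : 0 < eta * e / 4 by side.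
have e2 : 0 < eta * e / (8 * M) by side.
have [N1 h1] := uniform_coupled_test e1 e2.
have K0 : 0 <= (2 * M) ^+ 2 + 1 by side.
have [N2 h2] := inv_sqrt_small K0 (divr_gt0 ee0 (ltr0n R 2)).
exists (maxn N1 N2) => n; rewrite geq_max => /andP[N1n N2n].
pose avg (w : Om n) := n.+1%:R^-1 * \sum_(i < n.+1) f (Z i w).
pose avgY (w : Om n) := n.+1%:R^-1 * \sum_(i < n.+1) f (Y i w).
have mavg : measfun avg.
 apply: measurable_funM => //; apply: measurable_sum => i; side.
have mavgY : measfun avgY.
 apply: measurable_funM => //; apply: measurable_sum => i; side.
have n0 : 0 < n.+1%:R :> R by [].
have dist_mean i : (\int[P n]_w (dist i w)%:E <= (eta * e / 2)%:E)%E.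
 have mB : measurable [set w | eta * e / 4 < dist i w] by side.
 apply: (@le_trans _ _ (\int[P n]_w ((eta * e / 4)%:E + (2 * M)%:E * (\1_[set w | (eta * e / 4 < dist i w)%R] w)%:E))%E).
  apply: ge0_le_integral => //.
  - by move=> w _; rewrite lee_fin normr_ge0.
  - side.
  - apply: emeasurable_funD => //; apply: measurable_funeM; apply/measurable_EFinP; exact: measurable_indic.
  - move=> w _; rewrite indicE -EFinM -EFinD lee_fin; have [h|h] := ltP (eta * e / 4) (dist i w).
    rewrite mem_set// mulr1; apply: (@le_trans _ _ (2 * M)); last by rewrite lerDr ltW.
    rewrite mulr_natl mulr2n; apply: (le_trans (ler_normB _ _)); exact: lerD.
   by rewrite memNset ?mulr0 ?addr0//= ltNge h.
 rewrite ge0_integralD//; last 3 first.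
 - side.
 - side.
 - apply: measurable_funeM; side.
 rewrite int_prob_cst ge0_integralZl//; last 2 first.
 - side.
 - side.
 rewrite integral_indic// setIT.
 rewrite [leRHS](_ : _ = (eta * e / 4)%:E + (2 * M)%:E * (eta * e / (8 * M))%:E)%E; last first.
  by rewrite -EFinM -EFinD; congr EFin; field; rewrite lt0r_neq0.
 apply: leeD => //; apply: lee_wpmul2l; first side.
 exact: h1.
have close_mean : (\int[P n]_w (`|avg w - avgY w|)%:E <= (eta * e / 2)%:E)%E.
 apply: (@le_trans _ _ (\int[P n]_w \sum_(i < n.+1) (n.+1%:R^-1)%:E * (dist i w)%:E)%E).
  apply: ge0_le_integral => //.
  - by apply/measurable_EFinP; apply: mcomp => //; exact: measurable_funB.
  - apply: emeasurable_sum => i; apply: measurable_funeM; side.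
  - move=> w _; under eq_bigr do rewrite -EFinM.
   rewrite sumEFin lee_fin /avg /avgY -mulrBr normrM gtr0_norm ?invr_gt0// -mulr_sumr.
   by apply: ler_wpM2l; [rewrite invr_ge0 ltW|rewrite -sumrB; exact: ler_norm_sum].
 rewrite ge0_integral_sum//; last 2 first.
 - move=> i; apply: measurable_funeM; side.
 - by move=> i w _; rewrite -EFinM lee_fin mulr_ge0 ?normr_ge0// invr_ge0 ltW.
 apply: (@le_trans _ _ (\sum_(i < n.+1) (n.+1%:R^-1)%:E * (eta * e / 2)%:E)%E).
  apply: lee_sum => i _; rewrite ge0_integralZl//; last 2 first.
  - side.
  - by move=> w _; rewrite lee_fin normr_ge0.
  apply: lee_wpmul2l => //; side.
 by rewrite -EFinM sumEFin sumr_const card_ord -[_ *+ _]mulr_natl mulrA mulfV ?mul1r// lt0r_neq0.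
pose m0 := \int[l]_z f z.
have m0E : \int[distribution (P n) (@Y n ord0)]_z f z = m0.
 by congr fine; apply: eq_measure_integral => A mA _; exact: Yl.
have lln := iid_average_deviation (@test_fun_measurable _ f) fM (iidY n).
exists [set w | eta%:E <= (`|avg w - m0|)%:E]%E; split.
- rewrite (_ : [set w | _] = [set w | eta <= `|avg w - m0|]); last by [].
 by apply: meas_set_le => //; apply: mcomp => //; exact: measurable_funB.
- rewrite -(@lee_pmul2l _ eta%:E)//.
 apply: (le_trans (ge0_markov _ _ _ _)) => //.
  by apply/measurable_EFinP; apply: mcomp => //; exact: measurable_funB.
 apply: (@le_trans _ _ (\int[P n]_w ((`|avg w - avgY w|)%:E + (`|avgY w - m0|)%:E))%E).
  apply: ge0_le_integral => //.
  - by apply/measurable_EFinP; apply: mcomp => //; exact: measurable_funB.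
  - by apply: emeasurable_funD; apply/measurable_EFinP; apply: mcomp => //; exact: measurable_funB.
  - by move=> w _; rewrite -EFinD lee_fin; exact: ler_distD.
 rewrite ge0_integralD//; last 2 first.
 - by apply/measurable_EFinP; apply: mcomp => //; exact: measurable_funB.
 - by apply/measurable_EFinP; apply: mcomp => //; exact: measurable_funB.
 rewrite -EFinM (splitr (eta * e)) EFinD; apply: leeD => //.
 by rewrite -m0E; apply: (le_trans lln); rewrite lee_fin; exact: h2.
- by move=> w /= /negP; rewrite lee_fin -ltNge.
Qed.
End emp_deviation.

(** The sets of functionals that contain [test_eval (mu n w)] with probability tending to 1 form a
    filter [G]. In a product topology a filter converges as soon as each coordinate does, so single
    test functions suffice for an arbitrary weak neighbourhood. *)
Lemma cvg_in_prob_weak (R : realType) (d : nat -> measure_display) (Om : forall n, measurableType (d n))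
  (P : forall n, probability (Om n) R) (mu : forall n, Om n -> probability (skorokhod R) R)
  (l : probability (skorokhod R) R) :
 (forall (f : test_function R) (eta e : R), 0 < eta -> 0 < e -> exists N, forall n, (N <= n)%N ->
  exists D, [/\ measurable D, (P n D <= e%:E)%E &
   forall w, ~ D w -> `|\int[mu n w]_z f z - \int[l]_z f z| < eta]) ->
 cvg_in_probability (T := weak_topology_on_laws R) P mu l.
Proof.
move=> dev V Vl.
pose G : set_system (test_function R -> R) := [set W | forall e : R, 0 < e -> exists N, forall n, (N <= n)%N ->
 exists D, [/\ measurable D, (P n D <= e%:E)%E & forall w, ~ D w -> W (test_eval (mu n w))]].
have fG : Filter G.
 split.
 - by move=> e e0; exists 0%N => n _; exists set0; split => //; rewrite measure0 lee_fin ltW.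
 - move=> W W' GW GW' e e0.
  have [N1 h1] := GW _ (divr_gt0 e0 (ltr0n R 2)); have [N2 h2] := GW' _ (divr_gt0 e0 (ltr0n R 2)).
  exists (maxn N1 N2) => n; rewrite geq_max => /andP[/h1[D1 [m1 p1 w1]] /h2[D2 [m2 p2 w2]]].
  exists (D1 `|` D2); split; first side.
   by apply: (le_trans (measureU2 (P n) m1 m2)); rewrite (splitr e) EFinD; exact: leeD.
  by move=> w nD; split; [apply: w1|apply: w2] => Dw; apply: nD; [left|right].
 - move=> W W' WW' GW e e0; have [N h] := GW e e0; exists N => n Nn; have [D [mD pD wD]] := h n Nn.
  by exists D; split => // w nD; apply: WW'; exact: wD.
have Gcv : {ptws, G --> test_eval l}.
 apply/cvg_sup => f B; rewrite nbhsE => -[_ [[B' oB' <-] lB'] BB]; apply: filterS BB _.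
 have /nbhs_ballP[eta /= eta0 hB] : nbhs (test_eval l f) B' by apply: open_nbhs_nbhs.
 move=> e e0; have [N h] := dev f eta e eta0 e0; exists N => n Nn; have [D [mD pD wD]] := h n Nn.
 by exists D; split => // w nD; apply: hB; rewrite /ball/= distrC; exact: wD.
have [U [[W oW WU] Ul UV]] : exists U, [/\ @open (weak_topology_on_laws R) U, U l & U `<=` V] by side.
have GW : G W.
 apply: Gcv; apply: open_nbhs_nbhs; split => //; by move: Ul; rewrite -WU.
have bound e : 0 < e -> exists N, forall n, (N <= n)%N -> (mu_ext (P n) [set w | ~ V (mu n w)] <= e%:E)%E.
 move=> e0; have [N h] := GW e e0; exists N => n Nn; have [D [mD pD wD]] := h n Nn.
 apply: (le_trans _ pD); rewrite -(measurable_mu_extE (P n) mD); apply: le_mu_ext => w nV.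
 by apply: contrapT => /wD Ww; apply: nV; apply: UV; rewrite -WU.
apply/fine_cvgP; split.
 have [N h] := bound 1 ltr01; exists N => // n Nn.
 rewrite ge0_fin_numE ?mu_ext_ge0//; exact: le_lt_trans (h n Nn) (ltry _).
apply/cvgrPdist_le => e e0; have [N h] := bound e e0; exists N => // n Nn /=.
have fin : mu_ext (P n) [set w | ~ V (mu n w)] \is a fin_num.
 rewrite ge0_fin_numE ?mu_ext_ge0//; exact: le_lt_trans (h n Nn) (ltry _).
by rewrite sub0r normrN ger0_norm ?fine_ge0 ?mu_ext_ge0// -lee_fin fineK//; exact: h.
Qed.

Lemma lipschitz_constant (R : realType) (h : R -> R) : lipschitz h ->
 exists2 L, 0 <= L & lip L h.
Proof.
move=> [M [_ hM]]; exists (Num.max M 0 + 1); first by rewrite addr_ge0// le_max lexx orbT.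
move=> x y; apply: (hM _ _ (x, y)) => //=.
by rewrite (@le_lt_trans _ _ (Num.max M 0)) ?le_max ?lexx// ltrDl.
Qed.

(** * Convergence of the empirical measures *)

Section propagation.
Context (R : realType) (h phi : R -> R) (L : R).
Hypotheses (phi_loc : locally_square_integrable phi) (h0 : forall x, 0 <= h x) (L0 : 0 <= L)
 (hL : lip L h).

(** [Zbar] lives on a space of its own, so only its law can be compared with the copies: by pathwise
    uniqueness it is almost surely the thinning of its noise at the rate [lam0], and [path_law]
    carries the law over. *)
Lemma limit_solution_law d' (Om' : measurableType d') (P' : probability Om' R) (ppm' : R.-ker Om' ~> plane R)
  (Zbar : {RV P' >-> skorokhod R}) (lam0 : R -> R) (ml0 : measfun (lam0 : measurableTypeR R -> R))
  (l00 : forall s, 0 <= lam0 s)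
  (lb0 : loc_bounded lam0)
  (lfix0 : forall s, 0 <= s -> lam0 s = h (drive phi lam0 s))
  d (Om : measurableType d) (P : probability Om R) (k : R.-ker Om ~> plane R)
  (kc : forall w, count_measure (k w)) (A : set (skorokhod R)) :
 is_poisson_measure P' ppm' (quadrant_lebesgue R) -> is_limit_solution h phi ppm' Zbar ->
 is_poisson_measure P k (quadrant_lebesgue R) -> measurable A ->
 P (limit_path ml0 P kc @^-1` A) = distribution P' Zbar A.
Proof.
move=> poi' sol poi mA; have [k' [kpoi kc' kE]] := count_version poi'.
have mS : measurable (rate_reg lam0) := meas_region ml0.
have -> := path_law poi kpoi kc kc' mS (fun m => adm_rate ml0 lb0 (m := m)) mA.
have mY : measurable ((fun w => tally_path (k' w) (rate_reg lam0)) @^-1` A).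
 exact: (@measurable_funPTI _ _ _ _ (limit_path ml0 P' kc')).
have agree : {ae P', forall w, tally_path (k' w) (rate_reg lam0) = Zbar w}.
 have := limit_solution_unique phi_loc h0 L0 hL ml0 l00 lb0 lfix0 poi' sol.
 apply: filterS2 kE => w kw Zw.
 have adm : admissible (k' w) (rate_reg lam0) by apply: adm_rate => // q; have [] := kc' w.
 by apply: skorokhod_eq => t t0; rewrite tally_pathE// Zw// /tally kw.
have [N [mN N0 NP]] := agree.
apply: (measure_modulo mN N0 mY); first exact: measurable_funPTI.
have kZ w : ~ N w -> tally_path (k' w) (rate_reg lam0) = Zbar w.
 by move=> nN; apply: contrapT => ne; apply: nN; exact: NP.
by apply/seteqP; split => w [Aw nN]; split => //; move: Aw; rewrite /preimage /= kZ.
Qed.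

(** [X] is the Hawkes process constructed on the good version of the noise of [Z], and pathwise
    uniqueness identifies the two. Passing to [X] makes every outcome a step path, as the coding of
    paths requires. *)
Lemma coupled_copies : exists2 C : R -> R, (forall T, 0 <= C T) &
 forall d (Om : measurableType d) (P : probability Om R) (F : R -> set_system Om) n
  (ppm : 'I_n.+1 -> R.-ker Om ~> plane R) (Z : 'I_n.+1 -> {RV P >-> skorokhod R})
  d' (Om' : measurableType d') (P' : probability Om' R) (ppm' : R.-ker Om' ~> plane R)
  (Zbar : {RV P' >-> skorokhod R}),
 is_filtration F -> is_poisson_noise P F ppm -> is_mean_field_hawkes h phi F ppm Z ->
 is_poisson_measure P' ppm' (quadrant_lebesgue R) -> is_limit_solution h phi ppm' Zbar ->
 exists X Y : 'I_n.+1 -> {RV P >-> skorokhod R}, [/\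
  {ae P, forall w, forall i, Z i w = X i w},
  (forall i w, is_step_path (X i w)) /\ (forall i w, is_step_path (Y i w)),
  forall i A, measurable A -> P (Y i @^-1` A) = distribution P' Zbar A, iid Y &
  forall (T : nat) i, exists D, [/\ measurable D, (P D <= (C T%:R / Num.sqrt n.+1%:R)%:E)%E &
   forall w, ~ D w -> forall t, t <= T%:R -> X i w t = Y i w t]].
Proof.
have [lam0 [ml0 l00 lb0 lfix0]] := limit_rate_exists phi_loc h0 L0 hL.
have [C C0 hC] := hawkes_coupling phi_loc h0 L0 hL ml0 l00 lb0 lfix0.
exists C => // d Om P F n ppm Z d' Om' P' ppm' Zbar fF noise hZ poi' sol.
have [F' [k [fF' noise' Fnull kc kE]]] := good_noise fF noise.
have [X [G [hX Xs mG agree intG]]] := hC _ _ _ _ _ _ fF' noise' Fnull kc.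
have [poi ind _ _] := noise'.
exists X, (fun i => limit_path ml0 P (kc i)); split.
- have [_ _ eZ] := hZ; have [_ _ eX] := hX.
 apply: filterS3 kE eZ eX => w kw zw xw i.
 have sX : solves_hawkes h phi (fun i => k i w) (fun i => X i w) by side.
 have sZ : solves_hawkes h phi (fun i => k i w) (fun i => Z i w) by move=> j t t0; rewrite kw; exact: zw.
 by have /(congr1 (fun z => z i)) := hawkes_pathwise_unique phi_loc L0 hL (fun i => kc i w) sZ sX.
- by split => // i w; rewrite limit_pathE; exact: tally_path_step.
- by move=> i A mA; exact: (limit_solution_law ml0 l00 lb0 lfix0 (kc i) poi' sol (poi i) mA).
- exact: limit_paths_iid.
move=> T i; have [N [mN N0 NP]] := agree; have [mGi Gc] := mG T%:R i.
(* An integer count that is not 0 is at least 1, an event whose probability is at most the mean by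
   Markov's inequality. *)
have mB : measurable [set w | (1 <= G T%:R i w)%E].
 rewrite -[X in measurable X]setTI; exact: emeasurable_fun_c_infty.
exists (N `|` [set w | (1 <= G T%:R i w)%E]); split; first side.
 apply: (le_trans (measureU2 P mN mB)); rewrite [X in (X + _ <= _)%E]N0 add0e.
 apply: le_trans (intG T%:R i (ler0n _ _)).
 have := @ge0_markov _ _ _ P (G T%:R i) 1 mGi _ ltr01; rewrite mul1e; apply => w.
 case: (Gc w) => [->|[m ->]] //; side.
move=> w nD t tT; have [t0|t0] := ltP t 0.
 have [x0 _ _] := skorokhod_cadlag (X i w); have [y0 _ _] := skorokhod_cadlag (limit_path ml0 P (kc i) w).
 by rewrite x0// y0.
have : (`|X i w t - tally_path (k i w) (rate_reg lam0) t|%:E <= G T%:R i w)%E.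
 have : forall i T t, 0 <= t <= T -> (`|X i w t - tally_path (k i w) (rate_reg lam0) t|%:E <= G T i w)%E.
  by apply: contrapT => nw; apply: nD; left; exact: NP.
 by apply; rewrite t0.
have -> : G T%:R i w = 0%E.
 have : ~ (1 <= G T%:R i w)%E by move=> h1; apply: nD; right.
 case: (Gc w) => [->|[[|m] ->]] //; first by rewrite leey.
 by rewrite lee_fin ler1n.
by rewrite lee_fin normr_le0 subr_eq0 => /eqP.
Qed.

Lemma emp_measure_cvg (dO : nat -> measure_display) (Om : forall n, measurableType (dO n))
  (P : forall n, probability (Om n) R) (F : forall n, R -> set_system (Om n))
  (ppm : forall n, 'I_n.+1 -> R.-ker (Om n) ~> plane R)
  (Z : forall n, 'I_n.+1 -> {RV (P n) >-> skorokhod R})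
  d (Om' : measurableType d) (P' : probability Om' R)
  (ppm' : R.-ker Om' ~> plane R) (Zbar : {RV P' >-> skorokhod R}) :
 (forall n, is_filtration (F n) /\ is_poisson_noise (P n) (F n) (ppm n)) ->
 (forall n, is_mean_field_hawkes h phi (F n) (ppm n) (Z n)) ->
 is_poisson_measure P' ppm' (quadrant_lebesgue R) ->
 is_limit_solution h phi ppm' Zbar ->
 cvg_in_probability (T := weak_topology_on_laws R) P
  (fun n w => empirical R (fun i => Z n i w)) (distribution P' Zbar).
Proof.
move=> noise hZ poi' sol; have [C C0 hC] := coupled_copies.
have copies n := cid (hC _ _ _ _ _ _ _ _ _ _ _ _ (noise n).1 (noise n).2 (hZ n) poi' sol).
pose X n := sval (copies n); have copies' n := cid (svalP (copies n)).
pose Y n := sval (copies' n).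
have XY n : _ := svalP (copies' n).
apply: cvg_in_prob_weak => f eta e eta0 e0.
have [| | | | |N hN] := @emp_deviation R dO Om P Y X (distribution P' Zbar) _ _ _ _ _ f eta e eta0 e0.
- by move=> n i w; have [_ [_ Ys] _ _ _] := XY n; exact: Ys.
- by move=> n i w; have [_ [Xs _] _ _ _] := XY n; exact: Xs.
- by move=> n i A mA; have [_ _ Yl _ _] := XY n; exact: Yl.
- by move=> n; have [_ _ _ iidY _] := XY n.
- move=> T e1 e10; have [N hN] := inv_sqrt_small (C0 T%:R) e10; exists N => n Nn i.
 have [_ _ _ _ /(_ T i)[D [mD pD DXY]]] := XY n.
 by exists D; split => //; apply: (le_trans pD); rewrite lee_fin; exact: hN.
exists N => n Nn; have [D [mD pD wD]] := hN n Nn; have [[N' [mN' N0 NP]] _ _ _ _] := XY n.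
exists (D `|` N'); split; first side.
 by apply: (le_trans (measureU2 (P n) mD mN')); rewrite [X in (_ + X <= _)%E]N0 adde0.
move=> w nD; have [M [_ fM]] := @test_fun_bounded _ f.
rewrite (obs_int_empirical (@test_fun_measurable _ f) (M := M + 1)); last first.
 by move=> x; apply: fM => //; rewrite ltrDl.
have ZX : forall i, Z n i w = X n i w by apply: contrapT => nw; apply: nD; right; exact: NP.
under eq_bigr do rewrite ZX.
by apply: wD => Dw; apply: nD; left.
Qed.
End propagation.

Theorem theorem8 (R : realType) (h phi : R -> R)
    (h_ge0 : forall x, 0 <= h x) (h_lip : lipschitz h)
    (phi_loc : locally_square_integrable phi) :
  (* (i) *)
  (forall (d : measure_display) (Om : measurableType d)
      (P : probability Om R) (ppm : R.-ker Om ~> plane R),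
    is_poisson_measure P ppm (quadrant_lebesgue R) ->
    (exists Zbar : {RV P >-> skorokhod R},
       is_limit_solution h phi ppm Zbar) /\
    (forall Zbar Zbar' : {RV P >-> skorokhod R},
       is_limit_solution h phi ppm Zbar ->
       is_limit_solution h phi ppm Zbar' ->
       {ae P, forall w, forall t, 0 <= t -> Zbar w t = Zbar' w t})) /\
  (* (ii), with N = n + 1 *)
  (exists C : R -> R, forall n : nat,
    exists (d : measure_display) (Om : measurableType d)
      (P : probability Om R) (F : R -> set_system Om)
      (ppm : 'I_n.+1 -> R.-ker Om ~> plane R)
      (Z Zbar : 'I_n.+1 -> {RV P >-> skorokhod R}),
      [/\ is_filtration F /\ is_poisson_noise P F ppm,
          is_mean_field_hawkes h phi F ppm Z,
          forall i, exists ppm' : R.-ker Om ~> plane R,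
            is_poisson_measure P ppm' (quadrant_lebesgue R) /\
            is_limit_solution h phi ppm' (Zbar i),
          iid Zbar &
          forall T, 0 < T -> forall i,
            (\int[P]_w ereal_sup
               [set (`|Z i w t - Zbar i w t|)%:E | t in `[0%R, T]]
             <= (C T / Num.sqrt n.+1%:R)%:E)%E]) /\
  (* (iii), with N = n + 1 *)
  (forall (dO : nat -> measure_display) (Om : forall n, measurableType (dO n))
      (P : forall n, probability (Om n) R) (F : forall n, R -> set_system (Om n))
      (ppm : forall n, 'I_n.+1 -> R.-ker (Om n) ~> plane R)
      (Z : forall n, 'I_n.+1 -> {RV (P n) >-> skorokhod R})
      (d : measure_display) (Om' : measurableType d) (P' : probability Om' R)
      (ppm' : R.-ker Om' ~> plane R) (Zbar : {RV P' >-> skorokhod R}),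
    (forall n, is_filtration (F n) /\ is_poisson_noise (P n) (F n) (ppm n)) ->
    (forall n, is_mean_field_hawkes h phi (F n) (ppm n) (Z n)) ->
    is_poisson_measure P' ppm' (quadrant_lebesgue R) ->
    is_limit_solution h phi ppm' Zbar ->
    cvg_in_probability (T := weak_topology_on_laws R) P
      (fun n w => empirical R (fun i => Z n i w)) (distribution P' Zbar)).
Proof.
have [L L0 hL] := lipschitz_constant h_lip.
split; [|split].
- move=> d Om P ppm poi; have [lam [ml l0 lb lfix]] := limit_rate_exists phi_loc h_ge0 L0 hL.
 split; first exact: (limit_solution_exists phi_loc ml l0 lb lfix poi).
 move=> Zbar Zbar' sol sol'.
 have u := limit_solution_unique phi_loc h_ge0 L0 hL ml l0 lb lfix poi sol.
 have u' := limit_solution_unique phi_loc h_ge0 L0 hL ml l0 lb lfix poi sol'.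
 by apply: filterS2 u u' => w e e' t t0; rewrite e// e'.
- exact: coupling_on_one_space phi_loc h_ge0 L0 hL.
- move=> dO Om P F ppm Z d Om' P' ppm' Zbar noise hZ poi' sol.
 exact: (emp_measure_cvg phi_loc h_ge0 L0 hL noise hZ poi' sol).
Qed.
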